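(* Let $K$ be an algebraically closed field (of arbitrary characteristic), let $Y$ be an affine toric variety over $K$ under the action of the torus $T$, let $G$ be a reductive algebraic group over $K$, and let $f:E_G\to Y$ be a $T$-equivariant principal $G$-bundle. Then $E_G$ is equivariantly trivializable.
   Context: A $T$-equivariant principal $G$-bundle on $Y$ is an algebraic (right) principal $G$-bundle $E_G\to Y$ with an algebraic left $T$-action on $E_G$ lifting the $T$-action on $Y$ and commuting with the right $G$-action. It is equivariantly trivializable if there are a homomorphism of algebraic groups $\rho:T\to G$ and an isomorphism of $T$-equivariant principal $G$-bundles $E_G\cong Y\times G$, where $G$ acts on $Y\times G$ by right multiplication on the second factor and $T$ acts by $t\cdot(y,g)=(ty,\rho(t)g)$. Equivalently, $E_G$ admits a section $s$ over $Y$ with $t\,s(y)=s(ty)\rho(t)$ for all $t\in T$, $y\in Y$. *)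

(* Defs.v *)
(* Classical (Serre-style) algebraic geometry over an algebraically closed
   field: a variety is a topological space together with a sheaf of K-valued
   functions that is locally isomorphic to a Zariski closed subset of some
   affine space. *)
From HB Require Import structures.
From mathcomp Require Import all_boot all_order all_algebra.
From mathcomp Require Import all_classical topology.
(* mpoly's notations clash with those of topology. *)
From mathcomp Require Import (canonicals) mpoly.

Set Implicit Arguments.
Unset Strict Implicit.
Unset Printing Implicit Defensive.

Import GRing.Theory.
Local Open Scope classical_set_scope.
Local Open Scope ring_scope.

(* The sheaf of functions is given by its germs: [regular_at x f] says that f
   is a section over some open neighbourhood of x, its values away from x being
   irrelevant; the sections over an open U are the f with [regular_on U f].
   Only locality is required here: the remaining axioms of a space with
   functions (openness, K-algebra operations, inverses) follow for every
   space locally isomorphic to an affine algebraic set. *)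
Record fspace (K : closedFieldType) := FSpace {
  fspace_top :> topologicalType ;
  regular_at : fspace_top -> (fspace_top -> K) -> Prop ;
  regular_at_local : forall (x : fspace_top) (f g : fspace_top -> K),
    (\forall y \near x, f y = g y) -> regular_at x f -> regular_at x g }.

Definition regular_on (K : closedFieldType) (X : fspace K) (U : set X)
    (f : X -> K) : Prop :=
  forall x, U x -> regular_at x f.

Definition morphism (K : closedFieldType) (X Y : fspace K) (phi : X -> Y) : Prop :=
  continuous phi /\
  forall (x : X) (h : Y -> K), regular_at (phi x) h -> regular_at x (h \o phi).

Definition isomorphism (K : closedFieldType) (X Y : fspace K) (phi : X -> Y) : Prop :=
  morphism phi /\
  exists psi : Y -> X, [/\ morphism psi, cancel phi psi & cancel psi phi].

Definition sub_regular_at (K : closedFieldType) (X : fspace K) (S : set X)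
    (s : set_type S) (f : set_type S -> K) : Prop :=
  exists g : X -> K, regular_at (set_val s) g /\
    \forall t \near s, f t = g (set_val t).

Lemma sub_regular_at_local (K : closedFieldType) (X : fspace K) (S : set X)
    (s : set_type S) (f g : set_type S -> K) :
  (\forall t \near s, f t = g t) -> sub_regular_at s f -> sub_regular_at s g.
Proof.
move=> fg [h [hreg fh]]; exists h; split=> //.
by apply: filterS2 fg fh => t <- <-.
Qed.

(* For S closed this is the reduced induced structure. *)
Definition sub_space (K : closedFieldType) (X : fspace K) (S : set X) : fspace K :=
  FSpace (@sub_regular_at_local K X S).

Definition peval (K : closedFieldType) (n : nat) (p : mpoly.mpoly n K)
    (x : 'rV[K]_n) : K :=
  mpoly.meval (fun i => x 0 i) p.

Definition affine_point (K : closedFieldType) (n : nat) : Type := 'rV[K]_n.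

HB.instance Definition _ (K : closedFieldType) (n : nat) :=
  Choice.copy (affine_point K n) 'rV[K]_n.

Definition zariski_open (K : closedFieldType) (n : nat) : set (set (affine_point K n)) :=
  [set U | exists S : set (mpoly.mpoly n K),
     U = [set x | exists2 p, S p & peval p x != 0]].

Lemma zariski_openT (K : closedFieldType) (n : nat) : @zariski_open K n setT.
Proof.
exists [set 1]; apply/seteqP; split=> x //= _.
by exists 1 => //; rewrite /peval rmorph1 oner_neq0.
Qed.

Lemma zariski_openI (K : closedFieldType) (n : nat) : setI_closed (@zariski_open K n).
Proof.
move=> _ _ [S ->] [S' ->].
exists [set r | exists p, S p /\ exists2 q, S' q & r = p * q].
apply/seteqP; split=> x /=.
  move=> [[p Sp px] [q Sq qx]]; exists (p * q); last by rewrite /peval rmorphM mulf_neq0.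
  by exists p; split => //; exists q.
move=> [_ [p [Sp [q Sq ->]]]]; rewrite /peval rmorphM mulf_eq0 negb_or.
by move=> /andP[px qx]; split; [exists p | exists q].
Qed.

Lemma zariski_open_bigU (K : closedFieldType) (n : nat) (I : Type)
    (f : I -> set (affine_point K n)) :
  (forall i, @zariski_open K n (f i)) -> @zariski_open K n (\bigcup_i f i).
Proof.
move=> H; exists [set p | exists i, forall x, peval p x != 0 -> f i x].
apply/seteqP; split=> x /=.
  move=> [i _]; have [S fE] := H i; rewrite fE => -[p Sp px].
  by exists p => //; exists i => y py; rewrite fE; exists p.
by move=> [p [i pf] px]; exists i => //; exact: pf.
Qed.

HB.instance Definition _ (K : closedFieldType) (n : nat) :=
  isOpenTopological.Build (affine_point K n)
    (@zariski_openT K n) (@zariski_openI K n) (@zariski_open_bigU K n).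

Definition affine_regular_at (K : closedFieldType) (n : nat)
    (x : affine_point K n) (f : affine_point K n -> K) : Prop :=
  exists p q : mpoly.mpoly n K, peval q x != 0 /\
    \forall y \near x, f y = peval p y / peval q y.

Lemma affine_regular_at_local (K : closedFieldType) (n : nat)
    (x : affine_point K n) (f g : affine_point K n -> K) :
  (\forall y \near x, f y = g y) -> affine_regular_at x f -> affine_regular_at x g.
Proof.
move=> fg [p [q [qx fpq]]]; exists p, q; split=> //.
by apply: filterS2 fg fpq => y <- <-.
Qed.

Definition affine_space (K : closedFieldType) (n : nat) : fspace K :=
  FSpace (@affine_regular_at_local K n).

(* The topology of a product of varieties is finer than the product topology,
   hence an alias of X * Y that does not carry the latter. *)
Definition prod_point (K : closedFieldType) (X Y : fspace K) : Type := (X * Y)%type.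

HB.instance Definition _ (K : closedFieldType) (X Y : fspace K) :=
  Choice.copy (prod_point X Y) (X * Y)%type.

(* h = \sum_i f_i (x) g_i with the f_i regular on U and the g_i regular on V. *)
Definition tensor_on (K : closedFieldType) (X Y : fspace K) (U : set X) (V : set Y) :
    set (prod_point X Y -> K) :=
  [set h | exists (k : nat) (f : 'I_k -> X -> K) (g : 'I_k -> Y -> K),
     [/\ forall i, regular_on U (f i), forall i, regular_on V (g i) &
         h = fun p => \sum_(i < k) f i p.1 * g i p.2]].

Definition prod_subbase (K : closedFieldType) (X Y : fspace K) :
    set (set (prod_point X Y)) :=
  [set W | exists (U : set X) (V : set Y) (h : prod_point X Y -> K),
     [/\ open U, open V, tensor_on U V h &
         W = [set p | [/\ U p.1, V p.2 & h p != 0]]]].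

HB.instance Definition _ (K : closedFieldType) (X Y : fspace K) :=
  isSubBaseTopological.Build (prod_point X Y) (@prod_subbase K X Y) id.

Definition prod_regular_at (K : closedFieldType) (X Y : fspace K)
    (z : prod_point X Y) (f : prod_point X Y -> K) : Prop :=
  exists p q : prod_point X Y -> K,
    [/\ tensor_on [set z.1] [set z.2] p, tensor_on [set z.1] [set z.2] q,
        q z != 0 & \forall w \near z, f w = p w / q w].

Lemma prod_regular_at_local (K : closedFieldType) (X Y : fspace K)
    (z : prod_point X Y) (f g : prod_point X Y -> K) :
  (\forall w \near z, f w = g w) -> prod_regular_at z f -> prod_regular_at z g.
Proof.
move=> fg [p [q [pt qt qz fpq]]]; exists p, q; split=> //.
by apply: filterS2 fg fpq => w <- <-.
Qed.

Definition prod_space (K : closedFieldType) (X Y : fspace K) : fspace K :=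
  FSpace (@prod_regular_at_local K X Y).

Definition affine_variety (K : closedFieldType) (X : fspace K) : Prop :=
  exists (n : nat) (Z : set (affine_space K n)),
    closed Z /\ exists phi : X -> sub_space Z, isomorphism phi.

Definition prevariety (K : closedFieldType) (X : fspace K) : Prop :=
  exists (k : nat) (U : 'I_k -> set X),
    [/\ forall i, open (U i), \bigcup_i U i = setT &
        forall i, affine_variety (sub_space (U i))].

Definition separated_space (K : closedFieldType) (X : fspace K) : Prop :=
  closed [set p : prod_space X X | p.1 = p.2].

Definition variety (K : closedFieldType) (X : fspace K) : Prop :=
  prevariety X /\ separated_space X.

Definition irreducible_space (K : closedFieldType) (X : fspace K) : Prop :=
  [set: X] !=set0 /\
  forall U V : set X, open U -> open V -> U !=set0 -> V !=set0 -> U `&` V !=set0.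

(* For X affine and irreducible: the domain K[X] is integrally closed in its
   field of fractions, i.e. a fraction a / b that is a root of the monic
   polynomial T^n + \sum_(i < n) c_i T^i over K[X] belongs to K[X]. *)
Definition normal_affine (K : closedFieldType) (X : fspace K) : Prop :=
  forall (a b : X -> K) (n : nat) (c : 'I_n -> X -> K),
    regular_on setT a -> regular_on setT b -> (exists x, b x != 0) ->
    (forall i, regular_on setT (c i)) ->
    (forall x, a x ^+ n + \sum_(i < n) c i x * a x ^+ i * b x ^+ (n - i) = 0) ->
    exists2 q : X -> K, regular_on setT q & forall x, a x = q x * b x.

(* Etale in the sense of the Jacobian criterion: locally on X and Y, phi is the
   projection to Z of the locus g_1 = ... = g_n = 0 in Z x A^n, with
   det (d g_i / d t_j) nowhere zero on that locus (t = last n coordinates).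
   The Jacobian condition makes Spec K[Z][t]/(g) reduced, so nothing is lost by
   only looking at points. *)
Definition etale_locus (K : closedFieldType) (m n : nat) (Z : set (affine_space K m))
    (g : 'I_n -> mpoly.mpoly (m + n) K) : set (affine_space K (m + n)) :=
  [set w | Z (lsubmx (w : 'rV[K]_(m + n))) /\ forall i, peval (g i) w = 0].

Definition jacobian (K : closedFieldType) (m n : nat)
    (g : 'I_n -> mpoly.mpoly (m + n) K) (w : 'rV[K]_(m + n)) : 'M[K]_n :=
  \matrix_(i, j) peval (mpoly.mderiv (rshift m j) (g i)) w.

Definition etale_at (K : closedFieldType) (X Y : fspace K) (phi : X -> Y) (x : X) : Prop :=
  exists (U : set X) (V : set Y) (m n : nat) (Z : set (affine_space K m))
    (g : 'I_n -> mpoly.mpoly (m + n) K)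
    (alpha : sub_space V -> sub_space Z)
    (beta : sub_space U -> sub_space (etale_locus Z g)),
  [/\ [/\ open U, U x, open V & forall u, U u -> V (phi u)],
      [/\ closed Z, isomorphism alpha & isomorphism beta],
      forall (u : sub_space U) (v : sub_space V), set_val v = phi (set_val u) ->
        lsubmx (set_val (beta u) : 'rV[K]_(m + n)) = set_val (alpha v) &
      forall w, etale_locus Z g w -> \det (jacobian g w) != 0].

Definition etale (K : closedFieldType) (X Y : fspace K) (phi : X -> Y) : Prop :=
  morphism phi /\ forall x, etale_at phi x.

Record alg_group (K : closedFieldType) := AlgGroup {
  ag_space :> fspace K ;
  ag_variety : variety ag_space ;
  ag_mul : ag_space -> ag_space -> ag_space ;
  ag_one : ag_space ;
  ag_inv : ag_space -> ag_space ;
  ag_mulA : associative ag_mul ;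
  ag_mul1 : left_id ag_one ag_mul ;
  ag_mulV : left_inverse ag_one ag_inv ag_mul ;
  ag_mul_morphism :
    morphism (fun p : prod_space ag_space ag_space => ag_mul p.1 p.2) ;
  ag_inv_morphism : morphism ag_inv }.

Definition alg_group_hom (K : closedFieldType) (H G : alg_group K) (rho : H -> G) : Prop :=
  morphism rho /\ forall s t, rho (ag_mul s t) = ag_mul (rho s) (rho t).

Definition rational_repr (K : closedFieldType) (G : alg_group K) (n : nat)
    (R : G -> 'M[K]_n) : Prop :=
  [/\ R (ag_one G) = 1%:M, forall g h, R (ag_mul g h) = R g *m R h &
      forall i j, regular_on setT (fun g => R g i j)].

Definition unipotent (K : closedFieldType) (G : alg_group K) (g : G) : Prop :=
  forall (n : nat) (R : G -> 'M[K]_n), rational_repr R ->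
    exists k : nat, (R g - 1%:M) ^+ k = 0.

Definition closed_normal_subgroup (K : closedFieldType) (G : alg_group K)
    (N : set G) : Prop :=
  [/\ closed N, N (ag_one G), forall g h, N g -> N h -> N (ag_mul g h),
      forall g, N g -> N (ag_inv g) &
      forall g h, N h -> N (ag_mul (ag_mul g h) (ag_inv g))].

(* Affine with trivial unipotent radical; not necessarily connected. *)
Definition reductive (K : closedFieldType) (G : alg_group K) : Prop :=
  affine_variety G /\
  forall N : set G, closed_normal_subgroup N -> connected N ->
    (forall g, N g -> unipotent g) -> N = [set ag_one G].

Definition torus (K : closedFieldType) (T : alg_group K) : Prop :=
  exists (r : nat)
    (phi : T -> sub_space [set x : affine_space K r | forall i, (x : 'rV[K]_r) 0 i != 0]),
  isomorphism phi /\
  forall s t i, (set_val (phi (ag_mul s t)) : 'rV[K]_r) 0 i =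
    (set_val (phi s) : 'rV[K]_r) 0 i * (set_val (phi t) : 'rV[K]_r) 0 i.

Definition left_action (K : closedFieldType) (H : alg_group K) (X : fspace K)
    (a : H -> X -> X) : Prop :=
  [/\ morphism (fun p : prod_space H X => a p.1 p.2),
      forall x, a (ag_one H) x = x &
      forall s t x, a (ag_mul s t) x = a s (a t x)].

Definition right_action (K : closedFieldType) (H : alg_group K) (X : fspace K)
    (a : X -> H -> X) : Prop :=
  [/\ morphism (fun p : prod_space X H => a p.1 p.2),
      forall x, a x (ag_one H) = x &
      forall x s t, a x (ag_mul s t) = a (a x s) t].

(* An irreducible normal affine variety with an action of the torus T and a
   dense open orbit that T is carried onto isomorphically by the orbit map. *)
Definition affine_toric_variety (K : closedFieldType) (T : alg_group K) (Y : fspace K)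
    (a : T -> Y -> Y) : Prop :=
  [/\ torus T, affine_variety Y, irreducible_space Y, normal_affine Y & left_action a] /\
  exists y0 : Y,
    [/\ open (range (a^~ y0)), dense (range (a^~ y0)) &
        exists j : T -> sub_space (range (a^~ y0)),
          isomorphism j /\ forall t, set_val (j t) = a t y0].

Definition pullback (K : closedFieldType) (X Y E : fspace K) (phi : X -> Y) (f : E -> Y) :
    fspace K :=
  sub_space [set p : prod_space X E | phi p.1 = f p.2].

(* Locally trivial in the etale topology; since G is smooth this is the same as
   being a G-torsor in the fppf topology. *)
Definition principal_bundle (K : closedFieldType) (G : alg_group K) (E Y : fspace K)
    (f : E -> Y) (r : E -> G -> E) : Prop :=
  [/\ variety E, morphism f, right_action r, forall e g, f (r e g) = f e &
      forall y : Y, exists (X : fspace K) (phi : X -> Y),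
        [/\ variety X, etale phi, range phi y &
            exists Phi : prod_space X G -> pullback phi f,
              [/\ isomorphism Phi,
                  forall x g, (set_val (Phi (x, g))).1 = x &
                  forall x g h,
                    (set_val (Phi (x, ag_mul g h))).2 = r (set_val (Phi (x, g))).2 h]]].

Definition equivariant_principal_bundle (K : closedFieldType) (T G : alg_group K)
    (E Y : fspace K) (a : T -> Y -> Y) (f : E -> Y) (b : T -> E -> E)
    (r : E -> G -> E) : Prop :=
  [/\ principal_bundle f r, left_action b,
      forall t e, f (b t e) = a t (f e) &
      forall t e g, b t (r e g) = r (b t e) g].

Definition equivariantly_trivializable (K : closedFieldType) (T G : alg_group K)
    (E Y : fspace K) (a : T -> Y -> Y) (f : E -> Y) (b : T -> E -> E)
    (r : E -> G -> E) : Prop :=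
  exists (rho : T -> G) (Phi : E -> prod_space Y G),
    [/\ alg_group_hom rho, isomorphism Phi,
        forall e, (Phi e).1 = f e,
        forall e g, Phi (r e g) = ((Phi e).1, ag_mul (Phi e).2 g) &
        forall t e, Phi (b t e) = (a t (Phi e).1, ag_mul (rho t) (Phi e).2)].

(* Main.v *)
(* Let ell retract Y onto its closed orbit, and let the one-parameter subgroup la contract the slice
   ell = 1 to the point ystar.  Newton iteration lifts the arcs z |-> la(z) y of the slice to an etale
   neighbourhood of ystar that trivializes E; the coefficients of the lifted arcs are weighted homogeneous
   in the coordinates of y.  In this formal trivialization T acts through a cocycle c with values in
   G(K[[z]]), whose value at z = 0 is a homomorphism rho.  Since tori are linearly reductive (averages
   over finitely many points suffice) and G is smooth, c is cohomologous to rho, order by order in z.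
   The resulting formal equivariant section is homogeneous under la, hence algebraic over the open orbit.
   There it is also a quotient of polynomials lying in the completed local ring of ystar, so that Krull's
   intersection theorem extends it over ystar, and translations extend it to a section sigma of E over Y.
   The same descent along arcs shows that g in e = sigma(f e) g depends regularly on e.  Identities between
   power series are checked on K-points, by specializing finitely generated subalgebras of K[[z]]. *)
Require Import Defs.
From HB Require Import structures.
From mathcomp Require Import all_boot all_order all_algebra.
From mathcomp Require Import all_classical topology.
From mathcomp Require Import mpoly ring lra zify.

Set Implicit Arguments.
Unset Strict Implicit.
Unset Printing Implicit Defensive.

Import Order.TTheory GRing.Theory Num.Theory.
Local Open Scope classical_set_scope.
Local Open Scope ring_scope.

(** * Evaluation of polynomials and specialization *)

(** The obstacle is that an etale neighbourhood of [ystar] carries no action of T; only its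
    completion does. Equivariance is therefore arranged over formal arcs, and the result must be
    brought back to polynomials. Varieties are given by their K-points, so a statement over K[[z]]
    is expressed by congruences between evaluations of polynomials, and families of series are kept
    graded in order that their coefficients remain polynomials on the slice. Smoothness of G has to
    be proved: its ideal is radical and every tangent vector at 1 extends to an invariant vector
    field, but in characteristic p a vanishing derivative only gives a p-th power, which calls for
    an analysis of the Frobenius. Normality of Y makes the lattice of invertible monomials
    saturated, so that the corresponding torus splits off T and the retraction [ell] exists. Krull's
    theorem serves twice, for the section and for the division map, each time to match a fraction
    valid generically with a formal one valid at the base point. *)

Section Evaluation.
Variables (A R : comNzRingType) (i : {rmorphism A -> R}).

Definition ev n (x : 'I_n -> R) (p : {mpoly A[n]}) : R := mmap i x p.

HB.instance Definition _ n (x : 'I_n -> R) := GRing.RMorphism.copy (ev x) (mmap i x).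

Lemma evC n (x : 'I_n -> R) c : ev x c%:MP = i c.
Proof. exact: mmapC. Qed.

Lemma evX n (x : 'I_n -> R) j : ev x 'X_j = x j.
Proof. by rewrite /ev mmapX mmap1U. Qed.

Lemma evXm n (x : 'I_n -> R) m : ev x 'X_[m] = \prod_j x j ^+ m j.
Proof. exact: mmapX. Qed.

Lemma evZ n (x : 'I_n -> R) c p : ev x (c *: p) = i c * ev x p.
Proof. exact: mmapZ. Qed.

(** Induction over ring operations instead of monomials: statements about evaluations then need no
    sums over supports. *)
Lemma mpoly_ring_ind n (P : {mpoly A[n]} -> Prop) :
  (forall c, P c%:MP) -> (forall j, P 'X_j) ->
  (forall p q, P p -> P q -> P (p + q)) -> (forall p q, P p -> P q -> P (p * q)) ->
  forall p, P p.
Proof.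
move=> PC PX PD PM p.
elim/mpolyind: p => [|c m p _ _ Pp]; first by rewrite -(mpolyC0 n).
apply: (PD) => //; rewrite -mul_mpolyC; apply: (PM) => //.
have P1 : P 1 by rewrite -(mpolyC1 n).
rewrite mpolyXE_id; apply: (big_ind P) => [//|x y|j _]; first exact: (PM).
by elim: (m j) => [|k IH]; rewrite ?expr0 ?exprS //; apply: (PM).
Qed.

Lemma eq_ev n (x y : 'I_n -> R) : x =1 y -> ev x =1 ev y.
Proof. by move=> xy p; rewrite (_ : x = y) //; apply/funext. Qed.

End Evaluation.

Lemma rmorph_ev (A R S : comNzRingType) (i : {rmorphism A -> R}) (j : {rmorphism A -> S})
    (f : {rmorphism R -> S}) n (x : 'I_n -> R) p :
  (forall c, f (i c) = j c) -> f (ev i x p) = ev j (f \o x) p.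
Proof.
move=> fi; elim/mpoly_ring_ind: p => [c|k|p q|p q]; rewrite ?evC ?evX ?rmorphD ?rmorphM //=.
  by move=> -> ->.
by move=> -> ->.
Qed.

Definition msub (A : comNzRingType) m n (q : 'I_n -> {mpoly A[m]}) (p : {mpoly A[n]}) :=
  ev (@mpolyC m A) q p.

HB.instance Definition _ (A : comNzRingType) m n (q : 'I_n -> {mpoly A[m]}) :=
  GRing.RMorphism.copy (msub q) (ev (@mpolyC m A) q).

Lemma ev_msub (A R : comNzRingType) (i : {rmorphism A -> R}) m n
    (q : 'I_n -> {mpoly A[m]}) (x : 'I_m -> R) p :
  ev i x (msub q p) = ev i (fun j => ev i x (q j)) p.
Proof. by rewrite /msub (rmorph_ev (j := i) (f := ev i x)) // => c; exact: evC. Qed.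

Lemma meval_msub (K : comNzRingType) m n (q : 'I_n -> {mpoly K[m]}) (x : 'I_m -> K) p :
  (msub q p).@[x] = p.@[fun j => (q j).@[x]].
Proof. exact: (ev_msub idfun). Qed.

Section Ideals.
Variable R : comNzRingType.

Definition ideal (I : R -> Prop) :=
  [/\ I 0, forall x y, I x -> I y -> I (x + y) & forall a x, I x -> I (a * x)].

Lemma idealN I x : ideal I -> I x -> I (- x).
Proof. by case=> _ _ IM Ix; rewrite -mulN1r; apply: IM. Qed.

Lemma idealB I x y : ideal I -> I x -> I y -> I (x - y).
Proof. by move=> iI Ix Iy; case: (iI) => _ ID _; apply: ID => //; apply: idealN. Qed.

Lemma idealMr I x a : ideal I -> I x -> I (x * a).
Proof. by case=> _ _ IM Ix; rewrite mulrC; apply: IM. Qed.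

Lemma ideal_sum I (J : Type) (r : seq J) (P : pred J) F :
  ideal I -> (forall j, P j -> I (F j)) -> I (\sum_(j <- r | P j) F j).
Proof. by case=> I0 ID _ IF; elim/big_ind: _. Qed.

Lemma ideal_congl I x y : ideal I -> I (x - y) -> I y -> I x.
Proof. by move=> iI Ixy Iy; rewrite -(subrK y x); case: (iI) => _ ID _; apply: ID. Qed.

Definition prime_ideal (P : R -> Prop) :=
  [/\ ideal P, ~ P 1 & forall x y, P (x * y) -> P x \/ P y].

Lemma prime_idealX P x k : prime_ideal P -> P (x ^+ k) -> P x.
Proof.
case=> _ P1 PM; elim: k => [|k IH]; first by rewrite expr0.
by rewrite exprS => /PM[].
Qed.

End Ideals.

Section Fold.
Variables (K : comNzRingType) (n : nat).
Notation A := {mpoly K[n]}.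

Let wid : {rmorphism A -> {mpoly K[n.+1]}} :=
  ev (@mpolyC n.+1 K) (fun j => 'X_(lift ord_max j)).

(** Ideals are pulled back along this map to eliminate the last variable; of the isomorphism between
    A[X] and the larger polynomial ring only surjectivity is used. *)
Definition fold_mpoly : {rmorphism {poly A} -> {mpoly K[n.+1]}} :=
  (horner_eval ('X_ord_max : {mpoly K[n.+1]}) \o map_poly wid).

Lemma fold_mpolyC a : fold_mpoly a%:P = wid a.
Proof. by rewrite /= map_polyC /= /horner_eval hornerC. Qed.

Lemma fold_mpoly_surj p : exists F, fold_mpoly F = p.
Proof.
elim/mpoly_ring_ind: p => [c|j|p q [F <-] [G <-]|p q [F <-] [G <-]].
- by exists (c%:MP)%:P; rewrite fold_mpolyC /= evC.
- case: (unliftP ord_max j) => [k ->|->].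
    by exists ('X_k)%:P; rewrite fold_mpolyC /= evX.
  by exists 'X; rewrite /= map_polyX /horner_eval hornerX.
- by exists (F + G); rewrite rmorphD.
by exists (F * G); rewrite rmorphM.
Qed.

Definition extend_point (c : 'I_n -> K) (x : K) (j : 'I_n.+1) : K :=
  if unlift ord_max j is Some k then c k else x.

Lemma meval_fold c x F :
  (fold_mpoly F).@[extend_point c x] = (map_poly (meval c) F).[x].
Proof.
elim/poly_ind: F => [|F a IH]; first by rewrite !rmorph0 /= horner0.
rewrite [fold_mpoly _]rmorphD [fold_mpoly (_ * _)]rmorphM mevalD mevalM IH fold_mpolyC.
have -> : map_poly (meval c) (F * 'X + a%:P) = map_poly (meval c) F * 'X + (a.@[c])%:P.
  by rewrite rmorphD rmorphM /= map_polyX map_polyC.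
rewrite hornerMXaddC; congr (_ * _ + _).
  by rewrite /= !map_polyX /horner_eval !hornerX mevalXU /extend_point unlift_none.
have := ev_msub idfun (fun j => 'X_(lift ord_max j)) (extend_point c x) a.
rewrite /msub /ev -/(meval _ _) => ->; apply: meval_eq => j.
by rewrite -[LHS]/('X_(lift ord_max j)).@[extend_point c x] mevalXU /extend_point liftK.
Qed.

End Fold.
Arguments fold_mpoly {K n}.

(** * Hilbert's Nullstellensatz and points of finitely generated algebras *)

Section Nullstellensatz.
Variable K : closedFieldType.

(* Either q[X] = Q and a nonzero coefficient of F0 is enough, or X is algebraic
   over A / q and l is a leading coefficient times a resultant. *)
Lemma prime_ideal_extension (A : idomainType) (Q : {poly A} -> Prop) (F0 : {poly A}) :
  prime_ideal Q -> ~ Q F0 ->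
  exists2 l, ~ Q l%:P & forall phi : {rmorphism A -> K},
    (forall a, Q a%:P -> phi a = 0) -> phi l != 0 ->
    exists2 x, (map_poly phi F0).[x] != 0 & forall F, Q F -> (map_poly phi F).[x] = 0.
Proof.
move=> prQ QF0; have [iQ Q1 Qp] := prQ; have [Q0 QD QM] := iQ.
pose q (a : A) := Q a%:P.
have prq : prime_ideal q.
  split=> [||x y]; first split => [|x y|x y]; rewrite /q ?rmorph0 ?rmorphD ?rmorphM //.
  - exact: QD.
  - exact: QM.
  - exact: Qp.
have iq : ideal q by case: prq.
pose red (F : {poly A}) := forall j, q F`_j.
have redQ F : red F -> Q F.
  move=> rF; rewrite -[F]coefK poly_def; apply: (ideal_sum _ iQ) => j _.
  by rewrite -mul_polyC mulrC; apply/QM/rF.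
have redM F G : red F -> red (G * F).
  by move=> rF j; rewrite coefM; apply: (ideal_sum _ iq) => k _; case: iq => _ _; apply.
have redD F G : red F -> red G -> red (F + G).
  by move=> rF rG j; rewrite coefD; case: iq => _ + _; apply.
have redN F : red F -> red (- F) by move=> rF j; rewrite coefN; apply: (idealN iq).
have red_lead (F : {poly A}) : q (lead_coef F) -> red (lead_coef F *: 'X^((size F).-1)).
  by move=> qF j; rewrite coefZ coefXn; apply: (idealMr _ iq).
have trunc (F : {poly A}) : F != 0 ->
    (size (F - lead_coef F *: 'X^((size F).-1))%R < size F)%N.
  move=> Fn0; rewrite [ltnRHS]polySpred // ltnS; apply/leq_sizeP => j lj.
  rewrite coefB coefZ coefXn; have [->|neq] := eqVneq j (size F).-1.
    by rewrite mulr1 subrr.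
  by rewrite mulr0 subr0 nth_default // -(prednK (n := size F)) ?size_poly_gt0 // ltn_neqAle eq_sym neq.
have red0 (phi : {rmorphism A -> K}) F :
    (forall a, q a -> phi a = 0) -> red F -> map_poly phi F = 0.
  by move=> qc rF; apply/polyP => j; rewrite coef_map coef0 /=; apply/qc/rF.
have [allred|/existsNP[F1 /not_implyP[QF1 nrF1]]] := pselect (forall F, Q F -> red F).
  have /existsNP[j qj] : ~ red F0 by move/redQ.
  exists F0`_j => // phi qc cj.
  have : map_poly phi F0 != 0.
    by apply: contra cj => /eqP E; rewrite -coef_map E coef0.
  by move/closed_nonrootP=> [x xF]; exists x => // F /allred /(red0 phi) ->; rewrite ?horner0.
(* An element of [J] outside q[X] of least degree: a leading term with coefficient in [q] could be
   removed, so its leading coefficient lies outside [q]. *)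
have minimal (J : {poly A} -> Prop) F : J F -> ~ red F ->
    (forall F, J F -> J (F - lead_coef F *: 'X^((size F).-1)) \/ ~ q (lead_coef F)) ->
    exists G, [/\ J G, ~ q (lead_coef G) & forall H, J H -> (size H < size G)%N -> red H].
  move=> JF nF Jt; have [N] := ubnP (size F); elim: N F JF nF => // N IHN F JF nF.
  rewrite ltnS => sF.
  have [[H [JH nH sH]]|noH] := pselect (exists H, [/\ J H, ~ red H & (size H < size F)%N]).
    by apply: IHN JH nH _; apply: leq_trans sF.
  exists F; split=> // [qF|H JH sH]; last by apply: contrapT => nH; apply: noH; exists H.
  have [JT|//] := Jt F JF; apply: noH; eexists; split; first exact: JT.
    by move=> rT; apply: nF; rewrite -[F](subrK (lead_coef F *: 'X^((size F).-1))); apply: redD => //; apply: red_lead.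
  by apply: trunc; apply: contra_notN nF => /eqP-> j; rewrite coef0; case: iq.
have [mu [Qmu qmu min_mu]] : exists G, [/\ Q G, ~ q (lead_coef G) & forall H, Q H -> (size H < size G)%N -> red H].
  apply: minimal QF1 nrF1 _ => F QF; have [qF|] := pselect (q (lead_coef F)); last by right.
  by left; apply: (idealB iQ) => //; apply/redQ/red_lead.
(* [J] is the ideal generated by [F0], [mu] and q[X]. Its least element [h] plays the role of a gcd
   of [F0] and [mu] over the fraction field of A / q, and primality of [Q] makes it constant. *)
pose J F := exists u v e, red e /\ F = u * F0 + v * mu + e.
have [h [[u [v [e [re hE]]]] qh min_h]] :
    exists G, [/\ J G, ~ q (lead_coef G) & forall H, J H -> (size H < size G)%N -> red H].
  apply: (minimal _ F0) => [||F [u [v [e [re FE]]]]].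
  - exists 1, 0, 0; split; first by move=> j; rewrite coef0; case: iq.
    by rewrite mul1r mul0r !addr0.
  - by move/redQ.
  have [qF|] := pselect (q (lead_coef F)); last by right.
  left; exists u, v, (e - lead_coef F *: 'X^((size F).-1)); split; last by rewrite {1}FE addrA.
  by apply: redD => //; apply/redN/red_lead.
have nz (F : {poly A}) : ~ q (lead_coef F) -> F != 0.
  by move=> qF; apply: contra_notN qF => /eqP ->; rewrite lead_coef0; case: iq.
have sh : size h = 1%N.
  apply/eqP; rewrite eqn_leq size_poly_gt0 nz // andbT leqNgt; apply/negP => sh.
  have Jrem F u' v' : F = u' * F0 + v' * mu -> red (Pdiv.Idomain.modp F h).
    move=> FE; apply: min_h; last by rewrite Pdiv.Idomain.ltn_modp nz.
    have := Pdiv.Idomain.divp_eq F h.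
    set k := lead_coef h ^+ _; set d := Pdiv.Idomain.divp F h.
    move=> E; have -> : Pdiv.Idomain.modp F h = k *: F - d * h by rewrite E addrAC subrr add0r.
    exists (k *: u' - d * u), (k *: v' - d * v), (- d * e).
    split; first exact: redM.
    rewrite hE FE -!mul_polyC; ring.
  have qX k : ~ q (lead_coef h ^+ k) by move/(prime_idealX prq).
  have notQh : ~ Q h.
    move=> Qh; have rem := Jrem F0 1 0; have := Pdiv.Idomain.divp_eq F0 h.
    rewrite mul1r mul0r addr0 in rem; move=> E.
    have : Q (lead_coef h ^+ Pdiv.Idomain.scalp F0 h *: F0).
      by rewrite E; apply: QD; [apply: QM|apply/redQ/rem].
    by rewrite -mul_polyC => /Qp[/qX|].
  have := Pdiv.Idomain.divp_eq mu h.
  have rem := Jrem mu 0 1; rewrite mul1r mul0r add0r in rem.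
  set k := lead_coef h ^+ _; set d := Pdiv.Idomain.divp mu h => E.
  have k0 : k != 0 by rewrite expf_neq0 // lead_coef_eq0 nz.
  have : Q (d * h).
    have -> : d * h = k *: mu - Pdiv.Idomain.modp mu h by rewrite E addrK.
    rewrite -mul_polyC; apply: (idealB iQ) => //; first exact: QM.
    exact/redQ/rem.
  case/Qp => // Qd.
  have rd : red d.
    apply: min_mu => //; rewrite /d Pdiv.Idomain.size_divp ?nz //.
    by have := nz _ qmu; rewrite -size_poly_gt0; lia.
  have /(_ (size mu).-1) : red (k *: mu).
    by rewrite E; apply: redD; [rewrite mulrC; apply: redM|apply: rem].
  by rewrite coefZ; case: prq => _ _ qp /qp[/qX|].
have hC : h = (lead_coef h)%:P by rewrite lead_coefE sh; apply: size1_polyC; rewrite sh.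
have smu : (1 < size mu)%N.
  rewrite ltnNge; apply/negP => smu; apply: qmu; rewrite /q lead_coefE.
  by rewrite (_ : (size mu).-1 = 0%N) -?size1_polyC //; lia.
(* [lead_coef mu] keeps the degree of [mu] under [phi], so that a root exists, and [lead_coef h]
   keeps [F0] nonzero at this root, by the Bezout relation [hE]. *)
exists (lead_coef mu * lead_coef h) => [|phi qc]; first by case: prq => _ _ qp /qp[].
rewrite rmorphM mulf_eq0 negb_or => /andP[muc hc].
have smuc : size (map_poly phi mu) != 1%N.
  suff -> : size (map_poly phi mu) = size mu by rewrite neq_ltn smu orbT.
  by rewrite size_map_poly_id0.
have /closed_rootP[x /rootP mux] := smuc.
exists x => [|F QF].
  apply: contra_neq hc => F0x.
  have := congr1 (fun P => (map_poly phi P).[x]) (etrans (esym hC) hE).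
  rewrite !rmorphD !rmorphM /= map_polyC hornerC /= !hornerE F0x mux (red0 _ _ qc re).
  by rewrite horner0 !mulr0 !addr0.
have rem : red (Pdiv.Idomain.modp F mu).
  apply: min_mu; last by rewrite Pdiv.Idomain.ltn_modp nz.
  have E := Pdiv.Idomain.divp_eq F mu.
  move: E; set c := lead_coef mu ^+ _ => E.
  have -> : Pdiv.Idomain.modp F mu = c *: F - Pdiv.Idomain.divp F mu * mu.
    by rewrite E addrAC subrr add0r.
  by rewrite -mul_polyC; apply: idealB => //; apply: QM.
have /(congr1 (fun P => (map_poly phi P).[x])) := Pdiv.Idomain.divp_eq F mu.
rewrite map_polyZ rmorphD rmorphM /= hornerZ hornerD hornerM mux.
rewrite (red0 _ _ qc rem) horner0 mulr0 addr0 rmorphXn => /eqP.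
by rewrite mulf_eq0 expf_eq0 (negPf muc) andbF => /eqP.
Qed.

Lemma mpoly0E (p : {mpoly K[0]}) : p = (p@_0)%:MP.
Proof.
apply/mpolyP => m; rewrite mcoeffC (_ : m = 0%MM) ?eqxx ?mulr1 //.
by apply/mnmP => -[].
Qed.

(** Induction on the number of variables: the polynomial [l] provided by [prime_ideal_extension] is
    nonzero at some point of the contracted prime, over which a last coordinate exists. *)
Lemma prime_ideal_point n (P : {mpoly K[n]} -> Prop) f : prime_ideal P -> ~ P f ->
  exists2 c : 'I_n -> K, f.@[c] != 0 & forall p, P p -> p.@[c] = 0.
Proof.
elim: n P f => [|n IH] P f prP Pf; have [[P0 PD PM] P1 Pp] := prP; have iP : ideal P by [].
  exists (fun=> 0) => [|p]; rewrite [X in X.@[_]]mpoly0E mevalC.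
    by apply/negP => /eqP f0; apply: Pf; rewrite [f]mpoly0E f0 mpolyC0.
  rewrite {1}[p]mpoly0E; have [//|p0] := eqVneq (p@_0) 0.
  by move=> /(PM (p@_0)^-1%:MP); rewrite -mpolyCM mulVf // mpolyC1.
pose Q (F : {poly {mpoly K[n]}}) := P (fold_mpoly F).
have prQ : prime_ideal Q.
  split=> [||F G]; rewrite /Q ?rmorph1 ?rmorphM //; last exact: Pp.
  split=> [|F G|F G]; rewrite /Q ?rmorph0 ?rmorphD ?rmorphM //; [exact: PD|exact: PM].
have [F0 f_F0] := fold_mpoly_surj f.
have {Pf} QF0 : ~ Q F0 by rewrite /Q f_F0.
have [l Ql lP] := prime_ideal_extension prQ QF0.
have [||c lc qc] := IH (fun a => Q a%:P) l; last 1 first.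
- have [x Fx Qx] := lP (meval c) qc lc.
  exists (extend_point c x) => [|p Pp']; first by rewrite -f_F0 meval_fold.
  by have [F pF] := fold_mpoly_surj p; rewrite -pF meval_fold; apply: Qx; rewrite /Q pF.
- have [[Q0 QD QM] Q1 Qp] := prQ.
  by split=> [||x y]; [split=> [|x y|x y]|..]; rewrite ?rmorph0 ?rmorphD ?rmorphM ?rmorph1;
    [|apply: QD|apply: QM|..|apply: Qp].
- by [].
Qed.

End Nullstellensatz.

(** An ideal maximal among those that miss the powers of [f], given by Zorn's lemma, is prime:
    enlarging it by either of two outside elements catches a power of [f], and the ideal would
    contain the product of both powers if it contained the product of the elements. *)
Lemma ideal_avoiding_prime (R : comNzRingType) (I : R -> Prop) f :
  ideal I -> (forall k, ~ I (f ^+ k)) ->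
  exists P, [/\ prime_ideal P, forall x, I x -> P x & ~ P f].
Proof.
move=> iI If; pose good (J : R -> Prop) :=
  [/\ ideal J, forall x, I x -> J x & forall k, ~ J (f ^+ k)].
pose T := {J : R -> Prop | good J}.
pose le (J L : T) := `[< forall x, sval J x -> sval L x >].
have gI : good I by split.
have [|||[P [iP IP Pf]] Pmax] := @ZL_preorder T (exist _ I gI) le.
- by move=> J; apply/asboolP.
- by move=> J L M /asboolP JL /asboolP LM; apply/asboolP => x /JL /LM.
- move=> C Ctot; have [[J0 CJ0]|C0] := pselect (exists J, C J); last first.
    by exists (exist _ I gI) => J CJ; case: C0; exists J.
  pose U x := exists2 J, C J & sval J x.
  have gU : good U.
    split; [split| |].
    - by exists J0 => //; case: (svalP J0) => -[].
    - move=> x y [J CJ Jx] [L CL Ly].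
      have [/asboolP JL|/asboolP LJ] := Ctot _ _ CJ CL.
        by exists L => //; case: (svalP L) => -[_ LD _] _ _; apply: LD => //; apply: JL.
      by exists J => //; case: (svalP J) => -[_ LD _] _ _; apply: LD => //; apply: LJ.
    - by move=> a x [J CJ Jx]; exists J => //; case: (svalP J) => -[_ _ JM] _ _; apply: JM.
    - by move=> x Ix; exists J0 => //; case: (svalP J0) => _ + _; apply.
    by move=> k [J CJ Jf]; case: (svalP J) => _ _ /(_ k).
  by exists (exist _ U gU) => J CJ; apply/asboolP => x Jx; exists J.
case: (iP) => P0 PD PM.
have grow x : ~ P x -> exists k a, P (f ^+ k - a * x).
  move=> Px; pose L y := exists a, P (y - a * x).
  have [//|nL] := pselect (exists k, L (f ^+ k)).
  have gL : good L.
    split; [split| |].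
    - by exists 0; rewrite mul0r subrr.
    - move=> y z [b Pb] [c Pc]; exists (b + c).
      rewrite (_ : _ - _ = (y - b * x) + (z - c * x)); [exact: PD|ring].
    - move=> d y [b Pb]; exists (d * b).
      rewrite (_ : _ - _ = d * (y - b * x)); [exact: PM|ring].
    - by move=> y Iy; exists 0; rewrite mul0r subr0; apply: (IP y).
    by move=> k Lk; apply: nL; exists k.
  have /asboolP LP : le (exist _ L gL) (exist _ P (And3 iP IP Pf)).
    by apply: Pmax; apply/asboolP => y /= Py; exists 0; rewrite mul0r subr0.
  by case: Px; apply: LP; exists 1; rewrite mul1r subrr.
exists P; split=> //; last by move=> Pf1; apply: (Pf 1); rewrite expr1.
split=> // [P1|x y Pxy]; first by apply: (Pf 0); rewrite expr0.
have [Px|/grow[k [c Pk]]] := pselect (P x); first by left.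
have [Py|/grow[j [d Pj]]] := pselect (P y); first by right.
case: (Pf (k + j)%N); rewrite exprD.
have -> : f ^+ k * f ^+ j = f ^+ j * (f ^+ k - c * x) + c * x * (f ^+ j - d * y) + c * d * (x * y) by ring.
by apply: (PD); [apply: (PD)|]; apply: (PM).
Qed.

Section Specialization.
Variable K : closedFieldType.

Lemma nullstellensatz n (I : {mpoly K[n]} -> Prop) f : ideal I ->
  (forall c, (forall p, I p -> p.@[c] = 0) -> f.@[c] = 0) -> exists k, I (f ^+ k).
Proof.
move=> iI If; apply: contrapT => /forallNP /(ideal_avoiding_prime iI) [P [prP IP Pf]].
have [c fc Pc] := prime_ideal_point prP Pf.
by case/eqP: fc; apply: If => p /IP; apply: Pc.
Qed.

Variables (R : comNzRingType) (i : {rmorphism K -> R}).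

(** A homomorphism of K-algebras on the subalgebra [A], encoded as a total function; its values off
    [A] are arbitrary. *)
Definition partial_hom (A : R -> Prop) (L : R -> K) :=
  [/\ forall c, A (i c) /\ L (i c) = c,
      forall x y, A x -> A y -> A (x + y) /\ L (x + y) = L x + L y &
      forall x y, A x -> A y -> A (x * y) /\ L (x * y) = L x * L y].

Lemma partial_hom_ev A L n (x : 'I_n -> R) p : partial_hom A L ->
  (forall j, A (x j)) -> A (ev i x p) /\ L (ev i x p) = p.@[L \o x].
Proof.
move=> [HC HD HM] Ax; elim/mpoly_ring_ind: p => [c|j|p q [Ap Lp] [Aq Lq]|p q [Ap Lp] [Aq Lq]].
- by rewrite evC mevalC.
- by rewrite evX mevalXU.
- by rewrite rmorphD mevalD -Lp -Lq; apply: HD.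
by rewrite rmorphM mevalM -Lp -Lq; apply: HM.
Qed.

Definition generated (s : seq R) (x : R) :=
  exists p : {mpoly K[size s]}, x = ev i (fun j : 'I_(size s) => s`_j) p.

Lemma generatedC s c : generated s (i c).
Proof. by exists c%:MP; rewrite evC. Qed.

Lemma generated_mem s x : x \in s -> generated s x.
Proof.
rewrite -index_mem => xi; exists 'X_(Ordinal xi).
by rewrite evX nth_index // -index_mem.
Qed.

Lemma generatedD s x y : generated s x -> generated s y -> generated s (x + y).
Proof. by move=> [p ->] [q ->]; exists (p + q); rewrite rmorphD. Qed.

Lemma generatedM s x y : generated s x -> generated s y -> generated s (x * y).
Proof. by move=> [p ->] [q ->]; exists (p * q); rewrite rmorphM. Qed.

(* A K-point of the affine scheme of a finitely generated subalgebra of the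
   domain R, avoiding the hypersurface f. *)
Lemma specialization (s : seq R) f :
  (forall x y : R, x * y = 0 -> x = 0 \/ y = 0) -> generated s f -> f != 0 ->
  exists2 L, partial_hom (generated s) L & L f != 0.
Proof.
move=> domR [f' ->] f0; pose e : {rmorphism {mpoly K[size s]} -> R} := ev i (fun j : 'I_(size s) => s`_j).
have prP : prime_ideal (fun p => e p = 0).
  split=> [||p q]; last by rewrite rmorphM => /domR.
    split=> [|p q|a p]; rewrite ?rmorph0 ?rmorphD ?rmorphM //; first by move=> -> ->; rewrite addr0.
    by move=> ->; rewrite mulr0.
  by rewrite rmorph1 => /eqP; rewrite oner_eq0.
have [c fc Pc] := prime_ideal_point prP (elimN eqP f0).
have val p q : e p = e q -> p.@[c] = q.@[c].
  by move=> pq; apply/eqP; rewrite -subr_eq0 -mevalB Pc // rmorphB pq subrr.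
pose L x := if pselect (generated s x) is left H then (projT1 (cid H)).@[c] else 0.
have LE p : L (e p) = p.@[c].
  by rewrite /L; case: pselect => [H|[]]; [case: (cid H) => q /= /val|exists p].
exists L; last by rewrite -[ev _ _ _]/(e f') LE.
split=> [a|_ _ [p ->] [q ->]|_ _ [p ->] [q ->]].
- split; first exact: generatedC.
  by have -> : i a = e a%:MP; [rewrite /e /= evC|rewrite LE mevalC].
- by split; [apply: generatedD; [exists p|exists q]|rewrite -[ev _ _ p]/(e p) -[ev _ _ q]/(e q) -rmorphD !LE mevalD].
by split; [apply: generatedM; [exists p|exists q]|rewrite -[ev _ _ p]/(e p) -[ev _ _ q]/(e q) -rmorphM !LE mevalM].
Qed.

End Specialization.

Section Noetherian.

(** * Noetherian rings and Krull's intersection theorem *)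

(** Intersection of all ideals containing [S]: membership is used by instantiating [J], which avoids
    explicit linear combinations. *)
Definition ideal_of (R : comNzRingType) (S : R -> Prop) (x : R) :=
  forall J, ideal J -> (forall y, S y -> J y) -> J x.

Lemma ideal_of_ideal (R : comNzRingType) (S : R -> Prop) : ideal (ideal_of S).
Proof.
split=> [J [] //|x y Sx Sy J iJ SJ|a x Sx J iJ SJ]; case: (iJ) => _ JD JM.
  by apply: JD; [apply: Sx|apply: Sy].
by apply: JM; apply: Sx.
Qed.

Lemma ideal_of_incl (R : comNzRingType) (S : R -> Prop) x : S x -> ideal_of S x.
Proof. by move=> Sx J _; apply. Qed.

Definition noetherian (R : comNzRingType) :=
  forall I : R -> Prop, ideal I ->
  exists2 s : seq R, forall x, x \in s -> I x & forall x, I x -> ideal_of (fun y => y \in s) x.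

Lemma field_noetherian (K : fieldType) : noetherian K.
Proof.
move=> I [I0 ID IM]; have [[x [Ix x0]]|I00] := pselect (exists x, I x /\ x != 0).
  exists [:: x] => [y|y _ J [_ _ JM] SJ]; first by rewrite inE => /eqP ->.
  by rewrite -(mulfVK x0 y); apply/JM/SJ; rewrite inE.
exists [::] => [//|x Ix J [J0 _ _] _]; have [->//|x0] := eqVneq x 0.
by case: I00; exists x.
Qed.

Lemma surj_noetherian (R S : comNzRingType) (f : {rmorphism R -> S}) :
  (forall y, exists x, f x = y) -> noetherian R -> noetherian S.
Proof.
move=> fS nR I [I0 ID IM].
have [|s sI Is] := nR (I \o f).
  split=> [|x y|a x] /=; rewrite ?rmorph0 ?rmorphD ?rmorphM //; [exact: ID|exact: IM].
exists (map f s) => [_ /mapP[x xs ->]|y Iy J [J0 JD JM] SJ]; first exact: sI.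
have [x xy] := fS y; rewrite -xy; apply: (Is x _ (J \o f)) => [||z zs] /=; first by rewrite /= xy.
  split=> [|z t|a z] /=; rewrite ?rmorph0 ?rmorphD ?rmorphM //; [exact: JD|exact: JM].
by apply: SJ; apply: map_f.
Qed.

Lemma seq_choice (A : eqType) (B : choiceType) (Q : A -> B -> Prop) (s : seq A) :
  (forall a, a \in s -> exists b, Q a b) ->
  exists t : seq B, (forall b, b \in t -> exists2 a, a \in s & Q a b) /\
                    (forall a, a \in s -> exists2 b, b \in t & Q a b).
Proof.
elim: s => [|a s IH] sQ; first by exists [::].
have [|t [ts st]] := IH; first by move=> c cs; apply: sQ; rewrite inE cs orbT.
have [b Qb] := sQ a (mem_head a s).
exists (b :: t); split=> [c|c]; rewrite inE => /orP[/eqP->|].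
- by exists a => //; rewrite mem_head.
- by move=> /ts[d ds]; exists d => //; rewrite inE ds orbT.
- by exists b => //; rewrite mem_head.
- by move=> /st[d dt]; exists d => //; rewrite inE dt orbT.
Qed.

(** Hilbert's basis theorem. Generators of the ideal of all leading coefficients lower every degree
    from [D] on; those of the ideals [Lead I d] with d < D treat the remaining degrees. *)
Lemma poly_noetherian (R : comNzRingType) : noetherian R -> noetherian {poly R}.
Proof.
move=> nR I iI; have [I0 ID IM] := iI.
pose Lead (J : {poly R} -> Prop) d a := exists F, [/\ J F, (size F <= d.+1)%N & F`_d = a].
have leadP J d : ideal J -> ideal (Lead J d).
  move=> [J0 JD JM]; split=> [|_ _ [F [IF sF <-]] [G [IG sG <-]]|a _ [F [IF sF <-]]].
  - by exists 0; rewrite size_poly0 coef0.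
  - exists (F + G); rewrite coefD; split=> //; first exact: JD.
    by rewrite (leq_trans (size_polyD _ _)) // geq_max sF.
  exists (a%:P * F); rewrite coefCM; split=> //; first exact: JM.
  by rewrite mul_polyC (leq_trans (size_scale_leq _ _)).
(* Membership in the ideal generated by [t] is tested on every ideal [J] containing [t]: inside it
   the coefficient of degree [e] of an element of [I] can be cancelled. *)
pose step e (t : seq {poly R}) := forall J F, ideal J -> (forall G, G \in t -> J G) -> I F ->
  (size F <= e.+1)%N -> exists H, [/\ J H, I H & (size (F - H)%R <= e)%N].
have stepP e (t : seq {poly R}) :
    (forall J, ideal J -> (forall G, G \in t -> J G) -> forall a, Lead I e a -> Lead (fun H => J H /\ I H) e a) -> step e t.
  move=> tP J F iJ tJ IF sF; have [|H [[JH IH] sH FH]] := tP J iJ tJ F`_e; first by exists F.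
  exists H; split=> //; apply/leq_sizeP => j; rewrite leq_eqVlt => /orP[/eqP<-|ej].
    by rewrite coefB FH subrr.
  by rewrite coefB !nth_default ?subrr // (leq_trans _ ej).
have JI J : ideal J -> ideal (fun H => J H /\ I H).
  move=> [J0 JD JM]; split=> [|x y [Jx Ix] [Jy Iy]|a x [Jx Ix]]; split=> //;
    by [apply: JD|apply: ID|apply: JM|apply: IM].
have one d : exists2 t : seq {poly R}, forall F, F \in t -> I F & step d t.
  have [s sL Ls] := nR _ (leadP I d iI).
  have [t [tI st]] := seq_choice sL.
  exists t => [F /tI[a _ []]//|]; apply: stepP => J iJ tJ a /Ls; apply; first exact/leadP/JI.
  by move=> b /st[F Ft [IF sF Fb]]; exists F; split=> //; split=> //; apply: tJ.
have low D : exists2 t : seq {poly R}, forall F, F \in t -> I F & forall d, (d < D)%N -> step d t.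
  elim: D => [|D [t tI tP]]; first by exists [::].
  have [u uI uP] := one D; exists (t ++ u) => [F|d].
    by rewrite mem_cat => /orP[/tI|/uI].
  rewrite ltnS leq_eqVlt => /orP[/eqP->|/tP dt] J F iJ tJ.
    by apply: uP => // G Gu; apply: tJ; rewrite mem_cat Gu orbT.
  by apply: dt => // G Gu; apply: tJ; rewrite mem_cat Gu.
pose L a := exists d, Lead I d a.
have shift (J : {poly R} -> Prop) (F : {poly R}) d e : ideal J -> J F -> (size F <= d.+1)%N -> (d <= e)%N ->
    exists G, [/\ J G, (size G <= e.+1)%N & G`_e = F`_d].
  move=> [_ _ JM] JF sF de; exists ('X^(e - d) * F); split; first exact: JM.
    by rewrite (leq_trans (size_polyMleq _ _)) // size_polyXn; lia.
  by rewrite coefXnM ltnNge leq_subr /= subKn.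
have iL : ideal L.
  split=> [|_ _ [d [F [IF sF <-]]] [e [G [IG sG <-]]]|a x [d Lx]].
  - by exists 0%N, 0; rewrite size_poly0 coef0.
  - exists (maxn d e).
    have [F' [IF' sF' <-]] := shift I F d _ iI IF sF (leq_maxl d e).
    have [G' [IG' sG' <-]] := shift I G e _ iI IG sG (leq_maxr d e).
    case: (leadP I (maxn d e) iI) => _ LD _; apply: LD; first by exists F'.
    by exists G'.
  by exists d; case: (leadP I d iI) => _ _; apply.
have [s sL Ls] := nR L iL.
have [D [t tI tP]] : exists D, exists2 t : seq {poly R}, forall F, F \in t -> I F &
    forall e, (D <= e)%N -> step e t.
  have sQ a : a \in s -> exists Fd : {poly R} * nat,
      [/\ I Fd.1, (size Fd.1 <= Fd.2.+1)%N & Fd.1`_Fd.2 = a].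
    by move=> /sL[d [F FP]]; exists (F, d).
  have [t [tI st]] := seq_choice sQ.
  exists (\max_(Fd <- t) Fd.2), (map fst t) => [_ /mapP[Fd /tI[a _ [IF _ _]] ->]//|e De].
  apply: stepP => J iJ tJ a La; apply: (Ls a); [by exists e|exact/leadP/JI|].
  move=> b /st[[F d] Ft /= [IF sF <-]]; apply: shift => //; first exact: JI.
    by split=> //; apply: tJ; apply/mapP; exists (F, d).
  by apply: leq_trans De; apply: (leq_bigmax_seq (F := snd) (F, d)).
have [u uI uP] := low D.
exists (t ++ u) => [F|F IF J iJ tuJ]; first by rewrite mem_cat => /orP[/tI|/uI].
have [n] := ubnP (size F); elim: n F IF => // n IHn F IF; rewrite ltnS => sF.
have [F0|] := leqP (size F) 0.
  by move: F0; rewrite size_poly_leq0 => /eqP ->; case: iJ.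
case: n sF IHn => [|n] sF IHn; first by rewrite leqNgt; lia.
move=> _.
have [H [JH IH sH]] : exists H, [/\ J H, I H & (size (F - H)%R <= n)%N].
  have [Dn|nD] := leqP D n; [apply: (tP n Dn J F iJ)|apply: (uP n nD J F iJ)] => // G Gu;
    by apply: tuJ; rewrite mem_cat Gu ?orbT.
rewrite -(subrK H F); case: iJ => _ JD _; apply: (JD) => //; apply: IHn => //.
exact: idealB.
Qed.

Lemma mpoly_noetherian (R : comNzRingType) n : noetherian R -> noetherian {mpoly R[n]}.
Proof.
move=> nR; elim: n => [|n /poly_noetherian IH].
  apply: (surj_noetherian (f := @mpolyC 0 R)) nR => p; exists p@_0.
  apply/mpolyP => m; rewrite mcoeffC (_ : m = 0%MM) ?eqxx ?mulr1 //.
  by apply/mnmP => -[].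
by apply: surj_noetherian IH; last exact: fold_mpoly_surj.
Qed.

End Noetherian.

Lemma pihomogM (R : comNzRingType) n (mf : measure n) k d (p q : {mpoly R[n]}) :
  p \is k.-homog for mf -> pihomog mf (d + k) (q * p) = pihomog mf d q * p.
Proof.
move=> hp; have [D sD] := ubnP (mmeasure mf q).
rewrite {1}[q](pihomog_partitionE (mf := mf) (ltnW sD)) mulr_suml linear_sum /=.
have [dD|Dd] := ltnP d D.
  rewrite (bigD1 (Ordinal dD)) //= pihomog_dE ?dhomogM ?pihomogP // big1 ?addr0 // => j jd.
  by apply: (pihomog_ne0 (d := (j + k)%N)); rewrite ?eqn_add2r // dhomogM ?pihomogP.
rewrite big1 => [|j _]; last first.
  apply: (pihomog_ne0 (d := (j + k)%N)); rewrite ?dhomogM ?pihomogP // eqn_add2r.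
  by rewrite ltn_eqF // (leq_trans (ltn_ord j)).
rewrite pihomogE big_seq_cond big_pred0 ?mul0r // => m.
apply/negP => /andP[mq /eqP md].
by have := mmeasure_mnm_lt mf mq; rewrite md ltnNge (leq_trans _ Dd) // ltnW.
Qed.

Section Krull.
Variables (R : comNzRingType) (d : nat) (y : 'I_d -> R).

(** The k-th power of the ideal (y_1, ..., y_d), as the values at [y] of forms of degree k. The
    forms themselves live in a Noetherian polynomial ring, which is what Krull's theorem
    exploits. *)
Definition ideal_pow k (x : R) := exists2 P : {mpoly R[d]}, P \is k.-homog & x = P.@[y].

Lemma ideal_powD k a b : ideal_pow k a -> ideal_pow k b -> ideal_pow k (a + b).
Proof. by move=> [P hP ->] [Q hQ ->]; exists (P + Q); rewrite ?mevalD // rpredD. Qed.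

Lemma ideal_powMl k a b : ideal_pow k b -> ideal_pow k (a * b).
Proof. by move=> [P hP ->]; exists (a *: P); rewrite ?mevalZ // rpredZ. Qed.

Lemma ideal_pow_ideal k : ideal (ideal_pow k).
Proof.
split; [by exists 0; rewrite ?rpred0 ?meval0|exact: ideal_powD|exact: ideal_powMl].
Qed.

Lemma ideal_powM j k a b : ideal_pow j a -> ideal_pow k b -> ideal_pow (j + k) (a * b).
Proof. by move=> [P hP ->] [Q hQ ->]; exists (P * Q); rewrite ?mevalM // dhomogM. Qed.

Lemma ideal_pow0 a : ideal_pow 0 a.
Proof.
by exists a%:MP; rewrite ?mevalC // -[_%:MP]mulr1 mul_mpolyC rpredZ // dhomog1.
Qed.

Lemma ideal_pow_var j : ideal_pow 1 (y j).
Proof. by exists 'X_j; rewrite ?mevalXU // dhomogX /= mdeg1. Qed.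

Lemma ideal_pow_sub k a : (0 < k)%N -> ideal_pow k a -> ideal_of (range y) a.
Proof.
move=> k0 [P hP ->] J iJ yJ; rewrite mevalE; apply: (ideal_sum _ iJ) => /= m _.
have [mP|] := boolP (m \in msupp P); last first.
  by rewrite -mcoeff_eq0 => /eqP ->; rewrite mul0r; case: iJ.
case: (iJ) => _ _ JM; apply: (JM).
have [j mj] : exists j, m j != 0%N.
  apply/existsP; rewrite -negb_forall; apply/negP => /forallP m0.
  have := dhomog_mf hP mP; rewrite /= mdegE big1 => [E|j _]; last exact/eqP.
  by rewrite -E in k0.
rewrite (bigD1 j) //= -[m j]prednK ?lt0n // exprS -mulrA mulrC.
by apply: (JM); apply: yJ; exists j.
Qed.

(** Forms [P k] of degree k representing [f] modulo [J] generate a finitely generated ideal, so some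
    [P N] is a combination of the earlier ones. Taking components of degree N makes the coefficients
    [q i] forms of positive degree N - i, and evaluation at [y] turns the relation into f = r f
    modulo [J]. *)
Lemma krull_intersection (J : R -> Prop) f : noetherian R -> ideal J ->
  (forall k, exists2 mu, ideal_pow k mu & J (f - mu)) ->
  exists2 r, ideal_of (range y) r & J ((1 - r) * f).
Proof.
move=> nR iJ fJ; have [J0 JD JM] := iJ.
have /choice[P PP] k : exists P : {mpoly R[d]}, P \is k.-homog /\ J (f - P.@[y]).
  by have [_ [P hP ->] Jf] := fJ k; exists P.
have [s sI Is] := mpoly_noetherian (n := d) nR (ideal_of_ideal (range P)).
pose comb N (x : {mpoly R[d]}) := exists c : nat -> {mpoly R[d]}, x = \sum_(i < N) c i * P i.
have icomb N : ideal (comb N).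
  split=> [|_ _ [c ->] [e ->]|a _ [c ->]].
  - by exists (fun=> 0); rewrite big1 // => i _; rewrite mul0r.
  - by exists (fun i => c i + e i); rewrite -big_split; apply: eq_bigr => i _; rewrite mulrDl.
  by exists (fun i => a * c i); rewrite mulr_sumr; apply: eq_bigr => i _; rewrite mulrA.
have combP i N : (i < N)%N -> comb N (P i).
  move=> iN; exists (fun j => (j == i)%:R); rewrite (bigD1 (Ordinal iN)) //= eqxx mul1r.
  by rewrite big1 ?addr0 // => j /negPf; rewrite -val_eqE /= => ->; rewrite mul0r.
have comb_le M N x : (M <= N)%N -> comb M x -> comb N x.
  move=> MN [c ->]; apply: (ideal_sum _ (icomb N)) => i _.
  by case: (icomb N) => _ _; apply; apply: combP; apply: leq_trans MN.
have [N sN] : exists N, forall x, x \in s -> comb N x.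
  elim: (s) sI => [|x t IH] tI; first by exists 0%N.
  have [|M tM] := IH; first by move=> z zt; apply: tI; rewrite inE zt orbT.
  have [M' xM'] : exists M', comb M' x.
    apply: (tI x (mem_head _ _) (fun z => exists M', comb M' z)) => [|_ [i _ <-]]; last by exists i.+1; apply: combP.
    split=> [|u v [a ua] [b vb]|u v [a ua]].
    - by exists 0%N; case: (icomb 0%N).
    - exists (maxn a b); case: (icomb (maxn a b)) => _ CD _; apply: CD.
        exact: comb_le (leq_maxl _ _) ua.
      exact: comb_le (leq_maxr _ _) vb.
    by exists a; case: (icomb a) => _ _; apply.
  exists (maxn M M') => z; rewrite inE => /orP[/eqP->|/tM].
    exact: comb_le (leq_maxr _ _) xM'.
  exact: comb_le (leq_maxl _ _).
have [c PN] : comb N (P N).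
  by apply: (Is (P N)); [apply: ideal_of_incl; exists N|exact: icomb|exact: sN].
pose q (i : 'I_N) := pihomog mdeg (N - i) (c i).
have {}PN : P N = \sum_(i < N) q i * P i.
  have [hN _] := PP N; rewrite -[LHS](pihomog_dE hN) PN linear_sum /=.
  apply: eq_bigr => i _; have [hi _] := PP i.
  by rewrite -(pihomogM _ _ hi) subnK // ltnW.
exists (\sum_(i < N) (q i).@[y]).
  apply: (ideal_sum _ (ideal_of_ideal _)) => i _.
  apply: (@ideal_pow_sub (N - i)); first by rewrite subn_gt0.
  by exists (q i) => //; apply: pihomogP.
have -> : (1 - \sum_(i < N) (q i).@[y]) * f =
    (f - (P N).@[y]) - \sum_(i < N) (q i).@[y] * (f - (P i).@[y]).
  have -> : (P N).@[y] = \sum_(i < N) (q i).@[y] * (P i).@[y].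
    by rewrite PN rmorph_sum; apply: eq_bigr => i _; apply: mevalM.
  have -> : \sum_(i < N) (q i).@[y] * (f - (P i).@[y]) =
      (\sum_(i < N) (q i).@[y]) * f - \sum_(i < N) (q i).@[y] * (P i).@[y].
    by rewrite mulr_suml -sumrB; apply: eq_bigr => i _; rewrite mulrBr.
  ring.
apply: idealB => //; first by case: (PP N).
by apply: ideal_sum => // i _; apply: JM; case: (PP i).
Qed.

End Krull.

Lemma mderiv_var (A : comNzRingType) n (k j : 'I_n) :
  mderiv k ('X_j : {mpoly A[n]}) = (j == k)%:R.
Proof.
rewrite mderivX mnm1E; have [->|_] := eqVneq j k; last by rewrite scale0r.
by rewrite scale1r (_ : _ - _ = 0)%MM ?mpolyX0 //; apply/mnmP => l; rewrite mnmBE subnn mnm0E.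
Qed.

Section Taylor.
Variables (A R : comNzRingType) (i : {rmorphism A -> R}) (n : nat).

Lemma ideal_ev_congr (I : R -> Prop) (x y : 'I_n -> R) p : ideal I ->
  (forall j, I (x j - y j)) -> I (ev i x p - ev i y p).
Proof.
move=> iI Ixy; have [I0 ID IM] := iI.
elim/mpoly_ring_ind: p => [c|j|p q Ip Iq|p q Ip Iq].
- by rewrite !evC subrr.
- by rewrite !evX.
- by rewrite !rmorphD opprD addrACA; apply: ID.
rewrite !rmorphM; set a := ev _ _ p in Ip *; set b := ev _ _ q in Iq *.
set c := ev _ _ p in Ip *; set d := ev _ _ q in Iq *.
by rewrite (_ : _ - _ = a * (b - d) + d * (a - c)); [apply: ID; apply: IM|ring].
Qed.

(** Two abstract ideals with I I contained in J serve at once the powers of a maximal ideal of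
    polynomials and the z-adic filtration of series. *)
Lemma ideal_taylor (I J : R -> Prop) (x h : 'I_n -> R) p : ideal I -> ideal J ->
  (forall a b, I a -> I b -> J (a * b)) -> (forall j, I (h j)) ->
  J (ev i (fun j => x j + h j) p - ev i x p - \sum_j ev i x (mderiv j p) * h j).
Proof.
move=> iI iJ IJ Ih; have [J0 JD JM] := iJ.
elim/mpoly_ring_ind: p => [c|j|p q Jp Jq|p q Jp Jq].
- by rewrite !evC big1 ?subrr ?subr0 // => j _; rewrite mderivC rmorph0 mul0r.
- rewrite !evX (bigD1 j) //= big1 => [|k kj]; last first.
    by rewrite mderiv_var eq_sym (negPf kj) rmorph0 mul0r.
  by rewrite mderiv_var eqxx rmorph1 mul1r addr0 [x j + _]addrC addrK subrr.
- have -> : \sum_j ev i x (mderiv j (p + q)) * h j =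
      \sum_j ev i x (mderiv j p) * h j + \sum_j ev i x (mderiv j q) * h j.
    by rewrite -big_split; apply: eq_bigr => j _; rewrite mderivD rmorphD mulrDl.
  rewrite !rmorphD.
  set a := ev _ _ p in Jp *; set b := ev _ _ p in Jp *; set c := \sum__ _ in Jp *.
  set d := ev _ _ q in Jq *; set e := ev _ _ q in Jq *; set f := \sum__ _ in Jq *.
  by rewrite (_ : _ - _ = (a - b - c) + (d - e - f)); [apply: JD|ring].
have -> : \sum_j ev i x (mderiv j (p * q)) * h j =
    ev i x q * (\sum_j ev i x (mderiv j p) * h j) + ev i x p * \sum_j ev i x (mderiv j q) * h j.
  rewrite !mulr_sumr -big_split; apply: eq_bigr => j _.
  by rewrite mderivM rmorphD !rmorphM /=; ring.
have Id (u : {mpoly A[n]}) : I (\sum_j ev i x (mderiv j u) * h j).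
  by apply: ideal_sum => // j _; case: iI => _ _; apply.
have Ip := Id p; have Iq := Id q.
rewrite !rmorphM /=.
set a := ev _ _ p in Jp *; set b := ev _ _ p in Jp *; set c := \sum__ _ in Ip Jp *.
set d := ev _ _ q in Jq *; set e := ev _ _ q in Jq *; set f := \sum__ _ in Iq Jq *.
rewrite (_ : _ - _ = d * (a - b - c) + (b + c) * (d - e - f) + c * f); last by ring.
by apply: (JD); [apply: (JD); apply: JM|apply: IJ].
Qed.

End Taylor.

(** * Power series *)

Definition series (R : Type) : Type := nat -> R.

HB.instance Definition _ (R : Type) := gen_eqMixin (series R).
HB.instance Definition _ (R : Type) := gen_choiceMixin (series R).

Section Series.
Variable R : comNzRingType.
Implicit Types f g h : series R.

Definition ser_trunc N f : {poly R} := \poly_(j < N) f j.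
Definition ser_add f g : series R := fun k => f k + g k.
Definition ser_opp f : series R := fun k => - f k.
Definition ser_mul f g : series R := fun k => \sum_(j < k.+1) f j * g (k - j)%N.
Definition ser_const (c : R) : series R := fun k => c *+ (k == 0%N).

Lemma coef_mul_congr N (p p' q q' : {poly R}) k : (k < N)%N ->
  (forall j, (j < N)%N -> p`_j = p'`_j) -> (forall j, (j < N)%N -> q`_j = q'`_j) ->
  (p * q)`_k = (p' * q')`_k.
Proof.
move=> kN pp' qq'; rewrite !coefM; apply: eq_bigr => j _.
by rewrite pp' ?qq' //; have := ltn_ord j; lia.
Qed.

Lemma ser_mulE N f g k : (k < N)%N -> ser_mul f g k = (ser_trunc N f * ser_trunc N g)`_k.
Proof.
move=> kN; rewrite coefM; apply: eq_bigr => j _; have := ltn_ord j => jk.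
by rewrite !coef_poly !ifT //; lia.
Qed.

Lemma coef_trunc N f k : (k < N)%N -> (ser_trunc N f)`_k = f k.
Proof. by move=> kN; rewrite coef_poly kN. Qed.

Lemma ser_addA : associative ser_add.
Proof. by move=> f g h; apply/funext => k; apply: addrA. Qed.
Lemma ser_addC : commutative ser_add.
Proof. by move=> f g; apply/funext => k; apply: addrC. Qed.
Lemma ser_add0 : left_id (fun=> 0 : R) ser_add.
Proof. by move=> f; apply/funext => k; apply: add0r. Qed.
Lemma ser_addN : left_inverse (fun=> 0 : R) ser_opp ser_add.
Proof. by move=> f; apply/funext => k; apply: addNr. Qed.

HB.instance Definition _ := GRing.isZmodule.Build (series R) ser_addA ser_addC ser_add0 ser_addN.

Lemma ser_mulA : associative ser_mul.
Proof.
move=> f g h; apply/funext => k; rewrite !(ser_mulE _ _ (ltnSn k)).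
have E u v j : (j < k.+1)%N -> (ser_trunc k.+1 (ser_mul u v))`_j =
    (ser_trunc k.+1 u * ser_trunc k.+1 v)`_j.
  by move=> jk; rewrite coef_trunc // (ser_mulE _ _ jk) // (@ser_mulE k.+1).
rewrite (coef_mul_congr (p' := ser_trunc k.+1 f) (ltnSn k) (fun _ _ => erefl) (E g h)).
rewrite (coef_mul_congr (q' := ser_trunc k.+1 h) (ltnSn k) (E f g) (fun _ _ => erefl)).
by rewrite mulrA.
Qed.

Lemma ser_mulC : commutative ser_mul.
Proof. by move=> f g; apply/funext => k; rewrite !(ser_mulE _ _ (ltnSn k)) mulrC. Qed.

Lemma ser_mul1 : left_id (ser_const 1) ser_mul.
Proof.
move=> f; apply/funext => k; rewrite /ser_mul big_ord_recl /ser_const /= mulr1n mul1r subn0.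
by rewrite big1 ?addr0 // => j _; rewrite mulr0n mul0r.
Qed.

Lemma ser_mulDl : left_distributive ser_mul ser_add.
Proof.
move=> f g h; apply/funext => k; rewrite /ser_mul /ser_add -big_split.
by apply: eq_bigr => j _; rewrite mulrDl.
Qed.

Lemma ser_1neq0 : ser_const 1 != 0.
Proof.
apply/eqP => /(congr1 (fun f : series R => f 0%N)) /eqP.
by rewrite /ser_const /= (_ : (0 : series R) 0%N = 0) // oner_eq0.
Qed.

HB.instance Definition _ := GRing.Zmodule_isComNzRing.Build (series R)
  ser_mulA ser_mulC ser_mul1 ser_mulDl ser_1neq0.

Lemma serD f g k : (f + g) k = f k + g k. Proof. by []. Qed.

Lemma serB f g k : (f - g) k = f k - g k. Proof. by []. Qed.
Lemma serM f g k : (f * g) k = \sum_(j < k.+1) f j * g (k - j)%N. Proof. by []. Qed.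
Lemma ser0 k : (0 : series R) k = 0. Proof. by []. Qed.
Lemma ser1 k : (1 : series R) k = (k == 0%N)%:R. Proof. by []. Qed.
Lemma ser_sum (J : Type) (r : seq J) (P : pred J) (F : J -> series R) k :
  (\sum_(j <- r | P j) F j) k = \sum_(j <- r | P j) F j k.
Proof. by elim/big_rec2: _ => // j _ x _ <-; rewrite serD. Qed.

Definition ser_of_poly (p : {poly R}) : series R := fun k => p`_k.

Lemma ser_of_poly_is_additive : additive ser_of_poly.
Proof. by move=> p q; apply/funext => k; apply: coefB. Qed.
Lemma ser_of_poly_is_multiplicative : multiplicative ser_of_poly.
Proof.
split=> [p q|]; apply/funext => k; first exact: coefM.
exact: coef1.
Qed.
HB.instance Definition _ := GRing.isAdditive.Build {poly R} (series R) ser_of_poly ser_of_poly_is_additive.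
HB.instance Definition _ := GRing.isMultiplicative.Build {poly R} (series R) ser_of_poly ser_of_poly_is_multiplicative.

Definition serC : {rmorphism R -> series R} := ser_of_poly \o polyC.

Lemma serCE c k : serC c k = c *+ (k == 0%N).
Proof. by rewrite /= /ser_of_poly coefC; case: eqP. Qed.

Lemma serCM c f k : (serC c * f) k = c * f k.
Proof.
rewrite serM big_ord_recl serCE mulr1n subn0 big1 ?addr0 // => j _.
by rewrite serCE mulr0n mul0r.
Qed.

Definition serX : series R := ser_of_poly 'X.

Lemma serXnM k f j : (serX ^+ k * f) j = if (j < k)%N then 0 else f (j - k)%N.
Proof.
rewrite -rmorphXn /=.
have -> : (ser_of_poly 'X^k * f) j = ('X^k * ser_trunc j.+1 f)`_j.
  rewrite serM coefM; apply: eq_bigr => l _; rewrite coef_trunc // ltnS leq_subr.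
  by [].
rewrite coefXnM; case: ltnP => // kj; rewrite coef_trunc // ltnS leq_subr //.
Qed.

Definition ord_ge k f := forall j, (j < k)%N -> f j = 0.

Lemma ord_geP k f : ord_ge k f <-> exists g, f = serX ^+ k * g.
Proof.
split=> [fk|[g ->] j jk]; last by rewrite serXnM jk.
exists (fun j => f (k + j)%N); apply/funext => j; rewrite serXnM.
by case: ltnP => [/fk //|kj]; rewrite subnKC.
Qed.

Lemma ord_ge_ideal k : ideal (ord_ge k).
Proof.
split=> [//|f g fk gk j jk|a f fk j jk]; first by rewrite serD fk ?gk ?addr0.
rewrite serM big1 // => l _; rewrite fk ?mulr0 //.
by rewrite (leq_ltn_trans (leq_subr _ _)).
Qed.

Lemma ord_geM j k f g : ord_ge j f -> ord_ge k g -> ord_ge (j + k) (f * g).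
Proof.
move=> /ord_geP[f' ->] /ord_geP[g' ->]; apply/ord_geP; exists (f' * g').
by rewrite exprD; ring.
Qed.

Lemma ord_ge_le j k f : (j <= k)%N -> ord_ge k f -> ord_ge j f.
Proof. by move=> jk fk l lj; apply: fk; apply: leq_trans jk. Qed.

Lemma ord_ge_all f : (forall k, ord_ge k f) -> f = 0.
Proof. by move=> fk; apply/funext => k; apply: (fk k.+1). Qed.

Lemma ord_geX k f : ord_ge 1 f -> ord_ge k (f ^+ k).
Proof.
move=> f1; elim: k => [j|k IH] //; rewrite exprS -addn1 addnC; exact: ord_geM.
Qed.

Lemma serX_inj k : injective ( *%R (serX ^+ k)).
Proof.
move=> f g fg; apply/funext => j; have := congr1 (fun h => h (k + j)%N) fg.
by rewrite !serXnM ltnNge leq_addr /= addKn.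
Qed.

Lemma ser_limit (F : nat -> series R) : (forall k, ord_ge k (F k.+1 - F k)) ->
  exists L, forall k, ord_ge k (L - F k).
Proof.
(* The coefficient of index k no longer changes after [F k.+1]. *)
move=> FF; exists (fun k => F k.+1 k) => k j jk.
rewrite serB; apply/eqP; rewrite subr_eq0; apply/eqP.
have : (j < k)%N by []. elim: k {jk} => // k IH; rewrite ltnS leq_eqVlt => /orP[/eqP -> //|jk].
by rewrite IH //; apply/eqP; rewrite eq_sym -subr_eq0; apply/eqP; apply: (FF k).
Qed.

End Series.
Arguments serC {R}.
Arguments serX {R}.
Arguments ord_ge_ideal {R} k.

Section SeriesField.
Variable K : fieldType.
Implicit Types f g h : series K.

Lemma ser_domain f g : f * g = 0 -> f = 0 \/ g = 0.
Proof.
move=> fg; have [/funext|] := pselect (forall k, f k = 0); first by left.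
move=> /existsNP /(cid)[k0 /eqP fk0]; right.
have exf : exists k, f k != 0 by exists k0.
have [k fk minf] := ex_minnP exf.
have fk' : ord_ge k f by move=> j; apply: contraTeq => /minf; rewrite leqNgt.
apply/funext; elim/ltn_ind => j IH.
have := congr1 (fun h => h (k + j)%N) fg; have kj : (k < (k + j).+1)%N by lia.
rewrite serM (bigD1 (Ordinal kj)) //= addKn big1 ?addr0 => [/eqP|l lk].
  by rewrite mulf_eq0 (negPf fk) => /eqP.
have [/fk' ->|kl] := ltnP l k; first by rewrite mul0r.
rewrite IH ?mulr0 //; have : (l != k :> nat) by apply: contra lk => /eqP lk; apply/eqP/val_inj.
by have := ltn_ord l; lia.
Qed.

(* The inverse of 1 - h, for h without constant term, as a limit of its partial geometric sums. *)
Definition ser_geom h : series K := fun k => (\sum_(j < k.+1) h ^+ j) k.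

Lemma ser_geomE h N k : ord_ge 1 h -> (k < N)%N -> ser_geom h k = (\sum_(j < N) h ^+ j) k.
Proof.
move=> h1; elim: N => // N IH; rewrite ltnS leq_eqVlt => /orP[/eqP-> //|kN].
by rewrite big_ord_recr /= serD -IH // (ord_geX h1) ?addr0.
Qed.

Lemma ser_geomP h : ord_ge 1 h -> (1 - h) * ser_geom h = 1.
Proof.
move=> h1; apply/eqP; rewrite -subr_eq0; apply/eqP/ord_ge_all => N.
have iN : ideal (@ord_ge K N) by apply: ord_ge_ideal.
apply: (ideal_congl (y := (1 - h) * (\sum_(j < N) h ^+ j) - 1) iN).
  have -> : (1 - h) * ser_geom h - 1 - ((1 - h) * (\sum_(j < N) h ^+ j) - 1) =
    (1 - h) * (ser_geom h - \sum_(j < N) h ^+ j) by ring.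
  by case: iN => _ _; apply => j jN; rewrite serB (ser_geomE h1 jN) subrr.
have -> : (1 - h) * (\sum_(j < N) h ^+ j) - 1 = - h ^+ N.
  by rewrite -[1 - h]opprB mulNr -subrX1; ring.
by apply: (idealN iN); apply: ord_geX.
Qed.

Definition ser_inv f : series K :=
  serC (f 0%N)^-1 * ser_geom (1 - serC (f 0%N)^-1 * f).

Lemma ser_invP f : f 0%N != 0 -> f * ser_inv f = 1.
Proof.
move=> f0; rewrite /ser_inv.
have h1 : ord_ge 1 (1 - serC (f 0%N)^-1 * f).
  by move=> j; rewrite ltnS leqn0 => /eqP->; rewrite serB serCM ser1 mulVf // subrr.
by rewrite -[RHS](ser_geomP h1); ring.
Qed.

End SeriesField.

Lemma msub_id (A : comNzRingType) n (h : {mpoly A[n]}) : msub (fun j => 'X_j) h = h.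
Proof.
elim/mpoly_ring_ind: h => [c|j|a b Ea Eb|a b Ea Eb].
- exact: evC.
- exact: evX.
- by rewrite rmorphD /= Ea Eb.
by rewrite rmorphM /= Ea Eb.
Qed.

Section IdealPowers.
Variables (R : comNzRingType) (d : nat) (y : 'I_d -> R).

Lemma ideal_pow_monomial m : ideal_pow y (mdeg m) (\prod_j y j ^+ m j).
Proof. by exists 'X_[m]; rewrite ?mevalX // dhomogX /=. Qed.

Lemma monomial_split (m : 'X_{1..d}) k : mdeg m = k.+1 ->
  exists2 j, \prod_l y l ^+ m l = y j * \prod_l y l ^+ (m - U_(j))%MM l & mdeg (m - U_(j))%MM = k.
Proof.
move=> mk; have [j mj] : exists j, m j != 0%N.
  apply/existsP; rewrite -negb_forall; apply/negP => /forallP m0.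
  by move: mk; rewrite mdegE big1 // => j _; exact/eqP.
have mE : m = (U_(j) + (m - U_(j)))%MM.
  by apply/mnmP => l; rewrite mnmDE mnmBE mnm1E; case: eqVneq => [<-|//]; rewrite subnKC // lt0n.
exists j; last by move: mk; rewrite {1}mE mdegD mdeg1 => -[].
have mv u : \prod_l y l ^+ (u : 'X_{1..d}) l = ('X_[u]).@[y] by rewrite mevalX.
by rewrite !mv {1}mE mpolyXD mevalM mevalXU.
Qed.

Lemma ideal_powS k x : ideal_pow y k.+1 x ->
  exists p : 'I_d -> R, (forall j, ideal_pow y k (p j)) /\ x = \sum_j y j * p j.
Proof.
move=> [P hP ->]; rewrite mevalE.
pose T x := exists p : 'I_d -> R, (forall j, ideal_pow y k (p j)) /\ x = \sum_j y j * p j.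
have [P0 PD PM] := ideal_pow_ideal y k.
have T0 : T 0 by exists (fun=> 0); split=> // ; rewrite big1 // => j _; rewrite mulr0.
rewrite big_seq; apply: (big_ind T) => // [u v [p [pk ->]] [q [qk ->]]|m mP].
  exists (fun j => p j + q j); split=> [j|]; first exact: PD.
  by rewrite -big_split; apply: eq_bigr => j _; rewrite mulrDr.
have [j -> mj] := monomial_split (dhomog_mf hP mP).
exists (fun l => if l == j then P@_m * \prod_l y l ^+ (m - U_(j))%MM l else 0); split=> [l|].
  by case: eqP => // _; apply: PM; rewrite -mj; apply: ideal_pow_monomial.
rewrite [RHS](bigD1 j) //= eqxx [X in _ + X]big1 ?addr0; first by ring.
by move=> u /negPf uj; rewrite uj mulr0.
Qed.

Lemma ideal_pow_le j k x : (j <= k)%N -> ideal_pow y k x -> ideal_pow y j x.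
Proof.
move=> /subnK <-; elim: (k - j)%N x => // l IH x /ideal_powS[p [pk ->]].
by apply: (ideal_sum _ (ideal_pow_ideal y j)) => i _; apply/ideal_powMl/IH.
Qed.

End IdealPowers.

Lemma mcoeff_pihomog (R : comNzRingType) n (mf : measure n) k (p : {mpoly R[n]}) m :
  (pihomog mf k p)@_m = if mf m == k then p@_m else 0.
Proof.
rewrite pihomogE raddf_sum /= -big_filter.
under eq_bigr => u _ do rewrite mcoeffZ mcoeffX.
have [mk|mk] := ifPn; last first.
  rewrite big_seq big1 // => u; rewrite mem_filter => /andP[/eqP uk _].
  case: eqVneq => [um|_]; last by rewrite mulr0.
  by move: mk; rewrite -um uk eqxx.
have [mp|mp] := boolP (m \in msupp p).
  rewrite (bigD1_seq m) ?filter_uniq ?mem_filter ?mk //= eqxx mulr1 big1 ?addr0 // => u um.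
  by rewrite (negPf um) mulr0.
rewrite big_seq big1 => [|u]; first by apply/esym/eqP; rewrite mcoeff_eq0.
rewrite mem_filter => /andP[_ up]; case: eqVneq => [um|_]; last by rewrite mulr0.
by move: mp; rewrite -um up.
Qed.

(** * Smoothness from vector fields, in arbitrary characteristic *)

Section Nakayama.
Variables (R : comNzRingType) (N : nat) (v : 'I_N -> R) (e : 'M[R]_N).

(** Cramer's rule. When the entries of [e] vanish at a point, the determinant takes the value 1
    there: multiplying by it replaces Nakayama's lemma and the passage to a local ring. *)
Lemma det_trick j : \det (1%:M - e) * v j =
  \sum_l (\adj (1%:M - e)) j l * (v l - \sum_k e l k * v k).
Proof.
pose V : 'cV[R]_N := \col_l v l.
have E l : v l - \sum_k e l k * v k = ((1%:M - e) *m V) l 0.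
  rewrite mulmxBl mul1mx !mxE; congr (_ - _).
  by apply: eq_bigr => k _; rewrite mxE.
under eq_bigr => l _ do rewrite E.
have := congr1 (fun M : 'cV[R]_N => M j 0) (mulmxA (\adj (1%:M - e)) (1%:M - e) V).
by rewrite mul_adj_mx mul_scalar_mx !mxE => <-.
Qed.

End Nakayama.

Section Smoothness.
Variables (K : closedFieldType) (n d : nat).
Notation A := {mpoly K[n]}.
Variables (I : A -> Prop) (l : 'I_d -> A) (D : 'I_d -> A -> A).
Hypothesis I_ideal : ideal I.
Hypothesis I_rad : forall f k, I (f ^+ k) -> I f.
Hypothesis I_origin : forall p, I p -> p.@[fun=> 0] = 0.
Hypothesis l_origin : forall i, (l i).@[fun=> 0] = 0.
Hypothesis DD : forall i p q, D i (p + q) = D i p + D i q.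
Hypothesis DM : forall i p q, D i (p * q) = D i p * q + p * D i q.
Hypothesis DC : forall i c, D i c%:MP = 0.
Hypothesis DI : forall i p, I p -> I (D i p).
Hypothesis Dl : forall i j, (D i (l j)).@[fun=> 0] = (i == j)%:R.

Notation M := (ideal_pow (fun j => 'X_j : A)).
Notation at0 p := (p.@[fun=> 0]).

(** Membership in m^k + I, where m is the maximal ideal of the origin: the quotients are the
    truncations of the completed local ring of A / I. *)
Let IM k (p : A) := exists2 e, M k e & I (p - e).

Hypothesis l_gen : forall j, exists c : 'I_d -> K, IM 2 ('X_j - \sum_i (c i)%:MP * l i).

Let I0 : I 0. Proof. by case: I_ideal. Qed.
Let ID p q : I p -> I q -> I (p + q). Proof. by case: I_ideal => _ H _; apply: H. Qed.
Let IMl p q : I q -> I (p * q). Proof. by case: I_ideal => _ _; apply. Qed.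

Let M_ideal k : ideal (M k). Proof. exact: ideal_pow_ideal. Qed.

Let IM_ideal k : ideal (IM k).
Proof.
have [M0 MD MM] := M_ideal k.
split=> [|p q [e Me pe] [f Mf qf]|p q [e Me qe]].
- by exists 0; rewrite ?subr0.
- exists (e + f); first exact: MD.
  by rewrite (_ : _ - _ = (p - e) + (q - f)); [apply: ID|ring].
exists (p * e); first exact: MM.
by rewrite -mulrBr; apply: IMl.
Qed.

Let IM_I k p : I p -> IM k p.
Proof. by move=> Ip; exists 0; rewrite ?subr0 //; case: (M_ideal k). Qed.

Let IM_M k p : M k p -> IM k p.
Proof. by move=> Mp; exists p; rewrite ?subrr. Qed.

Let IM_le j k p : (j <= k)%N -> IM k p -> IM j p.
Proof. by move=> jk [e Me pe]; exists e => //; apply: ideal_pow_le Me. Qed.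

Let IM_mul j k p q : IM j p -> IM k q -> IM (j + k) (p * q).
Proof.
move=> [e Me pe] [f Mf qf]; exists (e * f); first exact: ideal_powM.
by rewrite (_ : _ - _ = q * (p - e) + e * (q - f)); [apply: ID; apply: IMl|ring].
Qed.

Let M1_sub p : M 1 (p - (at0 p)%:MP).
Proof.
have [M0 MD MM] := M_ideal 1.
elim/mpoly_ring_ind: p => [c|j|p q Mp Mq|p q Mp Mq].
- by rewrite mevalC subrr.
- by rewrite mevalXU mpolyC0 subr0; apply: ideal_pow_var.
- by rewrite mevalD mpolyCD opprD addrACA; apply: MD.
rewrite mevalM mpolyCM.
by rewrite (_ : _ - _ = p * (q - (at0 q)%:MP) + (at0 q)%:MP * (p - (at0 p)%:MP));
  [apply: MD; apply: MM|ring].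
Qed.

Let M1 p : at0 p = 0 -> M 1 p.
Proof. by move=> p0; have := M1_sub p; rewrite p0 mpolyC0 subr0. Qed.

Let IM1 p : IM 1 p -> at0 p = 0.
Proof.
move=> [e [P hP ->] /I_origin]; rewrite mevalB => /eqP; rewrite subr_eq0 => /eqP ->.
have /ideal_powS[q [_ ->]] : M 1 P.@[fun j => 'X_j] by exists P.
by rewrite rmorph_sum big1 // => j _; rewrite /= mevalM mevalXU mul0r.
Qed.

Let M_l k (Q : {mpoly K[d]}) : Q \is k.-homog -> M k (msub l Q).
Proof.
move=> hQ; rewrite [Q]mpolyE /msub rmorph_sum big_seq.
apply: (ideal_sum _ (M_ideal k)) => m mQ; rewrite /= evZ; apply: ideal_powMl.
rewrite evXm -(dhomog_mf hQ mQ) /=.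
suff H (r : seq 'I_d) : M (\sum_(j <- r) m j)%N (\prod_(j <- r) l j ^+ m j).
  by rewrite mdegE; apply: H.
elim: r => [|j r IH]; first by rewrite !big_nil; apply: ideal_pow0.
rewrite !big_cons; apply: ideal_powM => //.
elim: (m j) => [|k' IHk]; first by rewrite expr0; apply: ideal_pow0.
by rewrite exprS -addn1 addnC; apply: ideal_powM => //; apply: M1.
Qed.

Let D_sum i (J : Type) (r : seq J) (P : pred J) F :
  D i (\sum_(j <- r | P j) F j) = \sum_(j <- r | P j) D i (F j).
Proof.
have D0 : D i 0 = 0 by rewrite -(mpolyC0 n) DC.
by apply: (big_morph (D i)) => // x y; apply: DD.
Qed.

Let D_M i k p : M k.+1 p -> M k (D i p).
Proof.
elim: k p => [|k IH] p; first by move=> _; apply: ideal_pow0.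
move=> /ideal_powS[q [qk ->]]; rewrite D_sum.
apply: (ideal_sum _ (M_ideal _)) => j _; rewrite DM; case: (M_ideal k.+1) => _ MD _; apply: MD.
  by apply: ideal_powMl.
by rewrite -addn1 addnC; apply: ideal_powM (IH _ (qk j)); apply: ideal_pow_var.
Qed.

Let D_IM i k p : IM k.+1 p -> IM k (D i p).
Proof.
move=> [e Me pe]; exists (D i e); first exact: D_M.
have -> : D i p - D i e = D i (p - e); last exact: DI.
by apply/eqP; rewrite subr_eq -DD subrK.
Qed.

Let D_chain i (B : comNzRingType) (q : {mpoly B[d]}) (h : {rmorphism B -> A}) :
  (forall c, D i (h c) = 0) ->
  D i (ev h l q) = \sum_k ev h l (mderiv k q) * D i (l k).
Proof.
move=> Dh; elim/mpoly_ring_ind: q => [c|k|p q Ep Eq|p q Ep Eq].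
- by rewrite evC Dh big1 // => k _; rewrite mderivC rmorph0 mul0r.
- rewrite evX (bigD1 k) //= mderiv_var eqxx rmorph1 mul1r big1 ?addr0 // => k' kk'.
  by rewrite mderiv_var eq_sym (negPf kk') rmorph0 mul0r.
- rewrite rmorphD DD Ep Eq -big_split; apply: eq_bigr => k _.
  by rewrite mderivD rmorphD mulrDl.
rewrite rmorphM DM Ep Eq mulr_suml mulr_sumr -big_split; apply: eq_bigr => k _.
by rewrite mderivM rmorphD !rmorphM /=; ring.
Qed.

Let unit_cancel k q f : at0 q = 1 -> IM k (q * f) -> IM k f.
Proof.
move=> q1 qf; suff H j : (j <= k)%N -> IM j f by apply: H.
elim: j => [_|j IH jk]; first exact/IM_M/ideal_pow0.
have -> : f = q * f + (1 - q) * f by ring.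
have [_ PD _] := IM_ideal j.+1; apply: PD; first exact: IM_le qf.
rewrite -addn1 addnC; apply: IM_mul (IH (ltnW jk)).
by apply/IM_M/M1; rewrite mevalB meval1 q1 subrr.
Qed.

(** Surjectivity of K[[l]] onto the completed local ring. To order 2 this is [l_gen]; the quadratic
    rest is a sum of products of elements of m, and approximating both factors to order B
    approximates the product to order B + 1. *)
Lemma smooth_approximation B (h : A) : exists Q : {mpoly K[d]}, IM B (h - msub l Q).
Proof.
elim: B h => [|B IH] h; first by exists 0; apply/IM_M/ideal_pow0.
have [_ PD PM] := IM_ideal B.+1.
have [B0|B0] := posnP B.
  rewrite B0; exists (at0 h)%:MP; rewrite /msub evC; exact/IM_M/M1_sub.
have closed h1 h2 : (exists Q : {mpoly K[d]}, IM B.+1 (h1 - msub l Q)) ->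
   (exists Q : {mpoly K[d]}, IM B.+1 (h2 - msub l Q)) -> exists Q : {mpoly K[d]}, IM B.+1 (h1 + h2 - msub l Q).
  move=> [Q1 h1P] [Q2 h2P]; exists (Q1 + Q2); rewrite rmorphD /=.
  by rewrite (_ : _ - _ = (h1 - msub l Q1) + (h2 - msub l Q2)); [exact: PD h1P h2P|ring].
elim/mpoly_ring_ind: h => [c|j|h1 h2|h1 h2 [Q1 h1P] [Q2 h2P]].
- by exists c%:MP; rewrite /msub evC subrr; case: (IM_ideal B.+1).
- have [c [e Me jE]] := l_gen j.
  have [q [Mq eE]] := ideal_powS Me.
  have [Q QP] : exists Q : {mpoly K[d]}, IM B.+1 (e - msub l Q).
    rewrite eE; elim/big_ind: _ => // [|i _].
      by exists 0; rewrite rmorph0 subrr; case: (IM_ideal B.+1).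
    have [Q1 iP] := IH 'X_i; have [Q2 qP] := IH (q i).
    exists (Q1 * Q2); rewrite rmorphM /=.
    rewrite (_ : _ - _ = q i * ('X_i - msub l Q1) + msub l Q1 * (q i - msub l Q2)); last by ring.
    have qi : IM 1 (q i) := IM_M (Mq i).
    have Q1i : IM 1 (msub l Q1).
      rewrite -(subKr 'X_i (msub l Q1)); apply: (idealB (IM_ideal 1)); last exact: IM_le iP.
      exact: IM_M (ideal_pow_var _ i).
    rewrite -addn1 addnC in PD *.
    exact: PD (IM_mul qi iP) (IM_mul Q1i qP).
  exists (\sum_i (c i)%:MP * 'X_i + Q); rewrite rmorphD /=.
  have -> : msub l (\sum_i (c i)%:MP * 'X_i) = \sum_i (c i)%:MP * l i.
    by rewrite rmorph_sum; apply: eq_bigr => i _; rewrite rmorphM /= /msub evC evX.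
  rewrite (_ : _ - _ = ('X_j - \sum_i (c i)%:MP * l i - e) + (e - msub l Q)); last by ring.
  exact: PD (IM_I _ jE) QP.
- exact: closed.
exists (Q1 * Q2); rewrite rmorphM /=.
rewrite (_ : _ - _ = h2 * (h1 - msub l Q1) + msub l Q1 * (h2 - msub l Q2)); last by ring.
exact: PD (PM _ _ h1P) (PM _ _ h2P).
Qed.

Section Frobenius.
Variables (p : nat) (charK : p \in [pchar K]).

Let p_gt0 : (0 < p)%N. Proof. by case/andP: charK => /prime_gt0. Qed.
Let charA : p \in [pchar A]. Proof. exact: (rmorph_pchar (@mpolyC n K)). Qed.
Let F : {rmorphism A -> A} := pFrobenius_aut charA.
Let FE f : F f = f ^+ p. Proof. exact: pFrobenius_autE. Qed.

Let root (c : K) : exists b, b ^+ p = c.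
Proof.
have [b bE] := @solve_monicpoly K p (fun i => c *+ (i == 0%N)) p_gt0.
exists b; rewrite bE (bigD1 (Ordinal p_gt0)) //= mulr1n expr0 mulr1 big1 ?addr0 // => i i0.
by rewrite (_ : (i == 0%N :> nat) = false) ?mulr0n ?mul0r //; apply/negbTE.
Qed.

(** [ev F y P] is a sum of terms a^p y^m, an element of the algebra generated by [y] over the ring
    of p-th powers. Constants of K are p-th powers, so every polynomial in [y] has this form. *)
Let F_root N (y : 'I_N -> A) (Q : {mpoly K[N]}) :
  exists P : {mpoly A[N]}, ev F y P = msub y Q.
Proof.
have /choice[r rP] := root.
exists (\sum_(m <- msupp Q) (r Q@_m)%:MP *: 'X_[m]).
rewrite [in RHS](mpolyE Q) /msub !rmorph_sum; apply: eq_bigr => m _ /=.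
by rewrite !evZ !evXm FE -rmorphXn rP.
Qed.

Let reduced N (P : {mpoly A[N]}) := forall m, m \in msupp P -> forall i, (m i < p)%N.
Let mquo N (m : 'X_{1..N}) : 'X_{1..N} := [multinom m i %/ p | i < N]%N.
Let mrem N (m : 'X_{1..N}) : 'X_{1..N} := [multinom m i %% p | i < N]%N.

(** Write y^m as F(y^(m / p)) y^(m mod p) and absorb the first factor into the coefficient; [C]
    carries along an additive property of the coefficient at each reduced monomial. *)
Let reduce N (y : 'I_N -> A) (P : {mpoly A[N]}) (C : 'X_{1..N} -> A -> Prop) :
  (forall m, C m 0) -> (forall m a b, C m a -> C m b -> C m (a + b)) ->
  (forall m, m \in msupp P -> C (mrem m) (P@_m * \prod_j y j ^+ mquo m j)) ->
  exists P', [/\ reduced P', ev F y P' = ev F y P & forall m, C m P'@_m].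
Proof.
move=> C0 CD CP.
pose P' := \sum_(m <- msupp P) (P@_m * \prod_j y j ^+ mquo m j) *: 'X_[mrem m].
have P'E u : P'@_u = \sum_(m <- msupp P) (P@_m * \prod_j y j ^+ mquo m j) * (mrem m == u)%:R.
  by rewrite raddf_sum; apply: eq_bigr => m _; rewrite /= mcoeffZ mcoeffX.
exists P'; split=> [u|| u].
- rewrite mcoeff_msupp P'E => /eqP nz i; apply: contra_notT nz; rewrite -leqNgt => pu.
  rewrite big1 // => m _; case: eqVneq => [E|_]; last by rewrite mulr0.
  by move: pu; rewrite -E mnmE leqNgt ltn_pmod.
- rewrite [in RHS](mpolyE P) !rmorph_sum; apply: eq_bigr => m _ /=.
  rewrite !evZ !evXm rmorphM rmorph_prod -mulrA -big_split; congr (_ * _).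
  apply: eq_bigr => j _; rewrite /= FE -!exprM -exprD !mnmE.
  by rewrite -divn_eq.
rewrite P'E big_seq; apply: (big_ind (C u)) => // [a b|m mP]; first exact: CD.
case: eqVneq => [<-|_]; last by rewrite mulr0.
by rewrite mulr1; apply: CP.
Qed.

Let expansion (h : A) : exists2 P : {mpoly A[n]}, reduced P & ev F (fun j => 'X_j) P = h.
Proof.
have [P PE] := F_root (fun j => 'X_j) h.
have [//|//|//|P' [rP' P'E _]] := @reduce n (fun j => 'X_j) P (fun _ _ => True).
exists P'; first exact: rP'.
by rewrite P'E PE msub_id.
Qed.

Let at0_det N (e : 'M[A]_N) : (forall i j, at0 (e i j) = 0) -> at0 (\det (1%:M - e)) = 1.
Proof.
move=> e0; rewrite -[at0 _]/(meval _ _) -det_map_mx (_ : map_mx _ _ = 1%:M) ?det1 //.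
apply/matrixP => i j; rewrite !mxE rmorphB /= e0 subr0.
by case: (i == j); rewrite ?meval1 ?meval0.
Qed.

(** Nakayama's lemma: modulo I the functions [l] generate m up to m^2, so that m^k is contained in
    (l)^k + I after multiplication by a power of [q1], which is invertible at the origin. *)
Let l_span : exists2 q1, at0 q1 = 1 & forall k w, M k w ->
  exists2 o, ideal_pow l k o & I (q1 ^+ k * w - o).
Proof.
have /choice[c cP] := l_gen.
have /choice[e eP] j : exists e, M 2 e /\ I ('X_j - \sum_i (c j i)%:MP * l i - e).
  by have [e] := cP j; exists e.
have /choice[q qP] j : exists q : 'I_n -> A, (forall k, M 1 (q k)) /\ e j = \sum_k 'X_k * q k.
  by have [/ideal_powS[q qE] _] := eP j; exists q.
pose ep : 'M[A]_n := \matrix_(j, k) q j k.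
exists (\det (1%:M - ep)) => [|k].
  by apply: at0_det => i j; rewrite mxE; apply/IM1/IM_M; case: (qP i).
set q1 := \det _.
have var j : exists2 o, ideal_pow l 1 o & I (q1 * 'X_j - o).
  exists (\sum_u (\adj (1%:M - ep)) j u * \sum_i (c u i)%:MP * l i).
    apply: (ideal_sum _ (ideal_pow_ideal l 1)) => u _; apply: ideal_powMl.
    apply: (ideal_sum _ (ideal_pow_ideal l 1)) => i _; apply: ideal_powMl.
    exact: ideal_pow_var.
  rewrite (det_trick (fun j => 'X_j)) -sumrB; apply: (ideal_sum _ I_ideal) => u _.
  rewrite -mulrBr; apply: IMl.
  have [_ ] := eP u; have [_ ->] := qP u.
  rewrite (_ : \sum_k ep u k * 'X_k = \sum_k 'X_k * q u k); last first.
    by apply: eq_bigr => v _; rewrite mxE mulrC.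
  by rewrite addrAC.
elim: k => [|k IH] w; first by exists w; [apply: ideal_pow0|rewrite expr0 mul1r subrr].
move=> /ideal_powS[s [sk ->]].
have /choice[o oP] j : exists o, ideal_pow l 1 o /\ I (q1 * 'X_j - o).
  by have [u] := var j; exists u.
have /choice[t tP] j : exists o, ideal_pow l k o /\ I (q1 ^+ k * s j - o).
  by have [u] := IH _ (sk j); exists u.
exists (\sum_j o j * t j).
  apply: (ideal_sum _ (ideal_pow_ideal l _)) => j _.
  by rewrite -addn1 addnC; apply: ideal_powM; [case: (oP j)|case: (tP j)].
rewrite mulr_sumr -sumrB; apply: (ideal_sum _ I_ideal) => j _.
have [_ o1] := oP j; have [_ t1] := tP j.
rewrite (_ : _ - _ = q1 ^+ k * s j * (q1 * 'X_j - o j) + o j * (q1 ^+ k * s j - t j)).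
  by apply: ID; apply: IMl.
by rewrite exprS; ring.
Qed.

(* Nakayama's lemma for the module A over its p-th powers: near the origin the
   monomials in l generate. *)
Let F_span : exists2 q2, at0 q2 = 1 & forall h, exists P : {mpoly A[d]}, I (F q2 * h - ev F l P).
Proof.
(* A reduced monomial has degree at most n (p - 1), so every monomial of degree at least [B] has an
   exponent at least p; its reduction then has a coefficient divisible by a variable. *)
pose B := (n * p.-1).+1.
pose X (j : 'I_n) : A := 'X_j.
have deg_red (P : {mpoly A[n]}) m : reduced P -> m \in msupp P -> (mdeg m < B)%N.
  move=> rP mP; rewrite ltnS mdegE; have -> : (n * p.-1 = \sum_(i < n) p.-1)%N by rewrite sum_nat_const card_ord.
  by apply: leq_sum => i _; have := rP m mP i; lia.
have small (m : 'X_{1..n < B}) : exists (P : {mpoly A[d]}) (e : {mpoly A[n]}),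
    [/\ I ('X_[m] - ev F l P - ev F X e), reduced e & forall u, M 1 e@_u].
  have [Q [e Me IQ]] := smooth_approximation B 'X_[m].
  have [P PE] := F_root l Q.
  have [e1 he1 eE] := Me.
  have /choice[g gP] h : exists P : {mpoly A[n]}, reduced P /\ ev F X P = h.
    by have [P' rP' P'E] := expansion h; exists P'.
  pose G : {mpoly A[n]} := \sum_(u <- msupp e1) g e1@_u * 'X_[u].
  have GE : ev F X G = e.
    rewrite rmorph_sum eE mevalE; apply: eq_bigr => u _ /=.
    by rewrite rmorphM /= evXm; have [_ ->] := gP e1@_u.
  have Gdeg u : u \in msupp G -> (B <= mdeg u)%N.
    rewrite leqNgt mcoeff_msupp; apply: contraNN => uB.
    rewrite raddf_sum big_seq big1 //= => v ve; apply/eqP; rewrite mcoeff_eq0.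
    apply: contraL uB => /msuppM_le /allpairsP[[u1 u2] /= [_]].
    rewrite msuppX inE => /eqP-> ->; rewrite -leqNgt mdegD (dhomog_mf he1 ve) leq_addl //.
  have [||u uG|G' [rG' G'E G'1]] := @reduce n X G (fun _ a => M 1 a).
  - by move=> _; case: (M_ideal 1).
  - by move=> _ a b; case: (M_ideal 1) => _ + _; apply.
  - apply: ideal_powMl.
    suff u0 : (0 < mdeg (mquo u))%N by apply: ideal_pow_le u0 _; apply: ideal_pow_monomial.
    rewrite lt0n mdeg_eq0; apply/negP => /eqP u0; have := Gdeg u uG.
    rewrite leqNgt ltnS mdegE; have -> : (n * p.-1 = \sum_(i < n) p.-1)%N by rewrite sum_nat_const card_ord.
    move/negP; apply; apply: leq_sum => i _; have := congr1 (fun v : 'X_{1..n} => v i) u0.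
    by rewrite !mnmE => /eqP; rewrite -leqn0 leqNgt divn_gt0 // -ltnNge; lia.
  exists P, G'; split; [rewrite PE G'E GE; exact: IQ|exact: rG'|exact: G'1].
have /choice[P1 /choice[e1 Pe1]] := small.
pose N := #|{: 'X_{1..n < B}}|.
pose mon (k : 'I_N) : 'X_{1..n < B} := enum_val k.
pose ep : 'M[A]_N := \matrix_(j, k) (e1 (mon j))@_(mon k).
have Fep : map_mx F (1%:M - ep) = 1%:M - map_mx F ep by rewrite map_mxB map_mx1.
exists (\det (1%:M - ep)) => [|h].
  by apply: at0_det => i j; rewrite mxE; apply/IM1/IM_M; case: (Pe1 (mon i)).
set q2 := \det _.
have evX_big (e : {mpoly A[n]}) : reduced e -> ev F X e = \sum_k F e@_(mon k) * 'X_[mon k].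
  move=> re; have eB : (msize e <= B)%N.
    by rewrite msizeE big_seq; elim/big_ind: _ => // [x y xB yB|m me]; [rewrite geq_max xB|apply: deg_red me].
  rewrite {1}[e](mpolywE eB) rmorph_sum (reindex mon) /=; last first.
    by exists enum_rank => k _; rewrite /mon ?enum_valK ?enum_rankK.
  by apply: eq_bigr => k _; rewrite evZ evXm (mpolyXE_id _ (mon k)).
have main k : exists P : {mpoly A[d]}, I (F q2 * 'X_[mon k] - ev F l P).
  exists (\sum_u (\adj (1%:M - ep)) k u *: P1 (mon u)).
  have -> : F q2 = \det (1%:M - map_mx F ep) by rewrite -Fep det_map_mx.
  rewrite (det_trick (fun k => 'X_[mon k])) rmorph_sum -sumrB; apply: (ideal_sum _ I_ideal) => u _.
  rewrite /= evZ -Fep -map_mx_adj mxE -mulrBr; apply: IMl.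
  have [Iu re _] := Pe1 (mon u); move: Iu; rewrite evX_big // addrAC.
  by rewrite (eq_bigr (fun v => (map_mx F ep) u v * 'X_[mon v])) // => v _; rewrite !mxE.
have /choice[P2 P2E] := main.
have [Ph rPh <-] := expansion h; rewrite evX_big //.
exists (\sum_k Ph@_(mon k) *: P2 k).
rewrite mulr_sumr [ev F l _]rmorph_sum -sumrB; apply: (ideal_sum _ I_ideal) => k _.
by rewrite /= evZ mulrCA -mulrBr; apply: IMl.
Qed.

Let DX i f k : D i (f ^+ k) = f ^+ k.-1 * D i f *+ k.
Proof.
case: k => [|k]; first by rewrite expr0 mulr0n -(mpolyC1 n) DC.
elim: k => [|k IH]; first by rewrite expr1 expr0 mul1r.
by rewrite exprS DM IH /= !exprS !mulrSr; ring.
Qed.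

Let DF i f : D i (F f) = 0.
Proof.
rewrite FE DX -mulr_natr.
by have -> : p%:R = 0 :> A; [apply/eqP; case/andP: charA|rewrite mulr0].
Qed.

Let mcoeff_unit (m : nat) : (0 < m < p)%N -> exists c : K, c * m%:R = 1.
Proof.
move=> /andP[m0 mp]; exists m%:R^-1; rewrite mulVf //.
by rewrite -(dvdn_pcharf charK) gtnNdvd.
Qed.

(** The derivations annihilate p-th powers and their matrix on [l] is invertible at the origin, so
    the relation can be differentiated with respect to the variables of [P]. Exponents below p are
    invertible in K: by induction a unit at the origin brings all coefficients but the constant one
    into I, and [I_rad] takes the p-th root of what remains. *)
Let F_free (P : {mpoly A[d]}) : reduced P -> I (ev F l P) ->
  exists2 q, at0 q = 1 & forall m, I (q * P@_m).
Proof.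
pose Delta : 'M[A]_d := \matrix_(i, j) D i (l j).
pose h0 := \det Delta.
have h01 : at0 h0 = 1.
  rewrite /h0 -[at0 _]/(meval _ _) -det_map_mx (_ : map_mx _ _ = 1%:M) ?det1 //.
  by apply/matrixP => i j; rewrite !mxE; apply: Dl.
have [s] := ubnP (msize P); elim: s P => // s IH P; rewrite ltnS => sP rP IP.
have deriv i : I (ev F l (h0 *: mderiv i P)).
  rewrite evZ FE -(prednK p_gt0) exprSr -mulrA; apply: IMl.
  have -> : h0 * ev F l (mderiv i P) = \sum_k (\adj Delta) i k * D k (ev F l P).
    transitivity (\sum_k \sum_j ev F l (mderiv j P) * ((\adj Delta) i k * D k (l j))); last first.
      apply: eq_bigr => k _; rewrite (@D_chain k A P F (DF k)) mulr_sumr.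
      by apply: eq_bigr => j _; rewrite mulrCA.
    rewrite exchange_big /= (eq_bigr (fun j => ev F l (mderiv j P) * (h0%:M : 'M_d) i j)); last first.
      move=> j _; rewrite -mulr_sumr -mul_adj_mx mxE; congr (_ * _).
      by apply: eq_bigr => k _; rewrite [Delta k j]mxE.
    rewrite (bigD1 i) //= mxE eqxx big1 ?addr0 => [|j ji]; first by rewrite mulr1n mulrC.
    by rewrite mxE eq_sym (negPf ji) mulr0.
  by apply: (ideal_sum _ I_ideal) => k _; apply/IMl/DI.
have derivP i : exists2 q, at0 q = 1 & forall m, I (q * (h0 *: mderiv i P)@_m).
  have [P0|P0] := eqVneq P 0.
    by exists 1 => [|m]; rewrite ?meval1 // P0 mderiv0 scaler0 mcoeff0 mulr0.
  apply: IH; last exact: deriv.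
    apply: leq_trans sP; rewrite -[in leqRHS](prednK (n := msize P)) ?lt0n ?msize_poly_eq0 // ltnS.
    rewrite msizeE big_seq; elim/big_ind: _ => // [x y xB yB|m]; first by rewrite geq_max xB.
    rewrite mcoeff_msupp mcoeffZ mcoeff_deriv => mP.
    have : (m + U_(i))%MM \in msupp P.
      by rewrite mcoeff_msupp; apply: contraNneq mP => ->; rewrite mul0rn mulr0.
    by move/msize_mdeg_lt; rewrite mdegD mdeg1; lia.
  move=> m; rewrite mcoeff_msupp mcoeffZ mcoeff_deriv => mP j.
  have /rP/(_ j) : (m + U_(i))%MM \in msupp P.
    by rewrite mcoeff_msupp; apply: contraNneq mP => ->; rewrite mul0rn mulr0.
  by apply: leq_ltn_trans; rewrite mnmDE leq_addr.
have /choice[q qP] i : exists q, at0 q = 1 /\ forall m, I (q * (h0 *: mderiv i P)@_m).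
  by have [q] := derivP i; exists q.
pose Q := h0 * \prod_i q i.
have Q1 : at0 Q = 1.
  by rewrite mevalM h01 mul1r rmorph_prod big1 // => i _; case: (qP i).
have Qm m : m != 0%MM -> I (Q * P@_m).
  move=> m0; have [mP|] := boolP (m \in msupp P); last by rewrite -mcoeff_eq0 => /eqP->; rewrite mulr0.
  have [i mi] : exists i, m i != 0%N.
    apply/existsP; rewrite -negb_forall; apply: contra m0 => /forallP m0.
    by apply/eqP/mnmP => j; rewrite mnm0E; apply/eqP.
  have [c cm] : exists c : K, c * (m i)%:R = 1 by apply: mcoeff_unit; rewrite lt0n mi (rP m mP).
  have mE : m = ((m - U_(i)) + U_(i))%MM.
    by apply/mnmP => j; rewrite mnmDE mnmBE mnm1E; case: eqVneq => [<-|]; rewrite ?subnK ?lt0n // subn0 addn0.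
  have [_ /(_ (m - U_(i))%MM)] := qP i.
  rewrite mcoeffZ mcoeff_deriv -mE mnmBE mnm1E eqxx subn1 prednK ?lt0n // => IE.
  rewrite /Q (bigD1 i) //=.
  have -> : h0 * (q i * \prod_(j | j != i) q j) * P@_m =
      c%:MP * (\prod_(j | j != i) q j) * (q i * (h0 * (P@_m *+ m i))).
    rewrite -mulr_natr -[(m i)%:R](rmorph_nat (@mpolyC n K)).
    have cm' : c%:MP * (m i)%:R%:MP = 1 :> A by rewrite -mpolyCM cm mpolyC1.
    set a := c%:MP in cm' *; set b := (m i)%:R%:MP in cm' *.
    rewrite -[LHS]mulr1 -cm'; ring.
  exact: IMl.
exists Q => // m; have [->|] := eqVneq m 0%MM; last exact: Qm.
apply: (I_rad (k := p)); rewrite -FE rmorphM /=.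
have : I (F Q * ev F l P) by apply: IMl.
have [P0|P0] := boolP (0%MM \in msupp P); last first.
  by move: P0; rewrite -mcoeff_eq0 => /eqP->; rewrite rmorph0 mulr0.
rewrite [in ev F l P](mpolyE P) rmorph_sum (bigD1_seq 0%MM) //= evZ evXm.
rewrite big1 => [|j _]; last by rewrite mnm0E expr0.
rewrite mulr1 mulrDr => H.
apply: (ideal_congl I_ideal (y := F Q * F P@_0 + F Q * \sum_(m <- msupp P | m != 0%MM) ev F l (P@_m *: 'X_[m]))) => //.
rewrite opprD addrA subrr add0r; apply: (idealN I_ideal).
rewrite mulr_sumr; apply: (ideal_sum _ I_ideal) => u u0; rewrite evZ mulrA -rmorphM.
rewrite mulrC /= FE -(prednK p_gt0) exprSr; apply/IMl/IMl.
exact: Qm.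
Qed.

(** Multiply [f ^+ p] by the p-th power of a function [q3] equal to 1 at the origin, and expand over
    the ring of p-th powers in reduced monomials in [l]. Only monomials of degree greater than p k
    occur before reduction, so the coefficient at 1 comes from m^(k+1). By [F_free] this coefficient
    agrees with [q3 * f] modulo I, up to another such function. *)
Lemma frobenius_order k f : IM (p * k).+1 (f ^+ p) -> IM k.+1 f.
Proof.
move=> [w Mw Iw]; set L := (p * k).+1 in Mw.
have [q1 q11 q1P] := l_span; have [q2 q21 q2P] := F_span.
have Mw' : M L (q1 ^+ (p.-1 * L) * w) by apply: ideal_powMl.
have [_ [o oL ->] oP] := q1P L _ Mw'.
have /choice[g gP] := q2P.
pose P := \sum_(m <- msupp o) g o@_m * 'X_[m].
pose q3 := q2 * q1 ^+ L.
have q31 : at0 q3 = 1 by rewrite mevalM rmorphXn /= q21 q11 expr1n mulr1.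
have IP : I (F q3 * f ^+ p - ev F l P).
  have -> : F q3 = F q2 * (q1 ^+ L * q1 ^+ (p.-1 * L)).
    by rewrite rmorphM /= [F (q1 ^+ L)]FE -exprD -exprM; congr (_ * q1 ^+ _); rewrite -mulSn prednK // mulnC.
  apply: (ideal_congl (y := F q2 * (q1 ^+ L * (q1 ^+ (p.-1 * L) * w)) - ev F l P) I_ideal).
    rewrite (_ : _ - _ = F q2 * (q1 ^+ L * q1 ^+ (p.-1 * L)) * (f ^+ p - w)); [exact: IMl|ring].
  apply: (ideal_congl (y := F q2 * o.@[l] - ev F l P) I_ideal).
    rewrite (_ : _ - _ = F q2 * (q1 ^+ L * (q1 ^+ (p.-1 * L) * w) - o.@[l])); [exact: IMl|ring].
  rewrite mevalE mulr_sumr rmorph_sum -sumrB; apply: (ideal_sum _ I_ideal) => m _.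
  by rewrite /= rmorphM /= evXm mulrA -mulrBl mulrC; apply: IMl (gP _).
have Pdeg u : u \in msupp P -> (L <= mdeg u)%N.
  rewrite leqNgt mcoeff_msupp; apply: contraNN => uB.
  rewrite raddf_sum big_seq big1 //= => v ve; apply/eqP; rewrite mcoeff_eq0.
  apply: contraL uB => /msuppM_le /allpairsP[[u1 u2] /= [_]].
  by rewrite msuppX inE => /eqP-> ->; rewrite -leqNgt mdegD (dhomog_mf oL ve) leq_addl.
pose C (m : 'X_{1..d}) (a : A) := m = 0%MM -> M k.+1 a.
have [||u uP|P' [rP' P'E P'0]] := @reduce d l P C.
- by move=> m _; case: (M_ideal k.+1).
- by move=> m a b Ca Cb m0; case: (M_ideal k.+1) => _ + _; apply; [apply: Ca|apply: Cb].
- move=> u0; apply: ideal_powMl.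
  have <- : msub l 'X_[mquo u] = \prod_j l j ^+ (mquo u) j by rewrite /msub evXm.
  have du : mdeg u = (p * mdeg (mquo u))%N.
    rewrite !mdegE big_distrr; apply: eq_bigr => j _ /=.
    have := congr1 (fun v : 'X_{1..d} => v j) u0; rewrite !mnmE => u0j.
    by rewrite {1}(divn_eq (u j) p) u0j addn0 mulnC.
  have ku : (k < mdeg (mquo u))%N by rewrite -(ltn_pmul2l p_gt0) -du; apply: Pdeg.
  by apply: ideal_pow_le ku _; apply: M_l; rewrite dhomogX.
have [||q qq qP] := F_free (P := P' - (q3 * f)%:MP).
- move=> m mP i; have [->|m0] := eqVneq m 0%MM; first by rewrite mnm0E.
  suff : m \in msupp P' by move/rP'; apply.
  by move: mP; rewrite !mcoeff_msupp mcoeffB mcoeffC (negPf m0) mulr0 subr0.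
- rewrite rmorphB /= evC P'E rmorphM /= [F f]FE -opprB; exact: (idealN I_ideal).
apply: (unit_cancel (q := q * q3)); first by rewrite mevalM qq q31 mulr1.
have := qP 0%MM; rewrite mcoeffB mcoeffC eqxx mulr1 => IE.
have -> : q * q3 * f = q * P'@_0 - q * (P'@_0 - q3 * f) by ring.
apply: (idealB (IM_ideal _)); last exact: IM_I.
by case: (IM_ideal k.+1) => _ _; apply; apply/IM_M/P'0.
Qed.

Lemma frobenius_root j (q : {mpoly K[d]}) : q \is j.+1.-homog -> (forall i, mderiv i q = 0) ->
  exists k (q' : {mpoly K[d]}), [/\ (p * k = j.+1)%N, q' \is k.-homog & q = q' ^+ p] \/ q = 0.
Proof.
move=> hq dq; have [->|q0] := eqVneq q 0; first by exists 0%N, 0; right.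
have charD : p \in [pchar {mpoly K[d]}] by apply: (rmorph_pchar (@mpolyC d K)).
have dvd m : m \in msupp q -> forall i, (p %| m i)%N.
  move=> mq i; have [->//|mi] := posnP (m i).
  have mE : m = ((m - U_(i)) + U_(i))%MM.
    by apply/mnmP => u; rewrite mnmDE mnmBE mnm1E; case: eqVneq => [<-|]; rewrite ?subnK // subn0 addn0.
  have := congr1 (mcoeff (m - U_(i))%MM) (dq i).
  rewrite mcoeff_deriv -mE mnmBE mnm1E eqxx subn1 prednK // mcoeff0 -mulr_natr => /eqP.
  by by rewrite mulf_eq0 mcoeff_eq0 mq /= -(dvdn_pcharf charK).
have degE m : m \in msupp q -> mdeg m = (p * mdeg (mquo m))%N.
  move=> mq; rewrite !mdegE big_distrr; apply: eq_bigr => i _ /=.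
  by rewrite mnmE mulnC divnK // dvd.
have /choice[r rP] := root.
exists (j.+1 %/ p)%N, (\sum_(m <- msupp q) r q@_m *: 'X_[mquo m]); left; split.
- have lq := mlead_supp q0.
  by rewrite mulnC divnK // -(dhomog_mf hq lq) /= (degE _ lq) dvdn_mulr.
- rewrite big_seq; apply: rpred_sum => m mq; apply: rpredZ; rewrite dhomogX /=.
  by rewrite -(dhomog_mf hq mq) /= (degE m mq) mulKn.
rewrite -(pFrobenius_autE charD) rmorph_sum {1}[q]mpolyE big_seq [in RHS]big_seq.
apply: eq_bigr => m mq; rewrite /= pFrobenius_autE exprZn rP mpolyXn; congr (_ *: 'X_[_]).
by apply/mnmP => i; rewrite mulmnE mnmE divnK // dvd.
Qed.

End Frobenius.

(** Strong induction on the degree: applying [D i] shows that every partial derivative of [q]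
    satisfies the hypothesis in degree j, hence vanishes. Then [q] is 0 in characteristic 0; in
    characteristic p it is 0 or the p-th power of a form of smaller degree, to which
    [frobenius_order] passes the hypothesis. *)
Let homogeneous_free j (q : {mpoly K[d]}) : q \is j.-homog -> IM j.+1 (msub l q) -> q = 0.
Proof.
elim/ltn_ind: j q => -[|j] IH q hq IMq.
  have qE : q = (q@_0)%:MP.
    apply/mpolyP => m; rewrite mcoeffC; have [->|m0] := eqVneq m 0%MM; first by rewrite mulr1.
    by rewrite mulr0 (dhomog_nemf_coeff hq) //= mdeg_eq0.
  move: qE; set c := q@_0 => qE.
  by move/IM1: IMq; rewrite qE /msub evC mevalC => ->; rewrite mpolyC0.
have dq i : mderiv i q = 0.
  apply: (IH j (ltnSn j)).
    apply/dhomogP => m; rewrite mcoeff_msupp mcoeff_deriv => mq /=.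
    have /(dhomog_mf hq) /= : (m + U_(i))%MM \in msupp q.
      by rewrite mcoeff_msupp; apply: contraNneq mq => ->; rewrite mul0rn.
    by rewrite mdegD mdeg1 addn1 => -[].
  have hd k : mderiv k q \is j.-homog.
    apply/dhomogP => m; rewrite mcoeff_msupp mcoeff_deriv => mq /=.
    have /(dhomog_mf hq) /= : (m + U_(k))%MM \in msupp q.
      by rewrite mcoeff_msupp; apply: contraNneq mq => ->; rewrite mul0rn.
    by rewrite mdegD mdeg1 addn1 => -[].
  have := D_IM i IMq; rewrite /msub (D_chain _ (fun c => DC i c)) => H.
  have -> : ev (@mpolyC n K) l (mderiv i q) = (\sum_k ev (@mpolyC n K) l (mderiv k q) * D i (l k)) -
      \sum_k ev (@mpolyC n K) l (mderiv k q) * (D i (l k) - (i == k)%:R).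
    rewrite -sumrB (bigD1 i) //= eqxx /= big1 ?addr0 => [|k ki]; first by ring.
    by rewrite eq_sym (negPf ki) /= subr0 subrr.
  apply: (idealB (IM_ideal _) H); apply: (ideal_sum _ (IM_ideal _)) => k _.
  rewrite -addn1; apply: IM_mul; first exact/IM_M/(M_l (hd k)).
  by apply/IM_M/M1; rewrite mevalB Dl rmorph_nat subrr.
have [[p pK]|noc] := pselect (exists p, p \in [pchar K]).
  have [k [q' [[pk hq' qE]|//]]] := frobenius_root pK hq dq.
  suff q'0 : q' = 0 by rewrite qE q'0 expr0n gtn_eqF //; case/andP: pK => /prime_gt0.
  have p1 : (1 < p)%N by case/andP: pK => /prime_gt1.
  have k0 : (0 < k)%N by rewrite lt0n; apply: contra_eqN pk => /eqP ->; rewrite muln0.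
  have kj : (k < j.+1)%N by rewrite -pk ltn_Pmull.
  apply: (IH k kj q' hq').
  by apply: (frobenius_order pK); rewrite pk -rmorphXn /= -qE.
apply/mpolyP => m; rewrite mcoeff0; have [mq|] := boolP (m \in msupp q); last by rewrite -mcoeff_eq0 => /eqP.
have [i mi] : exists i, m i != 0%N.
  apply/existsP; rewrite -negb_forall; apply/negP => /forallP m0.
  by have := dhomog_mf hq mq; rewrite /= mdegE big1 // => i _; apply/eqP.
have mE : m = ((m - U_(i)) + U_(i))%MM.
  by apply/mnmP => u; rewrite mnmDE mnmBE mnm1E; case: eqVneq => [<-|]; rewrite ?subnK ?lt0n // subn0 addn0.
have := congr1 (mcoeff (m - U_(i))%MM) (dq i).
rewrite mcoeff_deriv -mE mnmBE mnm1E eqxx subn1 prednK ?lt0n // mcoeff0 -mulr_natr => /eqP.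
rewrite mulf_eq0 => /orP[/eqP //|/natf0_pchar] [|p pK]; first by rewrite lt0n.
by case: noc; exists p.
Qed.

(* The completed local ring of the reduced scheme I = 0 at the origin is a power series ring in l. *)
Lemma smooth_independence k (q : {mpoly K[d]}) :
  IM k (msub l q) -> forall m, (mdeg m < k)%N -> q@_m = 0.
Proof.
move=> IMq; suff H j : (j <= k)%N -> forall m, (mdeg m < j)%N -> q@_m = 0 by apply: H.
elim: j => // j IH jk m; rewrite ltnS leq_eqVlt => /orP[/eqP mj|]; last by apply: IH; apply: ltnW.
have qj : pihomog mdeg j q = 0.
  apply: (homogeneous_free (pihomogP mdeg j q)).
  have -> : msub l (pihomog mdeg j q) = msub l q - msub l (q - pihomog mdeg j q).
    by rewrite rmorphB /=; ring.
  apply: (idealB (IM_ideal _)); first exact: IM_le IMq.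
  rewrite [q - _]mpolyE rmorph_sum big_seq; apply: (ideal_sum _ (IM_ideal _)) => u /=.
  rewrite mcoeff_msupp mcoeffB mcoeff_pihomog => uq; rewrite /msub evZ.
  case: (IM_ideal j.+1) => _ _; apply; apply: IM_M.
  have ju : (j < mdeg u)%N.
    rewrite ltnNge leq_eqVlt; apply: contraNN uq => /orP[/eqP uj|uj]; first by rewrite /= uj eqxx subrr.
    by rewrite IH ?(ltnW jk) // ltn_eqF // subrr.
  by apply: (ideal_pow_le ju); apply: (@M_l (mdeg u) 'X_[u]); rewrite dhomogX.
by have := congr1 (mcoeff m) qj; rewrite mcoeff_pihomog mcoeff0 /= mj eqxx.
Qed.

End Smoothness.

Lemma subspace_matrix (K : fieldType) n (S : 'rV[K]_n -> Prop) :
  S 0 -> (forall u v, S u -> S v -> S (u + v)) -> (forall c u, S u -> S (c *: u)) ->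
  exists B : 'M[K]_n, forall w, S w <-> (w <= B)%MS.
Proof.
move=> S0 SD SZ; pose good (B : 'M[K]_n) := forall w : 'rV_n, (w <= B)%MS -> S w.
have g0 : good 0 by move=> w; rewrite submx0 => /eqP ->.
have [r [B gB rB] maxr] : exists2 r, (exists2 B, good B & \rank B = r) &
    forall B, good B -> (\rank B <= r)%N.
  pose P r := `[< exists2 B, good B & \rank B = r >].
  have exP : exists r, P r by exists 0%N; apply/asboolP; exists 0 => //; rewrite mxrank0.
  have bP r : P r -> (r <= n)%N by move=> /asboolP[B _ <-]; apply: rank_leq_row.
  have [r /asboolP Pr maxr] := ex_maxnP exP bP.
  by exists r => // B gB; apply: maxr; apply/asboolP; exists B.
exists B => w; split=> [Sw|]; last exact: gB.
have gBw : good (B + w)%MS.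
  move=> u /sub_addsmxP[[u1 u2] /= ->]; apply: SD; first by apply: gB; apply: submxMl.
  by rewrite [u2]mx11_scalar mul_scalar_mx; apply: SZ.
have := maxr _ gBw; rewrite -rB => rBw.
apply: submx_trans (addsmxSr B w) _.
by rewrite -(mxrank_leqif_sup (addsmxSl B w)) eqn_leq rBw mxrankS // addsmxSl.
Qed.

Lemma mderiv_linear_form (A : comNzRingType) n (c : 'I_n -> A) j :
  mderiv j (\sum_u (c u)%:MP * 'X_u : {mpoly A[n]}) = (c j)%:MP.
Proof.
rewrite raddf_sum (bigD1 j) //= mderiv_mulC mderiv_var eqxx mulr1 big1 ?addr0 // => u uj.
by rewrite mderiv_mulC mderiv_var (negPf uj) mulr0.
Qed.

Lemma ord_ge_ideal_pow (R : comNzRingType) n (y : 'I_n -> series R) k e :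
  (forall j, ord_ge 1 (y j)) -> ideal_pow y k e -> ord_ge k e.
Proof.
move=> y1; elim: k e => [//|k IH] e /ideal_powS[q [qk ->]].
apply: (ideal_sum _ (ord_ge_ideal k.+1)) => j _.
by rewrite -addn1 addnC; apply: ord_geM; [apply: y1|apply/IH/qk].
Qed.

(** * Infinitesimal lifting of points with values in power series *)

Section SmoothLift.
Variables (K : closedFieldType) (n : nat).
Notation A := {mpoly K[n]}.
Variable I : A -> Prop.
Notation at0 p := (p.@[fun=> 0]).
Hypothesis I_ideal : ideal I.
Hypothesis I_rad : forall f k, I (f ^+ k) -> I f.
Hypothesis I_origin : forall p, I p -> at0 p = 0.
Hypothesis tangent : forall v : 'I_n -> K,
  (forall p, I p -> \sum_j at0 (mderiv j p) * v j = 0) ->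
  exists V : 'I_n -> A, (forall j, at0 (V j) = v j) /\
    forall p, I p -> I (\sum_j mderiv j p * V j).

Lemma tangent_frame : exists d (l : 'I_d -> A) (V : 'I_d -> 'I_n -> A),
  [/\ forall i, at0 (l i) = 0, forall i p, I p -> I (\sum_j mderiv j p * V i j),
      forall i k, at0 (\sum_j mderiv j (l k) * V i j) = (i == k)%:R &
      forall j, exists c : 'I_d -> K, exists2 e, ideal_pow (fun j => 'X_j : A) 2 e &
        I ('X_j - \sum_i (c i)%:MP * l i - e)].
Proof.
have [I0 ID IM] := I_ideal.
pose grad p : 'rV[K]_n := \row_j at0 (mderiv j p).
have [||c w [p [Ip <-]]|B BP] := @subspace_matrix K n (fun w => exists p, I p /\ grad p = w).
- by exists 0; split=> //; apply/rowP => j; rewrite !mxE mderiv0 meval0.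
- move=> u v [p [Ip <-]] [q [Iq <-]]; exists (p + q); split; first exact: ID.
  by apply/rowP => j; rewrite !mxE mderivD mevalD.
- exists (c%:MP * p); split; first exact: IM.
  by apply/rowP => j; rewrite !mxE mderiv_mulC mevalM mevalC.
(* The rows of [W] form a basis of the tangent space, the vectors killed by all gradients of I; the
   right inverse [L] provides linear forms dual to it. *)
pose W := row_base (kermx B^T); pose L := pinvmx W.
have WL : W *m L = 1%:M by apply: mulmxVp; apply: row_base_free.
have WB (p : A) : I p -> W *m (grad p)^T = 0.
  move=> Ip; have /submxP[u ->] : (grad p <= B)%MS by apply/BP; exists p.
  have /sub_kermxP : (W <= kermx B^T)%MS by rewrite eq_row_base.
  by rewrite trmx_mul mulmxA => ->; rewrite mul0mx.
have tan i : exists V : 'I_n -> A, (forall j, at0 (V j) = W i j) /\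
    forall p, I p -> I (\sum_j mderiv j p * V j).
  apply: tangent => p Ip; have /matrixP/(_ i 0) := WB p Ip; rewrite mxE [RHS]mxE; apply: etrans.
  by apply: eq_bigr => j _; rewrite [_^T j 0]mxE [grad p 0 j]mxE mulrC.
have /choice[V VP] := tan.
exists (\rank (kermx B^T)), (fun i => \sum_j (L j i)%:MP * 'X_j), V; split.
- by move=> i; rewrite rmorph_sum big1 // => j _; rewrite /= mevalM mevalXU mulr0.
- by move=> i; case: (VP i).
- move=> i k; have /matrixP/(_ i k) := WL; rewrite mxE [RHS]mxE; apply: etrans.
  rewrite rmorph_sum; apply: eq_bigr => j _; rewrite /= mevalM; have [-> _] := VP i.
  rewrite mulrC; congr (_ * _).
  by rewrite (mderiv_linear_form (L^~ k)) mevalC.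
move=> j; exists (fun i => W i j).
(* The form x_j minus its projection vanishes on the tangent space, hence is the linear part of some
   p in I; the rest of p is quadratic by Taylor's formula. *)
pose w : 'rV[K]_n := delta_mx 0 j - (\row_i W i j) *m L^T.
have wB : (w <= B)%MS.
  rewrite submxE; apply/eqP/trmx_inj; rewrite trmx_mul trmx0.
  have /submxP[u ->] : ((cokermx B)^T <= W)%MS.
    by rewrite eq_row_base; apply/sub_kermxP; rewrite -trmx_mul mulmx_coker trmx0.
  rewrite -mulmxA (_ : W *m w^T = 0) ?mulmx0 //.
  rewrite linearB /= mulmxBr trmx_mul trmxK mulmxA WL mul1mx.
  by apply/matrixP => a b; rewrite ord1 mxE trmx_delta -colE !mxE subrr.
have /BP[p [Ip wE]] := wB.
pose e := p - \sum_j (at0 (mderiv j p))%:MP * 'X_j.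
exists (- e); last first.
  rewrite opprK (_ : _ + e = p) // /e.
  have -> : \sum_(k < n) (at0 (mderiv k p))%:MP * 'X_k =
      'X_j - \sum_i (W i j)%:MP * \sum_k (L k i)%:MP * 'X_k.
    transitivity (\sum_k (w 0 k)%:MP * 'X_k : A).
      by apply: eq_bigr => k _; rewrite -wE mxE.
    under eq_bigr => k _ do rewrite !mxE mpolyCB mulrBl eqxx /=.
    rewrite sumrB; congr (_ - _).
      rewrite (bigD1 j) //= eqxx mul1r big1 ?addr0 // => k kj.
      by rewrite (negPf kj) mpolyC0 mul0r.
    under eq_bigr => k _ do rewrite rmorph_sum mulr_suml.
    rewrite exchange_big; apply: eq_bigr => i _ /=; rewrite mulr_sumr.
    by apply: eq_bigr => k _; rewrite !mxE rmorphM /= mulrA.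
  by rewrite addrC subrK.
apply: (idealN (ideal_pow_ideal _ _)).
have := @ideal_taylor K A (@mpolyC n K) n (ideal_pow (fun j => 'X_j) 1)
  (ideal_pow (fun j => 'X_j) 2) (fun=> 0) (fun j => 'X_j) p
  (ideal_pow_ideal _ _) (ideal_pow_ideal _ _) (fun a b => @ideal_powM _ _ _ 1 1 a b)
  (fun j => ideal_pow_var _ j).
have ev0 (q : A) : ev (@mpolyC n K) (fun=> 0) q = (at0 q)%:MP.
  by rewrite [RHS](rmorph_ev (j := @mpolyC n K) (i := idfun)) //; apply: eq_ev => k /=; rewrite mpolyC0.
rewrite ev0 I_origin // subr0.
rewrite (eq_ev _ (y := fun j => 'X_j)) => [|k]; last by rewrite add0r.
rewrite -/(msub _ _) msub_id (eq_bigr (fun j => (at0 (mderiv j p))%:MP * 'X_j)) // => k _.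
by rewrite ev0.
Qed.

(** [Psi j] is x_j rewritten as a polynomial [Q j] in [l] modulo m^(k+1) + I. For p in I the
    polynomial p(Q) has no term of degree at most k, because the [l] are independent, so it has
    order k + 1 along every arc through the origin. [Psi] does not depend on [x], which keeps graded
    families graded. *)
Lemma smooth_lift k : exists Psi : 'I_n -> A, forall x : 'I_n -> series K,
  (forall j, ord_ge 1 (x j)) -> (forall p, I p -> ord_ge k (ev serC x p)) ->
  (forall j, ord_ge k (ev serC x (Psi j) - x j)) /\
  forall p, I p -> ord_ge k.+1 (ev serC (fun j => ev serC x (Psi j)) p).
Proof.
have [d [l [V [l0 VI lV gen]]]] := tangent_frame.
pose D i p := \sum_j mderiv j p * V i j.
have DD i p q : D i (p + q) = D i p + D i q.
  by rewrite -big_split; apply: eq_bigr => j _; rewrite mderivD mulrDl.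
have DM i p q : D i (p * q) = D i p * q + p * D i q.
  rewrite mulr_suml mulr_sumr -big_split; apply: eq_bigr => j _.
  by rewrite /= mderivM; ring.
have DC i c : D i c%:MP = 0 by rewrite /D big1 // => j _; rewrite mderivC mul0r.
have /choice[Q QP] j := smooth_approximation I_ideal gen k.+1 'X_j.
have indep := @smooth_independence K n d I l D I_ideal I_rad I_origin l0 DD DM DC VI lV gen.
exists (fun j => msub l (Q j)) => x x1 Ix.
have ordM m e : ideal_pow (fun j => 'X_j : A) m e -> ord_ge m (ev serC x e).
  elim: m e => [//|m IH] e /ideal_powS[q [qm ->]]; rewrite rmorph_sum.
  apply: (ideal_sum _ (ord_ge_ideal m.+1)) => j _; rewrite /= rmorphM /= evX.
  by rewrite -addn1 addnC; apply: ord_geM; [apply: x1|apply/IH/qm].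
split=> [j|p Ip].
  have [e Me Ie] := QP j.
  have -> : ev serC x (msub l (Q j)) - x j = - (ev serC x ('X_j - msub l (Q j) - e) + ev serC x e).
    by rewrite !rmorphB /= evX; ring.
  apply: (idealN (ord_ge_ideal k)); case: (@ord_ge_ideal K k) => _ OD _; apply: OD.
    exact: Ix.
  by apply: (ord_ge_le (leqnSn k)); apply: ordM.
have q0 m : (mdeg m < k.+1)%N -> (msub Q p)@_m = 0.
  move: m; apply: indep.
  pose IMp (p : A) := exists2 e, ideal_pow (fun j => 'X_j : A) k.+1 e & I (p - e).
  have IMi : ideal IMp.
    have [I0 ID IM] := I_ideal; have [P0 PD PM] := ideal_pow_ideal (fun j => 'X_j : A) k.+1.
    split=> [|u v [e Pe ue] [f Pf vf]|u v [e Pe ve]].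
    - by exists 0; rewrite ?subr0.
    - exists (e + f); first exact: PD.
      by rewrite (_ : _ - _ = (u - e) + (v - f)); [apply: ID|ring].
    exists (u * e); first exact: PM.
    by rewrite -mulrBr; apply: IM.
  have E : msub l (msub Q p) = ev (@mpolyC n K) (fun j => msub l (Q j)) p by rewrite /msub ev_msub.
  rewrite E; apply: (ideal_congl IMi (y := p)); last first.
    by exists 0; rewrite ?subr0 //; case: (ideal_pow_ideal (fun j => 'X_j : A) k.+1).
  rewrite -[X in _ - X](msub_id p); apply: (@ideal_ev_congr _ _ _ _ IMp) => // j.
  by rewrite -opprB; apply: (idealN IMi); apply: QP.
have y1 i : ord_ge 1 (ev serC x (l i)).
  have l0x : ev serC (fun=> 0) (l i) = 0.
    transitivity (serC (at0 (l i))); last by rewrite l0 rmorph0.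
    rewrite [RHS](rmorph_ev (i := idfun) (j := serC)) //.
    by apply: eq_ev => j /=; rewrite rmorph0.
  rewrite -[ev _ _ _]subr0 -l0x.
  by apply: (@ideal_ev_congr _ _ _ _ (@ord_ge K 1)) => [|j]; [apply: ord_ge_ideal|rewrite subr0; apply: x1].
rewrite (eq_ev _ (y := fun j => ev serC (fun i => ev serC x (l i)) (Q j))) => [|j]; last first.
  by rewrite ev_msub.
rewrite -ev_msub [msub Q p]mpolyE rmorph_sum big_seq.
apply: (ideal_sum _ (ord_ge_ideal k.+1)) => m mp; rewrite /= evZ evXm.
case: (@ord_ge_ideal K k.+1) => _ _; apply.
apply: (@ord_ge_le _ _ (mdeg m)); last first.
  by apply: (ord_ge_ideal_pow y1); apply: ideal_pow_monomial.
by rewrite leqNgt; apply: contraL mp => /q0 mp; rewrite -mcoeff_eq0 mp.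
Qed.

End SmoothLift.

(** * Points of a matrix group with values in K-algebras *)

Section MatrixPoints.
Variables (K : closedFieldType) (N : nat).

Definition mxcoord (R : Type) (A : 'M[R]_N) (k : 'I_(N * N)) : R := mxvec A 0 k.

Lemma mxcoordE (R : Type) (A : 'M[R]_N) i j : mxcoord A (mxvec_index i j) = A i j.
Proof. exact: mxvecE. Qed.

Lemma mxcoordP (P : 'I_(N * N) -> Prop) : (forall i j, P (mxvec_index i j)) -> forall k, P k.
Proof. by move=> Pij k; case/mxvec_indexP: k. Qed.

(** Comultiplication of the coordinate ring of matrices, as finitely many pairs that are valid over
    every K-algebra [R]. *)
Lemma mxcoord_product (q : {mpoly K[N * N]}) : exists s : seq ({mpoly K[N * N]} * {mpoly K[N * N]}),
  forall (R : comNzRingType) (i : {rmorphism K -> R}) (A B : 'M[R]_N),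
    ev i (mxcoord (A *m B)) q = \sum_(FG <- s) ev i (mxcoord A) FG.1 * ev i (mxcoord B) FG.2.
Proof.
elim/mpoly_ring_ind: q => [c|k|p q [s sE] [t tE]|p q [s sE] [t tE]].
- exists [:: (c%:MP, 1)] => R i A B.
  by rewrite big_seq1 /= !evC rmorph1 mulr1.
- elim/mxcoordP: k => a b.
  exists [seq ('X_(mxvec_index a c), 'X_(mxvec_index c b)) | c <- enum 'I_N] => R i A B.
  rewrite evX mxcoordE mxE big_map big_enum /=; apply: eq_bigr => c _.
  by rewrite !evX !mxcoordE.
- by exists (s ++ t) => R i A B; rewrite rmorphD /= sE tE big_cat.
exists [seq (u.1 * v.1, u.2 * v.2) | u <- s, v <- t] => R i A B.
rewrite rmorphM /= sE tE big_allpairs_dep mulr_suml; apply: eq_bigr => u _.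
by rewrite mulr_sumr; apply: eq_bigr => v _; rewrite /= !rmorphM /=; ring.
Qed.

(* A bilinear relation on X x {r} extends from K-points to points with values in R modulo J:
   induction on the number of terms, eliminating one coefficient r at a time. *)
Lemma linear_transfer (R : comNzRingType) (i : {rmorphism K -> R}) n (X : ('I_n -> K) -> Prop)
    (J : R -> Prop) (a : 'I_n -> R) (s : seq ({mpoly K[n]} * R)) : ideal J ->
  (forall p, (forall x, X x -> p.@[x] = 0) -> J (ev i a p)) ->
  (forall x, X x -> J (\sum_(Fr <- s) i (Fr.1.@[x]) * Fr.2)) ->
  J (\sum_(Fr <- s) ev i a Fr.1 * Fr.2).
Proof.
move=> iJ aX; have [J0 JD JM] := iJ.
have [k] := ubnP (size s); elim: k s => // k IH s; rewrite ltnS => sk sX.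
have [s0|] := pselect (forall F, F \in s -> forall x, X x -> F.1.@[x] = 0).
  rewrite big_seq; apply: (ideal_sum _ iJ) => F Fs; rewrite mulrC; apply: JM.
  by apply: aX; apply: s0.
move=> /existsNP[[F r] /not_implyP[Fs /existsNP[x0 /not_implyP[Xx0 /eqP Fx0]]]].
pose t := rem (F, r) s; have st := perm_to_rem Fs.
rewrite (perm_big _ st) big_cons /=.
pose lam (H : {mpoly K[n]}) := H.@[x0] / F.@[x0].
pose t' := [seq (Hr.1 - (lam Hr.1)%:MP * F, Hr.2) | Hr <- t].
have rJ : J (r + \sum_(Hr <- t) i (lam Hr.1) * Hr.2).
  have := JM (i (F.@[x0])^-1) _ (sX x0 Xx0); rewrite (perm_big _ st) big_cons /= mulrDr mulrA.
  rewrite -rmorphM mulVf // rmorph1 mul1r mulr_sumr.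
  rewrite (eq_bigr (fun Hr => i (lam Hr.1) * Hr.2)) // => Hr _.
  by rewrite /lam rmorphM /=; ring.
have E (f : {mpoly K[n]} -> R) : (forall H c, f (H - c%:MP * F) = f H - i c * f F) ->
    \sum_(Hr <- t') f Hr.1 * Hr.2 =
    (f F * r + \sum_(Hr <- t) f Hr.1 * Hr.2) - f F * (r + \sum_(Hr <- t) i (lam Hr.1) * Hr.2).
  move=> fB; rewrite big_map mulrDr opprD addrACA subrr add0r mulr_sumr -sumrB.
  by apply: eq_bigr => Hr _; rewrite /= fB; ring.
have fev H c : ev i a (H - c%:MP * F) = ev i a H - i c * ev i a F.
  by rewrite rmorphB rmorphM /= evC.
apply: (ideal_congl iJ (y := \sum_(Hr <- t') ev i a Hr.1 * Hr.2)).
  by rewrite (E (ev i a)) // subKr; apply: JM.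
apply: IH => [|x Xx].
  by rewrite size_map; have := perm_size st; rewrite /= => <-.
rewrite (E (fun H => i H.@[x])) => [|H c]; last by rewrite mevalB mevalM mevalC rmorphB rmorphM.
apply: idealB => //; last exact: JM.
by have := sX x Xx; rewrite (perm_big _ st) big_cons.
Qed.

Variable G : 'M[K]_N -> Prop.
Hypothesis GM : forall A B, G A -> G B -> G (A *m B).

Definition group_ideal (p : {mpoly K[N * N]}) := forall A, G A -> p.@[mxcoord A] = 0.

(** G is known only through its K-points, while [J] need not be radical: the coproduct of p gives a
    bilinear relation on G x G, and [linear_transfer] extends it in one factor at a time. *)
Lemma group_point_mul (R : comNzRingType) (i : {rmorphism K -> R}) (J : R -> Prop) (A B : 'M[R]_N) :
  ideal J -> (forall p, group_ideal p -> J (ev i (mxcoord A) p)) ->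
  (forall p, group_ideal p -> J (ev i (mxcoord B) p)) ->
  forall p, group_ideal p -> J (ev i (mxcoord (A *m B)) p).
Proof.
move=> iJ GA GB p Gp; have [s sE] := mxcoord_product p; rewrite sE.
have coordG H (q : {mpoly K[N * N]}) : (forall x, (exists2 g, G g & x = mxcoord g) -> q.@[x] = 0) -> group_ideal q.
  by move=> qx g Gg; apply: qx; exists g.
pose X (x : 'I_(N * N) -> K) := exists2 g, G g & x = mxcoord g.
have := @linear_transfer R i _ X J (mxcoord A) [seq (u.1, ev i (mxcoord B) u.2) | u <- s] iJ.
rewrite !big_map; apply=> [q qX|_ [g Gg ->]]; first by apply: GA => g Gg; apply: qX; exists g.
rewrite big_map /=.
have := @linear_transfer R i _ X J (mxcoord B) [seq (u.2, i (u.1.@[mxcoord g])) | u <- s] iJ.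
rewrite !big_map /=; under eq_bigr => u _ do rewrite mulrC.
apply=> [q qX|_ [h Gh ->]]; first by apply: GB => h Gh; apply: qX; exists h.
rewrite big_map /= (_ : \sum_(_ <- _) _ = i (p.@[mxcoord (g *m h)])); last first.
  rewrite -[p.@[_]]/(ev idfun (mxcoord (g *m h)) p) sE rmorph_sum; apply: eq_bigr => u _.
  by rewrite /= rmorphM mulrC.
by rewrite (Gp _ (GM Gg Gh)) rmorph0; case: iJ.
Qed.

End MatrixPoints.

Lemma mderiv_msub (A : comNzRingType) m n (Q : 'I_n -> {mpoly A[m]}) j p :
  mderiv j (msub Q p) = \sum_k msub Q (mderiv k p) * mderiv j (Q k).
Proof.
elim/mpoly_ring_ind: p => [c|k|p q Ep Eq|p q Ep Eq].
- by rewrite /msub evC mderivC big1 // => k _; rewrite mderivC rmorph0 mul0r.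
- rewrite /msub evX (bigD1 k) //= mderiv_var eqxx rmorph1 mul1r big1 ?addr0 // => u uk.
  by rewrite mderiv_var eq_sym (negPf uk) rmorph0 mul0r.
- rewrite rmorphD /= mderivD Ep Eq -big_split; apply: eq_bigr => k _ /=.
  by rewrite mderivD rmorphD mulrDl.
rewrite rmorphM /= mderivM Ep Eq mulr_suml mulr_sumr -big_split; apply: eq_bigr => k _ /=.
by rewrite mderivM rmorphD !rmorphM /=; ring.
Qed.

Section GroupLift.
Variables (K : closedFieldType) (N : nat) (G : 'M[K]_N -> Prop).
Hypothesis G1 : G 1%:M.
Hypothesis GM : forall A B, G A -> G B -> G (A *m B).
Notation n := (N * N)%N.
Notation MP := {mpoly K[n]}.

(** The ideal of G translated so that the identity becomes the origin, as [smooth_lift] requires. *)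
Let shift_ideal (p : MP) := forall A, G A -> p.@[mxcoord (A - 1%:M)] = 0.
Let Xm : 'M[MP]_N := \matrix_(a, b) 'X_(mxvec_index a b).

Let meval_mxcoord x (M : 'M[MP]_N) k : (mxcoord M k).@[x] = mxcoord (map_mx (meval x) M) k.
Proof. by elim/mxcoordP: k => a b; rewrite !mxcoordE mxE. Qed.

(** The invariant field [(1 + X) v] at a point A of G is the image of [v] under left translation by
    A, and this translation preserves the ideal of G. *)
Let shift_tangent (v : 'I_n -> K) :
  (forall p, shift_ideal p -> \sum_j (mderiv j p).@[fun=> 0] * v j = 0) ->
  exists V : 'I_n -> MP, (forall j, (V j).@[fun=> 0] = v j) /\
    forall p, shift_ideal p -> shift_ideal (\sum_j mderiv j p * V j).
Proof.
move=> tan; pose vm : 'M[K]_N := \matrix_(a, b) v (mxvec_index a b).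
have Xx (x : 'I_n -> K) : map_mx (meval x) Xm = \matrix_(a, b) x (mxvec_index a b).
  by apply/matrixP => a b; rewrite !mxE; apply: mevalXU.
have Cx (x : 'I_n -> K) (M : 'M[K]_N) : map_mx (meval x) (map_mx (@mpolyC n K) M) = M.
  by apply/matrixP => a b; rewrite !mxE; apply: mevalC.
exists (mxcoord ((1%:M + Xm) *m map_mx (@mpolyC n K) vm)); split=> [j|p Ip A GA].
  rewrite meval_mxcoord map_mxM map_mxD map_mx1 Xx Cx (_ : \matrix_(_, _) _ = 0); last first.
    by apply/matrixP => a b; rewrite !mxE.
  by rewrite addr0 mul1mx; elim/mxcoordP: j => a b; rewrite mxcoordE mxE.
pose Q := mxcoord (map_mx (@mpolyC n K) A *m (1%:M + Xm) - 1%:M).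
have Qx x k : (Q k).@[x] = mxcoord (A *m (1%:M + \matrix_(a, b) x (mxvec_index a b)) - 1%:M) k.
  by rewrite meval_mxcoord map_mxB map_mxM map_mxD map_mx1 Xx Cx.
have Iq : shift_ideal (msub Q p).
  move=> B GB; rewrite meval_msub -(Ip _ (GM GA GB)); apply: meval_eq => k; rewrite Qx.
  congr (mxcoord (_ *m _ - _) _); apply/matrixP => a b.
  by rewrite mxE [X in _ + X]mxE mxcoordE [X in _ + X]mxE [X in _ + (_ + X)]mxE; ring.
have := tan _ Iq; under eq_bigr => j _ do rewrite mderiv_msub rmorph_sum mulr_suml.
rewrite exchange_big /= => E; rewrite -[RHS]E rmorph_sum; apply: eq_bigr => k _ /=.
under eq_bigr => j _ do rewrite mevalM -mulrA.
rewrite -mulr_sumr mevalM meval_msub; congr (_ * _).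
  apply: meval_eq => u; rewrite Qx; congr (mxcoord (_ - _) _).
  rewrite (_ : \matrix_(_, _) _ = 0) ?addr0 ?mulmx1 //.
  by apply/matrixP => a b; rewrite !mxE.
rewrite meval_mxcoord map_mxM map_mxD map_mx1 Xx Cx.
have -> : 1%:M + \matrix_(a, b) mxcoord (A - 1%:M) (mxvec_index a b) = A.
  by apply/matrixP => a b; rewrite mxE [X in _ + X]mxE mxcoordE [X in _ + X]mxE [X in _ + (_ + X)]mxE; ring.
elim/mxcoordP: k => a b; rewrite mxcoordE mxE.
have dQ j : (mderiv j (Q (mxvec_index a b))).@[fun=> 0] = \sum_c A a c * (mxvec_index c b == j)%:R.
  have -> : Q (mxvec_index a b) = (\sum_c (A a c)%:MP * ((c == b)%:R%:MP + 'X_(mxvec_index c b))) - (a == b)%:R%:MP.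
    rewrite /Q mxcoordE !mxE; congr (_ - _); last by rewrite rmorph_nat.
    by apply: eq_bigr => c _; rewrite !mxE rmorph_nat.
  rewrite mderivB mderivC subr0 [mderiv j _]linear_sum [LHS]rmorph_sum; apply: eq_bigr => c _ /=.
  by rewrite mul_mpolyC mderivZ -mul_mpolyC mevalM mevalC mderivD mderivC add0r mderiv_var rmorph_nat.
under [RHS]eq_bigr => j _ do rewrite dQ mulr_suml.
rewrite exchange_big /=; apply: eq_bigr => c _.
rewrite (bigD1 (mxvec_index c b)) //= eqxx mulr1 big1 ?addr0 ?mxE // => j jc.
by rewrite eq_sym (negPf jc) mulr0 mul0r.
Qed.

Lemma group_lift k : exists Psi : 'M[MP]_N, forall A : 'M[series K]_N,
  (forall i j, ord_ge 1 (A i j - (1%:M : 'M_N) i j)) ->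
  (forall p, group_ideal G p -> ord_ge k (ev serC (mxcoord A) p)) ->
  let B := \matrix_(i, j) ev serC (mxcoord A) (Psi i j) in
  (forall i j, ord_ge k (B i j - A i j)) /\
  forall p, group_ideal G p -> ord_ge k.+1 (ev serC (mxcoord B) p).
Proof.
have iI : ideal shift_ideal.
  split=> [A _|p q Ip Iq A GA|p q Iq A GA]; first by rewrite meval0.
    by rewrite mevalD Ip ?Iq ?addr0.
  by rewrite mevalM Iq ?mulr0.
have radI f m : shift_ideal (f ^+ m) -> shift_ideal f.
  move=> If A GA; apply/eqP; have /eqP := If A GA.
  by rewrite rmorphXn expf_eq0 => /andP[].
have orI p : shift_ideal p -> p.@[fun=> 0] = 0.
  move=> /(_ _ G1); rewrite subrr; apply: etrans; apply: meval_eq => j.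
  by elim/mxcoordP: j => a b; rewrite mxcoordE [RHS]mxE.
have [Psi PsiP] := smooth_lift iI radI orI shift_tangent k.
pose one := mxcoord (1%:M : 'M[K]_N).
pose minus1 := msub (fun j => 'X_j - (one j)%:MP : MP).
pose plus1 := msub (fun j => 'X_j + (one j)%:MP : MP).
have one_ser j : serC (one j) = mxcoord (1%:M : 'M[series K]_N) j.
  by elim/mxcoordP: j => a b; rewrite /one !mxcoordE !mxE rmorph_nat.
have coordB (M P : 'M[series K]_N) j : mxcoord (M - P) j = mxcoord M j - mxcoord P j.
  by elim/mxcoordP: j => a b; rewrite !mxcoordE !mxE.
exists (\matrix_(a, b) (minus1 (Psi (mxvec_index a b)) + (one (mxvec_index a b))%:MP)) => A A1 AG B.
pose x := mxcoord (A - 1%:M).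
have ev_minus q : ev serC (mxcoord A) (minus1 q) = ev serC x q.
  rewrite /minus1 ev_msub; apply: eq_ev => j.
  by rewrite rmorphB /= evX evC one_ser /x coordB.
have ev_plus (y : 'M[series K]_N) q : ev serC (mxcoord (y - 1%:M)) (plus1 q) = ev serC (mxcoord y) q.
  rewrite /plus1 ev_msub; apply: eq_ev => j.
  by rewrite rmorphD /= evX evC one_ser coordB subrK.
have Iplus p : group_ideal G p -> shift_ideal (plus1 p).
  move=> Gp M GM'; rewrite /plus1 meval_msub -[RHS](Gp _ GM'); apply: meval_eq => j.
  by rewrite mevalD mevalXU mevalC /one; elim/mxcoordP: j => a b; rewrite !mxcoordE !mxE subrK.
have Iminus p : shift_ideal p -> group_ideal G (minus1 p).
  move=> Gp M GM'; rewrite /minus1 meval_msub -[RHS](Gp _ GM'); apply: meval_eq => j.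
  by rewrite mevalB mevalXU mevalC /one; elim/mxcoordP: j => a b; rewrite !mxcoordE !mxE.
have [|p Ip|PA PI] := PsiP x.
- by move=> j; rewrite /x; elim/mxcoordP: j => a b; rewrite mxcoordE mxE; have := A1 a b; rewrite [(- _ : 'M_N) a b]mxE.
- by rewrite -ev_minus; apply/AG/Iminus.
have Bx j : mxcoord (B - 1%:M) j = ev serC x (Psi j).
  elim/mxcoordP: j => a b; rewrite coordB !mxcoordE /B !mxE rmorphD /= ev_minus evC one_ser.
  by rewrite mxcoordE mxE addrK.
split=> [a b|p Gp].
  have := PA (mxvec_index a b); rewrite -Bx /x !coordB !mxcoordE.
  by rewrite opprB addrA subrK.
rewrite -ev_plus (eq_ev _ Bx); exact/PI/Iplus.
Qed.

End GroupLift.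

(** * Characters and averaging *)

Section Characters.
Variables (K : fieldType) (T : Type) (mul : T -> T -> T) (one : T).
Hypothesis mul1 : left_id one mul.

Definition character (chi : T -> K) := forall s t, chi (mul s t) = chi s * chi t.

(* The number of characters involved is bounded uniformly in the parameter. *)
Definition char_sums (P : Type) (F : T -> P -> K) :=
  exists (I : finType) (chi : I -> T -> K), (forall i, character (chi i)) /\
    forall p, exists c : I -> K, forall u, F u p = \sum_i c i * chi i u.

Section CharSums.
Variable P : Type.
Implicit Types F G : T -> P -> K.

Lemma char_sums_ext F G : (forall u p, F u p = G u p) -> char_sums F -> char_sums G.
Proof.
move=> FG [I [chi [chiM cF]]]; exists I, chi; split=> // p; have [c cE] := cF p.
by exists c => u; rewrite -FG.
Qed.

Lemma char_sums_const (f : P -> K) : char_sums (fun=> f).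
Proof.
exists unit, (fun _ _ => 1); split=> [_ s t|p]; first by rewrite mulr1.
by exists (fun=> f p) => u; rewrite big_const card_unit /= mulr1 addr0.
Qed.

Lemma char_sums_add F G : char_sums F -> char_sums G -> char_sums (fun u p => F u p + G u p).
Proof.
move=> [I [chi [chiM cF]]] [J [psi [psiM cG]]].
exists (I + J)%type, (fun k => match k with inl i => chi i | inr j => psi j end).
split=> [[i|j]|p]; [exact: chiM|exact: psiM|].
have [c cE] := cF p; have [d dE] := cG p.
exists (fun k => match k with inl i => c i | inr j => d j end) => u.
by rewrite big_sumType /= -cE -dE.
Qed.

Lemma char_sums_mul F G : char_sums F -> char_sums G -> char_sums (fun u p => F u p * G u p).
Proof.
move=> [I [chi [chiM cF]]] [J [psi [psiM cG]]].
exists (I * J)%type, (fun k u => chi k.1 u * psi k.2 u); split=> [k s t|p].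
  by rewrite chiM psiM mulrACA.
have [c cE] := cF p; have [d dE] := cG p.
exists (fun k => c k.1 * d k.2) => u; rewrite cE dE big_distrlr /= pair_big.
by apply: eq_bigr => k _; rewrite mulrACA.
Qed.

Lemma char_sums_sum (J : Type) (r : seq J) (F : J -> T -> P -> K) :
  (forall j, char_sums (F j)) -> char_sums (fun u p => \sum_(j <- r) F j u p).
Proof.
move=> cF; elim: r => [|j r IH].
  by apply: char_sums_ext (char_sums_const (fun=> 0)) => u p; rewrite big_nil.
by apply: char_sums_ext (char_sums_add (cF j) IH) => u p; rewrite big_cons.
Qed.

End CharSums.

(** Merges a finite family into the parameter, so that one choice of averaging points serves all
    matrix entries and coefficients. *)
Lemma char_sums_family (P : Type) (J : finType) (F : J -> T -> P -> K) :
  (forall j, char_sums (F j)) -> char_sums (fun u (q : P * J) => F q.2 u q.1).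
Proof.
move=> cF; pose I j := sval (cid (cF j)).
pose chi j : I j -> T -> K := sval (cid (svalP (cid (cF j)))).
have chiP j : (forall i, character (chi j i)) /\
    forall p, exists c : I j -> K, forall u, F j u p = \sum_i c i * chi j i u.
  exact: (svalP (cid (svalP (cid (cF j))))).
exists {j : J & I j}, (fun k => chi (tag k) (tagged k)); split=> [k|[p j]] /=.
  by have [h _] := chiP (tag k); apply: h.
pose c j' : I j' -> K := sval (cid ((chiP j').2 p)).
have cE j' u : F j' u p = \sum_i c j' i * chi j' i u by exact: (svalP (cid ((chiP j').2 p))).
exists (fun k => (tag k == j)%:R * c (tag k) (tagged k)) => u.
rewrite (eq_bigr (fun k : {j : J & I j} => (tag k == j)%:R * (c (tag k) (tagged k) * chi (tag k) (tagged k) u))); last first.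
  by move=> k _; rewrite mulrA.
rewrite -(@sig_big_dep _ 0 +%R _ _ xpredT (fun _ => xpredT)
  (fun j' i => (j' == j)%:R * (c j' i * chi j' i u))) /=.
rewrite (bigD1 j) //= [X in _ + X]big1 ?addr0 => [|j' /negPf j'j].
  by rewrite cE; apply: eq_bigr => i _; rewrite eqxx mul1r.
by rewrite big1 // => i _; rewrite j'j mul0r.
Qed.

(* Averaging over the points of [W] kills the nontrivial characters [chi i]: [W] is the
   product, in the group algebra of [T], of the elements [t - chi_i(t)] up to scaling. *)
Lemma quadrature (P : Type) (F : T -> P -> K) : char_sums F ->
  exists W : seq (K * T), \sum_(x <- W) x.1 = 1 /\
    forall u p, \sum_(x <- W) x.1 * F (mul x.2 u) p = \sum_(x <- W) x.1 * F x.2 p.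
Proof.
move=> [I [chi [chiM cF]]].
suff [W [W1 Wchi]] : exists W : seq (K * T), \sum_(x <- W) x.1 = 1 /\
    forall i, i \in enum I -> (forall t, chi i t = 1) \/ \sum_(x <- W) x.1 * chi i x.2 = 0.
  exists W; split=> // u p; have [c cE] := cF p.
  under eq_bigr => x _ do rewrite cE mulr_sumr.
  under [RHS]eq_bigr => x _ do rewrite cE mulr_sumr.
  rewrite exchange_big [RHS]exchange_big; apply: eq_bigr => i _ /=.
  have [|chi1|W0] := Wchi i; first by rewrite mem_enum.
    by apply: eq_bigr => x _; rewrite !chi1.
  under eq_bigr => x _ do rewrite mulrCA chiM.
  under [RHS]eq_bigr => x _ do rewrite mulrCA.
  rewrite -!mulr_sumr W0 mulr0; under eq_bigr => x _ do rewrite mulrA.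
  by rewrite -mulr_suml W0 mul0r mulr0.
elim: (enum I) => [|i r [W [W1 Wchi]]]; first by exists [:: (1, one)]; rewrite big_seq1.
have [[t chit]|chi1] := pselect (exists t, chi i t != 1); last first.
  exists W; split=> // j; rewrite inE => /predU1P[->|jr]; last exact: Wchi.
  by left=> t; apply/eqP/negPn/negP => n1; apply: chi1; exists t.
(* A [character] is only multiplicative, so it may be identically 0. *)
have [[s0 s0P]|n0] := pselect (exists s, chi i s != 0); last first.
  exists W; split=> // j; rewrite inE => /predU1P[->|jr]; last exact: Wchi.
  right; apply: big1 => x _; have [->|c0] := eqVneq (chi i x.2) 0; first by rewrite mulr0.
  by case: n0; exists x.2.
have chi1 : chi i one = 1.
  by apply: (mulIf s0P); rewrite -chiM mul1 mul1r.
pose e := chi i t; have e1 : 1 - e != 0 by rewrite subr_eq0 eq_sym.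
(* The combination (t - chi_i(t)) / (1 - chi_i(t)): it has total weight 1 and is killed by
   [chi i]. *)
pose V : seq (K * T) := [:: ((1 - e)^-1, t); (- e / (1 - e), one)].
pose VW := [seq (x.1 * y.1, mul x.2 y.2) | x <- V, y <- W].
have VWE (f : T -> K) : \sum_(x <- VW) x.1 * f x.2 =
    \sum_(x <- V) \sum_(y <- W) x.1 * y.1 * f (mul x.2 y.2) by rewrite big_allpairs_dep.
have VWM (f : T -> K) : (forall s t, f (mul s t) = f s * f t) ->
    \sum_(x <- VW) x.1 * f x.2 = (\sum_(x <- V) x.1 * f x.2) * \sum_(y <- W) y.1 * f y.2.
  move=> fM; rewrite VWE mulr_suml; apply: eq_bigr => x _; rewrite mulr_sumr.
  by apply: eq_bigr => y _; rewrite fM mulrACA.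
have sum1 (U : seq (K * T)) : \sum_(x <- U) x.1 = \sum_(x <- U) x.1 * (fun=> 1 : K) x.2.
  by apply: eq_bigr => x _; rewrite mulr1.
exists VW; split=> [|j].
  rewrite sum1; apply: etrans (VWM (fun=> 1) _) _ => [s t'|]; first by rewrite mulr1.
  by rewrite -!sum1 W1 mulr1 big_cons big_seq1 /=; field.
rewrite inE => /predU1P[->|/Wchi[j1|j0]]; [right|by left|right]; rewrite (VWM _ (chiM _)).
  rewrite big_cons big_seq1 /= chi1 mulr1 -/e.
  have -> : (1 - e)^-1 * e + - e / (1 - e) = 0 by field.
  by rewrite mul0r.
by rewrite j0 mulr0.
Qed.

End Characters.

(** * Cocycles of a torus with values in power series points of G *)

Section ExistenceTools.
Variables (K : closedFieldType) (N : nat).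
Implicit Types A B C D : 'M[series K]_N.

Definition mx_cong k A B := forall i j, ord_ge k (A i j - B i j).

Lemma mx_cong_trans k A B C : mx_cong k A B -> mx_cong k B C -> mx_cong k A C.
Proof.
move=> AB BC i j; rewrite -(subrK (B i j) (A i j)) -addrA.
by have [_ iD _] := @ord_ge_ideal K k; apply: iD.
Qed.

Lemma mx_cong_sym k A B : mx_cong k A B -> mx_cong k B A.
Proof. by move=> AB i j; rewrite -opprB; apply: (idealN (@ord_ge_ideal K k)). Qed.

Lemma mx_cong_refl k A : mx_cong k A A.
Proof. by move=> i j; rewrite subrr; have [] := @ord_ge_ideal K k. Qed.

Lemma mx_cong_le k l A B : (k <= l)%N -> mx_cong l A B -> mx_cong k A B.
Proof. by move=> kl AB i j; apply: ord_ge_le kl (AB i j). Qed.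

Lemma mx_cong_mul k A B C D : mx_cong k A B -> mx_cong k C D -> mx_cong k (A *m C) (B *m D).
Proof.
have [_ iD iM] := @ord_ge_ideal K k => AB CD i j; rewrite !mxE -sumrB.
apply: (ideal_sum _ (@ord_ge_ideal K k)) => l _.
rewrite (_ : _ - _ = A i l * (C l j - D l j) + D l j * (A i l - B i l)); last by ring.
by apply: iD; apply: iM.
Qed.

Lemma mx_cong_coord k A B l : mx_cong k A B -> ord_ge k (mxcoord A l - mxcoord B l).
Proof. by move=> AB; elim/mxcoordP: l => i j; rewrite !mxcoordE. Qed.

Lemma mx_cong_all A B : (forall k, mx_cong k A B) -> A = B.
Proof.
move=> AB; apply/matrixP => i j; apply/eqP; rewrite -subr_eq0; apply/eqP.
by apply: ord_ge_all => k; apply: AB.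
Qed.

Lemma ev_serC_const n (x : 'I_n -> K) p : ev serC (fun i => serC (x i)) p = serC p.@[x].
Proof. by rewrite [RHS](rmorph_ev (i := idfun) (j := serC)). Qed.

Lemma scale_serX_inj b A B : serX ^+ b *: A = serX ^+ b *: B -> A = B.
Proof.
move=> /matrixP AB; apply/matrixP => i j; have := AB i j; rewrite !mxE; exact: serX_inj.
Qed.

Lemma ser_char_mul (T P : Type) (mul : T -> T -> T) (F G : T -> P -> series K) :
  (forall k, char_sums mul (fun u p => F u p k)) ->
  (forall k, char_sums mul (fun u p => G u p k)) ->
  forall k, char_sums mul (fun u p => (F u p * G u p) k).
Proof.
move=> cF cG k; pose H (j : 'I_k.+1) u p := F u p j * G u p (k - j)%N.
apply: (char_sums_ext (F := fun u p => \sum_(j <- index_enum 'I_k.+1) H j u p)) => [//|].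
by apply: char_sums_sum => j; apply: char_sums_mul.
Qed.

Lemma ser_char_mulmx (T P : Type) (mul : T -> T -> T) (F G : T -> P -> 'M[series K]_N) :
  (forall i j k, char_sums mul (fun u p => F u p i j k)) ->
  (forall i j k, char_sums mul (fun u p => G u p i j k)) ->
  forall i j k, char_sums mul (fun u p => (F u p *m G u p) i j k).
Proof.
move=> cF cG i j k; pose H (l : 'I_N) u p := (F u p i l * G u p l j) k.
apply: (char_sums_ext (F := fun u p => \sum_(l <- index_enum 'I_N) H l u p)) => [u p|].
  by rewrite mxE ser_sum.
by apply: char_sums_sum => l; apply: ser_char_mul.
Qed.

Lemma entry_sum_scale (J : Type) (r : seq J) (w : J -> series K) (A B : J -> 'M[series K]_N) i j :
  (\sum_(x <- r) w x *: (A x - B x)) i j = \sum_(x <- r) w x * (A x i j - B x i j).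
Proof. by rewrite summxE; apply: eq_bigr => x _; rewrite !mxE. Qed.

Lemma affine_combination (J : Type) (r : seq J) (w : J -> series K) (A : J -> 'M[series K]_N) B :
  \sum_(x <- r) w x = 1 ->
  \sum_(x <- r) w x *: A x - B = \sum_(x <- r) w x *: (A x - B).
Proof.
move=> w1; under [RHS]eq_bigr => x _ do rewrite scalerBr.
by rewrite sumrB -scaler_suml w1 scale1r.
Qed.

Lemma entryB A B i j : (A - B) i j = A i j - B i j.
Proof. by rewrite !mxE. Qed.

End ExistenceTools.

Section Existence.
Variables (K : closedFieldType) (T : Type) (mul : T -> T -> T) (one : T).
Hypotheses (mulA : associative mul) (mulC : commutative mul) (mul1 : left_id one mul).
Variables (N : nat) (G : 'M[K]_N -> Prop).
Hypotheses (G1 : G 1%:M) (GM : forall A B, G A -> G B -> G (A *m B)).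

(* Families of power series over T whose coefficients are of a restricted kind. *)
Variable gr : (T -> series K) -> Prop.
Hypotheses (gr_C : forall c, gr (fun=> serC c))
  (gr_D : forall F H, gr F -> gr H -> gr (fun t => F t + H t))
  (gr_M : forall F H, gr F -> gr H -> gr (fun t => F t * H t))
  (gr_shift : forall s F, gr F -> gr (fun t => F (mul s t)))
  (gr_limit : forall F, (forall k, exists H, gr H /\ forall t, ord_ge k (F t - H t)) -> gr F)
  (gr_char : forall F k, gr F -> char_sums mul (fun u (_ : unit) => F u k)).

Variables (rho ri : T -> 'M[K]_N) (ga gai : T -> 'M[series K]_N) (b : nat)
  (c : T -> T -> 'M[series K]_N).
Hypotheses (rhoM : forall s t, rho (mul s t) = rho s *m rho t)
  (rho_ri : forall s, rho s *m ri s = 1%:M)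
  (G_ri : forall s, G (ri s))
  (ri_char : forall i j, char_sums mul (fun u (_ : unit) => ri u i j)).
Hypotheses (ga_gai : forall t, ga t *m gai t = (serX ^+ b)%:M)
  (ga_char : forall i j k, char_sums mul (fun u (_ : unit) => ga u i j k))
  (cE : forall s t, serX ^+ b *: c s t = gai t *m ga (mul s t)).
Hypotheses (c_gr : forall s i j, gr (fun t => c s t i j))
  (c_G : forall s t p, group_ideal G p -> ev serC (mxcoord (c s t)) p = 0)
  (c_0 : forall s t, mx_cong 1 (c s t) (map_mx serC (rho s))).

Let char_shift (F : T -> K) : char_sums mul (fun u (_ : unit) => F u) ->
  char_sums mul (fun u t => F (mul u t)).
Proof.
move=> [I [chi [chiM cF]]]; exists I, chi; split=> // t; have [d dE] := cF tt.
by exists (fun i => d i * chi i t) => u; rewrite dE; apply: eq_bigr => i _; rewrite chiM; ring.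
Qed.

Let char_param (F : T -> K) : char_sums mul (fun u (_ : unit) => F u) ->
  char_sums mul (fun u (_ : T) => F u).
Proof.
by move=> [I [chi [chiM cF]]]; exists I, chi; split=> // t; have [d dE] := cF tt; exists d.
Qed.

Let gr_ev n (x : T -> 'I_n -> series K) p : (forall i, gr (fun t => x t i)) ->
  gr (fun t => ev serC (x t) p).
Proof.
move=> grx; elim/mpoly_ring_ind: p => [d|k|p q Ep Eq|p q Ep Eq].
- by rewrite (_ : (fun=> _) = fun=> serC d) //; apply/funext => t; rewrite evC.
- by rewrite (_ : (fun=> _) = fun t => x t k) //; apply/funext => t; rewrite evX.
- rewrite (_ : (fun=> _) = fun t => ev serC (x t) p + ev serC (x t) q); first exact: gr_D.
  by apply/funext => t; rewrite rmorphD.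
rewrite (_ : (fun=> _) = fun t => ev serC (x t) p * ev serC (x t) q); first exact: gr_M.
by apply/funext => t; rewrite rmorphM.
Qed.

Let gr_sum (J : Type) (r : seq J) (F : J -> T -> series K) : (forall j, gr (F j)) ->
  gr (fun t => \sum_(j <- r) F j t).
Proof.
move=> grF; elim: r => [|j r IH].
  rewrite (_ : (fun=> _) = fun=> serC 0) //; apply/funext => t; by rewrite big_nil rmorph0.
rewrite (_ : (fun=> _) = fun t => F j t + \sum_(j <- r) F j t); first exact: gr_D.
by apply/funext => t; rewrite big_cons.
Qed.

(** After inverting z the cocycle is the coboundary of [ga]: [gai] is z^b times its inverse, and
    [cE] reads c(s, t) = ga(t)^-1 ga(s t). *)
Let c_cocycle s t u : c s t *m c u (mul s t) = c (mul u s) t.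
Proof.
apply: (@scale_serX_inj K N b); apply: (@scale_serX_inj K N b).
have -> : serX ^+ b *: (serX ^+ b *: (c s t *m c u (mul s t))) =
    gai t *m ga (mul s t) *m (gai (mul s t) *m ga (mul u (mul s t))).
  by rewrite -!cE -scalemxAr -scalemxAl.
by rewrite mulmxA -[X in X *m _]mulmxA ga_gai mul_mx_scalar -scalemxAl mulA cE.
Qed.

Let ri_rho s : ri s *m rho s = 1%:M.
Proof. by apply: mulmx1C. Qed.

Let ri_mul s t : ri (mul s t) *m rho t = ri s.
Proof.
rewrite -[LHS]mulmx1 -(rho_ri s) mulmxA -[X in X *m _]mulmxA -rhoM (mulC t s) ri_rho.
by rewrite mul1mx.
Qed.

(** Modulo z^k, a change of trivialization with values in G, equal to 1 at z = 0, that turns the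
    cocycle [c] into the constant [rho]. *)
Definition equivariant_to k (ka : T -> 'M[series K]_N) :=
  [/\ forall i j, gr (fun t => ka t i j), forall t, mx_cong 1 (ka t) 1%:M,
      forall t p, group_ideal G p -> ord_ge k (ev serC (mxcoord (ka t)) p) &
      forall s t, mx_cong k (c s t *m ka (mul s t)) (ka t *m map_mx serC (rho s))].

(** A lift [kc] of [ka] to G modulo z^(k+2) is replaced by the average of its transforms [xi u], all
    of which agree with it modulo z^(k+1). The ideal of z^(k+1) has square zero modulo z^(k+2), so
    the lifts in G form an affine space and averages stay in G. *)
Let equivariant_step k ka : equivariant_to k.+1 ka ->
  exists2 kb, equivariant_to k.+2 kb & forall t, mx_cong k.+1 (kb t) (ka t).
Proof.
move=> [ka_gr ka1 kaG ka_eq].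
have [Psi PsiP] := group_lift G1 GM k.+1.
pose kc t := \matrix_(i, j) ev serC (mxcoord (ka t)) (Psi i j).
have kc_ka t : mx_cong k.+1 (kc t) (ka t).
  by have [] := PsiP (ka t) (ka1 t) (kaG t).
have kcG t p : group_ideal G p -> ord_ge k.+2 (ev serC (mxcoord (kc t)) p).
  by have [_] := PsiP (ka t) (ka1 t) (kaG t); apply.
have kc_gr i j : gr (fun t => kc t i j).
  rewrite (_ : (fun=> _) = fun t => ev serC (mxcoord (ka t)) (Psi i j)).
    by apply: gr_ev => l; elim/mxcoordP: l => i' j'; rewrite /= (_ : (fun=> _) = fun t => ka t i' j') //; apply/funext => t; rewrite mxcoordE.
  by apply/funext => t; rewrite mxE.
pose xi u t := c u t *m kc (mul u t) *m map_mx serC (ri u).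
have xi_kc u t : mx_cong k.+1 (xi u t) (kc t).
  apply: mx_cong_trans (mx_cong_sym (kc_ka t)).
  apply: (@mx_cong_trans _ _ _ _ (ka t *m map_mx serC (rho u) *m map_mx serC (ri u))).
    apply: mx_cong_mul; last exact: mx_cong_refl.
    apply: mx_cong_trans (ka_eq u t).
    by apply: mx_cong_mul; [exact: mx_cong_refl|exact: kc_ka].
  by rewrite -mulmxA -map_mxM rho_ri map_mx1 mulmx1; apply: mx_cong_refl.
have xiG u t p : group_ideal G p -> ord_ge k.+2 (ev serC (mxcoord (xi u t)) p).
  move: p; apply: (@group_point_mul K N G GM) => [|p Gp|p Gp]; first exact: ord_ge_ideal.
    move: p Gp; apply: (@group_point_mul K N G GM) => [|p Gp|p Gp]; first exact: ord_ge_ideal.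
      by rewrite c_G //; have [] := @ord_ge_ideal K k.+2.
    exact: kcG.
  rewrite (eq_ev _ (y := fun l => serC (mxcoord (ri u) l))) => [|l].
    by rewrite ev_serC_const Gp // rmorph0; have [] := @ord_ge_ideal K k.+2.
  by elim/mxcoordP: l => i j; rewrite !mxcoordE mxE.
(* The cocycle depends on [u] only through [ga (mul u t)], so the coefficients of z^b [xi] are
   combinations of characters of [u]; those of [xi] are read off b places further. *)
have xi_char : char_sums mul (fun u (q : T * ('I_N * 'I_N * 'I_k.+2)) => xi u q.1 q.2.1.1 q.2.1.2 q.2.2).
  apply: (char_sums_family (F := fun (q : 'I_N * 'I_N * 'I_k.+2) u t => xi u t q.1.1 q.1.2 q.2)).
  move=> [[i j] l] /=; pose Z u t := gai t *m ga (mul u t) *m kc (mul u t) *m map_mx serC (ri u).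
  have ZE u t : Z u t = serX ^+ b *: xi u t.
    by rewrite /xi !scalemxAl cE.
  apply: (char_sums_ext (F := fun u t => Z u t i j (l + b)%N)) => [u t|].
    by rewrite ZE mxE serXnM ltnNge leq_addl addnK.
  apply: ser_char_mulmx => {i j l} i j l.
    move: i j l; apply: ser_char_mulmx => i j l.
      move: i j l; apply: ser_char_mulmx => i j l.
        exact: char_sums_const.
      by apply: (char_shift (F := fun u => ga u i j l)); apply: ga_char.
    by apply: (char_shift (F := fun u => kc u i j l)); apply: (gr_char (F := fun t => kc t i j)).
  have [->|l0] := eqVneq l 0%N.
    apply: (char_sums_ext (F := fun u _ => ri u i j)) => [u t|]; last exact: char_param.
    by rewrite mxE serCE.
  apply: (char_sums_ext (F := fun u _ => 0)) => [u t|]; last exact: char_sums_const.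
  by rewrite mxE serCE (negPf l0).
have [W [W1 Wavg]] := quadrature mul1 xi_char.
have serW1 : \sum_(x <- W) serC x.1 = 1 :> series K by rewrite -rmorph_sum W1 rmorph1.
pose kb t := \sum_(x <- W) serC x.1 *: xi x.2 t.
have [I0 ID IM] := @ord_ge_ideal K k.+1; have [J0 JD JM] := @ord_ge_ideal K k.+2.
have kb_kc t i j : kb t i j - kc t i j =
    \sum_(x <- W) serC x.1 * (xi x.2 t i j - kc t i j).
  by rewrite -entryB affine_combination // entry_sum_scale.
have kb_cong t : mx_cong k.+1 (kb t) (kc t).
  move=> i j; rewrite kb_kc; apply: (ideal_sum _ (@ord_ge_ideal K k.+1)) => x _.
  by apply: IM; apply: xi_kc.
have kb_ka t : mx_cong k.+1 (kb t) (ka t) by apply: mx_cong_trans (kb_cong t) (kc_ka t).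
exists kb; last exact: kb_ka.
split=> [i j|t|t p Gp|s t].
- rewrite (_ : (fun=> _) = fun t => \sum_(x <- W) serC x.1 * xi x.2 t i j); last first.
    by apply/funext => t; rewrite summxE; apply: eq_bigr => x _; rewrite mxE.
  apply: gr_sum => x; apply: gr_M => //.
  rewrite (_ : (fun=> _) = fun t => \sum_(l <- index_enum 'I_N) (\sum_(m <- index_enum 'I_N) c x.2 t i m * kc (mul x.2 t) m l) * serC (ri x.2 l j)); last first.
    by apply/funext => t; rewrite mxE; apply: eq_bigr => l _; rewrite !mxE.
  apply: gr_sum => l; apply: gr_M => //; apply: gr_sum => m; apply: gr_M => //.
  exact: (gr_shift _ (F := fun t => kc t m l)).
- by apply: mx_cong_trans (ka1 t); apply: mx_cong_le (kb_ka t).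
(* To first order at [kc t] the equations of G are affine in the difference, hence stable under
   affine combinations. *)
- pose h (A : 'M[series K]_N) l := mxcoord A l - mxcoord (kc t) l.
  have taylor A : mx_cong k.+1 A (kc t) -> ord_ge k.+2 (ev serC (mxcoord A) p -
      ev serC (mxcoord (kc t)) p - \sum_l ev serC (mxcoord (kc t)) (mderiv l p) * h A l).
    move=> Akc; rewrite (eq_ev _ (y := fun l => mxcoord (kc t) l + h A l)) => [|l].
      apply: (@ideal_taylor _ _ serC _ (ord_ge k.+1) (ord_ge k.+2)) => [|||l]; try exact: ord_ge_ideal.
        move=> x y xk yk; apply: (@ord_ge_le _ _ (k.+1 + k.+1)); first by rewrite addSnnS leq_addl.
        exact: ord_geM.
      exact: mx_cong_coord.
    by rewrite /h addrC subrK.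
  have hkb l : h (kb t) l = \sum_(x <- W) serC x.1 * h (xi x.2 t) l.
    rewrite /h; elim/mxcoordP: l => i j; rewrite !mxcoordE.
    by rewrite kb_kc; apply: eq_bigr => x _; rewrite !mxcoordE.
  have D_J A : mx_cong k.+1 A (kc t) -> ord_ge k.+2 (ev serC (mxcoord A) p) ->
      ord_ge k.+2 (\sum_l ev serC (mxcoord (kc t)) (mderiv l p) * h A l).
    move=> Akc AG; apply: (ideal_congl (@ord_ge_ideal K k.+2) (y := ev serC (mxcoord A) p - ev serC (mxcoord (kc t)) p)).
      by rewrite -opprB; apply: (idealN (@ord_ge_ideal K k.+2)); apply: taylor.
    by apply: (idealB (@ord_ge_ideal K k.+2)) => //; apply: kcG.
  apply: (ideal_congl (@ord_ge_ideal K k.+2) (y := ev serC (mxcoord (kc t)) p)); last exact: kcG.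
  apply: (ideal_congl (@ord_ge_ideal K k.+2) (taylor _ (kb_cong t))).
  under eq_bigr => l _ do rewrite hkb mulr_sumr.
  rewrite exchange_big /=; apply: (ideal_sum _ (@ord_ge_ideal K k.+2)) => x _.
  under eq_bigr => l _ do rewrite mulrCA.
  by rewrite -mulr_sumr; apply: JM; apply: D_J; [exact: xi_kc|exact: xiG].
(* The defect of equivariance of [kb] is the difference of two averages of [xi], one of them
   translated by [s]; the choice of [W] makes its coefficients of index at most k + 1 vanish. *)
pose D := \sum_(x <- W) serC x.1 *: (xi (mul x.2 s) t - xi x.2 t).
have c_xi u : c s t *m xi u (mul s t) = xi (mul u s) t *m map_mx serC (rho s).
  rewrite /xi !mulmxA c_cocycle mulA -!mulmxA; congr (_ *m (_ *m _)).
  by rewrite -map_mxM ri_mul.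
have DE : c s t *m kb (mul s t) - kb t *m map_mx serC (rho s) = D *m map_mx serC (rho s).
  rewrite mulmx_sumr mulmx_suml -sumrB /D mulmx_suml; apply: eq_bigr => x _.
  by rewrite -!scalemxAr -!scalemxAl c_xi mulmxBl scalerBr.
have D0 : mx_cong k.+2 D 0.
  move=> i j l lk; rewrite [X in _ - X]mxE subr0 entry_sum_scale ser_sum.
  under eq_bigr => x _ do rewrite serCM serB mulrBr.
  rewrite sumrB; have /= -> := Wavg s (t, (i, j, Ordinal lk)).
  by rewrite subrr.
move=> i j; rewrite -entryB DE.
have := mx_cong_mul D0 (@mx_cong_refl K N k.+2 (map_mx serC (rho s))).
by move=> /(_ i j); rewrite mul0mx [X in _ - X]mxE subr0.
Qed.

Lemma equivariant_trivialization : exists ka : T -> 'M[series K]_N,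
  [/\ forall i j, gr (fun t => ka t i j),
      forall t p, group_ideal G p -> ev serC (mxcoord (ka t)) p = 0 &
      forall s t, c s t *m ka (mul s t) = ka t *m map_mx serC (rho s)].
Proof.
have one_P : equivariant_to 1 (fun=> 1%:M).
  split=> [i j|t|t p Gp|s t].
  - by rewrite mxE; have := gr_C ((i == j)%:R); rewrite rmorph_nat.
  - exact: mx_cong_refl.
  - rewrite (eq_ev _ (y := fun l => serC (mxcoord (1%:M : 'M[K]_N) l))) => [|l].
      by rewrite ev_serC_const Gp // rmorph0; have [] := @ord_ge_ideal K 1.
    by elim/mxcoordP: l => i j; rewrite !mxcoordE !mxE rmorph_nat.
  by rewrite mulmx1 mul1mx; apply: c_0.
have [next nextP] : exists next : nat -> (T -> 'M[series K]_N) -> (T -> 'M[series K]_N),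
    forall k ka, equivariant_to k.+1 ka ->
      equivariant_to k.+2 (next k ka) /\ forall t, mx_cong k.+1 (next k ka t) (ka t).
  have /choice[F FP] : forall q : nat * (T -> 'M[series K]_N), exists kb, equivariant_to q.1.+1 q.2 ->
      equivariant_to q.1.+2 kb /\ forall t, mx_cong q.1.+1 (kb t) (q.2 t).
    move=> [k ka] /=; have [/equivariant_step[kb]|nka] := pselect (equivariant_to k.+1 ka).
      by exists kb.
    by exists ka.
  by exists (fun k ka => F (k, ka)) => k ka; apply: (FP (k, ka)).
pose f := fix f k := if k is k'.+1 then next k' (f k') else fun=> 1%:M.
have fP k : equivariant_to k.+1 (f k).
  by elim: k => [//|k IH]; have [] := nextP k _ IH.
have f_step k t i j : ord_ge k (f k.+1 t i j - f k t i j).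
  by apply: (@ord_ge_le _ _ k.+1) => //; have [_] := nextP k _ (fP k); apply.
have /choice[L LP] : forall q : T * ('I_N * 'I_N), exists L, forall k, ord_ge k (L - f k q.1 q.2.1 q.2.2).
  by move=> [t [i j]] /=; apply: ser_limit => k; apply: f_step.
pose ka t := \matrix_(i, j) L (t, (i, j)).
have ka_f k t : mx_cong k (ka t) (f k t) by move=> i j; rewrite mxE; apply: (LP (t, (i, j))).
exists ka; split=> [i j|t p Gp|s t].
- apply: gr_limit => k; exists (fun t => f k t i j); split; first by have [] := fP k.
  by move=> t; apply: ka_f.
- apply: ord_ge_all => k; have [_ _ /(_ t p Gp) fG _] := fP k.
  apply: (ideal_congl (@ord_ge_ideal K k) (y := ev serC (mxcoord (f k t)) p)); last exact: (ord_ge_le (leqnSn k)).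
  by apply: (@ideal_ev_congr _ _ _ _ (ord_ge k)) => [|l]; [exact: ord_ge_ideal|exact: mx_cong_coord].
apply: mx_cong_all => k; have [_ _ _ /(_ s t) feq] := fP k.
apply: (mx_cong_trans (mx_cong_mul (@mx_cong_refl K N k _) (ka_f k _))).
apply: (mx_cong_trans (mx_cong_le (leqnSn k) feq)).
exact: (mx_cong_mul (mx_cong_sym (ka_f k t)) (@mx_cong_refl K N k _)).
Qed.

End Existence.

(** * Weighted degrees and graded families of power series *)

Section WeightedDegree.
Variables (l : nat) (lam : 'I_l -> nat).

Definition wdeg (m : 'X_{1..l}) : nat := (\sum_i m i * lam i)%N.

Lemma wdeg0 : wdeg 0%MM = 0%N.
Proof. by apply: big1 => i _; rewrite mnm0E mul0n. Qed.

Lemma wdegD : {morph wdeg : m1 m2 / (m1 + m2)%MM >-> (m1 + m2)%N}.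
Proof.
by move=> m1 m2; rewrite /wdeg -big_split; apply: eq_bigr => i _; rewrite mnmDE mulnDl.
Qed.

Lemma wdeg1 i : wdeg U_(i)%MM = lam i.
Proof.
rewrite /wdeg (bigD1 i) //= mnm1E eqxx mul1n big1 ?addn0 // => j ji.
by rewrite mnm1E eq_sym (negPf ji).
Qed.

HB.instance Definition _ := isMeasure.Build l wdeg wdeg0 wdegD.

End WeightedDegree.

Section Graded.
Variables (K : closedFieldType) (T : Type) (mul : T -> T -> T).
Variables (l : nat) (lam : 'I_l -> nat) (o : T -> 'I_l -> K).
Hypothesis lam_gt0 : forall i, (0 < lam i)%N.
Hypothesis o_char : forall i, character mul (fun t => o t i).
Notation P := {mpoly K[l]}.
Notation whomog k := (k.-homog for (wdeg lam)).
Implicit Types (F H : T -> series K) (p : P).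

(* [t |-> F t] is a section over the formal arcs [t |-> z^lam o(t)]: the coefficient of
   z^k is a function of weight k in the coordinates of [o t]. *)
Definition graded F :=
  forall k, exists2 Q : P, Q \is whomog k & forall t, F t k = Q.@[o t].

Lemma graded_C c : graded (fun=> serC c).
Proof.
move=> [|k]; [exists c%:MP|exists 0] => [|t||t]; rewrite ?serCE ?mevalC ?meval0 ?dhomog0 //.
by rewrite -[c%:MP]mulr1 mul_mpolyC; apply: dhomogZ; apply: dhomog1.
Qed.

Lemma graded_D F H : graded F -> graded H -> graded (fun t => F t + H t).
Proof.
move=> gF gH k; have [Q Qk QE] := gF k; have [R Rk RE] := gH k.
by exists (Q + R) => [|t]; rewrite ?dhomogD // mevalD -QE -RE.
Qed.

Lemma graded_M F H : graded F -> graded H -> graded (fun t => F t * H t).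
Proof.
move=> gF gH k; have /choice[Q QP] : forall j, exists Q : P, Q \is whomog j /\ forall t, F t j = Q.@[o t].
  by move=> j; have [Q] := gF j; exists Q.
have /choice[R RP] : forall j, exists R : P, R \is whomog j /\ forall t, H t j = R.@[o t].
  by move=> j; have [R] := gH j; exists R.
exists (\sum_(j < k.+1) Q j * R (k - j)%N) => [|t].
  apply: rpred_sum => j _; have [Qj _] := QP j; have [Rj _] := RP (k - j)%N.
  by have := dhomogM Qj Rj; rewrite subnKC // leq_ord.
rewrite serM rmorph_sum; apply: eq_bigr => j _ /=; rewrite mevalM.
by have [_ ->] := QP j; have [_ ->] := RP (k - j)%N.
Qed.

Lemma graded_limit F : (forall k, exists H, graded H /\ forall t, ord_ge k (F t - H t)) -> graded F.
Proof.
move=> FH k; have [H [gH Hk]] := FH k.+1; have [Q Qk QE] := gH k; exists Q => // t.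
by rewrite -QE; apply/eqP; rewrite -subr_eq0; apply/eqP; apply: Hk.
Qed.

Let o_mul s t i : o (mul s t) i = o s i * o t i.
Proof. exact: o_char. Qed.

Let homog_scale k p (a : 'I_l -> K) : p \is whomog k ->
  exists2 Q : P, Q \is whomog k & forall x, Q.@[x] = p.@[fun i => a i * x i].
Proof.
move=> pk; exists (\sum_(m <- msupp p) (p@_m * \prod_i a i ^+ m i) *: 'X_[m]) => [|x].
  rewrite big_seq; apply: rpred_sum => m mp; apply: dhomogZ; rewrite dhomogX; exact/eqP/(dhomogP _ _ _ pk).
rewrite [in RHS](mpolyE p) !rmorph_sum; apply: eq_bigr => m _ /=.
rewrite !mevalZ !mevalX -mulrA; congr (_ * _); rewrite -big_split.
by apply: eq_bigr => i _; rewrite exprMn.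
Qed.

Lemma graded_shift s F : graded F -> graded (fun t => F (mul s t)).
Proof.
move=> gF k; have [p pk pE] := gF k; have [Q Qk QE] := homog_scale (o s) pk.
exists Q => // t; rewrite QE pE; apply: meval_eq => i; exact: o_mul.
Qed.

Lemma graded_char F k : graded F -> char_sums mul (fun u (_ : unit) => F u k).
Proof.
move=> gF; have [p _ pE] := gF k.
exists 'I_(size (msupp p)), (fun (j : 'I__) u => \prod_i o u i ^+ (nth 0%MM (msupp p) j) i).
split=> [j s t|_].
  by rewrite -big_split; apply: eq_bigr => i _; rewrite o_mul exprMn.
exists (fun j : 'I__ => p@_(nth 0%MM (msupp p) j)) => u; rewrite pE [in LHS](mpolyE p) rmorph_sum /=.
rewrite (big_nth 0%MM) big_mkord; apply: eq_bigr => j _.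
by rewrite mevalZ mevalX.
Qed.

Definition weight_arc t i : series K := serX ^+ lam i * serC (o t i).

Lemma graded_arc i : graded (fun t => weight_arc t i).
Proof.
move=> k; have [<-|kl] := eqVneq (lam i) k.
  exists 'X_i => [|t]; last by rewrite mevalXU /weight_arc serXnM ltnn subnn serCE.
  by rewrite dhomogX; apply/eqP; apply: wdeg1.
exists 0 => [|t]; first exact: dhomog0.
rewrite meval0 /weight_arc serXnM; case: ltnP => // lk; rewrite serCE.
by rewrite subn_eq0 leqNgt ltn_neqAle kl lk.
Qed.

Lemma ev_arc k p t : p \is whomog k -> ev serC (weight_arc t) p = serX ^+ k * serC (p.@[o t]).
Proof.
move=> pk; rewrite mevalE [serC _]rmorph_sum mulr_sumr [in LHS](mpolyE p) rmorph_sum.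
apply: eq_big_seq => m mp; rewrite [LHS]evZ evXm [serC (_ * _)]rmorphM mulrCA [serC (\prod_i _)]rmorph_prod.
congr (_ * _).
rewrite -(dhomogP _ _ _ pk _ mp) -prodrXr -big_split; apply: eq_bigr => i _.
by rewrite [serC (_ ^+ _)]rmorphXn /weight_arc exprMn -exprM [(lam i * _)%N]mulnC.
Qed.

(** A form of weight j evaluated on the arc is z^j times its value at [o t], so the sum of the first
    coefficients is one polynomial that follows the whole family up to order k. *)
Lemma graded_trunc F k : graded F ->
  exists X : P, forall t, ord_ge k (F t - ev serC (weight_arc t) X).
Proof.
move=> gF; have /choice[Q QP] : forall j, exists Q : P, Q \is whomog j /\ forall t, F t j = Q.@[o t].
  by move=> j; have [Q] := gF j; exists Q.
exists (\sum_(j < k) Q j) => t j jk; rewrite serB rmorph_sum ser_sum /=.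
rewrite (bigD1 (Ordinal jk)) //= big1 ?addr0 => [|i ij].
  have [Qj ->] := QP j; rewrite (ev_arc _ Qj) serXnM ltnn subnn serCE.
  by rewrite mulr1n subrr.
have [Qi _] := QP i; rewrite (ev_arc _ Qi) serXnM; case: ltnP => // le_ij.
rewrite serCE subn_eq0 leqNgt ltn_neqAle le_ij andbT.
by rewrite (_ : (i : nat) != j) //; apply: contra ij => /eqP ij; apply/eqP/val_inj.
Qed.

(** The components of low weight vanish at all [o t]. [L] exceeds every weight, so a monomial of
    weight at least d L has degree at least d. *)
Lemma arc_vanishing d : exists k, forall p, (forall t, ord_ge k (ev serC (weight_arc t) p)) ->
  exists2 e, ideal_pow (fun i => 'X_i : P) d e & forall t, (p - e).@[o t] = 0.
Proof.
pose L := (\sum_i lam i).+1; exists (d * L)%N => p pk.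
pose N := mmeasure (wdeg lam) p.
have pE : p = \sum_(j < N) pihomog (wdeg lam) j p by apply: pihomog_partitionE.
have p0 j t : (j < d * L)%N -> (pihomog (wdeg lam) j p).@[o t] = 0.
  move=> jd; have := pk t j jd; rewrite {1}pE rmorph_sum ser_sum /=.
  have E i : ev serC (weight_arc t) (pihomog (wdeg lam) i p) j = (pihomog (wdeg lam) i p).@[o t] *+ (i == j).
    rewrite (ev_arc _ (pihomogP _ _ _)) serXnM; case: ltngtP => [//|ij|->].
      by rewrite serCE subn_eq0 leqNgt ij.
    by rewrite subnn serCE.
  under eq_bigr => i _ do rewrite E.
  case: (ltnP j N) => [jN|Nj].
    rewrite (bigD1 (Ordinal jN)) //= eqxx big1 ?addr0 // => i ij.
    by rewrite (_ : (i : nat) == j = false) //; apply: contraNF ij => /eqP ij; apply/eqP/val_inj.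
  move=> _; rewrite pihomogE big_seq_cond big1 ?meval0 // => m /andP[mp /eqP mj].
  by have := mmeasure_mnm_lt (wdeg lam) mp; rewrite ltnNge mj -/N Nj.
exists (\sum_(j < N | (d * L <= j)%N) pihomog (wdeg lam) j p) => [|t].
  apply: (ideal_sum _ (ideal_pow_ideal _ _)) => j dj.
  rewrite [pihomog _ _ _]mpolyE big_seq; apply: (ideal_sum _ (ideal_pow_ideal _ _)) => m mp.
  rewrite -mul_mpolyC; apply: ideal_powMl; rewrite mpolyXE_id.
  apply: (ideal_pow_le _ (ideal_pow_monomial _ m)).
  have mw : wdeg lam m = j := dhomogP _ _ _ (pihomogP (wdeg lam) j p) m mp.
  have mL : (wdeg lam m <= mdeg m * L)%N.
    rewrite mdegE big_distrl /=; apply: leq_sum => i _; rewrite leq_mul2l /L.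
    by rewrite (bigD1 i) //= ltnW ?orbT // ltnS leq_addr.
  by rewrite -(leq_pmul2r (ltn0Sn (\sum_i lam i))) (leq_trans dj) // -mw.
rewrite {1}pE (bigID (fun j : 'I_N => (d * L <= j)%N)) /= addrAC subrr add0r.
rewrite [LHS]rmorph_sum; apply: big1 => j; rewrite -ltnNge => jd; exact: p0.
Qed.

Lemma graded_sum (J : Type) (r : seq J) (F : J -> T -> series K) : (forall j, graded (F j)) ->
  graded (fun t => \sum_(j <- r) F j t).
Proof.
move=> grF; elim: r => [|j r IH].
  rewrite (_ : (fun=> _) = fun=> serC 0); first exact: graded_C.
  by apply/funext => t; rewrite big_nil rmorph0.
rewrite (_ : (fun=> _) = fun t => F j t + \sum_(j <- r) F j t); first exact: graded_D.
by apply/funext => t; rewrite big_cons.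
Qed.

Lemma graded_N F : graded F -> graded (fun t => - F t).
Proof.
move=> gF; rewrite (_ : (fun=> _) = fun t => serC (-1) * F t).
  by apply: graded_M => //; apply: graded_C.
by apply/funext => t; rewrite rmorphN1 mulN1r.
Qed.

Lemma graded_ev n (x : T -> 'I_n -> series K) (p : {mpoly K[n]}) : (forall i, graded (fun t => x t i)) ->
  graded (fun t => ev serC (x t) p).
Proof.
move=> grx; elim/mpoly_ring_ind: p => [d|k|p q Ep Eq|p q Ep Eq].
- rewrite (_ : (fun=> _) = fun=> serC d); first exact: graded_C.
  by apply/funext => t; rewrite evC.
- by rewrite (_ : (fun=> _) = fun t => x t k) //; apply/funext => t; rewrite evX.
- rewrite (_ : (fun=> _) = fun t => ev serC (x t) p + ev serC (x t) q); first exact: graded_D.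
  by apply/funext => t; rewrite rmorphD.
rewrite (_ : (fun=> _) = fun t => ev serC (x t) p * ev serC (x t) q); first exact: graded_M.
by apply/funext => t; rewrite rmorphM.
Qed.

Lemma graded_inv F c : c != 0 -> (forall t, F t 0%N = c) -> graded F ->
  graded (fun t => ser_inv (F t)).
Proof.
move=> c0 Fc gF.
pose h t := 1 - serC c^-1 * F t.
have gh : graded h.
  apply: graded_D; first by have := graded_C 1; rewrite rmorph1.
  by apply/graded_N/graded_M => //; apply: graded_C.
have h1 t : ord_ge 1 (h t).
  by move=> [|//] _; rewrite /h serB ser1 serCM Fc mulVf // subrr.
have gX j : graded (fun t => h t ^+ j).
  elim: j => [|j IH]; first by have := graded_C 1; rewrite rmorph1.
  rewrite (_ : (fun=> _) = fun t => h t * h t ^+ j); first exact: graded_M.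
  by apply/funext => t; rewrite exprS.
apply: graded_limit => k; exists (fun t => serC c^-1 * \sum_(j <- iota 0 k) h t ^+ j); split.
  by apply: graded_M; [exact: graded_C|apply: graded_sum].
move=> t j jk; pose S := \sum_(j <- iota 0 k) h t ^+ j.
have -> : ser_inv (F t) - serC c^-1 * S = serC c^-1 * (ser_geom (h t) - S).
  by rewrite /ser_inv Fc mulrBr.
rewrite serCM serB (ser_geomE (h1 t) jk) /S.
by rewrite -(big_mkord xpredT (fun j => h t ^+ j)) /index_iota subn0 subrr mulr0.
Qed.

End Graded.

(** * Newton's method over power series *)

Section NewtonLifting.
Variables (K : closedFieldType) (m n : nat) (g : 'I_n -> {mpoly K[m + n]}).

Definition join_coord (A : Type) (x : 'I_m -> A) (y : 'I_n -> A) (k : 'I_(m + n)) : A :=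
  match fintype.split k with inl i => x i | inr j => y j end.

Lemma join_coordl (A : Type) (x : 'I_m -> A) (y : 'I_n -> A) i : join_coord x y (lshift n i) = x i.
Proof. by rewrite /join_coord (unsplitK (inl i)). Qed.

Lemma join_coordr (A : Type) (x : 'I_m -> A) (y : 'I_n -> A) j : join_coord x y (rshift m j) = y j.
Proof. by rewrite /join_coord (unsplitK (inr j)). Qed.

Lemma join_coordP (P : 'I_(m + n) -> Prop) : (forall i, P (lshift n i)) ->
  (forall j, P (rshift m j)) -> forall k, P k.
Proof. by move=> Pl Pr k; rewrite -(splitK k); case: (fintype.split k). Qed.

Variables (x0 : 'I_m -> K) (y0 : 'I_n -> K).
Hypothesis g0 : forall i, (g i).@[join_coord x0 y0] = 0.
Let J0 : 'M[K]_n := \matrix_(i, j) (mderiv (rshift m j) (g i)).@[join_coord x0 y0].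
Hypothesis J0_unit : J0 \in unitmx.

(* Newton iteration with the constant matrix J0^-1, which keeps the families graded. *)
Variables (T : Type) (gr : (T -> series K) -> Prop).
Hypotheses (gr_C : forall c, gr (fun=> serC c))
  (gr_D : forall F H, gr F -> gr H -> gr (fun t => F t + H t))
  (gr_M : forall F H, gr F -> gr H -> gr (fun t => F t * H t))
  (gr_N : forall F, gr F -> gr (fun t => - F t))
  (gr_sum : forall (r : seq 'I_n) (F : 'I_n -> T -> series K), (forall j, gr (F j)) ->
     gr (fun t => \sum_(j <- r) F j t))
  (gr_ev : forall (x : T -> 'I_(m + n) -> series K) p, (forall i, gr (fun t => x t i)) ->
     gr (fun t => ev serC (x t) p))
  (gr_limit : forall F, (forall k, exists H, gr H /\ forall t, ord_ge k (F t - H t)) -> gr F).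

(** [J0] agrees with the Jacobian along the iterates only to order 1, so each step gains one power
    of z, which is enough for convergence. *)
Lemma newton_lifting (x : T -> 'I_m -> series K) : (forall i, gr (fun t => x t i)) ->
  (forall t i, ord_ge 1 (x t i - serC (x0 i))) ->
  exists y : T -> 'I_n -> series K, [/\ forall j, gr (fun t => y t j),
    forall t j, ord_ge 1 (y t j - serC (y0 j)) &
    forall t i, ev serC (join_coord (x t) (y t)) (g i) = 0].
Proof.
move=> grx x1; pose val y t i := ev serC (join_coord (x t) (y t)) (g i).
pose next (y : T -> 'I_n -> series K) t j := y t j - \sum_i serC (invmx J0 j i) * val y t i.
pose Y k := iter k next (fun _ j => serC (y0 j)).
have gr_join y : (forall j, gr (fun t => y t j)) -> forall i, gr (fun t => join_coord (x t) (y t) i).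
  move=> gry; elim/join_coordP => [i|j].
    by rewrite (_ : (fun=> _) = fun t => x t i) //; apply/funext => t; rewrite join_coordl.
  by rewrite (_ : (fun=> _) = fun t => y t j) //; apply/funext => t; rewrite join_coordr.
have grY k j : gr (fun t => Y k t j).
  elim: k j => [|k IH] j; first exact: gr_C.
  apply: gr_D => //; apply: gr_N; apply: gr_sum => i; apply: gr_M => //.
  by apply: gr_ev; apply: gr_join.
have ord1_join y t : (forall j, ord_ge 1 (y t j - serC (y0 j))) ->
    forall k, ord_ge 1 (join_coord (x t) (y t) k - serC (join_coord x0 y0 k)).
  by move=> y1; elim/join_coordP => [i|j]; rewrite ?join_coordl ?join_coordr.
have ev1 y t p : (forall j, ord_ge 1 (y t j - serC (y0 j))) ->
    ord_ge 1 (ev serC (join_coord (x t) (y t)) p - serC (p.@[join_coord x0 y0])).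
  move=> y1; rewrite -ev_serC_const; apply: (@ideal_ev_congr _ _ _ _ (ord_ge 1)).
    exact: ord_ge_ideal.
  exact: ord1_join.
have step k t : (forall j, ord_ge 1 (Y k t j - serC (y0 j))) /\ forall i, ord_ge k.+1 (val (Y k) t i).
  elim: k => [|k [IH1 IHg]].
    have y1 j : ord_ge 1 (Y 0%N t j - serC (y0 j)) by rewrite subrr; have [] := @ord_ge_ideal K 1.
    split=> // i; apply: (ideal_congl (@ord_ge_ideal K 1) (ev1 _ _ _ y1)).
    by rewrite g0 rmorph0; have [] := @ord_ge_ideal K 1.
  have [I0 ID IM] := @ord_ge_ideal K k.+1.
  pose h j := - \sum_i serC (invmx J0 j i) * val (Y k) t i.
  have hk j : ord_ge k.+1 (h j).
    apply/(idealN (@ord_ge_ideal K k.+1))/(ideal_sum _ (@ord_ge_ideal K k.+1)) => i _.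
    exact: IM.
  have YS j : Y k.+1 t j = Y k t j + h j by [].
  have y1 j : ord_ge 1 (Y k.+1 t j - serC (y0 j)).
    rewrite YS addrAC; have [_ D1 _] := @ord_ge_ideal K 1; apply: D1 => //.
    exact: (ord_ge_le (ltn0Sn k)).
  split=> // i.
  have hjoin u : ord_ge k.+1 (join_coord (fun=> 0) h u : series K).
    by elim/join_coordP: u => u; rewrite ?join_coordl ?join_coordr.
  have ordM a1 a2 : ord_ge k.+1 a1 -> ord_ge k.+1 a2 -> ord_ge k.+2 (a1 * a2 : series K).
    move=> o1 o2; apply: (@ord_ge_le _ _ (k.+1 + k.+1)); first by rewrite addSnnS leq_addl.
    exact: ord_geM.
  have := @ideal_taylor _ _ serC _ (ord_ge k.+1) (ord_ge k.+2) (join_coord (x t) (Y k t))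
    (join_coord (fun=> 0) h) (g i) (@ord_ge_ideal K _) (@ord_ge_ideal K _) ordM hjoin.
  have -> : ev serC (fun j => join_coord (x t) (Y k t) j + join_coord (fun=> 0) h j) (g i) = val (Y k.+1) t i.
    by apply: eq_ev; elim/join_coordP => u; rewrite ?join_coordl ?join_coordr ?addr0.
  rewrite -addrA -opprD => taylor; apply: (ideal_congl (@ord_ge_ideal K k.+2) taylor).
  rewrite big_split_ord /= big1 ?add0r => [|u _]; last by rewrite join_coordl mulr0.
  have -> : ev serC (join_coord (x t) (Y k t)) (g i) = - \sum_j serC (J0 i j) * h j.
    rewrite -/(val (Y k) t i).
    rewrite (eq_bigr (fun j => - \sum_u serC (J0 i j) * serC (invmx J0 j u) * val (Y k) t u)); last first.
      by move=> j _; rewrite mulrN mulr_sumr; under eq_bigr => u _ do rewrite mulrA.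
    rewrite sumrN opprK exchange_big /= (bigD1 i) //= -mulr_suml.
    have E u : \sum_j serC (J0 i j) * serC (invmx J0 j u) = serC ((i == u)%:R : K).
      have /matrixP/(_ i u) := mulmxV J0_unit; rewrite !mxE => <-; rewrite rmorph_sum.
      by apply: eq_bigr => j _; rewrite rmorphM.
    rewrite E eqxx rmorph1 mul1r big1 ?addr0 // => u ui.
    by rewrite -mulr_suml E eq_sym (negPf ui) rmorph0 mul0r.
  rewrite addrC -sumrB; apply: (ideal_sum _ (@ord_ge_ideal K k.+2)) => j _.
  rewrite join_coordr -mulrBl -add1n; apply: (@ord_geM _ 1 k.+1) => //.
  rewrite /J0 mxE; exact: ev1.
have Ystep k t j : ord_ge k (Y k.+1 t j - Y k t j).
  have [_ gk] := step k t; rewrite /Y /= -/(Y k) /next addrC addKr.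
  apply/(idealN (@ord_ge_ideal K k))/(ideal_sum _ (@ord_ge_ideal K k)) => i _.
  have [_ _ IM] := @ord_ge_ideal K k; apply: IM.
  by apply: (@ord_ge_le _ _ k.+1).
have /choice[L LP] : forall q : T * 'I_n, exists L, forall k, ord_ge k (L - Y k q.1 q.2).
  by move=> [t j] /=; apply: ser_limit => k; apply: Ystep.
exists (fun t j => L (t, j)); split=> [j|t j|t i].
- apply: gr_limit => k; exists (fun t => Y k t j); split; first exact: grY.
  by move=> t; apply: (LP (t, j)).
- by have := LP (t, j) 1%N; have [/(_ j) y1 _] := step 1%N t; move=> L1;
    rewrite -(subrK (Y 1%N t j) (L _)) -addrA; have [_ D1 _] := @ord_ge_ideal K 1; apply: D1.
apply: ord_ge_all => k; have [_ gk] := step k t.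
apply: (ideal_congl (@ord_ge_ideal K k) (y := val (Y k) t i)); last by apply: (@ord_ge_le _ _ k.+1).
apply: (@ideal_ev_congr _ _ _ _ (ord_ge k)); first exact: ord_ge_ideal.
elim/join_coordP => u; rewrite ?join_coordl ?join_coordr ?subrr; last exact: (LP (t, u)).
by have [] := @ord_ge_ideal K k.
Qed.

End NewtonLifting.

(** * From power series identities to polynomial ones *)

Section Descent.
Variables (K : closedFieldType) (n : nat) (u0 : 'I_n -> K).
Notation R := {mpoly K[n]}.
Let y (i : 'I_n) : R := 'X_i - (u0 i)%:MP.

Let vanish_pow1 (p : R) : p.@[u0] = 0 -> ideal_pow y 1 p.
Proof.
move=> p0; have := @ideal_ev_congr _ _ (@mpolyC n K) _ (ideal_pow y 1) (fun j => 'X_j)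
  (fun j => (u0 j)%:MP) p (ideal_pow_ideal _ _) (fun j => ideal_pow_var _ j).
rewrite -/(msub _ p) msub_id (_ : ev _ _ _ = 0) ?subr0 //.
have := rmorph_ev (i := idfun) (j := @mpolyC n K) (f := @mpolyC n K) u0 p (fun=> erefl).
by rewrite -[ev idfun u0 p]/(p.@[u0]) p0 rmorph0.
Qed.

Let pow_msub l (S : 'I_l -> R) k (e : {mpoly K[l]}) : (forall i, (S i).@[u0] = 0) ->
  ideal_pow (fun i => 'X_i) k e -> ideal_pow y k (msub S e).
Proof.
move=> S0; elim: k e => [|k IH] e; first by move=> _; apply: ideal_pow0.
move=> /ideal_powS[p [pk ->]]; rewrite rmorph_sum.
apply: (ideal_sum _ (ideal_pow_ideal _ _)) => j _; rewrite rmorphM /= {1}/msub evX.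
by apply: (@ideal_powM _ _ _ 1 k); [exact: vanish_pow1|exact: IH].
Qed.

Variables (T : Type) (l : nat) (lam : 'I_l -> nat) (o : T -> 'I_l -> K) (t0 : T).
Hypothesis lam_gt0 : forall i, (0 < lam i)%N.
Variables (W : Type) (c : W -> 'I_n -> K) (S : 'I_l -> R).
Hypothesis S0 : forall i, (S i).@[u0] = 0.
Hypothesis S_closure : forall p : {mpoly K[l]}, (forall t, p.@[o t] = 0) ->
  forall e, p.@[fun i => (S i).@[c e]] = 0.
Variables (m : nat) (xi : T -> 'I_m -> series K) (x0 : 'I_m -> K).
Hypotheses (xi_graded : forall i, graded lam o (fun t => xi t i))
  (xi0 : forall t i, xi t i 0%N = x0 i).

(* On W, [a / b] is the value of [P / Q] at the formal arcs [xi]; Krull's theorem makes it a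
   quotient of polynomials that is defined at [u0]. *)
Lemma descent (a b d : R) (P Q : {mpoly K[m + n]}) (J : finType)
    (v : J -> R) (F : J -> {mpoly K[m + l]}) :
  Q.@[join_coord x0 u0] != 0 ->
  (forall e x, d.@[c e] * (a.@[c e] * Q.@[join_coord x (c e)] - b.@[c e] * P.@[join_coord x (c e)]) =
     \sum_j (v j).@[c e] * (F j).@[join_coord x (fun i => (S i).@[c e])]) ->
  (forall t j, ev serC (join_coord (xi t) (weight_arc lam o t)) (F j) = 0) ->
  exists q r : R, q.@[u0] != 0 /\
    forall e, q.@[c e] * (d.@[c e] * a.@[c e]) = r.@[c e] * (d.@[c e] * b.@[c e]).
Proof.
move=> Q0 dF Fxi.
(* The ideal generated by [d * b] and by the polynomials vanishing on [W]; for Krull's theorem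
   [d * a] has to lie, modulo this ideal, in every power of the ideal of [u0]. *)
pose Jd (f : R) := exists r : R, forall e, f.@[c e] = r.@[c e] * (d.@[c e] * b.@[c e]).
have iJ : ideal Jd.
  split=> [|p q [r rE] [s sE]|p q [r rE]].
  - by exists 0 => e; rewrite !meval0; ring.
  - by exists (r + s) => e; rewrite !mevalD rE sE; ring.
  - by exists (p * r) => e; rewrite mevalM rE mevalM; ring.
have : forall k, exists2 mu, ideal_pow y k mu & Jd (d * a - mu).
  move=> N; have [M MP] := @arc_vanishing K T l lam o N.
  have /choice[X XP] : forall i, exists X : {mpoly K[l]}, forall t, ord_ge M.+1 (xi t i - ev serC (weight_arc lam o t) X).
    by move=> i; apply: graded_trunc.
  (* Truncating the arcs makes the relations [F j] polynomials in the weighted coordinates alone; by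
     [arc_vanishing] they agree at the points [o t] with elements [h j] of the N-th power of the
     maximal ideal. *)
  pose H j : {mpoly K[l]} := msub (join_coord X (fun i => 'X_i)) (F j).
  have Hk j t : ord_ge M.+1 (ev serC (weight_arc lam o t) (H j)).
    rewrite /H ev_msub -[ev _ _ _]subr0 -(Fxi t j).
    apply: (@ideal_ev_congr _ _ _ _ (ord_ge M.+1)); first exact: ord_ge_ideal.
    elim/join_coordP => i; rewrite !(join_coordl, join_coordr).
      by rewrite -opprB; apply: (idealN (@ord_ge_ideal K M.+1)); apply: XP.
    by rewrite evX subrr; have [] := @ord_ge_ideal K M.+1.
  have /choice[h hP] : forall j, exists h, ideal_pow (fun i => 'X_i : {mpoly K[l]}) N h /\ forall t, (H j - h).@[o t] = 0.
    by move=> j; have [h] := MP (H j) (fun t => ord_ge_le (leqnSn M) (Hk j t)); exists h.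
  have Hh j e : (F j).@[join_coord (fun i => (X i).@[fun i => (S i).@[c e]]) (fun i => (S i).@[c e])] =
      (msub S (h j)).@[c e].
    have [_ /S_closure/(_ e)/eqP] := hP j; rewrite mevalB subr_eq0 => /eqP E.
    rewrite meval_msub -E /H meval_msub; apply: meval_eq.
    by elim/join_coordP => i; rewrite ?join_coordl ?join_coordr ?mevalXU.
  pose sub (G : {mpoly K[m + n]}) : R := msub (join_coord (fun i => msub S (X i)) (fun i => 'X_i)) G.
  have subE G e : (sub G).@[c e] = G.@[join_coord (fun i => (X i).@[fun i => (S i).@[c e]]) (c e)].
    rewrite /sub meval_msub; apply: meval_eq.
    by elim/join_coordP => i; rewrite ?join_coordl ?join_coordr ?mevalXU ?meval_msub.
  have X0 i : (X i).@[fun=> 0] = x0 i.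
    have := XP i t0 0%N isT; rewrite serB xi0 => /eqP; rewrite subr_eq0 => /eqP->.
    have := @ideal_ev_congr _ _ serC _ (ord_ge 1) (weight_arc lam o t0) (fun i => serC 0) (X i) (@ord_ge_ideal K 1).
    rewrite ev_serC_const => E; apply/esym/eqP; rewrite -subr_eq0; apply/eqP.
    have := E _ 0%N isT; rewrite serB serCE; apply=> j [|//] _.
    by rewrite rmorph0 subr0 /weight_arc serXnM lam_gt0.
  have sub0 G : (sub G).@[u0] = G.@[join_coord x0 u0].
    rewrite /sub meval_msub; apply: meval_eq.
    elim/join_coordP => i; rewrite ?join_coordl ?join_coordr ?mevalXU // meval_msub -X0.
    by apply: meval_eq => j; rewrite S0.
  (* [sub Q] is nonzero at [u0]; its inverse modulo the N-th power is a truncated geometric series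
     in [eta]. *)
  pose eps := Q.@[join_coord x0 u0]; pose eta := 1 - eps^-1%:MP * sub Q.
  have eta1 : ideal_pow y 1 eta.
    by apply: vanish_pow1; rewrite mevalB meval1 mevalM mevalC sub0 mulVf ?subrr.
  have etaN : ideal_pow y N (eta ^+ N).
    elim: N {MP h hP Hh} => [|N IH]; first exact: ideal_pow0.
    by rewrite exprS; apply: (@ideal_powM _ _ _ 1 N).
  pose U := eps^-1%:MP * \sum_(j < N) eta ^+ j.
  have UQ : U * sub Q = 1 - eta ^+ N.
    have -> : 1 - eta ^+ N = (1 - eta) * \sum_(j < N) eta ^+ j.
      rewrite -{1}(expr1n _ N) subrXX; congr (_ * _); apply: eq_bigr => j _.
      by rewrite expr1n mul1r.
    by rewrite /U /eta subKr mulrAC.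
  exists (d * a * eta ^+ N + U * \sum_j v j * msub S (h j)).
    have [_ iD _] := ideal_pow_ideal y N.
    apply: iD; first exact: ideal_powMl.
    apply: ideal_powMl; apply: (ideal_sum _ (ideal_pow_ideal _ _)) => j _.
    by apply: ideal_powMl; apply: pow_msub => //; have [] := hP j.
  exists (U * sub P) => e; have := dF e (fun i => (X i).@[fun i => (S i).@[c e]]).
  under [X in _ = X -> _]eq_bigr => j _ do rewrite Hh.
  rewrite -!subE => E.
  have -> : d * a - (d * a * eta ^+ N + U * \sum_j v j * msub S (h j)) =
      d * a * (U * sub Q) - U * \sum_j v j * msub S (h j) by rewrite UQ; ring.
  have sumE : (\sum_j v j * msub S (h j)).@[c e] = \sum_j (v j).@[c e] * (msub S (h j)).@[c e].
    by rewrite [LHS]rmorph_sum; apply: eq_bigr => j _; apply: mevalM.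
  have alg (A B C D V Z : K) : D * A * (V * B) - V * (D * (A * B - C * Z)) = V * Z * (D * C) by ring.
  by rewrite mevalB !mevalM sumE -E; apply: alg.
move=> /(krull_intersection (@mpoly_noetherian K n (@field_noetherian K)) iJ)[r0 r0y [r rE]].
exists (1 - r0), r; split=> [|e]; last by rewrite -rE !mevalM.
have : r0.@[u0] = 0.
  apply: (r0y (fun p => p.@[u0] = 0)) => [|p [i _ <-]].
    split=> [|p q p0 q0|p q q0]; rewrite ?meval0 ?mevalD ?mevalM ?p0 ?q0 ?addr0 ?mulr0 //.
  by rewrite /y mevalB mevalXU mevalC subrr.
by rewrite mevalB meval1 => ->; rewrite subr0 oner_neq0.
Qed.

End Descent.

(** * Charts of spaces with functions *)

Section Charts.
Variable K : closedFieldType.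
Implicit Types X Y : fspace K.

(* Polynomials in [c] describe the topology and the germs at the points of [U];
   the values of [c] off [U] are junk. *)
Definition chart X (U : set X) n (c : X -> 'I_n -> K) : Prop :=
  [/\ open U,
      forall x f, U x -> (regular_at x f <-> exists p q : {mpoly K[n]}, q.@[c x] != 0 /\
        forall y, U y -> q.@[c y] != 0 -> f y = p.@[c y] / q.@[c y]) &
      forall x (V : set X), U x -> (nbhs x V <-> exists2 q : {mpoly K[n]}, q.@[c x] != 0 &
        forall y, U y -> q.@[c y] != 0 -> V y)].

(** Zariski closedness of the image of [U], which together with [chart] makes [U] affine. *)
Definition closed_chart X (U : set X) n (c : X -> 'I_n -> K) : Prop :=
  forall w, (forall p : {mpoly K[n]}, (forall x, U x -> p.@[c x] = 0) -> p.@[w] = 0) ->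
    exists2 x, U x & c x = w.

Lemma affine_space_chart n :
  chart (setT : set (affine_space K n)) (fun (x : affine_space K n) i => (x : 'rV[K]_n) 0 i).
Proof.
have nbP (x : affine_space K n) (V : set (affine_space K n)) : nbhs x V <-> exists2 q : {mpoly K[n]},
    peval q x != 0 & forall y, peval q y != 0 -> V y.
  split=> [|[q qx qV]].
    rewrite nbhsE => -[O [[S ->] [p Sp px]] OV]; exists p => // y py.
    by apply: OV; exists p.
  rewrite nbhsE; exists [set y | peval q y != 0] => //; split=> //.
  by exists [set q]; apply/seteqP; split=> y /=; [exists q|move=> [_ ->]].
split=> [|x f _|x V _]; first exact: openT.
  split=> [[p [q [qx /nbP[h hx hf]]]]|[p [q [qx qf]]]].
    exists (p * h), (q * h); rewrite mevalM mulf_neq0 //; split=> // y _.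
    rewrite mevalM mulf_eq0 negb_or => /andP[qy hy].
    by rewrite hf // !mevalM -mulf_div divff // mulr1.
  by exists p, q; split=> //; apply/nbP; exists q; [exact: qx|exact: (fun y => qf y I)].
split=> [/nbP[q qx qV]|[q qx qV]]; first by exists q => [|y _]; [exact: qx|exact: qV].
by apply/nbP; exists q; [exact: qx|exact: (fun y => qV y I)].
Qed.

Lemma nbhs_sub_space X (S : set X) (s : set_type S) (V : set (set_type S)) :
  nbhs s V <-> exists2 O, nbhs (set_val s) O & forall t, O (set_val t) -> V t.
Proof.
split=> [|[O sO OV]]; last first.
  have : nbhs s (set_val @^-1` O) by apply: (@initial_continuous _ _ (set_val : set_type S -> X)).
  by apply: filterS => t; apply: OV.
rewrite {1}nbhsE => -[B [[O oO <-] Os] BV].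
by exists O => [|t Ot]; [exists O|apply: BV].
Qed.

Lemma sub_space_chart X (U S : set X) n (c : X -> 'I_n -> K) : chart U c ->
  chart (set_val @^-1` U : set (sub_space S)) (fun s : sub_space S => c (set_val s)).
Proof.
move=> [oU regU nbU]; split=> [|s f Us|s V Us]; first by exists U.
  split=> [[g [/(regU _ _ Us)[p [q [qs gE]]]]]|[p [q [qs fE]]]].
    move=> /nbhs_sub_space[O /(nbU _ _ Us)[h hs hO] fg].
    exists (p * h), (q * h); rewrite mevalM mulf_neq0 //; split=> // t Ut.
    rewrite mevalM mulf_eq0 negb_or => /andP[qt ht].
    by rewrite fg ?gE //; [rewrite !mevalM -mulf_div divff // mulr1|apply: hO].
  exists (fun y => p.@[c y] / q.@[c y]); split; first by apply/(regU _ _ Us); exists p, q.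
  apply/nbhs_sub_space; exists [set y | U y /\ q.@[c y] != 0]; last by move=> t [Ut qt]; apply: fE.
  by apply/(nbU _ _ Us); exists q.
split=> [/nbhs_sub_space[O /(nbU _ _ Us)[q qs qO] OV]|[q qs qV]].
  by exists q => // t Ut qt; apply/OV/qO.
apply/nbhs_sub_space; exists [set y | U y /\ q.@[c y] != 0]; last by move=> t [Ut qt]; apply: qV.
by apply/(nbU _ _ Us); exists q.
Qed.

Lemma isomorphism_chart X Y (phi : X -> Y) (U : set Y) n (c : Y -> 'I_n -> K) :
  isomorphism phi -> chart U c -> chart (phi @^-1` U) (c \o phi).
Proof.
move=> [[phic phir] [psi [[psic psir] phiK psiK]]] [oU regU nbU].
split=> [|x f Ux|x V Ux]; first by move/continuousP: phic; apply.
  split=> [xf|[p [q [qx qf]]]].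
    have : regular_at (phi x) (f \o psi) by apply: (psir (phi x) f); rewrite phiK.
    move=> /(regU _ _ Ux)[p [q [qx qf]]]; exists p, q; split=> // y Uy qy.
    by have := qf (phi y) Uy qy; rewrite /= phiK.
  have : regular_at (phi x) (f \o psi).
    by apply/(regU _ _ Ux); exists p, q; split=> // y Uy qy; rewrite /= qf /= ?psiK.
  move=> /phir; congr regular_at; apply/funext => y /=; by rewrite phiK.
split=> [xV|[q qx qV]].
  have : nbhs (phi x) (psi @^-1` V) by apply: (psic (phi x) V); rewrite phiK.
  move=> /(nbU _ _ Ux)[q qx qV]; exists q => // y Uy qy.
  by have := qV (phi y) Uy qy; rewrite /= phiK.
have : nbhs (phi x) (psi @^-1` V) by apply/(nbU _ _ Ux); exists q => // y Uy qy; apply: qV; rewrite /= psiK.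
move=> /(phic x) nV; apply: (@filterS _ (nbhs x) _ (phi @^-1` (psi @^-1` V))) nV => y.
by rewrite /= phiK.
Qed.

Definition extend_fun X (U : set X) n (c : set_type U -> 'I_n -> K) (x : X) : 'I_n -> K :=
  match pselect (U x) with left Ux => c (SigSub (mem_set Ux)) | right _ => fun=> 0 end.

Lemma extend_funE X (U : set X) n (c : set_type U -> 'I_n -> K) (u : set_type U) :
  extend_fun c (set_val u) = c u.
Proof.
rewrite /extend_fun; case: pselect => [Ux|[]]; last exact: set_valP.
by congr c; apply: val_inj.
Qed.

Lemma open_sub_chart X (U : set X) n (c : sub_space U -> 'I_n -> K) :
  open U -> chart setT c -> chart U (extend_fun c).
Proof.
move=> oU [_ regU nbU].
have lift x : U x -> exists u : set_type U, set_val u = x by move=> Ux; exists (SigSub (mem_set Ux)).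
split=> [//|_ f /lift[u <-]|_ V /lift[u <-]]; rewrite extend_funE.
  split=> [uf|[p [q [qu qf]]]].
    have /(regU u _ I)[p [q [qu qf]]] : @regular_at K (sub_space U) u (f \o set_val).
      exists f; split; first exact: uf.
      by apply/nbhs_sub_space; exists setT => //; apply: filterT.
    exists p, q; split=> // _ /lift[y <-]; rewrite extend_funE => qy; exact: qf.
  have /(regU u _ I)[g [gu /nbhs_sub_space[O uO Og]]] : exists p q : {mpoly K[n]}, q.@[c u] != 0 /\
      forall y, setT y -> q.@[c y] != 0 -> (f \o set_val) y = p.@[c y] / q.@[c y].
    by exists p, q; split=> // y _ qy; rewrite /= qf ?extend_funE //; apply: set_valP.
  apply: regular_at_local gu.
  have : nbhs (set_val u) U by apply: open_nbhs_nbhs; split=> //; apply: set_valP.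
  by apply: filterS2 uO => y Oy /lift[v vy]; move: Oy; rewrite -vy => /Og.
split=> [uV|[q qu qV]].
  have /(nbU u _ I)[q qu qV] : nbhs u (set_val @^-1` V : set (set_type U)).
    by apply/nbhs_sub_space; exists V.
  by exists q => // _ /lift[y <-]; rewrite extend_funE => qy; apply: qV.
have /(nbU u _ I)/nbhs_sub_space[O uO OV] : exists2 q : {mpoly K[n]}, q.@[c u] != 0 &
    forall y, setT y -> q.@[c y] != 0 -> (set_val @^-1` V) y.
  by exists q => // y _ qy; apply: qV; rewrite ?extend_funE //; apply: set_valP.
have : nbhs (set_val u) U by apply: open_nbhs_nbhs; split=> //; apply: set_valP.
by apply: filterS2 uO => y Oy /lift[v vy]; rewrite -vy; apply: OV; rewrite vy.
Qed.

Lemma affine_variety_chart X n (Z : set (affine_space K n)) (phi : X -> sub_space Z) :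
  closed Z -> isomorphism phi ->
  chart setT (fun x i => (set_val (phi x) : 'rV[K]_n) 0 i) /\
  closed_chart setT (fun x i => (set_val (phi x) : 'rV[K]_n) 0 i).
Proof.
move=> cZ iso; split.
  exact: (isomorphism_chart iso (sub_space_chart Z (affine_space_chart n))).
have [_ [psi [_ _ psiK]]] := iso.
move=> w wZ; pose w' : affine_space K n := \row_i w i.
have [Zw|nZw] := pselect (Z w').
  exists (psi (SigSub (mem_set Zw))) => //; apply/funext => i.
  by rewrite psiK /= mxE.
have : open (~` Z) by exact: closed_openC.
move=> [S ZS]; have : (~` Z) w' by [].
rewrite ZS => -[p Sp /eqP[]]; rewrite -[RHS](wZ p) => [|x _].
  by apply: meval_eq => i; rewrite mxE.
apply/eqP; have [//|px] := eqVneq (meval _ p) 0.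
have : (~` Z) (set_val (phi x)) by rewrite ZS; exists p.
by move=> []; apply: set_valP.
Qed.

Lemma prevariety_chart X (x : X) : prevariety X ->
  exists (U : set X) n (c : X -> 'I_n -> K), [/\ U x, chart U c & closed_chart U c].
Proof.
move=> [k [U [oU UT affU]]]; have [i _ Uix] : (\bigcup_i U i) x by rewrite UT.
have [n [Z [cZ [phi iso]]]] := affU i.
have [ch cl] := affine_variety_chart cZ iso.
pose c (u : set_type (U i)) j := (set_val (phi u) : 'rV[K]_n) 0 j.
exists (U i), n, (extend_fun c); split=> //; first exact: open_sub_chart.
move=> w wU; have [|u _ uw] := cl w.
  move=> p pU; apply: wU => y Uy; have := pU (SigSub (mem_set Uy)) I.
  by have := extend_funE c (SigSub (mem_set Uy)) => /= ->.
by exists (set_val u); [apply: set_valP|rewrite extend_funE].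
Qed.

End Charts.

Section LocalFractions.
Variables (K : closedFieldType) (X : Type) (U : set X) (n : nat) (c : X -> 'I_n -> K) (x : X).
Hypothesis Ux : U x.

Definition local_fraction (f : X -> K) := exists p q : {mpoly K[n]}, q.@[c x] != 0 /\
  forall y, U y -> q.@[c y] != 0 -> f y = p.@[c y] / q.@[c y].

Definition local_open (V : set X) :=
  exists2 q : {mpoly K[n]}, q.@[c x] != 0 & forall y, U y -> q.@[c y] != 0 -> V y.

Lemma local_openS V W : (forall y, V y -> W y) -> local_open V -> local_open W.
Proof. by move=> VW [q qx qV]; exists q => // y Uy qy; apply/VW/qV. Qed.

Lemma local_openI V W : local_open V -> local_open W -> local_open [set y | V y /\ W y].
Proof.
move=> [q qx qV] [h hx hW]; exists (q * h); rewrite ?mevalM ?mulf_neq0 // => y Uy.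
by rewrite mevalM mulf_eq0 negb_or => /andP[qy hy]; split; [apply: qV|apply: hW].
Qed.

Lemma local_fraction_eq f g V : local_open V -> (forall y, V y -> f y = g y) ->
  local_fraction f -> local_fraction g.
Proof.
move=> [h hx hV] fg [p [q [qx fE]]]; exists (p * h), (q * h).
rewrite mevalM mulf_neq0 //; split=> // y Uy.
rewrite mevalM mulf_eq0 negb_or => /andP[qy hy]; rewrite -fg; last exact: hV.
by rewrite fE // !mevalM -mulf_div divff // mulr1.
Qed.

Lemma local_fraction_poly (p : {mpoly K[n]}) : local_fraction (fun y => p.@[c y]).
Proof. by exists p, 1; rewrite meval1 oner_neq0; split=> // y _ _; rewrite meval1 divr1. Qed.

Lemma local_fractionC a : local_fraction (fun=> a).
Proof.
exists a%:MP, 1; rewrite meval1 oner_neq0; split=> // y _ _.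
by rewrite meval1 mevalC divr1.
Qed.

Lemma local_fractionD f g : local_fraction f -> local_fraction g ->
  local_fraction (fun y => f y + g y).
Proof.
move=> [p [q [qx fE]]] [r [s [sx gE]]]; exists (p * s + r * q), (q * s).
rewrite mevalM mulf_neq0 //; split=> // y Uy.
rewrite mevalM mulf_eq0 negb_or => /andP[qy sy].
by rewrite fE // gE // addf_div // mevalD !mevalM.
Qed.

Lemma local_fractionM f g : local_fraction f -> local_fraction g ->
  local_fraction (fun y => f y * g y).
Proof.
move=> [p [q [qx fE]]] [r [s [sx gE]]]; exists (p * r), (q * s).
rewrite mevalM mulf_neq0 //; split=> // y Uy.
rewrite mevalM mulf_eq0 negb_or => /andP[qy sy].
by rewrite fE // gE // mulf_div // !mevalM.
Qed.

Lemma local_fraction_neq0 f : local_fraction f -> f x != 0 -> local_open [set y | U y /\ f y != 0].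
Proof.
move=> [p [q [qx fE]]]; rewrite fE // mulf_eq0 negb_or => /andP[px _].
exists (p * q); rewrite ?mevalM ?mulf_neq0 // => y Uy; rewrite mevalM mulf_eq0 negb_or => /andP[py qy].
by split=> //; rewrite fE // mulf_neq0 ?invr_neq0.
Qed.

Lemma local_fractionV f : local_fraction f -> f x != 0 -> local_fraction (fun y => (f y)^-1).
Proof.
move=> [p [q [qx fE]]]; rewrite fE // mulf_eq0 negb_or => /andP[px _].
exists (q * q), (p * q); rewrite mevalM mulf_neq0 //; split=> // y Uy.
rewrite mevalM mulf_eq0 negb_or => /andP[py qy]; rewrite fE // !mevalM.
by rewrite -mulf_div divff // mulr1 invf_div.
Qed.

Lemma local_fraction_sum (J : Type) (r : seq J) (F : J -> X -> K) :
  (forall j, local_fraction (F j)) -> local_fraction (fun y => \sum_(j <- r) F j y).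
Proof.
move=> FJ; elim: r => [|j r IH].
  rewrite (_ : (fun=> _) = fun=> 0); first exact: local_fractionC.
  by apply/funext => y; rewrite big_nil.
rewrite (_ : (fun=> _) = fun y => F j y + \sum_(j <- r) F j y); first exact: local_fractionD.
by apply/funext => y; rewrite big_cons.
Qed.

End LocalFractions.

(** * Products, germs and morphisms in charts *)

Section Products.
Variables (K : closedFieldType) (X Y : fspace K).

Lemma tensor_poly (U : set X) (V : set Y) m n (c : X -> 'I_m -> K) (d : Y -> 'I_n -> K) U' V'
    (p : {mpoly K[m + n]}) :
  chart U c -> chart V d -> (forall x, U' x -> U x) -> (forall y, V' y -> V y) ->
  tensor_on U' V' (fun z : prod_point X Y => p.@[join_coord (c z.1) (d z.2)]).
Proof.
move=> [_ regU _] [_ regV _] U'U V'V; pose mon i := nth 0%MM (msupp p) i.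
exists (size (msupp p)), (fun i x => p@_(mon i) * \prod_j c x j ^+ mon i (lshift n j)),
  (fun i y => \prod_j d y j ^+ mon i (rshift m j)); split.
- move=> i x /U'U Ux /=.
  pose q : {mpoly K[m]} := (p@_(mon i)) *: \prod_j 'X_j ^+ mon i (lshift n j).
  rewrite (_ : (fun=> _) = fun x => q.@[c x]).
    by apply/(regU _ _ Ux); apply: local_fraction_poly.
  apply/funext => y; rewrite /q mevalZ rmorph_prod; congr (_ * _).
  by apply: eq_bigr => j _; rewrite rmorphXn /= mevalXU.
- move=> i y /V'V Vy /=.
  pose q : {mpoly K[n]} := \prod_j 'X_j ^+ mon i (rshift m j).
  rewrite (_ : (fun=> _) = fun x => q.@[d x]).
    by apply/(regV _ _ Vy); apply: local_fraction_poly.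
  apply/funext => x; rewrite /q rmorph_prod.
  by apply: eq_bigr => j _; rewrite rmorphXn /= mevalXU.
apply/funext => z; rewrite mevalE (big_nth 0%MM) big_mkord; apply: eq_bigr => i _.
rewrite -mulrA big_split_ord /=; congr (_ * (_ * _)).
  by apply: eq_bigr => j _; rewrite join_coordl.
by apply: eq_bigr => j _; rewrite join_coordr.
Qed.

Variables (U : set X) (V : set Y) (m n : nat) (c : X -> 'I_m -> K) (d : Y -> 'I_n -> K).
Hypotheses (chX : chart U c) (chY : chart V d).
Let D : set (prod_space X Y) := [set z | U z.1 /\ V z.2].
Let cd (z : prod_space X Y) := join_coord (c z.1) (d z.2).

Let frac_fst z f : D z -> regular_at z.1 f -> local_fraction D cd z (fun w => f w.1).
Proof.
move=> [Uz _]; case: chX => _ regU _ /(regU _ _ Uz)[p [q [qz fE]]].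
pose e (p : {mpoly K[m]}) : {mpoly K[m + n]} := msub (fun i => 'X_(lshift n i)) p.
have eE r w : (e r).@[cd w] = r.@[c w.1].
  by rewrite meval_msub; apply: meval_eq => i; rewrite mevalXU /cd join_coordl.
by exists (e p), (e q); rewrite eE; split=> // w [Uw _]; rewrite !eE; apply: fE.
Qed.

Let frac_snd z f : D z -> regular_at z.2 f -> local_fraction D cd z (fun w => f w.2).
Proof.
move=> [_ Vz]; case: chY => _ regV _ /(regV _ _ Vz)[p [q [qz fE]]].
pose e (p : {mpoly K[n]}) : {mpoly K[m + n]} := msub (fun i => 'X_(rshift m i)) p.
have eE r w : (e r).@[cd w] = r.@[d w.2].
  by rewrite meval_msub; apply: meval_eq => i; rewrite mevalXU /cd join_coordr.
by exists (e p), (e q); rewrite eE; split=> // w [_ Vw]; rewrite !eE; apply: fE.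
Qed.

Let frac_tensor z (A : set X) (B : set Y) h : D z -> A z.1 -> B z.2 -> tensor_on A B h ->
  local_fraction D cd z h.
Proof.
move=> Dz Az Bz [k [f [g [fA gB ->]]]].
rewrite (_ : (fun=> _) = fun w => \sum_(i <- index_enum 'I_k) f i w.1 * g i w.2) //.
apply: local_fraction_sum => i; apply: local_fractionM; first exact: (frac_fst Dz (fA i _ Az)).
exact: (frac_snd Dz (gB i _ Bz)).
Qed.

Lemma prod_subbase_open (W : set (prod_space X Y)) : prod_subbase W -> open W.
Proof.
move=> sW; exists [set W]; last by rewrite bigcup_set1.
by move=> _ ->; apply: (@finI_from1 _ _ (@prod_subbase K X Y) id).
Qed.

Let open_fst (z : prod_space X Y) (A : set X) : D z -> nbhs z.1 A ->
  local_open D cd z [set w | A w.1].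
Proof.
move=> Dz; case: chX => _ _ nbU /(nbU _ _ Dz.1)[q qz qA].
have /(frac_fst Dz) fq : regular_at z.1 (fun x => q.@[c x]).
  by case: chX => _ regU _; apply/(regU _ _ Dz.1); apply: local_fraction_poly.
have := local_fraction_neq0 Dz fq qz.
by apply: local_openS => w [[Uw _] qw]; apply: qA.
Qed.

Let open_snd (z : prod_space X Y) (B : set Y) : D z -> nbhs z.2 B ->
  local_open D cd z [set w | B w.2].
Proof.
move=> Dz; case: chY => _ _ nbV /(nbV _ _ Dz.2)[q qz qB].
have /(frac_snd Dz) fq : regular_at z.2 (fun x => q.@[d x]).
  by case: chY => _ regV _; apply/(regV _ _ Dz.2); apply: local_fraction_poly.
have := local_fraction_neq0 Dz fq qz.
by apply: local_openS => w [[_ Vw] qw]; apply: qB.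
Qed.

(** On [D] the tensors defining the topology of the product are fractions in the joint coordinates,
    and conversely polynomials in these coordinates are tensors by [tensor_poly]; a finite
    intersection of members of the subbase is treated one member at a time. *)
Lemma prod_chart : chart D cd.
Proof.
have nbP (z : prod_space X Y) (W : set (prod_space X Y)) : D z -> nbhs z W <-> local_open D cd z W.
  move=> Dz; split=> [|[q qz qW]]; last first.
    rewrite nbhsE; exists [set w | [/\ U w.1, V w.2 & q.@[cd w] != 0]]; last by move=> w [Uw Vw]; apply: qW.
    split; last by case: Dz.
    apply: prod_subbase_open; exists U, V, (fun w => q.@[cd w]); split=> //.
    - by case: chX.
    - by case: chY.
    exact: (tensor_poly q chX chY).
  rewrite {1}nbhsE => -[O [[B Bsub <-] [S BS Sz]] OW].
  have [F Fsub SE] := Bsub _ BS.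
  have : local_open D cd z S.
    pose s0 : seq (set (prod_point X Y)) := finmap.enum_fset F.
    have {}Sz i : i \in s0 -> i z by move=> iF; move: Sz; rewrite -SE; apply.
    have {Fsub} Fsub i : i \in s0 -> prod_subbase i by move=> /Fsub; rewrite inE.
    pose P (s : seq (set (prod_point X Y))) := local_open D cd z [set w | forall i, i \in s -> i w].
    have : forall s : seq (set (prod_point X Y)), (forall i, i \in s -> i \in s0) -> P s.
      elim=> [|i s IH] sF; first by exists 1 => //; rewrite meval1 oner_neq0.
      have iF : i \in s0 by apply: sF; rewrite mem_head.
      have Ps : P s by apply: IH => j js; apply: sF; rewrite inE js orbT.
      have [A [A' [h [oA oA' th iE]]]] := Fsub _ iF.
      have := Sz _ iF; rewrite iE => -[Az A'z hz].
      have L1 : local_open D cd z [set w | A w.1] by apply: open_fst => //; apply: open_nbhs_nbhs.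
      have L2 : local_open D cd z [set w | A' w.2] by apply: open_snd => //; apply: open_nbhs_nbhs.
      have L3 := local_fraction_neq0 Dz (frac_tensor Dz Az A'z th) hz.
      have := local_openI Ps (local_openI (local_openI L1 L2) L3).
      apply: local_openS => w [Pw [[Aw A'w] [_ hw]]] j; by rewrite inE => /predU1P[->|/Pw//].
    move=> /(_ s0 (fun _ h => h)); rewrite -SE.
    by apply: local_openS => w Pw i /=; apply: Pw.
  by apply: local_openS => w Sw; apply: OW; exists S.
split=> [|z f Dz|z W Dz]; last exact: nbP.
  have [oU _ _] := chX; have [oV _ _] := chY.
  apply: prod_subbase_open; exists U, V, (fun w => (1 : {mpoly K[m + n]}).@[cd w]); split=> //.
    exact: (tensor_poly 1 chX chY).
  by apply/seteqP; split=> w /= [Uw Vw]; split=> //; rewrite meval1 oner_neq0.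
split=> [[p [q [pt qt qz /(nbP _ _ Dz) fE]]]|[p [q [qz fE]]]].
  have fp := frac_tensor Dz erefl erefl pt; have fq := frac_tensor Dz erefl erefl qt.
  have := local_fractionM fp (local_fractionV Dz fq qz).
  by apply: (local_fraction_eq (V := fun w => f w = p w / q w)) => // w /= ->.
exists (fun w => p.@[cd w]), (fun w => q.@[cd w]); split=> //.
- by apply: (tensor_poly p chX chY) => x ->; case: Dz.
- by apply: (tensor_poly q chX chY) => x ->; case: Dz.
by apply/(nbP _ _ Dz); exists q.
Qed.

End Products.

Section Germs.
Variable K : closedFieldType.
Implicit Types X Y Z : fspace K.

(** What the calculus of germs needs. Unlike [prevariety] it passes to arbitrary subspaces, in
    particular to fibre products. *)
Definition charted X := forall x : X, exists (U : set X) n (c : X -> 'I_n -> K), U x /\ chart U c.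

Lemma charted_prevariety X : prevariety X -> charted X.
Proof. by move=> pX x; have [U [n [c [Ux ch _]]]] := prevariety_chart x pX; exists U, n, c. Qed.

Lemma charted_prod X Y : charted X -> charted Y -> charted (prod_space X Y).
Proof.
move=> nX nY z; have [U [m [c [Uz ch]]]] := nX z.1; have [V [n [d [Vz dh]]]] := nY z.2.
by exists [set z | U z.1 /\ V z.2], (m + n)%N, (fun z => join_coord (c z.1) (d z.2)); split; last exact: prod_chart.
Qed.

Lemma charted_sub X (S : set X) : charted X -> charted (sub_space S).
Proof.
move=> nX s; have [U [n [c [Us ch]]]] := nX (set_val s).
by exists (set_val @^-1` U), n, (fun s => c (set_val s)); split; last exact: sub_space_chart.
Qed.

Section AtPoint.
Variables (X : fspace K) (x : X).
Hypothesis nX : charted X.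
Implicit Types f g : X -> K.

Let chx : exists (U : set X) n (c : X -> 'I_n -> K), [/\ U x,
  forall f, regular_at x f <-> local_fraction U c x f &
  forall V, nbhs x V <-> local_open U c x V].
Proof.
have [U [n [c [Ux [_ regU nbU]]]]] := nX x.
by exists U, n, c; split=> // [f|V]; [exact: regU|exact: nbU].
Qed.

Lemma reg_C a : regular_at x (fun=> a).
Proof. by have [U [n [c [Ux regP _]]]] := chx; apply/regP; apply: local_fractionC. Qed.

Lemma reg_D f g : regular_at x f -> regular_at x g -> regular_at x (fun y => f y + g y).
Proof.
have [U [n [c [Ux regP _]]]] := chx.
by move=> /regP rf /regP rg; apply/regP; apply: local_fractionD.
Qed.

Lemma reg_M f g : regular_at x f -> regular_at x g -> regular_at x (fun y => f y * g y).
Proof.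
have [U [n [c [Ux regP _]]]] := chx.
by move=> /regP rf /regP rg; apply/regP; apply: local_fractionM.
Qed.

Lemma reg_V f : regular_at x f -> f x != 0 -> regular_at x (fun y => (f y)^-1).
Proof.
have [U [n [c [Ux regP _]]]] := chx.
by move=> /regP rf fx; apply/regP; apply: local_fractionV.
Qed.

Lemma reg_neq0 f : regular_at x f -> f x != 0 -> nbhs x [set y | f y != 0].
Proof.
have [U [n [c [Ux regP nbP]]]] := chx; move=> /regP rf fx; apply/nbP.
by apply: local_openS (local_fraction_neq0 Ux rf fx) => y [].
Qed.

Lemma reg_sum (J : Type) (r : seq J) (F : J -> X -> K) :
  (forall j, regular_at x (F j)) -> regular_at x (fun y => \sum_(j <- r) F j y).
Proof.
have [U [n [c [Ux regP _]]]] := chx => FJ; apply/regP; apply: local_fraction_sum => // j.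
exact/regP.
Qed.

Lemma reg_ev n (F : 'I_n -> X -> K) (p : {mpoly K[n]}) :
  (forall j, regular_at x (F j)) -> regular_at x (fun y => p.@[fun j => F j y]).
Proof.
move=> FJ; elim/mpoly_ring_ind: p => [a|k|p q Ep Eq|p q Ep Eq].
- have -> : (fun y => a%:MP.@[fun j => F j y]) = fun=> a by apply/funext => y; rewrite mevalC.
  exact: reg_C.
- have -> : (fun y => ('X_k : {mpoly K[n]}).@[fun j => F j y]) = F k by apply/funext => y; rewrite mevalXU.
  exact: FJ.
- have -> : (fun y => (p + q).@[fun j => F j y]) = (fun y => p.@[fun j => F j y] + q.@[fun j => F j y]).
    by apply/funext => y; rewrite mevalD.
  exact: reg_D.
have -> : (fun y => (p * q).@[fun j => F j y]) = (fun y => p.@[fun j => F j y] * q.@[fun j => F j y]).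
  by apply/funext => y; rewrite mevalM.
exact: reg_M.
Qed.

End AtPoint.

Lemma reg_near X (x : X) f : charted X -> regular_at x f -> nbhs x [set y | regular_at y f].
Proof.
move=> nX; have [U [n [c [Ux [_ regU nbU]]]]] := nX x.
move=> /(regU _ _ Ux)[p [q [qx fE]]]; apply/(nbU _ _ Ux); exists q => // y Uy qy.
by apply/(regU _ _ Uy); exists p, q.
Qed.

Lemma reg_coord X (U : set X) n (c : X -> 'I_n -> K) x i : chart U c -> U x ->
  regular_at x (fun y => c y i).
Proof.
move=> [_ regU _] Ux; have <- : (fun y => ('X_i : {mpoly K[n]}).@[c y]) = (fun y => c y i).
  by apply/funext => y; rewrite mevalXU.
by apply/(regU _ _ Ux); apply: local_fraction_poly.
Qed.

Lemma chart_nbhs X (U : set X) n (c : X -> 'I_n -> K) x : chart U c -> U x -> nbhs x U.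
Proof. by move=> [oU _ _] Ux; apply: open_nbhs_nbhs. Qed.

(** Morphisms one point at a time: regularity is often known only near a single point and is then
    spread by translations. *)
Definition morph_at X Y (f : X -> Y) (x : X) : Prop :=
  (forall V, nbhs (f x) V -> nbhs x (f @^-1` V)) /\
  forall h, regular_at (f x) h -> regular_at x (h \o f).

Lemma morphismP X Y (f : X -> Y) : morphism f <-> forall x, morph_at f x.
Proof.
split=> [[fc fr] x|fx].
  split; [exact: fc|exact: fr].
split=> [x V nV|x h]; first exact: ((fx x).1 V nV).
exact: (fx x).2.
Qed.

Lemma morph_at_comp X Y Z (f : X -> Y) (g : Y -> Z) x :
  morph_at f x -> morph_at g (f x) -> morph_at (fun y => g (f y)) x.
Proof. by move=> [fc fr] [gc gr]; split=> [V /gc/fc//|h /gr/fr]. Qed.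

Lemma morph_at_eq X Y (f g : X -> Y) x : nbhs x [set y | f y = g y] -> morph_at f x -> morph_at g x.
Proof.
move=> fg [fc fr]; have fgx : f x = g x by apply: (nbhs_singleton fg).
rewrite /morph_at -fgx; split=> [V /fc nV|h /fr rh].
  by apply: filterS2 fg nV => y /= ->.
by apply: regular_at_local rh; apply: filterS fg => y /= ->.
Qed.

Lemma morph_at_id X (x : X) : morph_at id x.
Proof. by split. Qed.

Lemma morph_at_chart X Y (f : X -> Y) x (U : set Y) n (c : Y -> 'I_n -> K) : charted X ->
  chart U c -> U (f x) -> nbhs x (f @^-1` U) ->
  (forall i, regular_at x (fun y => c (f y) i)) -> morph_at f x.
Proof.
move=> nX [_ regU nbU] Ux nU rc; split=> [V /(nbU _ _ Ux)[q qx qV]|h /(regU _ _ Ux)[p [q [qx hE]]]].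
  have := reg_neq0 nX (reg_ev nX q rc) qx.
  by apply: filterS2 nU => y Uy qy; apply: qV.
have nq := reg_neq0 nX (reg_ev nX q rc) qx.
have := reg_M nX (reg_ev nX p rc) (reg_V nX (reg_ev nX q rc) qx).
by apply: regular_at_local; apply: filterS2 nU nq => y Uy qy; rewrite /= hE.
Qed.

Lemma morph_at_val X (S : set X) (s : sub_space S) : morph_at (set_val : sub_space S -> X) s.
Proof.
split=> [V nV|h rh]; first by apply/nbhs_sub_space; exists V.
by exists h; split=> //; apply/nbhs_sub_space; exists setT => //; apply: filterT.
Qed.

Lemma morph_at_sub X Z (S : set X) (f : Z -> sub_space S) z :
  morph_at (fun y => set_val (f y)) z -> morph_at f z.
Proof.
move=> [fc fr]; split=> [V /nbhs_sub_space[O nO OV]|h [g [rg /nbhs_sub_space[O nO hg]]]].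
  by apply: filterS (fc _ nO) => y; apply: OV.
apply: regular_at_local (fr _ rg).
by apply: filterS (fc _ nO) => y /hg /= ->.
Qed.

Lemma morph_at_fst X Y (z : prod_space X Y) : charted X -> charted Y ->
  morph_at (fun w : prod_space X Y => w.1) z.
Proof.
move=> nX nY; have [U [m [c [Uz ch]]]] := nX z.1; have [V [n [d [Vz dh]]]] := nY z.2.
have pc := prod_chart ch dh; apply: (morph_at_chart _ ch Uz) => [||i].
- exact: charted_prod.
- by apply: (filterS (P := [set z | U z.1 /\ V z.2])) (chart_nbhs pc _) => // w [].
have := @reg_coord _ _ _ _ z (lshift n i) pc (conj Uz Vz).
by congr regular_at; apply/funext => w; rewrite join_coordl.
Qed.

Lemma morph_at_snd X Y (z : prod_space X Y) : charted X -> charted Y ->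
  morph_at (fun w : prod_space X Y => w.2) z.
Proof.
move=> nX nY; have [U [m [c [Uz ch]]]] := nX z.1; have [V [n [d [Vz dh]]]] := nY z.2.
have pc := prod_chart ch dh; apply: (morph_at_chart _ dh Vz) => [||i].
- exact: charted_prod.
- by apply: (filterS (P := [set z | U z.1 /\ V z.2])) (chart_nbhs pc _) => // w [].
have := @reg_coord _ _ _ _ z (rshift m i) pc (conj Uz Vz).
by congr regular_at; apply/funext => w; rewrite join_coordr.
Qed.

Lemma morph_at_pair X Y Z (f : Z -> X) (g : Z -> Y) z : charted X -> charted Y -> charted Z ->
  morph_at f z -> morph_at g z -> morph_at (fun y => (f y, g y) : prod_space X Y) z.
Proof.
move=> nX nY nZ [fc fr] [gc gr].
have [U [m [c [Uz ch]]]] := nX (f z); have [V [n [d [Vz dh]]]] := nY (g z).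
have pc := prod_chart ch dh; apply: (morph_at_chart nZ pc) => [//||].
  apply: filterS2 (fc _ (chart_nbhs ch Uz)) (gc _ (chart_nbhs dh Vz)) => y Uy Vy //.
elim/join_coordP => i.
  have := fr _ (reg_coord i ch Uz); congr regular_at.
  by apply/funext => y; rewrite /= join_coordl.
have := gr _ (reg_coord i dh Vz); congr regular_at.
by apply/funext => y; rewrite /= join_coordr.
Qed.

Lemma morph_at_const X Y (y : Y) (x : X) : charted X -> morph_at (fun _ : X => y) x.
Proof.
move=> nX; split=> [V /nbhs_singleton Vy|h _]; last exact: reg_C.
by apply: filterS (filterT : nbhs x setT) => ? _.
Qed.

(* The conductor ideal of f contains chi, up to radical. *)
Lemma bounded_denominator X (U : set X) n (c : X -> 'I_n -> K) (chi : {mpoly K[n]}) f :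
  chart U c -> closed_chart U c ->
  (forall u, U u -> chi.@[c u] != 0 -> regular_at u f) ->
  exists M (P : {mpoly K[n]}), forall u, U u -> chi.@[c u] != 0 -> chi.@[c u] ^+ M * f u = P.@[c u].
Proof.
move=> [_ regU _] cl rf.
pose I (q : {mpoly K[n]}) := exists p : {mpoly K[n]}, forall u, U u -> chi.@[c u] != 0 ->
  q.@[c u] * f u = p.@[c u].
have iI : ideal I.
  split=> [|q q' [p pE] [p' pE']|a q [p pE]].
  - by exists 0 => u _ _; rewrite !meval0 mul0r.
  - by exists (p + p') => u Uu cu; rewrite !mevalD mulrDl pE ?pE'.
  - by exists (a * p) => u Uu cu; rewrite !mevalM -mulrA pE.
have [|M [P PE]] := nullstellensatz (f := chi) iI; last first.
  by exists M, P => u Uu cu; rewrite -PE // rmorphXn.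
move=> w wI; have [|u Uu cw] := cl w.
  by move=> q qU; apply: wI; exists 0 => u Uu _; rewrite qU // meval0 mul0r.
rewrite -cw; apply/eqP/negPn/negP => cu.
have /(regU _ _ Uu)[p [q [qu fE]]] := rf u Uu cu.
have : (q * q).@[w] = 0.
  apply: wI; exists (q * p) => v Uv _; rewrite !mevalM -mulrA.
  have [q0|qv] := eqVneq q.@[c v] 0; first by rewrite q0 !mul0r.
  by congr (_ * _); rewrite fE // mulrC divfK.
by rewrite -cw mevalM => /eqP; rewrite mulf_eq0 (negPf qu).
Qed.

End Germs.

(** * Finite-dimensional spans and linear embeddings of affine groups *)

Lemma meval_sum (R : comNzRingType) n (x : 'I_n -> R) (J : Type) (r : seq J) (P : pred J)
    (F : J -> {mpoly R[n]}) :
  (\sum_(j <- r | P j) F j).@[x] = \sum_(j <- r | P j) (F j).@[x].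
Proof. exact: rmorph_sum. Qed.

(** Take an invertible sample matrix of maximal size, which the cardinal of [J] bounds. Bordering it
    by a further [j] and [y] gives a singular matrix, whose Schur complement is the difference of
    the two sides of the interpolation formula. *)
Lemma finite_rank_sample (K : fieldType) (X I : Type) (phi : I -> X -> K) (J : finType)
    (a : J -> X -> K) (coef : I -> J -> K) :
  (forall i x, phi i x = \sum_m a m x * coef i m) ->
  exists N (i : 'I_N -> I) (x : 'I_N -> X),
    \matrix_(l, k) phi (i k) (x l) \in unitmx /\
    forall j y, phi j y =
      \sum_k phi (i k) y * \sum_l invmx (\matrix_(l, k) phi (i k) (x l)) k l * phi j (x l).
Proof.
move=> phiE; pose good N := exists (i : 'I_N -> I) (x : 'I_N -> X),
  \matrix_(l, k) phi (i k) (x l) \in unitmx.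
have good0 : good 0%N.
  exists (fun i : 'I_0 => match i with Ordinal _ h => match notF h with end end),
    (fun i : 'I_0 => match i with Ordinal _ h => match notF h with end end).
  by rewrite unitmxE det_mx00 unitr1.
have bound N : good N -> (N <= #|J|)%N.
  move=> [i [x Fu]]; rewrite -(mxrank_unit Fu).
  have -> : \matrix_(l, k) phi (i k) (x l) = (\matrix_(l < N, m < #|J|) a (enum_val m) (x l)) *m (\matrix_(m < #|J|, k < N) coef (i k) (enum_val m)).
    apply/matrixP => l k; rewrite !mxE phiE (reindex _ (onW_bij _ (@enum_val_bij J))).
    by apply: eq_bigr => m _; rewrite !mxE.
  by apply: leq_trans (mxrankM_maxl _ _) (rank_leq_col _).
have [N gN maxN] : exists2 N, good N & ~ good N.+1.
  pose b N := `[< good N >]; have exb : exists N, b N by exists 0%N; apply/asboolP.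
  have ubb N : b N -> (N <= #|J|)%N by move=> /asboolP; apply: bound.
  case: (ex_maxnP exb ubb) => N /asboolP gN mx; exists N => // /asboolP /mx.
  by rewrite ltnn.
have [i [x Fu]] := gN; exists N, i, x; split=> // j y; set F := (\matrix_(l, k) _) in Fu *.
pose cj : 'cV[K]_N := \col_l phi j (x l); pose ry : 'rV[K]_N := \row_k phi (i k) y.
have -> : \sum_k phi (i k) y * \sum_l invmx F k l * phi j (x l) = (ry *m (invmx F *m cj)) 0 0.
  rewrite mxE; apply: eq_bigr => k _; rewrite !mxE; congr (_ * _).
  by apply: eq_bigr => l _; rewrite mxE.
apply/eqP; rewrite -subr_eq0; apply/negPn/negP => nz; apply: maxN; rewrite -addn1.
exists (fun k => match fintype.split k with inl k => i k | inr _ => j end),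
  (fun k => match fintype.split k with inl k => x k | inr _ => y end).
pose B := block_mx F cj ry (phi j y)%:M.
have -> : \matrix_(l, k) phi (match fintype.split k with inl k => i k | inr _ => j end)
    (match fintype.split l with inl k => x k | inr _ => y end) = B.
  apply/matrixP => l k; rewrite mxE /B /block_mx.
  rewrite -(splitK l) -(splitK k); case: (fintype.split l) => l'; case: (fintype.split k) => k' /=.
  - by rewrite !(unsplitK (inl _)) col_mxEu row_mxEl mxE.
  - by rewrite (unsplitK (inl _)) (unsplitK (inr _)) col_mxEu row_mxEr mxE.
  - by rewrite (unsplitK (inl _)) (unsplitK (inr _)) col_mxEd row_mxEl mxE.
  by rewrite !(unsplitK (inr _)) col_mxEd row_mxEr !ord1 mxE.
have : B *m block_mx 1%:M (- (invmx F *m cj)) 0 1%:M =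
    block_mx F 0 ry ((phi j y)%:M - ry *m (invmx F *m cj)).
  rewrite mulmx_block !mulmx1 !mulmx0 !addr0 !mulmxN mulmxA mulmxV // mul1mx addNr.
  by rewrite addrC.
move=> /(congr1 determinant); rewrite det_mulmx det_ublock !det1 !mulr1 det_lblock det_mx11 => detB.
rewrite unitmxE detB unitrM -unitmxE Fu unitfE.
by rewrite mxE [X in _ + X]mxE mxE eqxx mulr1n.
Qed.

Section ChartChange.
Variables (K : closedFieldType) (X : fspace K) (U : set X) (m n : nat).
Variables (c : X -> 'I_m -> K) (d : X -> 'I_n -> K).
Variables (P : 'I_n -> {mpoly K[m]}) (Q : 'I_m -> {mpoly K[n]}).
Hypotheses (dP : forall x i, U x -> d x i = (P i).@[c x]) (cQ : forall x i, U x -> c x i = (Q i).@[d x]).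

Lemma chart_change : chart U c -> chart U d.
Proof.
move=> [oU regU nbU].
have subP (p : {mpoly K[n]}) x : U x -> (msub P p).@[c x] = p.@[d x].
  by move=> Ux; rewrite meval_msub; apply: meval_eq => i; rewrite dP.
have subQ (p : {mpoly K[m]}) x : U x -> (msub Q p).@[d x] = p.@[c x].
  by move=> Ux; rewrite meval_msub; apply: meval_eq => i; rewrite cQ.
split=> // [x f Ux|x V Ux].
  split=> [/(regU _ _ Ux)|] [p [q [qx fE]]].
    exists (msub Q p), (msub Q q); rewrite subQ //; split=> // y Uy.
    by rewrite !subQ //; apply: fE.
  apply/(regU _ _ Ux); exists (msub P p), (msub P q); rewrite subP //; split=> // y Uy.
  by rewrite !subP //; apply: fE.
split=> [/(nbU _ _ Ux)|] [q qx qV].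
  by exists (msub Q q) => [|y Uy]; rewrite subQ //; apply: qV.
by apply/(nbU _ _ Ux); exists (msub P q) => [|y Uy]; rewrite subP //; apply: qV.
Qed.

Lemma closed_chart_change : closed_chart U c -> closed_chart U d.
Proof.
move=> cl w wU; have [|x Ux cx] := cl (fun i => (Q i).@[w]).
  move=> p pU; rewrite -meval_msub; apply: wU => x Ux.
  by rewrite meval_msub -[RHS](pU x Ux); apply: meval_eq => i; rewrite cQ.
exists x => //; apply/funext => i; rewrite dP // cx -meval_msub.
apply/eqP; rewrite -subr_eq0; apply/eqP.
rewrite -[X in _ - X](mevalXU w i) -mevalB; apply: wU => y Uy.
rewrite mevalB meval_msub mevalXU dP //; apply/eqP; rewrite subr_eq0; apply/eqP.
by apply: meval_eq => j; rewrite cQ.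
Qed.

End ChartChange.

Section ProductClosed.
Variables (K : closedFieldType) (X Y : fspace K).

Lemma prod_closed_chart (U : set X) (V : set Y) m n (c : X -> 'I_m -> K) (d : Y -> 'I_n -> K) :
  closed_chart U c -> closed_chart V d ->
  closed_chart [set z : prod_space X Y | U z.1 /\ V z.2] (fun z => join_coord (c z.1) (d z.2)).
Proof.
move=> clU clV w wUV.
have [|x Ux cx] := clU (fun i => w (lshift n i)).
  move=> p pU; have := wUV (msub (fun i => 'X_(lshift n i)) p) _; rewrite meval_msub.
  under meval_eq => i do rewrite mevalXU.
  apply=> z [Uz _]; rewrite meval_msub -[RHS](pU _ Uz); apply: meval_eq => i.
  by rewrite mevalXU join_coordl.
have [|y Vy dy] := clV (fun i => w (rshift m i)).
  move=> p pV; have := wUV (msub (fun i => 'X_(rshift m i)) p) _; rewrite meval_msub.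
  under meval_eq => i do rewrite mevalXU.
  apply=> z [_ Vz]; rewrite meval_msub -[RHS](pV _ Vz); apply: meval_eq => i.
  by rewrite mevalXU join_coordr.
exists (x, y) => //; apply/funext; elim/join_coordP => i /=.
  by rewrite join_coordl cx.
by rewrite join_coordr dy.
Qed.

Lemma regular_poly (U : set X) n (c : X -> 'I_n -> K) f : chart U c -> closed_chart U c ->
  (forall u, U u -> regular_at u f) -> exists P : {mpoly K[n]}, forall u, U u -> f u = P.@[c u].
Proof.
move=> ch cl rf; have [M [P PE]] := bounded_denominator (chi := 1) ch cl (fun u Uu _ => rf u Uu).
by exists P => u Uu; rewrite -PE // meval1 ?expr1n ?mul1r // oner_neq0.
Qed.

End ProductClosed.

Section MatrixGroup.
Variables (K : closedFieldType) (G : alg_group K).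

Lemma alg_group_charted : charted G.
Proof. by apply: charted_prevariety; case: (ag_variety G). Qed.

Lemma ag_mulgV (g : G) : ag_mul g (ag_inv g) = ag_one G.
Proof.
have idem (x : G) : ag_mul x x = x -> x = ag_one G.
  by move=> xx; rewrite -[LHS]ag_mul1 -(ag_mulV x) -ag_mulA xx.
by apply: idem; rewrite -ag_mulA (ag_mulA (ag_inv g)) ag_mulV ag_mul1.
Qed.

Lemma ag_mulr1 (g : G) : ag_mul g (ag_one G) = g.
Proof. by rewrite -(ag_mulV g) ag_mulA ag_mulgV ag_mul1. Qed.

Lemma ag_mulI (g h k : G) : ag_mul g h = ag_mul g k -> h = k.
Proof. by move=> E; rewrite -[h]ag_mul1 -[k]ag_mul1 -(ag_mulV g) -!ag_mulA E. Qed.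

Lemma morph_at_mul (Z : fspace K) (f h : Z -> G) (z : Z) : charted Z -> morph_at f z -> morph_at h z ->
  morph_at (fun y => ag_mul (f y) (h y)) z.
Proof.
move=> nZ mf mh; have nG := alg_group_charted.
have /morphismP mm := ag_mul_morphism G.
exact: (morph_at_comp (morph_at_pair nG nG nZ mf mh) (mm (f z, h z))).
Qed.

Lemma morph_at_inv (Z : fspace K) (f : Z -> G) (z : Z) : morph_at f z -> morph_at (fun y => ag_inv (f y)) z.
Proof. by move=> mf; have /morphismP mi := ag_inv_morphism G; apply: (morph_at_comp mf (mi _)). Qed.

(** The right translates of the coordinate functions span a space of finite dimension, since the
    group law is polynomial. [A g] is right translation by [g] in a basis of it extracted by
    [finite_rank_sample], and evaluation at 1 recovers the coordinates. *)
Lemma matrix_embedding : affine_variety G -> exists N (A : G -> 'M[K]_N),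
  [/\ forall g h, A (ag_mul g h) = A g *m A h, A (ag_one G) = 1%:M, injective A,
      chart setT (fun g => mxcoord (A g)) & closed_chart setT (fun g => mxcoord (A g))].
Proof.
move=> [n [Z [cZ [phi iso]]]]; have [ch cl] := affine_variety_chart cZ iso.
set c := (fun x i => _) in ch cl; have nG := alg_group_charted.
have pch := prod_chart ch ch; have pcl := prod_closed_chart cl cl.
have /choice[P PE] : forall i, exists P : {mpoly K[n + n]}, forall g h, c (ag_mul g h) i = P.@[join_coord (c g) (c h)].
  move=> i; have [|P PE] := regular_poly (f := fun z : prod_space G G => c (ag_mul z.1 z.2) i) pch pcl.
    move=> z _; have /morphismP mm := ag_mul_morphism G.
    by have [_ /(_ _ (reg_coord i ch I))] := mm z.
  by exists P => g h; apply: (PE (g, h)).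
pose Ix := ('I_n * G)%type; pose f (j : Ix) (x : G) := c (ag_mul x j.2) j.1.
pose mon i k := nth 0%MM (msupp (P i)) k.
pose J : finType := {i : 'I_n & 'I_(size (msupp (P i)))}.
pose a (q : J) (x : G) := \prod_u c x u ^+ mon (tag q) (tagged q) (lshift n u).
pose co (j : Ix) (q : J) := (tag q == j.1)%:R * ((P (tag q))@_(mon (tag q) (tagged q)) *
  \prod_u c j.2 u ^+ mon (tag q) (tagged q) (rshift n u)).
have fE j x : f j x = \sum_q a q x * co j q.
  rewrite /f PE mevalE (big_nth 0%MM) big_mkord.
  pose F i (k : 'I_(size (msupp (P i)))) := (i == j.1)%:R * ((P i)@_(mon i k) *
    \prod_u join_coord (c x) (c j.2) u ^+ mon i k u).
  rewrite [RHS](eq_bigr (fun q : J => F (tag q) (tagged q))) => [|q _]; last first.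
    rewrite /F /a /co mulrCA; congr (_ * _); rewrite mulrCA big_split_ord /=; congr (_ * (_ * _)).
      by apply: eq_bigr => u _; rewrite join_coordl.
    by apply: eq_bigr => u _; rewrite join_coordr.
  rewrite -(@sig_big_dep _ 0 +%R _ _ xpredT (fun _ => xpredT) F) /= (bigD1 j.1) //=.
  rewrite [X in _ = _ + X]big1 ?addr0 => [|i /negPf ij]; last first.
    by apply: big1 => k _; rewrite /F ij mul0r.
  by apply: eq_bigr => k _; rewrite /F eqxx mul1r.
have [N [ij [x [Fu fspan]]]] := finite_rank_sample fE.
set F := (\matrix_(l, k) _) in Fu fspan.
pose A (g : G) : 'M[K]_N := \matrix_(k, j) \sum_l invmx F k l * f ((ij j).1, ag_mul g (ij j).2) (x l).
have fA g y j : f (ij j) (ag_mul y g) = \sum_k f (ij k) y * A g k j.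
  rewrite (_ : f (ij j) _ = f ((ij j).1, ag_mul g (ij j).2) y); last by rewrite /f ag_mulA.
  by rewrite fspan; apply: eq_bigr => k _; rewrite mxE.
have Au (B C : 'M[K]_N) : (forall l j, \sum_k f (ij k) (x l) * B k j = \sum_k f (ij k) (x l) * C k j) -> B = C.
  move=> BC; rewrite -[B]mul1mx -[C]mul1mx -(mulVmx Fu) -!mulmxA; congr (_ *m _).
  have E (D : 'M[K]_N) l j : (F *m D) l j = \sum_k f (ij k) (x l) * D k j.
    by rewrite mxE; apply: eq_bigr => k _; rewrite mxE.
  by apply/matrixP => l j; rewrite !E BC.
have AM g h : A (ag_mul g h) = A g *m A h.
  apply: Au => l j; rewrite -fA ag_mulA fA.
  under eq_bigr => k _ do rewrite fA mulr_suml.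
  rewrite exchange_big; apply: eq_bigr => k _ /=; rewrite mxE mulr_sumr.
  by apply: eq_bigr => u _; rewrite mulrA.
have A1 : A (ag_one G) = 1%:M.
  apply: Au => l j; rewrite -fA ag_mulr1 (bigD1 j) //= mxE eqxx mulr1 big1 ?addr0 // => k /negPf kj.
  by rewrite mxE kj mulr0.
have cA g i : c g i = \sum_k \sum_u f (ij u) (ag_one G) * A g u k *
    \sum_l invmx F k l * f (i, ag_one G) (x l).
  have -> : c g i = f (i, ag_one G) g by rewrite /f ag_mulr1.
  rewrite fspan; apply: eq_bigr => k _.
  by rewrite -[in LHS](ag_mul1 g) fA mulr_suml.
have Areg g k j : regular_at g (fun h => A h k j).
  have -> : (fun h => A h k j) = fun h => \sum_(l <- index_enum 'I_N) invmx F k l * c (ag_mul (x l) (ag_mul h (ij j).2)) (ij j).1.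
    by apply/funext => h; rewrite mxE.
  apply: reg_sum => // l; apply: reg_M => //; first exact: reg_C.
  have mm : morph_at (fun h => ag_mul (x l) (ag_mul h (ij j).2)) g.
    exact: (morph_at_mul nG (morph_at_const _ _ nG) (morph_at_mul nG (morph_at_id g) (morph_at_const _ _ nG))).
  exact: (mm.2 _ (reg_coord (ij j).1 ch I)).
have /choice[Q QE] : forall q, exists Q : {mpoly K[n]}, forall g, setT g -> mxcoord (A g) q = Q.@[c g].
  elim/mxcoordP => k j; have [|Q QE] := regular_poly (f := fun g => A g k j) ch cl; first by move=> g _.
  by exists Q => g Tg; rewrite mxcoordE QE.
pose L i : {mpoly K[N * N]} := \sum_k \sum_u (f (ij u) (ag_one G))%:MP * 'X_(mxvec_index u k) *
    (\sum_l invmx F k l * f (i, ag_one G) (x l))%:MP.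
have LE g i : setT g -> c g i = (L i).@[mxcoord (A g)].
  move=> _; rewrite cA /L meval_sum; apply: eq_bigr => k _.
  rewrite meval_sum; apply: eq_bigr => u _.
  by rewrite !mevalM !mevalC mevalXU mxcoordE.
have A_inj : injective A.
  move=> g h gh; have [_ [psi [_ phiK _]]] := iso; apply: (can_inj phiK); apply: val_inj; apply/rowP => i.
  by have := LE g i I; rewrite gh -LE.
by exists N, A; split=> //; [apply: (chart_change (fun g q Tg => QE q g Tg) LE)|apply: (closed_chart_change (fun g q Tg => QE q g Tg) LE)].
Qed.

End MatrixGroup.

(* Applied to [u - chi_i(u)], translations separate the characters. *)
Lemma character_components (K : fieldType) (T : Type) (mul : T -> T -> T) (V : (T -> K) -> Prop) :
  (forall f g, V f -> V g -> V (fun t => f t + g t)) ->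
  (forall a f, V f -> V (fun t => a * f t)) ->
  (forall u f, V f -> V (fun t => f (mul u t))) ->
  forall k (chi : 'I_k -> T -> K) (c : 'I_k -> K), injective chi ->
  (forall i, character mul (chi i)) -> V (fun t => \sum_i c i * chi i t) ->
  forall i, V (fun t => c i * chi i t).
Proof.
move=> VD VZ Vs; elim=> [|k IH] chi c chi_inj chiM Vf; first by case.
have Vlt i : V (fun t => c (widen_ord (leqnSn k) i) * chi (widen_ord (leqnSn k) i) t).
  pose w := @widen_ord k k.+1 (leqnSn k).
  have [u du] : exists u, chi (w i) u != chi ord_max u.
    apply: contrapT => nex; have : chi (w i) = chi ord_max.
      by apply/funext => u; apply/eqP/negPn/negP => h; apply: nex; exists u.
    by move/chi_inj/(congr1 val) => /= ik; have := ltn_ord i; rewrite ik ltnn.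
  have du0 : chi (w i) u - chi ord_max u != 0 by rewrite subr_eq0.
  pose d j := c (w j) * (chi (w j) u - chi ord_max u).
  have Vg : V (fun t => \sum_j d j * chi (w j) t).
    have := VD _ _ (Vs u _ Vf) (VZ (- chi ord_max u) _ Vf); congr V; apply/funext => t.
    rewrite !big_ord_recr /= mulrDr mulr_sumr (_ : c ord_max * _ = chi ord_max u * (c ord_max * chi ord_max t)); last first.
      by rewrite chiM mulrCA.
    rewrite addrACA -big_split /= mulNr subrr addr0; apply: eq_bigr => j _.
    by rewrite chiM /d /w; ring.
  have w_inj : injective (fun j => chi (w j)).
    by move=> j j' /chi_inj/(congr1 val) /= /val_inj.
  have := VZ (chi (w i) u - chi ord_max u)^-1 _ (IH (fun j => chi (w j)) d w_inj (fun j => chiM _) Vg i).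
  congr V; apply/funext => t; rewrite /d -/(w i).
  by field.
move=> i; have [ik|ik] := ltnP i k.
  have := Vlt (Ordinal ik); congr V; apply/funext => t.
  by have -> : widen_ord (leqnSn k) (Ordinal ik) = i by apply: val_inj.
have -> : i = ord_max by apply/val_inj/eqP; rewrite eqn_leq ik -ltnS ltn_ord.
have Vsum : V (fun t => - \sum_(j < k) c (widen_ord (leqnSn k) j) * chi (widen_ord (leqnSn k) j) t).
  have V0 : V (fun=> 0) by have := VZ 0 _ Vf; congr V; apply/funext => t; rewrite mul0r.
  have : V (fun t => \sum_(j <- index_enum 'I_k) c (widen_ord (leqnSn k) j) * chi (widen_ord (leqnSn k) j) t).
    elim: (index_enum _) => [|j r IHr]; first by move: V0; congr V; apply/funext => t; rewrite big_nil.
    by have := VD _ _ (Vlt j) IHr; congr V; apply/funext => t; rewrite big_cons.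
  by move=> /(VZ (-1)); congr V; apply/funext => t; rewrite mulN1r.
have := VD _ _ Vf Vsum; congr V; apply/funext => t.
by rewrite big_ord_recr /= addrAC subrr add0r.
Qed.

(** * Cones and lattices of weights *)

Section Farkas.
Variable r : nat.
Implicit Types (x y : 'rV[rat]_r) (s : seq 'rV[rat]_r).

Definition rdot x y : rat := \sum_i x 0 i * y 0 i.

Lemma rdotDl x y z : rdot (x + y) z = rdot x z + rdot y z.
Proof. by rewrite -big_split; apply: eq_bigr => i _; rewrite mxE mulrDl. Qed.

Lemma rdotDr x y z : rdot z (x + y) = rdot z x + rdot z y.
Proof. by rewrite -big_split; apply: eq_bigr => i _; rewrite mxE mulrDr. Qed.

Lemma rdotZl a x z : rdot (a *: x) z = a * rdot x z.
Proof. by rewrite mulr_sumr; apply: eq_bigr => i _; rewrite mxE mulrA. Qed.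

Lemma rdotZr a x z : rdot z (a *: x) = a * rdot z x.
Proof. by rewrite mulr_sumr; apply: eq_bigr => i _; rewrite mxE mulrCA. Qed.

(* Bartl's proof, by induction on the number of constraints. *)
Lemma farkas s y : (forall x, (forall v, v \in s -> 0 <= rdot v x) -> 0 <= rdot y x) ->
  exists2 c : nat -> rat, forall i, 0 <= c i & y = \sum_(i < size s) c i *: s`_i.
Proof.
elim: {s}(size s) {-2}s (erefl (size s)) y => [|n IH] [|v s] //= sz y ys.
  exists (fun=> 0) => //; rewrite big_ord0; apply/rowP => i; rewrite mxE.
  have E e : rdot y (e *: delta_mx 0 i) = e * y 0 i.
    rewrite rdotZr; congr (_ * _); rewrite /rdot (bigD1 i) //= mxE !eqxx mulr1 big1 ?addr0 // => j ji.
    by rewrite mxE (negPf ji) andbF mulr0.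
  have h1 : 0 <= 1 * y 0 i by rewrite -E; apply: ys.
  have h2 : 0 <= -1 * y 0 i by rewrite -E; apply: ys.
  by apply/eqP; rewrite eq_le; lra.
have [|/existsNP[x0 /not_implyP[x0s /negP]]] :=
    pselect (forall x, (forall v, v \in s -> 0 <= rdot v x) -> 0 <= rdot y x).
  move=> /(IH s (succn_inj sz))[c c0 ->]; exists (fun i => if i is i'.+1 then c i' else 0) => [[|i]//|].
  by rewrite /= big_ord_recl scale0r add0r.
rewrite -ltNge => yx0.
have vx0 : rdot v x0 < 0.
  rewrite ltNge; apply/negP => vx; move: yx0; rewrite ltNge ys // => w.
  by rewrite inE => /predU1P[->|/x0s].
pose b := rdot v x0; pose pr w := w - (rdot w x0 / b) *: v.
have b0 : b != 0 by rewrite lt_eqF.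
have prE w x : rdot (pr w) x = rdot w (x - (rdot v x / b) *: x0).
  by rewrite /pr -scaleNr -[in RHS]scaleNr rdotDl rdotDr rdotZl rdotZr; ring.
have szp : size (map pr s) = n by rewrite size_map; case: sz.
have [x xs|c c0 yE] := IH _ szp (pr y).
  rewrite prE; apply: ys => w; rewrite inE => /predU1P[->|ws].
    by rewrite -scaleNr rdotDr rdotZr mulNr divfK // subrr.
  by rewrite -prE; apply/xs/map_f.
pose e := \sum_(i < size s) c i * rdot s`_i x0.
exists (fun i => if i is i'.+1 then c i' else (rdot y x0 - e) / b).
  move=> [|i] //; apply: mulr_le0; last by rewrite invr_le0 ltW.
  rewrite subr_le0 ltW // (lt_le_trans yx0) //; apply: sumr_ge0 => i' _.
  by apply: mulr_ge0 => //; apply/x0s/mem_nth.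
rewrite big_ord_recl /= -[LHS](subrK ((rdot y x0 / b) *: v)) -/(pr y) yE size_map (eq_bigr (fun i : 'I_(size s) => c i *: s`_i - (c i * rdot s`_i x0 / b) *: v)); last first.
  by move=> i _; rewrite (nth_map 0) // scalerBr scalerA mulrA.
rewrite sumrB -scaler_suml -mulr_suml -/e mulrBl scalerBl.
by rewrite [RHS]addrC -addrA [X in _ + X]addrC.
Qed.

(** [lam] lies in the relative interior of the cone dual to the weights: up to a common denominator
    it is a sum of witnesses, one for each weight that is positive somewhere on this cone. A weight
    on which it vanishes is therefore nonpositive on the dual cone, and Farkas' lemma puts its
    opposite into the cone of the weights. *)
Lemma generic_form N (m : 'I_N -> 'rV[int]_r) :
  exists lam : 'I_r -> int, forall j, 0 <= \sum_i m j 0 i * lam i /\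
    (\sum_i m j 0 i * lam i = 0 -> exists k (b : 'I_N -> nat), (0 < k)%N /\
       forall i, m j 0 i *+ k + \sum_u m u 0 i *+ b u = 0).
Proof.
pose q (j : 'I_N) : 'rV[rat]_r := map_mx intr (m j).
pose s := [seq q j | j <- enum 'I_N].
have clear (I : finType) (f : I -> rat) : exists2 D : nat, (0 < D)%N & exists g : I -> int, forall i, f i * D%:R = (g i)%:~R.
  exists (\prod_i `|denq (f i)|)%N; first by apply: prodn_gt0 => i; rewrite absz_gt0 denq_neq0.
  exists (fun i => numq (f i) * \prod_(u | u != i) (`|denq (f u)|%N : int)) => i.
  rewrite (bigD1 i) //= natrM mulrA rmorphM /=; congr (_ * _); last first.
    by rewrite [RHS]rmorph_prod natr_prod; apply: eq_bigr.
  rewrite natr_absz ger0_norm ?denq_ge0 // -{1}[f i]divq_num_den divfK //.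
  by rewrite intr_eq0 denq_neq0.
pose good j := forall x, (forall v, v \in s -> 0 <= rdot v x) -> rdot (q j) x <= 0.
have /choice[x xP] : forall j, exists x, (forall v, v \in s -> 0 <= rdot v x) /\ (good j \/ 0 < rdot (q j) x).
  move=> j; have [gj|/existsNP[x /not_implyP[xs /negP]]] := pselect (good j); last first.
    by rewrite -ltNge => h; exists x; split=> //; right.
  exists 0; split; last by left.
  by move=> v _; apply: sumr_ge0 => i _; rewrite mxE mulr0.
have [D D0 [lam lamE]] := clear _ (fun i : 'I_r => (\sum_j x j) 0 i).
exists lam => j.
have pos u v : v \in s -> 0 <= rdot v (x u) by have [h _] := xP u; apply: h.
have qs u : q u \in s by apply: map_f; rewrite mem_enum.
have E : (\sum_i m j 0 i * lam i)%:~R = (\sum_u rdot (q j) (x u)) * D%:R :> rat.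
  rewrite rmorph_sum /rdot exchange_big mulr_suml; apply: eq_bigr => i _ /=.
  rewrite rmorphM /= -lamE summxE mulrA; congr (_ * _); rewrite mulr_sumr.
  by apply: eq_bigr => u _; rewrite mxE.
have Dpos : 0 < D%:R :> rat by rewrite ltr0n.
split.
  rewrite -(ler0z rat) E; apply: mulr_ge0; last exact: ltW.
  by apply: sumr_ge0 => u _; apply: pos.
move=> m0; have gj : good j.
  have [_ [//|h]] := xP j; move: E; rewrite m0 => /esym/eqP.
  rewrite mulf_eq0 (gt_eqF Dpos) orbF (bigD1 j) //= gt_eqF //.
  by apply: ltr_wpDr h; apply: sumr_ge0 => u _; apply: pos.
have [y ys|c c0 qE] := @farkas s (- q j).
  by rewrite -scaleN1r rdotZl mulN1r oppr_ge0; apply: gj.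
have ss : size s = N by rewrite size_map size_enum_ord.
have [k k0 [g gE]] := clear _ (fun i : 'I_N => c i).
have g0 i : 0 <= g i by rewrite -(ler0z rat) -gE; apply: mulr_ge0 => //; apply: ler0n.
exists k, (fun i => `|g i|%N); split=> // i.
apply: (@intr_inj rat); rewrite rmorphD rmorph_sum rmorphMn /=.
have -> : (m j 0 i)%:~R = - \sum_(u < N) c u * (m u 0 i)%:~R :> rat.
  have /rowP/(_ i) := qE; rewrite !mxE => /(congr1 -%R); rewrite opprK => ->; congr (- _).
  rewrite summxE ss; apply: eq_bigr => u _; rewrite mxE (nth_map u) ?size_enum_ord //.
  by rewrite nth_ord_enum mxE.
rewrite -mulr_natr mulNr mulr_suml; apply/eqP; rewrite addrC subr_eq0; apply/eqP.
apply: eq_bigr => u _; rewrite mulrAC gE rmorphMn /= -mulr_natl.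
by rewrite pmulrn gez0_abs.
Qed.

End Farkas.

(* The image of a matrix whose row lattice is saturated is a direct summand. *)
Lemma saturated_splitting N r (A : 'M[int]_(N, r)) :
  (forall (v : 'rV_r) (x : 'rV_N) (k : int), k != 0 -> k *: v = x *m A -> exists y, v = y *m A) ->
  exists B : 'M[int]_(r, N), A *m B *m A = A.
Proof.
move=> sat; have [L Lu [R Ru [d _ AE]]] := int_Smith_normal_form A.
set D : 'M[int]_(N, r) := \matrix_(i, j) _ in AE.
have DE i j : D i j = d`_i *+ (i == j :> nat) by rewrite mxE.
(* Saturation forces each nonzero invariant factor to be a unit of the integers, so transposing [D]
   inverts it. *)
have d1 (i : 'I_N) (j : 'I_r) : i = j :> nat -> d`_i = 0 \/ d`_i * d`_i = 1.
  move=> ij; have [->|d0] := eqVneq d`_i 0; [by left|right].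
  have [|y yE] := sat (row j R) (row i (invmx L)) d`_i d0.
    rewrite {1}AE -row_mul !mulmxA mulVmx // mul1mx; apply/rowP => k; rewrite !mxE.
    rewrite (bigD1 j) //= DE ij eqxx mulr1n big1 ?addr0 // => u uj.
    by rewrite DE ij (_ : (j : nat) == u = false) ?mul0r //; apply: contraNF uj => /eqP/val_inj->.
  have : row j 1%:M = y *m L *m D.
    by rewrite -(mulmxV Ru) row_mul yE {1}AE -!mulmxA mulmxV // mulmx1 !mulmxA.
  move=> /rowP/(_ j); rewrite !mxE eqxx (bigD1 i) //= DE ij eqxx mulr1n big1 ?addr0; last first.
    by move=> u ui; rewrite DE (_ : (u : nat) == j = false) ?mulr0 // -ij; apply: contraNF ui => /eqP/val_inj->.
  rewrite -ij mulr1n; set e := d`_i; set w := (y *m L) 0 i => h.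
  have /eqP : (`|w| * `|e|)%N = 1%N by rewrite -abszM -h.
  rewrite muln_eq1 => /andP[_ /eqP e1].
  suff sq (z : int) : `|z|%N = 1%N -> z * z = 1 by apply: sq.
  by case: z => [[|[|z]]|[|z]].
exists (invmx R *m D^T *m invmx L); rewrite {1 2}AE.
have -> : L *m D *m R *m (invmx R *m D^T *m invmx L) *m (L *m D *m R) = L *m (D *m D^T *m D) *m R.
  by rewrite !mulmxA -(mulmxA (L *m D)) mulmxV // mulmx1 -(mulmxA (L *m D *m D^T)) mulVmx // mulmx1.
suff -> : D *m D^T *m D = D by rewrite AE.
have DDE i k : (D *m D^T) i k = (i == k)%:R * \sum_(j < r) d`_i * d`_i *+ (i == j :> nat).
  rewrite mxE mulr_sumr; apply: eq_bigr => j _; rewrite [D^T _ _]mxE !DE.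
  have [<-|ik] := eqVneq i k; first by case: eqP => _; rewrite ?mulr1n ?mul1r // mulr0n mul0r mulr0.
  case: (eqVneq (i : nat) j) => [ij|_]; last by rewrite mulr0n mul0r mulr0.
  by rewrite -ij (_ : (k : nat) == i = false) ?mulr0n ?mulr0 ?mul0r //; apply: contraNF ik => /eqP/val_inj->.
apply/matrixP => i j; rewrite mxE.
rewrite (eq_bigr (fun k => (i == k)%:R * ((\sum_(j < r) d`_i * d`_i *+ (i == j :> nat)) * D k j))) => [|k _]; last first.
  by rewrite DDE mulrA.
rewrite (bigD1 i) //= [X in _ + X]big1 => [|k]; last by rewrite eq_sym => /negPf->; rewrite mul0r.
rewrite addr0 eqxx mul1r.
rewrite DE; case: (eqVneq (i : nat) j) => [ij|_]; last by rewrite mulr0.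
rewrite (bigD1 j) //= ij eqxx !mulr1n big1 ?addr0; last first.
  by move=> u uj; rewrite (_ : (j : nat) == u = false) //; apply: contraNF uj => /eqP/val_inj->.
by rewrite -ij; have [->|->] := d1 i j ij; rewrite ?mulr0 // mul1r.
Qed.

(** At a root x of [p * 'X - 1] the product p(x) x equals 1. *)
Lemma poly_nonroot (K : closedFieldType) (p : {poly K}) : p != 0 -> exists2 x, x != 0 & p.[x] != 0.
Proof.
move=> p0; have /closed_rootP[x] : size (p * 'X - 1) != 1%N.
  rewrite size_polyDl ?size_polyN ?size_poly1 ?size_mulX //.
    by rewrite eqSS size_poly_eq0.
  by rewrite ltnS lt0n size_poly_eq0.
rewrite rootE !hornerE subr_eq0 => /eqP px; exists x.
  by apply/eqP => z; move/eqP: px; rewrite z mulr0 eq_sym oner_eq0.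
by apply/eqP => z; move/eqP: px; rewrite z mul0r eq_sym oner_eq0.
Qed.

Lemma exprz_generic (K : closedFieldType) (d : int) : (forall x : K, x != 0 -> x ^ d = 1) -> d = 0.
Proof.
move=> h; suff pos n : (0 < n)%N -> exists2 x : K, x != 0 & x ^+ n != 1.
  case: d h => [[|n]|n] h; first by [].
    by have [x x0] := pos n.+1 isT; rewrite exprnP h // eqxx.
  have [x x0] := pos n.+1 isT; rewrite exprnP.
  by have := h x x0; rewrite NegzE -invr_expz => /eqP; rewrite invr_eq1 => /eqP ->; rewrite eqxx.
move=> n0; have [|x x0] := @poly_nonroot K ('X^n - 1).
  by rewrite -size_poly_eq0 size_XnsubC.
by rewrite !hornerE subr_eq0; exists x.
Qed.

Lemma exprz_prod (K : fieldType) (J : Type) (r : seq J) (F : J -> K) (d : int) :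
  (\prod_(j <- r) F j) ^ d = \prod_(j <- r) F j ^ d.
Proof.
elim: r => [|j r IH]; first by rewrite !big_nil exp1rz.
by rewrite !big_cons expfzMl IH.
Qed.

Lemma exprz_sum (K : fieldType) (J : Type) (r : seq J) (x : K) (d : J -> int) : x != 0 ->
  x ^ (\sum_(j <- r) d j) = \prod_(j <- r) x ^ d j.
Proof.
move=> x0; elim: r => [|j r IH]; first by rewrite !big_nil expr0z.
by rewrite !big_cons expfzDr // IH.
Qed.

Section CharacterClasses.
Variables (K : fieldType) (T : Type) (mul : T -> T -> T) (V : (T -> K) -> Prop).
Hypotheses (VD : forall f g, V f -> V g -> V (fun t => f t + g t))
  (VZ : forall a f, V f -> V (fun t => a * f t))
  (Vs : forall u f, V f -> V (fun t => f (mul u t))).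

(** [character_components] for a family with repetitions: equal characters are merged first. *)
Lemma character_classes (J : finType) (chi : J -> T -> K) (c : J -> K) :
  (forall j, character mul (chi j)) -> V (fun t => \sum_j c j * chi j t) ->
  forall j0, V (fun t => (\sum_(j | `[< chi j = chi j0 >]) c j) * chi j0 t).
Proof.
move=> chiM Vf j0; pose s := undup [seq chi j | j <- enum J].
have us : uniq s by apply: undup_uniq.
have chis j : chi j \in s by rewrite mem_undup; apply/map_f; rewrite mem_enum.
pose th (i : 'I_(size s)) := nth (chi j0) s i.
have th_inj : injective th.
  by move=> i i' /eqP; rewrite nth_uniq // => /eqP/val_inj.
have thM i : character mul (th i).
  have : th i \in s by apply: mem_nth.
  by rewrite mem_undup => /mapP[j _ ->]; apply: chiM.
pose idx j : 'I_(size s) := Ordinal (etrans (index_mem (chi j) s) (chis j)).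
have idxE j : th (idx j) = chi j by rewrite /th nth_index.
have := character_components VD VZ Vs (chi := th) (c := fun i => \sum_(j | idx j == i) c j) th_inj thM.
have -> : (fun t => \sum_i (\sum_(j | idx j == i) c j) * th i t) = (fun t => \sum_j c j * chi j t).
  apply/funext => t; rewrite [RHS](partition_big idx predT) //=; apply: eq_bigr => i _.
  by rewrite mulr_suml; apply: eq_bigr => j /eqP <-; rewrite idxE.
move=> /(_ Vf (idx j0)); rewrite idxE; congr V; apply/funext => t; congr (_ * _).
apply: eq_bigl => j; apply/eqP/asboolP => [ij|cj]; first by rewrite -idxE ij idxE.
by apply: th_inj; rewrite !idxE.
Qed.

End CharacterClasses.

(** * Characters and regular functions of a torus *)

Section TorusCoordinates.
Variables (K : closedFieldType) (T : alg_group K).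

Lemma torus_coordinates : torus T -> exists r (tau : T -> 'I_r -> K),
  [/\ forall t i, tau t i != 0, forall s t i, tau (ag_mul s t) i = tau s i * tau t i,
      forall x, (forall i, x i != 0) -> exists t, tau t = x, injective tau & chart setT tau].
Proof.
move=> [r [phi [iso phiM]]]; exists r, (fun t i => (set_val (phi t) : 'rV[K]_r) 0 i).
have [_ [psi [_ phiK psiK]]] := iso.
split=> [t i|s t i|x x0|s t st|].
- by have := set_valP (phi t); apply.
- exact: phiM.
- pose v : affine_space K r := \row_i x i.
  have Sv : [set x : affine_space K r | forall i, (x : 'rV[K]_r) 0 i != 0] v by move=> i; rewrite mxE.
  exists (psi (SigSub (mem_set Sv))); apply/funext => i.
  by rewrite psiK /= mxE.
- apply: (can_inj phiK); apply: val_inj; apply/rowP => i.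
  by have := congr1 (fun f => f i) st.
exact: (isomorphism_chart iso (sub_space_chart _ (affine_space_chart K r))).
Qed.

Variables (r : nat) (tau : T -> 'I_r -> K).
Hypotheses (tau0 : forall t i, tau t i != 0)
  (tauM : forall s t i, tau (ag_mul s t) i = tau s i * tau t i)
  (tau_surj : forall x, (forall i, x i != 0) -> exists t, tau t = x)
  (tau_inj : injective tau) (tau_chart : chart setT tau).

Definition torus_char (v : 'I_r -> int) (t : T) : K := \prod_i tau t i ^ v i.

Lemma torus_charM v : character (@ag_mul K T) (torus_char v).
Proof. by move=> s t; rewrite -big_split; apply: eq_bigr => i _; rewrite tauM expfzMl. Qed.

Lemma torus_char_neq0 v t : torus_char v t != 0.
Proof. by apply/prodf_neq0 => i _; rewrite expfz_neq0. Qed.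

Lemma torus_char_comb N (x : 'I_N -> int) (m : 'I_N -> 'I_r -> int) t :
  torus_char (fun i => \sum_j x j * m j i) t = \prod_j torus_char (m j) t ^ x j.
Proof.
rewrite /torus_char; under eq_bigr => i _ do rewrite exprz_sum //.
rewrite exchange_big; apply: eq_bigr => j _ /=; rewrite exprz_prod.
by apply: eq_bigr => i _; rewrite exprz_exp mulrC.
Qed.

Lemma torus_char_inj : injective torus_char.
Proof.
move=> v v' vv; apply/funext => i; apply/eqP; rewrite -subr_eq0; apply/eqP.
apply: (@exprz_generic K) => x x0.
have [t tE] : exists t, tau t = fun j => if j == i then x else 1.
  by apply: tau_surj => j; case: ifP => // _; apply: oner_neq0.
have E u : torus_char u t = x ^ u i.
  rewrite /torus_char (bigD1 i) //= tE eqxx big1 ?mulr1 // => j /negPf ->.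
  by rewrite exp1rz.
rewrite expfzDr // -invr_expz -(E v) -(E v') vv; apply: divff.
by rewrite E expfz_neq0.
Qed.

Lemma torus_mulC (s t : T) : ag_mul s t = ag_mul t s.
Proof. by apply: tau_inj; apply/funext => i; rewrite !tauM mulrC. Qed.

(** Extended by arbitrary values to affine space, [f] is regular where [chi], the product of the
    coordinates, is nonzero. A power of [chi] clears the denominator, so that [f] is a Laurent
    polynomial. *)
Lemma torus_regular f : (forall t, regular_at t f) ->
  exists k (c : 'I_k -> K) (v : 'I_k -> 'I_r -> int), injective v /\
    forall t, f t = \sum_i c i * torus_char (v i) t.
Proof.
move=> rf; pose chi : {mpoly K[r]} := \prod_i 'X_i.
pose co (x : affine_space K r) i := (x : 'rV[K]_r) 0 i.
have chiE x : chi.@[x] = \prod_i x i.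
  by rewrite rmorph_prod; apply: eq_bigr => i _; apply: mevalXU.
have chi0 x : chi.@[x] != 0 -> forall i, x i != 0 by rewrite chiE => /prodf_neq0 h i; apply: h.
have /choice[lift liftP] : forall x : affine_space K r, exists t, chi.@[co x] != 0 -> tau t = co x.
  move=> x; have [c0|/chi0/tau_surj[t tE]] := eqVneq chi.@[co x] 0; last by exists t.
  by exists (ag_one T); rewrite ?c0 ?eqxx.
pose f' x := f (lift x).
have [||M [P PE]] := @bounded_denominator K (affine_space K r) setT r co chi f' (affine_space_chart K r).
- move=> w _; exists (\row_i w i) => //; apply/funext => i; exact: mxE.
- move=> u _ cu; have [_ regT _] := tau_chart; have [_ regA _] := affine_space_chart K r.
  have [p [q [qu fE]]] := (regT (lift u) f I).1 (rf _).
  rewrite liftP // in qu; apply/(regA _ _ I); exists (p * chi), (q * chi).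
  rewrite mevalM mulf_neq0 //; split=> // y _; rewrite mevalM mulf_eq0 negb_or => /andP[qy cy].
  have -> : f' y = p.@[co y] / q.@[co y] by rewrite /f' fE // liftP.
  by rewrite !mevalM -mulf_div divff // mulr1.
exists (size (msupp P)), (fun i => P@_(nth 0%MM (msupp P) i)),
  (fun i u => (nth 0%MM (msupp P) i u)%:Z - M%:Z); split=> [i i' ii'|t].
  have ii u := congr1 (fun h : 'I_r -> int => h u) ii'.
  have E : nth 0%MM (msupp P) i = nth 0%MM (msupp P) i'.
    by apply/mnmP => u; have := ii u => /= /addIr [].
  have := nth_uniq 0%MM (ltn_ord i) (ltn_ord i') (msupp_uniq P).
  by rewrite E eqxx => /esym/eqP/val_inj.
pose x : affine_space K r := \row_i tau t i.
have cox : co x = tau t by apply/funext => i; rewrite /co mxE.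
have cx : chi.@[co x] != 0 by rewrite chiE cox; apply/prodf_neq0 => i _.
have lx : lift x = t by apply: tau_inj; rewrite liftP.
have := PE x I cx; rewrite /f' lx cox => E.
apply: (mulfI (expf_neq0 M (_ : chi.@[tau t] != 0))); first by rewrite -cox.
rewrite E mevalE (big_nth 0%MM) big_mkord mulr_sumr; apply: eq_bigr => i _.
rewrite mulrCA; congr (_ * _); rewrite chiE -prodrXl -big_split; apply: eq_bigr => u _ /=.
by rewrite !exprnP -expfzDr // addrC subrK.
Qed.

End TorusCoordinates.

Lemma reg_exp (K : closedFieldType) (X : fspace K) (x : X) f n : charted X ->
  regular_at x f -> regular_at x (fun y => f y ^+ n).
Proof.
move=> nX rf; elim: n => [|n IH]; first by apply: reg_C.
have -> : (fun y => f y ^+ n.+1) = fun y => f y * f y ^+ n by apply/funext => y; rewrite exprS.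
exact: reg_M.
Qed.

Lemma reg_exprz (K : closedFieldType) (X : fspace K) (x : X) f (d : int) : charted X ->
  regular_at x f -> f x != 0 -> regular_at x (fun y => f y ^ d).
Proof.
move=> nX rf f0; case: d => n; first exact: reg_exp.
have -> : (fun y => f y ^ Negz n) = fun y => (f y ^+ n.+1)^-1 by [].
by apply: reg_V => //; [apply: reg_exp|apply: expf_neq0].
Qed.

Lemma reg_prod (K : closedFieldType) (X : fspace K) (x : X) (J : Type) (r : seq J) F : charted X ->
  (forall j, regular_at x (F j)) -> regular_at x (fun y => \prod_(j <- r) F j y).
Proof.
move=> nX rF; elim: r => [|j r IH].
  have -> : (fun y => \prod_(j <- [::]) F j y) = fun=> 1 by apply/funext => y; rewrite big_nil.
  exact: reg_C.
have -> : (fun y => \prod_(j <- j :: r) F j y) = fun y => F j y * \prod_(j <- r) F j y.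
  by apply/funext => y; rewrite big_cons.
exact: reg_M.
Qed.

Lemma morph_at_open (K : closedFieldType) (X Z : fspace K) (U : set X) (f : X -> Z) (u : sub_space U) :
  open U -> morph_at (fun v : sub_space U => f (set_val v)) u -> morph_at f (set_val u).
Proof.
move=> oU [fc fr]; have nU : nbhs (set_val u) U by apply: open_nbhs_nbhs; split=> //; apply: set_valP.
split=> [V /fc/nbhs_sub_space[O nO OV]|h /fr[g [rg /nbhs_sub_space[O nO gO]]]].
  by apply: filterS2 nU nO => y Uy Oy; have := OV (SigSub (mem_set Uy)) Oy.
apply: regular_at_local rg; apply: filterS2 nU nO => y Uy Oy.
by have /= -> := gO (SigSub (mem_set Uy)) Oy.
Qed.

(** * The slice of an affine toric variety *)

Section Toric.
Variables (K : closedFieldType) (T : alg_group K) (Y : fspace K) (a : T -> Y -> Y).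
Hypothesis toric : affine_toric_variety a.

(* [s] are the characters of positive lambda-weight among the monomial coordinates, [ell]
   retracts Y onto the closed orbit, and [ell y = 1] is a slice through the limit point [ystar]. *)
Lemma toric_slice : exists (y0 : Y) (n : nat) (lam : 'I_n -> nat) (s : Y -> 'I_n -> K)
    (chi : 'I_n -> T -> K) (ell : Y -> T) (la : K -> T) (ystar : Y) (tinv : Y -> T),
  [/\ [/\ charted Y, forall s t : T, ag_mul s t = ag_mul t s,
          forall f, (forall t : T, regular_at t f) -> char_sums (@ag_mul K T) (fun u (_ : unit) => f u),
          forall t y, morph_at (a t) y &
          forall f g, (forall y, regular_at y f) -> (forall y, regular_at y g) ->
            (forall t, f (a t y0) = g (a t y0)) -> forall y, f y = g y],
      [/\ forall i, (0 < lam i)%N, forall i, character (@ag_mul K T) (chi i),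
          forall t y i, s (a t y) i = chi i t * s y i, forall i, s y0 i = 1 &
          forall y i, regular_at y (fun y => s y i)],
      [/\ forall y, morph_at ell y, ell y0 = ag_one T,
          forall t y, ell (a t y) = ag_mul (ell (a t y0)) (ell y),
          forall y, ell (a (ag_inv (ell y)) y) = ag_one T &
          forall w y, w != 0 -> ell (a (la w) y) = ell y /\
            forall i, s (a (la w) y) i = w ^+ lam i * s y i],
      [/\ ell ystar = ag_one T, forall i, s ystar i = 0,
          forall y, ell y = ag_one T -> (forall i, s y i = 0) -> y = ystar,
          forall f, regular_at ystar f -> exists P Q : {mpoly K[n]}, Q.@[fun=> 0] != 0 /\
            forall y, ell y = ag_one T -> Q.@[s y] != 0 -> f y = P.@[s y] / Q.@[s y] &
          forall V : set Y, nbhs ystar V -> exists2 Q : {mpoly K[n]}, Q.@[fun=> 0] != 0 &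
            forall y, ell y = ag_one T -> Q.@[s y] != 0 -> V y] &
      [/\ forall y, (forall i, s y i != 0) -> exists t, y = a t y0,
          forall t, tinv (a t y0) = t &
          forall t, morph_at tinv (a t y0)]].
Proof.
have [[tor [n0 [Z [cZ [phi iso]]]] irrY normY [actm act1 actM]] [y0 [oO dO [j [jiso jE]]]]] := toric.
have [ch0 cl0] := affine_variety_chart cZ iso.
set c := (fun x i => _) in ch0 cl0.
have nY : charted Y by move=> y; exists setT, n0, c.
have nT : charted T by exact: alg_group_charted.
have [r [tau [tau0 tauM tau_surj tau_inj tau_ch]]] := torus_coordinates tor.
pose chr := torus_char tau.
have chrM := torus_charM tauM; have chr0 := torus_char_neq0 tau0.
have mulC := torus_mulC tauM tau_inj.
have tauR t i : regular_at t (fun t => tau t i) by apply: (reg_coord i tau_ch I).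
have mact t y : morph_at (a t) y.
  have /morphismP mm := actm.
  exact: (morph_at_comp (morph_at_pair nT nY nY (morph_at_const t y nY) (morph_at_id y)) (mm (t, y))).
have morb t : morph_at (fun t => a t y0) t.
  have /morphismP mm := actm.
  exact: (morph_at_comp (morph_at_pair nT nY nT (morph_at_id t) (morph_at_const y0 t nT)) (mm (t, y0))).
have dens f g : (forall y, regular_at y f) -> (forall y, regular_at y g) ->
    (forall t, f (a t y0) = g (a t y0)) -> forall y, f y = g y.
  move=> rf rg fg y; apply/eqP; rewrite -subr_eq0; apply/negPn/negP => nz.
  have rd : regular_at y (fun y => f y + -1 * g y) by apply: reg_D => //; apply: reg_M => //; apply: reg_C.
  have := reg_neq0 nY rd; rewrite /= mulN1r => /(_ nz).
  rewrite {1}nbhsE => -[O [oO' Oy] OV].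
  have [z [Oz [t _ tz]]] := dO O (ex_intro _ y Oy) oO'.
  by have := OV z Oz; rewrite /= -tz mulN1r fg subrr eqxx.
have regY_poly f : (forall y, regular_at y f) -> forall t, regular_at t (fun t => f (a t y0)).
  by move=> rf t; apply: ((morb t).2 f (rf _)).
have Treg f : (forall t : T, regular_at t f) -> char_sums (@ag_mul K T) (fun u (_ : unit) => f u).
  move=> /(torus_regular tau0 tau_surj tau_inj tau_ch)[k [C [v [_ fE]]]].
  by exists 'I_k, (fun i => chr (v i)); split=> [i|_]; [exact: chrM|exists C].
(* Functions on T that extend from the open orbit to Y: a space stable under translations, so each
   character occurring in a coordinate of Y extends by itself. *)
pose Vext (f : T -> K) := exists2 g : Y -> K, (forall y, regular_at y g) & forall t, g (a t y0) = f t.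
have VD f g : Vext f -> Vext g -> Vext (fun t => f t + g t).
  move=> [f' rf fE] [g' rg gE]; exists (fun y => f' y + g' y) => [y|t]; first exact: reg_D.
  by rewrite fE gE.
have VZ b f : Vext f -> Vext (fun t => b * f t).
  move=> [f' rf fE]; exists (fun y => b * f' y) => [y|t]; last by rewrite fE.
  by apply: reg_M => //; apply: reg_C.
have Vs u f : Vext f -> Vext (fun t => f (ag_mul u t)).
  move=> [f' rf fE]; exists (fun y => f' (a u y)) => [y|t]; last by rewrite -fE actM.
  exact: ((mact u y).2 f' (rf _)).
have [k0 [C [v [v_inj cE]]]] : exists (k0 : 'I_n0 -> nat) (C : forall i, 'I_(k0 i) -> K)
    (v : forall i, 'I_(k0 i) -> 'I_r -> int), (forall i, injective (v i)) /\
    forall i t, c (a t y0) i = \sum_k C i k * chr (v i k) t.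
  have H i : exists k (C : 'I_k -> K) (v : 'I_k -> 'I_r -> int), injective v /\
      forall t, c (a t y0) i = \sum_k C k * chr (v k) t.
    apply: (torus_regular tau0 tau_surj tau_inj tau_ch); apply: (regY_poly (fun y => c y i)) => y.
    exact: (reg_coord i ch0 I).
  pose k0 i := sval (cid (H i)); pose C i := sval (cid (svalP (cid (H i)))).
  pose v i := sval (cid (svalP (cid (svalP (cid (H i)))))).
  exists k0, C, v; split=> i; first exact: (svalP (cid (svalP (cid (svalP (cid (H i))))))).1.
  exact: (svalP (cid (svalP (cid (svalP (cid (H i))))))).2.
pose J : finType := {i : 'I_n0 & 'I_(k0 i)}.
(* A term with coefficient 0 gets the trivial character, since its own character need not extend to
   Y. *)
pose vJ (q : J) i := if C (tag q) (tagged q) == 0 then 0 else v (tag q) (tagged q) i.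
have /choice[eJ eJP] : forall q, exists g : Y -> K, (forall y, regular_at y g) /\ forall t, g (a t y0) = chr (vJ q) t.
  move=> [i k]; rewrite /vJ /=; have [C0|C0] := eqVneq (C i k) 0.
    exists (fun=> 1); split=> [y|t]; first exact: reg_C.
    by rewrite /chr /torus_char big1 // => u _; rewrite expr0z.
  have chi_inj : injective (fun k => chr (v i k)).
    by move=> k1 k2 /(torus_char_inj tau_surj)/v_inj.
  have [|g rg gE] := character_components VD VZ Vs (c := C i) chi_inj (fun k => chrM _) _ k.
    exists (fun y => c y i) => [y|t]; last exact: cE.
    exact: (reg_coord i ch0 I).
  exists (fun y => (C i k)^-1 * g y); split=> [y|t]; first by apply: reg_M => //; apply: reg_C.
  by rewrite gE mulKf.
pose N := #|J|; pose m (q : 'I_N) := vJ (enum_val q); pose e y (q : 'I_N) := eJ (enum_val q) y.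
have re y q : regular_at y (fun y => e y q) by have [h _] := eJP (enum_val q); apply: h.
have eO t q : e (a t y0) q = chr (m q) t by have [_ h] := eJP (enum_val q); apply: h.
pose Q i : {mpoly K[N]} := \sum_(q : 'I_N | tag (enum_val q) == i) (C (tag (enum_val q)) (tagged (enum_val q)))%:MP * 'X_q.
have cQ y i : setT y -> c y i = (Q i).@[e y].
  move=> _; move: y; apply: dens => [y|y|t]; first exact: (reg_coord i ch0 I).
    by apply: reg_ev => // q; apply: re.
  pose F i' (k : 'I_(k0 i')) := (i' == i)%:R * (C i' k * chr (v i' k) t).
  rewrite cE meval_sum; transitivity (\sum_(q : J) F (tag q) (tagged q)).
    rewrite -(@sig_big_dep _ 0 +%R _ _ xpredT (fun _ => xpredT) F) /= (bigD1 i) //= [X in _ = _ + X]big1.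
      by rewrite addr0; apply: eq_bigr => k _; rewrite /F eqxx mul1r.
    by move=> i' /negPf i'i; apply: big1 => k _; rewrite /F i'i mul0r.
  rewrite (reindex _ (onW_bij _ (@enum_val_bij J))) [RHS]big_mkcond; apply: eq_bigr => q _ /=.
  rewrite /F; case: eqP => // _; rewrite ?mul1r ?mul0r // mevalM mevalC mevalXU eO /m /vJ.
  by case: eqP => [->|_]; rewrite ?mul0r.
have /choice[P0 eP0] : forall q, exists P : {mpoly K[n0]}, forall y, setT y -> e y q = P.@[c y].
  by move=> q; apply: (regular_poly ch0 cl0) => y _; apply: re.
have che : chart setT e := chart_change (fun y q Ty => eP0 q y Ty) cQ ch0.
have cle : closed_chart setT e := closed_chart_change (fun y q Ty => eP0 q y Ty) cQ cl0.
have e_inj y y' : e y = e y' -> y = y'.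
  move=> ee; have [_ [psi [_ phiK _]]] := iso; apply: (can_inj phiK); apply: val_inj; apply/rowP => i.
  by have := cQ y i I; rewrite ee -cQ.
have eM t y q : e (a t y) q = chr (m q) t * e y q.
  move: y; apply: dens => [y|y|u]; first exact: ((mact t y).2 _ (re (a t y) q)).
    by apply: reg_M => //; apply: reg_C.
  by rewrite -actM !eO; apply: chrM.
have chr1 u : chr u (ag_one T) = 1.
  have h : chr u (ag_one T) = chr u (ag_one T) * chr u (ag_one T).
    by have := chrM u (ag_one T) (ag_one T); rewrite ag_mul1.
  by apply: (mulfI (chr0 u (ag_one T))); rewrite mulr1; exact: (esym h).
have e1 q : e y0 q = 1 by rewrite -(act1 y0) eO chr1.
(* The coordinates whose weight under [lam0] is 0 are invertible on Y, since some monomial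
   containing them is 1; the others are contracted to 0 by the cocharacter. *)
have [lam0 lam0P] := generic_form (fun q => \row_i m q i).
pose w q := \sum_i m q i * lam0 i.
have wE q : \sum_i (\row_i m q i) 0 i * lam0 i = w q by apply: eq_bigr => i _; rewrite mxE.
have w_ge0 q : 0 <= w q by rewrite -wE; have [] := lam0P q.
have unit_e q y : w q = 0 -> e y q != 0.
  move=> wq; have [_] := lam0P q; rewrite wE => /(_ wq)[k [b [k_gt0 kb]]].
  have : e y q ^+ k * \prod_u e y u ^+ b u = 1.
    move: y; apply: dens => [y|y|t].
    - apply: reg_M => //; first exact: reg_exp.
      by apply: reg_prod => // u; apply: reg_exp.
    - exact: reg_C.
    rewrite eO (eq_bigr (fun u => chr (m u) t ^ (b u)%:Z)) => [|u _]; last by rewrite eO.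
    rewrite /chr -(torus_char_comb tau0) exprnP /torus_char exprz_prod -big_split.
    apply: big1 => i _ /=; rewrite exprz_exp -expfzDr // (_ : _ + _ = 0) ?expr0z //.
    rewrite -[RHS](kb i) mxE -mulr_natr natz; congr (_ + _); apply: eq_bigr => u _.
    by rewrite mxE -mulr_natl natz.
  move=> E; apply/eqP => z; move/eqP: E.
  by rewrite z expr0n eqn0Ngt k_gt0 mul0r eq_sym oner_eq0.
(* Exponents of the invertible coordinates [ub]; the other rows are 0 and the other entries of [ub]
   are 1, to keep a single index set. *)
pose A : 'M[int]_(N, r) := \matrix_(q, i) if w q == 0 then m q i else 0.
pose ub y q := if w q == 0 then e y q else 1.
have rub y q : regular_at y (fun y => ub y q).
  by rewrite /ub; case: eqP => _; [exact: re|exact: reg_C].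
have ub0 y q : ub y q != 0.
  by rewrite /ub; case: (w q =P 0) => [wq|_]; [exact: (unit_e q y wq)|exact: oner_neq0].
pose rA q i := A q i.
have ubO t q : ub (a t y0) q = chr (rA q) t.
  rewrite /ub; case: (eqVneq (w q) 0) => wq.
    by rewrite eO; congr (chr _ t); apply/funext => i; rewrite /rA mxE wq eqxx.
  by rewrite /chr /torus_char big1 // => i _; rewrite /rA mxE (negPf wq) expr0z.
have ubM t y q : ub (a t y) q = chr (rA q) t * ub y q.
  move: y; apply: dens => [y|y|u]; first exact: ((mact t y).2 _ (rub (a t y) q)).
    by apply: reg_M => //; apply: reg_C.
  by rewrite -actM !ubO; apply: chrM.
have ub1 q : ub y0 q = 1 by rewrite -(act1 y0) ubO; apply: chr1.
have irr (y1 y2 : Y) (V1 V2 : set Y) : nbhs y1 V1 -> nbhs y2 V2 -> exists y, V1 y /\ V2 y.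
  rewrite !nbhsE => -[O1 [oO1 O1y] OV1] [O2 [oO2 O2y] OV2].
  have [_ /(_ O1 O2 oO1 oO2 (ex_intro _ y1 O1y) (ex_intro _ y2 O2y))[y [Oy1 Oy2]]] := irrY.
  by exists y; split; [apply: OV1|apply: OV2].
have [psi [psim phiK psiK]] := jiso.2.
pose tinv y := match pselect (range (a^~ y0) y) with
  | left h => psi (SigSub (mem_set h)) | right _ => ag_one T end.
have tinvE t : tinv (a t y0) = t.
  rewrite /tinv; case: pselect => [h|[]]; last by exists t.
  by rewrite -[RHS]phiK; congr psi; apply: val_inj; rewrite [RHS]jE.
have tinvm t : morph_at tinv (a t y0).
  have := @morph_at_open K Y T _ tinv (j t) oO; rewrite jE; apply.
  have -> : (fun u : sub_space (range (a^~ y0)) => tinv (set_val u)) = psi.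
    by apply/funext => u; rewrite -{1}(psiK u) jE tinvE.
  by have /morphismP := psim; apply.
have orbP y : range (a^~ y0) y -> exists t, y = a t y0 by move=> [t _ <-]; exists t.
have nO : nbhs y0 (range (a^~ y0)).
  by apply: open_nbhs_nbhs; split=> //; exists (ag_one T) => //; apply: act1.
have [_ _ /(_ y0 (range (a^~ y0)) I)[/(_ nO)[q0 q0y q0O] _]] := che.
(* Here normality is used. If a multiple of [u] lies in the row lattice, the rational function given
   by the character [u] is integral over K[Y], hence regular. Its expansion in the coordinates
   exhibits [u] as a nonnegative combination of weights; as [lam0] vanishes on [u], only weights on
   which it vanishes can occur. *)
have sat (u : 'rV_r) (x : 'rV_N) (k : int) : k != 0 -> k *: u = x *m A -> exists z, u = z *m A.
  wlog k_gt0 : x k / 0 < k.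
    move=> H kn0 E; have [k_gt0|k_lt0|k0'] := ltgtP k 0; last by rewrite k0' eqxx in kn0.
      apply: (H (- x) (- k)); rewrite ?oppr_gt0 ?oppr_eq0 //.
      by rewrite scaleNr mulNmx E.
    exact: (H x k).
  move=> _ E; pose u' i := u 0 i; pose n := `|k|%N.
  have nk : k = n%:Z by rewrite /n gtz0_abs.
  have n_gt0 : (0 < n)%N by rewrite absz_gt0 gt_eqF.
  pose Fu y := chr u' (tinv y).
  have [y _|M [P PE]] := bounded_denominator (chi := q0) (f := Fu) che cle.
    move=> /(q0O y I)/orbP[t ->].
    have rchr : regular_at t (chr u').
      by apply: reg_prod => // i; apply: reg_exprz.
    by apply: (tinvm t).2; rewrite tinvE.
  pose aa y := P.@[e y]; pose bb y := q0.@[e y] ^+ M * q0.@[e y].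
  pose ux y := \prod_q ub y q ^ x 0 q.
  have re' y p : regular_at y (fun y => p.@[e y]) by apply: reg_ev => // q; apply: re.
  have rux y : regular_at y ux by apply: reg_prod => // q; apply: reg_exprz.
  have rbb y : regular_at y bb by apply: (reg_M nY (reg_exp M nY (re' y q0)) (re' y q0)).
  pose a' y := q0.@[e y] * aa y.
  have ra' y : regular_at y a' by apply: (reg_M nY (re' y q0) (re' y P)).
  have a'E t : a' (a t y0) = bb (a t y0) * chr u' t.
    rewrite /a' /bb /aa; have [->|qn0] := eqVneq q0.@[e (a t y0)] 0; first by rewrite mul0r mulr0 mul0r.
    by rewrite -(PE _ I qn0) /Fu tinvE; ring.
  have uxO t : ux (a t y0) = chr u' t ^+ n.
    rewrite /ux (eq_bigr (fun q => chr (rA q) t ^ x 0 q)) => [|q _]; last by rewrite ubO.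
    rewrite /chr -(torus_char_comb tau0) exprnP /torus_char exprz_prod; apply: eq_bigr => i _.
    rewrite exprz_exp; congr (_ ^ _); have /rowP/(_ i) := E; rewrite !mxE nk mulrC => ->.
    by apply: eq_bigr.
  pose cc (i : 'I_n) y := if i == 0%N :> nat then - ux y else 0.
  have [||||y|q rq aq] := normY a' bb n cc.
  - by move=> y _; apply: ra'.
  - by move=> y _; apply: rbb.
  - by exists y0; rewrite mulf_neq0 // expf_neq0.
  - move=> i y _; rewrite /cc; case: eqP => _; last exact: reg_C.
    have -> : (fun y => - ux y) = fun y => -1 * ux y by apply/funext => z; rewrite mulN1r.
    by apply: reg_M => //; apply: reg_C.
  - have -> : \sum_(i < n) cc i y * a' y ^+ i * bb y ^+ (n - i) = - (ux y * bb y ^+ n).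
      rewrite (bigD1 (Ordinal n_gt0)) //= /cc /= expr0 mulr1 subn0 big1 ?addr0 ?mulNr // => i i0.
      by rewrite (_ : (i == 0%N :> nat) = false) ?mul0r //; apply: contraNF i0 => /eqP i0; apply/eqP/val_inj.
    apply/eqP; rewrite subr_eq0; apply/eqP; move: y; apply: dens => [y|y|t].
    + exact: reg_exp.
    + by apply: reg_M => //; apply: reg_exp.
    by rewrite a'E uxO exprMn mulrC.
  have qO t : q (a t y0) = chr u' t.
    apply/eqP; rewrite -subr_eq0; apply/negPn/negP => nz.
    have rd : regular_at t (fun t => q (a t y0) + -1 * chr u' t).
      apply: reg_D => //; first by apply: regY_poly => y; apply: rq.
      by apply: reg_M => //; [apply: reg_C|apply: reg_prod => // i; apply: reg_exprz].
    have rd' : regular_at (a t y0) (fun y => q (a (tinv y) y0) + -1 * chr u' (tinv y)).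
      by apply: ((tinvm t).2 (fun t => q (a t y0) + -1 * chr u' t)); rewrite tinvE.
    have := reg_neq0 nY rd'; rewrite /= tinvE mulN1r => /(_ nz) n1.
    have n1' : nbhs (a t y0) (range (a^~ y0)) by apply: open_nbhs_nbhs; split=> //; exists t.
    have nb : nbhs y0 [set y | bb y != 0].
      by apply: reg_neq0 => //; rewrite /bb mulf_neq0 // expf_neq0.
    have [y [[/orbP[t' ->] /=]]] := irr _ _ _ _ (filterI n1' n1) nb.
    rewrite tinvE mulN1r subr_eq0 => /eqP ne nb'; apply: ne; apply: (mulIf nb').
    by rewrite -aq a'E mulrC.
  have [R RE] := regular_poly che cle (fun y _ => rq y I).
  have [mo moR moE] : exists2 mo : 'X_{1..N}, mo \in msupp R & forall i, u 0 i = \sum_q (mo q)%:Z * m q i.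
    pose sz := size (msupp R); pose mon (i : nat) := nth 0%MM (msupp R) i.
    (* The expansion of [q] minus the character [u'], the latter with coefficient -1 at the last
       index, is a vanishing combination of characters: some monomial must have the character
       [u']. *)
    pose thv (i : 'I_sz.+1) := if (i < sz)%N then (fun i' => \sum_q (mon i q)%:Z * m q i') else u'.
    pose co (i : 'I_sz.+1) := if (i < sz)%N then R@_(mon i) else -1.
    have := @character_classes K T (@ag_mul K T) (fun f => forall t, f t = 0)
      (fun f g f0 g0 t => etrans (congr2 +%R (f0 t) (g0 t)) (addr0 0))
      (fun b f f0 t => etrans (congr1 ( *%R b) (f0 t)) (mulr0 b))
      (fun u f f0 t => f0 _) _ (fun i => chr (thv i)) co (fun i => chrM _).
    have sum0 t : \sum_i co i * chr (thv i) t = 0.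
      rewrite big_ord_recr /= /co /thv ltnn mulN1r -qO RE // mevalE (big_nth 0%MM) big_mkord.
      apply/eqP; rewrite subr_eq0; apply/eqP; apply: eq_bigr => i _.
      rewrite /= ltn_ord /chr (torus_char_comb tau0); congr (_ * _).
      by apply: eq_bigr => q' _; rewrite eO exprnP.
    move=> /(_ sum0 ord_max (ag_one T))/eqP; rewrite mulf_eq0 (negPf (chr0 _ _)) orbF.
    have thm : thv ord_max = u' by rewrite /thv ltnn.
    rewrite thm => clsum; have [[i [isz iu]]|none] := pselect (exists i : 'I_sz.+1, (i < sz)%N /\ chr (thv i) = chr u').
      exists (mon i); first exact: mem_nth.
      move: iu => /(torus_char_inj tau_surj); rewrite /thv isz => /(congr1 (fun h => h _)) iu i'.
      exact: (esym (iu i')).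
    move/eqP: clsum; rewrite (bigD1 ord_max) /=; last by apply/asboolP; rewrite thm.
    rewrite big1 ?addr0 /co ?ltnn; first by move/eqP; rewrite oppr_eq0 oner_eq0.
    move=> i /andP[/asboolP iu imax]; case: none; exists i; split=> //.
    by rewrite ltn_neqAle -ltnS ltn_ord andbT; apply: contra imax => /eqP h; apply/eqP/val_inj.
  have moA q' : (mo q')%:Z * w q' = 0.
    have tot : \sum_q (mo q)%:Z * w q = 0.
      have : n%:Z * \sum_i u 0 i * lam0 i = 0.
        rewrite mulr_sumr (eq_bigr (fun i => \sum_q x 0 q * (A q i * lam0 i))) => [|i _].
          rewrite exchange_big big1 // => q1 _ /=; rewrite -mulr_sumr.
          have [wq|wq] := eqVneq (w q1) 0.
            have -> : \sum_i A q1 i * lam0 i = w q1.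
              by apply: eq_bigr => i _; rewrite mxE wq eqxx.
            by rewrite wq mulr0.
          by rewrite big1 ?mulr0 // => i _; rewrite mxE (negPf wq) mul0r.
        have /rowP/(_ i) := E; rewrite !mxE nk mulrA => ->; rewrite mulr_suml.
        by apply: eq_bigr => q1 _; rewrite mulrA.
      move/eqP; rewrite mulf_eq0 eqz_nat (gtn_eqF n_gt0) /= => /eqP ul.
      apply: etrans ul; transitivity (\sum_q \sum_i (mo q)%:Z * m q i * lam0 i).
        by apply: eq_bigr => q1 _; rewrite /w mulr_sumr; apply: eq_bigr => i _; rewrite mulrA.
      by rewrite exchange_big; apply: eq_bigr => i _ /=; rewrite moE mulr_suml.
    apply: (psumr_eq0P _ tot) => // q1 _; apply: mulr_ge0 => //; exact: w_ge0.
  exists (\row_q (mo q)%:Z); apply/rowP => i; rewrite moE mxE; apply: eq_bigr => q1 _.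
  rewrite !mxE; case: (eqVneq (w q1) 0) => wq //.
  by have /eqP := moA q1; rewrite mulf_eq0 (negPf wq) orbF => /eqP ->; rewrite !mul0r.
have [B AB] := saturated_splitting sat.
(* The splitting [B] lifts the torus of invertible coordinates back into T, which defines the
   retraction; [chr_ell] says that translating the base point by [ell y] gives the invertible
   coordinates of [y]. *)
have /choice[ell ellE] : forall y, exists t, tau t = fun i => \prod_q ub y q ^ B i q.
  by move=> y; apply: tau_surj => i; apply/prodf_neq0 => q _; apply: expfz_neq0.
have tau1 i : tau (ag_one T) i = 1.
  by apply: (mulfI (tau0 (ag_one T) i)); rewrite -tauM ag_mul1 mulr1.
have ell_eq1 y : (forall q, ub y q = 1) -> ell y = ag_one T.
  move=> u1; apply: tau_inj; rewrite ellE; apply/funext => i; rewrite tau1 big1 // => q _.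
  by rewrite u1 exp1rz.
have mell y : morph_at ell y.
  apply: (morph_at_chart nY tau_ch) => [//||i]; first exact: filterT.
  have -> : (fun y => tau (ell y) i) = fun y => \prod_q ub y q ^ B i q.
    by apply/funext => z; rewrite ellE.
  by apply: reg_prod => // q; apply: reg_exprz.
have ell_M t y : ell (a t y) = ag_mul (ell (a t y0)) (ell y).
  apply: tau_inj; apply/funext => i; rewrite tauM !ellE -big_split; apply: eq_bigr => q _.
  by rewrite ubM ubO expfzMl.
have chr_ell y q : chr (rA q) (ell y) = ub y q.
  move: y; apply: dens => [y|y|t] //.
    apply: ((mell y).2 (chr (rA q))); apply: reg_prod => // i; exact: reg_exprz.
  rewrite ubO /chr {1}/torus_char ellE.
  rewrite (eq_bigr (fun i => torus_char tau (fun i' => \sum_u (B i u * rA q i) * rA u i') t)) => [|i _]; last first.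
    rewrite (torus_char_comb tau0) exprz_prod; apply: eq_bigr => u _.
    by rewrite ubO exprz_exp.
  rewrite /torus_char exchange_big; apply: eq_bigr => i' _ /=; rewrite -exprz_sum //; congr (_ ^ _).
  have /matrixP/(_ q i') := AB; rewrite /rA => <-.
  rewrite [(A *m B *m A) q i']mxE exchange_big; apply: eq_bigr => u _ /=.
  rewrite [(A *m B) q u]mxE mulr_suml; apply: eq_bigr => i _; congr (_ * _); apply: mulrC.
have ub_slice y q : ell y = ag_one T -> ub y q = 1 by move=> y1; rewrite -chr_ell y1; apply: chr1.
have ell_slice y : ell (a (ag_inv (ell y)) y) = ag_one T.
  apply: ell_eq1 => q; rewrite ubM -chr_ell.
  by have := chrM (rA q) (ag_inv (ell y)) (ell y); rewrite ag_mulV => <-; apply: chr1.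
have /choice[la laE] : forall x : K, exists t, x != 0 -> tau t = fun i => x ^ lam0 i.
  move=> x; have [->|x0] := eqVneq x 0; first by exists (ag_one T).
  by have [|t tE] := tau_surj (fun i => x ^ lam0 i); [move=> i; apply: expfz_neq0|exists t].
pose lamN q := `|w q|%N.
have chr_la x q : x != 0 -> chr (m q) (la x) = x ^+ lamN q.
  move=> x0; rewrite /chr /torus_char laE // exprnP /lamN gez0_abs // /w exprz_sum //.
  by apply: eq_bigr => i _; rewrite exprz_exp mulrC.
pose S := [set q | w q != 0]%SET; pose n := #|S|.
pose ix (i : 'I_n) : 'I_N := enum_val i.
have ixS q : w q != 0 -> exists i, ix i = q.
  move=> wq; have qS : q \in S by rewrite inE.
  by exists (enum_rank_in qS q); rewrite /ix enum_rankK_in.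
have ix0 i : w (ix i) != 0 by have := enum_valP i; rewrite inE.
pose s y i := e y (ix i).
(* On the slice the coordinates of weight 0 are 1, so polynomials in [e] become polynomials in the
   remaining coordinates [s]. *)
pose sub (p : {mpoly K[N]}) : {mpoly K[n]} :=
  msub (fun q => if [pick i | ix i == q] is Some i then 'X_i else 1) p.
have subE p z y : (forall i, e y (ix i) = z i) -> (forall q, w q = 0 -> e y q = 1) -> (sub p).@[z] = p.@[e y].
  move=> ez e1'; rewrite meval_msub; apply: meval_eq => q; case: pickP => [i /eqP <-|nq].
    by rewrite mevalXU ez.
  rewrite meval1 e1' //; apply/eqP/negPn/negP => /ixS[i iq].
  by have := nq i; rewrite iq eqxx.
have e_slice y q : ell y = ag_one T -> w q = 0 -> e y q = 1.
  by move=> y1 wq; have := ub_slice y q y1; rewrite /ub wq eqxx.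
(* The limit of la(x) y0 at x = 0: an equation of Y holds along this curve as a polynomial identity
   in x, hence also at 0. *)
have [ystar _ ystarE] : exists2 y, setT y & e y = fun q => (w q == 0)%:R.
  apply: cle => p p0; pose pi := ev polyC (fun q => 'X^(lamN q)) p.
  have piE x : pi.[x] = p.@[fun q => x ^+ lamN q].
    rewrite -[pi.[x]]/(horner_eval x pi) (@rmorph_ev _ _ _ polyC idfun (horner_eval x)) => [|b].
      by apply: eq_ev => q; apply: (hornerXn x (lamN q)).
    exact: hornerC.
  have pi0 : pi = 0.
    apply/eqP/negPn/negP => /poly_nonroot[x x0]; rewrite piE -(p0 (a (la x) y0)) //.
    by move/eqP; apply; apply: meval_eq => q; rewrite eM e1 mulr1 chr_la.
  have := piE 0; rewrite pi0 horner0 => ->; apply: meval_eq => q.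
  by rewrite expr0n /lamN absz_eq0.
have star1 : ell ystar = ag_one T.
  by apply: ell_eq1 => q; rewrite /ub ystarE; case: eqP => // ->.
exists y0, n, (fun i => lamN (ix i)), s, (fun i => chr (m (ix i))), ell, la, ystar, tinv.
have slice_e y : ell y = ag_one T -> forall p, (sub p).@[s y] = p.@[e y].
  by move=> y1 p; apply: subE => // q; apply: e_slice.
have star_e p : (sub p).@[fun=> 0] = p.@[e ystar].
  by apply: subE => [i|q wq]; rewrite ystarE ?wq ?eqxx // (negPf (ix0 i)).
split.
- by split.
- split=> [i|i|t y i|i|y i]; [by rewrite absz_gt0|exact: chrM|exact: eM|exact: e1|exact: re].
- split=> // [|x y x0]; first by apply: ell_eq1.
  split=> [|i]; last by rewrite /s eM chr_la.
  apply: tau_inj; rewrite !ellE; apply/funext => i; apply: eq_bigr => q _; congr (_ ^ _).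
  rewrite /ub; case: (eqVneq (w q) 0) => // wq; rewrite eM chr_la // /lamN wq.
  by rewrite absz0 expr0 mul1r.
- split=> // [i|y y1 ys|f|V].
  + by rewrite /s ystarE (negPf (ix0 i)).
  + apply: e_inj; rewrite ystarE; apply/funext => q; have [wq|/ixS[i <-]] := eqVneq (w q) 0.
      exact: e_slice.
    exact: ys.
  + have [_ regE _] := che; move=> /(regE _ _ I)[p [h [hz fE]]].
    exists (sub p), (sub h); rewrite star_e; split=> // y y1; rewrite !slice_e // => hy.
    exact: fE.
  have [_ _ nbE] := che; move=> /(nbE _ _ I)[h hz hV].
  exists (sub h) => [|y y1]; first by rewrite star_e.
  by rewrite slice_e // => hy; apply: hV.
split=> [y sy|//|//].
have ey q : e y q != 0.
  have [wq|/ixS[i <-]] := eqVneq (w q) 0; [exact: unit_e|exact: sy].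
(* [q0] is nonzero only on the open orbit. For [y] outside, [q0] vanishes on the orbit of [y]; as
   all monomials are nonzero at [y], the coefficients of [q0] sum to 0 on each class of equal
   characters, and [q0] would vanish at [y0] too. *)
apply: contrapT => nory; move/eqP: q0y; apply.
pose mon (i : 'I_(size (msupp q0))) := nth 0%MM (msupp q0) i.
pose th i := chr (fun i' => \sum_q (mon i q)%:Z * m q i').
pose em (i : 'I_(size (msupp q0))) z := \prod_q e z q ^+ mon i q.
have emO i t z : em i (a t z) = th i t * em i z.
  rewrite /th /chr (torus_char_comb tau0) -big_split; apply: eq_bigr => q _.
  by rewrite eM exprMn exprnP.
have q0E z : q0.@[e z] = \sum_i q0@_(mon i) * em i z by rewrite mevalE (big_nth 0%MM) big_mkord.
have em1 i : em i y0 = 1 by apply: big1 => q _; rewrite e1 expr1n.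
have classes := @character_classes K T (@ag_mul K T) (fun f => forall t, f t = 0)
  (fun f g f0 g0 t => etrans (congr2 +%R (f0 t) (g0 t)) (addr0 0))
  (fun b f f0 t => etrans (congr1 ( *%R b) (f0 t)) (mulr0 b))
  (fun u f f0 t => f0 _) _ th (fun i => q0@_(mon i) * em i y) (fun i => chrM _).
have em_th i i' : th i = th i' -> em i y = em i' y.
  move=> ii; move: y {sy ey nory classes}; apply: dens => [z|z|t].
  - by apply: reg_prod => // q; apply: reg_exp.
  - by apply: reg_prod => // q; apply: reg_exp.
  by rewrite !emO ii !em1.
have cl0' i0 : \sum_(i | `[< th i = th i0 >]) q0@_(mon i) = 0.
  have H t : \sum_i q0@_(mon i) * em i y * th i t = 0.
    transitivity (q0.@[e (a t y)]).
      by rewrite q0E; apply: eq_bigr => i _; rewrite emO; ring.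
    apply/eqP/negPn/negP => /(q0O _ I)/orbP[t' ty]; apply: nory; exists (ag_mul (ag_inv t) t').
    by rewrite actM -ty -actM ag_mulV act1.
  have /eqP := classes H i0 (ag_one T); rewrite mulf_eq0 (negPf (chr0 _ _)) orbF => /eqP E.
  have em0 : em i0 y != 0 by apply/prodf_neq0 => q _; apply: expf_neq0.
  apply: (mulIf em0); rewrite mul0r -[RHS]E mulr_suml.
  by apply: eq_bigr => i /asboolP /em_th ->.
rewrite q0E (eq_bigr (fun i => q0@_(mon i))) => [|i _]; last by rewrite em1 mulr1.
pose key i := [pick i' | `[< th i' = th i >]].
have keyE i i' : (key i == key i') = `[< th i = th i' >].
  apply/eqP/asboolP => [|ii]; last by apply: eq_pick => u; rewrite ii.
  rewrite /key; case: pickP => [u /asboolP ui|/(_ i)]; last by rewrite asboolT.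
  by case: pickP => [u' /asboolP ui' [uu]|//]; rewrite -ui uu.
rewrite (partition_big key predT) //=; apply: big1 => k _.
have [[i0 <-]|nk] := pselect (exists i0, key i0 = k); last first.
  by apply: big1 => i /eqP ik; case: nk; exists i.
by rewrite -[RHS](cl0' i0); apply: eq_bigl => i; apply: keyE.
Qed.

End Toric.

(** * Etale neighbourhoods and trivializations in coordinates *)

Section EtaleChart.
Variables (K : closedFieldType) (X Y : fspace K).

Lemma chart_ext (U : set X) n (c d : X -> 'I_n -> K) : (forall x, U x -> c x = d x) ->
  chart U c -> chart U d.
Proof.
move=> cd; have E i x : U x -> d x i = ('X_i : {mpoly K[n]}).@[c x] by move=> Ux; rewrite mevalXU cd.
have E' i x : U x -> c x i = ('X_i : {mpoly K[n]}).@[d x] by move=> Ux; rewrite mevalXU cd.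
exact: (chart_change (fun x i => E i x) (fun x i => E' i x)).
Qed.

(** The charts of X and Y share the coordinates [zc], so that a point of [U] above y amounts to a
    solution of the equations [g] in the remaining unknowns. *)
Lemma etale_chart (phi : X -> Y) (x0 : X) : etale_at phi x0 ->
  exists (U : set X) (V : set Y) m k (zc : Y -> 'I_m -> K) (tc : X -> 'I_k -> K)
    (g : 'I_k -> {mpoly K[m + k]}), let wc x := join_coord (zc (phi x)) (tc x) in
  [/\ [/\ U x0, forall x, U x -> V (phi x), chart V zc, chart U wc & closed_chart U wc],
      forall x, U x -> forall i, (g i).@[wc x] = 0,
      forall y th, V y -> (forall i, (g i).@[join_coord (zc y) th] = 0) ->
        exists x, [/\ U x, phi x = y & tc x = th] &
      forall x, U x -> \matrix_(i, j) (mderiv (rshift m j) (g i)).@[wc x] \in unitmx].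
Proof.
move=> [U [V [m [k [Z [g [alpha [beta [[oU Ux oV UV] [cZ ia ib] ab jac]]]]]]]]].
pose za (v : set_type V) i := (set_val (alpha v) : 'rV[K]_m) 0 i.
pose wb (u : set_type U) i := (set_val (beta u) : 'rV[K]_(m + k)) 0 i.
have cha : chart V (extend_fun za).
  by apply: open_sub_chart => //; exact: (isomorphism_chart ia (sub_space_chart Z (affine_space_chart K m))).
have chb : chart U (extend_fun wb).
  apply: open_sub_chart => //.
  exact: (isomorphism_chart ib (sub_space_chart (etale_locus Z g) (affine_space_chart K (m + k)))).
pose zc := extend_fun za; pose tc x j := extend_fun wb x (rshift m j).
have zcE (v : set_type V) i : zc (set_val v) i = za v i by rewrite /zc extend_funE.
have liftV y : V y -> exists v : set_type V, set_val v = y by move=> Vy; exists (SigSub (mem_set Vy)).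
have liftU x : U x -> exists u : set_type U, set_val u = x by move=> Ux'; exists (SigSub (mem_set Ux')).
have wcE x : U x -> extend_fun wb x = join_coord (zc (phi x)) (tc x).
  move=> /liftU[u ux]; apply/funext; elim/join_coordP => i; last by rewrite join_coordr.
  rewrite join_coordl -ux extend_funE; have [v vx] := liftV _ (UV _ (set_valP u)).
  rewrite -vx zcE /za; have := ab u v vx => /rowP/(_ i); by rewrite mxE.
exists U, V, m, k, zc, tc, g; split.
- split=> //; first exact: chart_ext chb.
  move=> w wU; have locus : etale_locus Z g (\row_i w i).
    split=> [|i]; last first.
      rewrite /peval -[RHS](wU (g i)) => [|x Ux'].
        by apply: meval_eq => j; rewrite mxE.
      have [u ux] := liftU x Ux'; rewrite -wcE // -ux extend_funE.
      by have [_ /(_ i)] := set_valP (beta u).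
    apply: contrapT => nZ; have : open (~` Z) by exact: closed_openC.
    move=> [S ZS]; have : (~` Z) (lsubmx (\row_i w i : 'rV[K]_(m + k))) by [].
    rewrite ZS => -[p Sp /eqP[]].
    have := wU (msub (fun i => 'X_(lshift k i)) p); rewrite meval_msub => H.
    rewrite /peval -[RHS]H => [|x Ux'].
      by apply: meval_eq => j; rewrite mxE mxE mevalXU.
    have [v vx] := liftV _ (UV _ Ux').
    have : (~` Z) (set_val (alpha v)) -> False by move=> []; apply: set_valP.
    rewrite ZS => nz; apply/eqP; rewrite meval_msub; apply/negPn/negP => nz'; apply: nz; exists p => //.
    apply: contra nz' => /eqP E; apply/eqP; rewrite -[RHS]E; apply: meval_eq => j.
    by rewrite mevalXU join_coordl -vx zcE.
  have [_ [psi [_ bK psiK]]] := ib.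
  pose u := psi (SigSub (mem_set locus)); exists (set_val u); first exact: set_valP.
  rewrite -wcE ?extend_funE; last exact: set_valP.
  by apply/funext => i; rewrite /wb psiK /= mxE.
- move=> x Ux' i; have [u ux] := liftU x Ux'; rewrite -wcE // -ux extend_funE.
  by have [_ /(_ i)] := set_valP (beta u).
- move=> y th Vy gy; have [v vy] := liftV y Vy.
  pose w : 'rV[K]_(m + k) := \row_i join_coord (zc y) th i.
  have lw : lsubmx w = set_val (alpha v).
    by apply/rowP => i; rewrite !mxE join_coordl -vy zcE.
  have locus : etale_locus Z g w.
    split=> [|i]; first by rewrite lw; apply: set_valP.
    by rewrite /peval -[RHS](gy i); apply: meval_eq => j; rewrite mxE.
  have [_ [psi [_ bK psiK]]] := ib; pose u := psi (SigSub (mem_set locus)).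
  have bu : set_val (beta u) = w by rewrite /u psiK.
  have [_ [psia [_ aK _]]] := ia.
  have phiu : phi (set_val u) = y.
    have [v' v'x] := liftV _ (UV _ (set_valP u)); rewrite -v'x -vy; congr set_val.
    apply: (can_inj aK); apply: val_inj; rewrite -[RHS]lw -bu; exact: (esym (ab u v' v'x)).
  exists (set_val u); split=> //; first exact: set_valP.
  by apply/funext => j; rewrite /tc extend_funE /wb bu mxE join_coordr.
move=> x Ux'; have [u ux] := liftU x Ux'.
have := jac _ (set_valP (beta u)); rewrite unitmxE unitfE; congr (\det _ != 0).
apply/matrixP => i j; rewrite !mxE /peval; apply: meval_eq => q.
by rewrite -wcE // -ux extend_funE.
Qed.

End EtaleChart.

(** A nonzero row of [m k] is an eigenvector of [R w] for the eigenvalue w^k / w^B. Infinitely many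
    nonzero [m k] and a [w] with enough distinct powers would give more than N eigenvalues. *)
Lemma eigen_finite (K : closedFieldType) N (m : nat -> 'M[K]_N) (R : K -> 'M[K]_N) B :
  (forall w k, w != 0 -> w ^+ B *: (m k *m R w) = w ^+ k *: m k) ->
  exists K0, forall k, (K0 <= k)%N -> m k = 0.
Proof.
move=> mR; apply: contrapT => inf.
have [s [us ss sm]] : exists s : seq nat, [/\ uniq s, size s = N.+1 & forall k, k \in s -> m k != 0].
  elim: (N.+1) => [|j [s [us ss sm]]]; first by exists [::].
  have [k [ks mk]] : exists k, (\max_(i <- s) i < k)%N /\ m k != 0.
    apply: contrapT => nk; apply: inf; exists (\max_(i <- s) i).+1 => k ks.
    by apply/eqP/negPn/negP => mk; apply: nk; exists k.
  exists (k :: s); rewrite /= us ss; split=> //.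
    rewrite andbT; apply: contraL ks => ks'; rewrite -leqNgt.
    by rewrite (bigD1_seq k) //= leq_maxl.
  by move=> i; rewrite inE => /predU1P[->|/sm].
(* A nonzero [w] that is not a root of [pr] has distinct powers for the exponents in [s]. *)
pose pr : {poly K} := \prod_(i <- s) \prod_(j <- s | j != i) ('X^i - 'X^j).
have pr0 : pr != 0.
  rewrite prodf_seq_neq0; apply/allP => i _; rewrite implyTb prodf_seq_neq0.
  apply/allP => j _; apply/implyP => ji; rewrite subr_eq0; apply/eqP => /(congr1 (fun p : {poly K} => size p)).
  by rewrite !size_polyXn => -[ij]; rewrite ij eqxx in ji.
have [w w0 pw] := poly_nonroot pr0.
have w_inj i j : i \in s -> j \in s -> w ^+ i = w ^+ j -> i = j.
  move=> si sj wij; apply/eqP; rewrite eq_sym; apply/negPn/negP => ji; move/negP: pw; apply.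
  rewrite /pr horner_prod (big_rem i) //= horner_prod (big_rem j) //= ji.
  by rewrite !hornerE wij subrr !mul0r.
pose al k := w ^+ k / w ^+ B.
have rt k : k \in s -> root (char_poly (R w)) (al k).
  move=> ks; rewrite -eigenvalue_root_char; apply/eigenvalueP.
  have [i ri] : exists i, row i (m k) != 0.
    apply: contrapT => nr; move/negP: (sm k ks); apply; apply/eqP/row_matrixP => i.
    by rewrite row0; apply/eqP/negPn/negP => h; apply: nr; exists i.
  exists (row i (m k)) => //; rewrite -row_mul /al.
  have wB : w ^+ B != 0 by apply: expf_neq0.
  rewrite -[m k *m R w]scale1r -(mulVf wB) -scalerA mR // scalerA mulrC.
  by apply/rowP => j; rewrite !mxE.
have cp0 : char_poly (R w) != 0 by rewrite -size_poly_eq0 size_char_poly.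
have al_roots : all (root (char_poly (R w))) [seq al k | k <- s].
  by apply/allP => _ /mapP[k ks ->]; apply: rt.
have al_uniq : uniq [seq al k | k <- s].
  rewrite map_inj_in_uniq // => i j si sj; rewrite /al => /(mulIf (invr_neq0 (expf_neq0 B w0))).
  exact: w_inj.
by have := max_poly_roots cp0 al_roots al_uniq; rewrite size_char_poly size_map ss ltnn.
Qed.

(** The [d i] are combined into the sum of w_i d_i with new variables w_i, evaluated at points with
    at most one nonzero w_i; a single application of [descent] then yields [q] and [r] valid for all
    i. The resulting identity is polynomial in the value of w_i and can be specialized to 0. *)
Lemma descent_family (K : closedFieldType) (n : nat) (u0 : 'I_n -> K) (T : Type) (l : nat)
    (lam : 'I_l -> nat) (o : T -> 'I_l -> K) (t0 : T) (W : Type) (c : W -> 'I_n -> K)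
    (S : 'I_l -> {mpoly K[n]}) (m : nat) (xi : T -> 'I_m -> series K) (x0 : 'I_m -> K)
    (a b : {mpoly K[n]}) (P Q : {mpoly K[m + n]}) (p : nat) (d : 'I_p -> {mpoly K[n]})
    (J : finType) (v : 'I_p -> J -> {mpoly K[n]}) (F : 'I_p -> J -> {mpoly K[m + l]}) :
  (forall i, (0 < lam i)%N) -> (forall i, (S i).@[u0] = 0) ->
  (forall p : {mpoly K[l]}, (forall t, p.@[o t] = 0) -> forall e, p.@[fun i => (S i).@[c e]] = 0) ->
  (forall i, graded lam o (fun t => xi t i)) -> (forall t i, xi t i 0%N = x0 i) ->
  Q.@[join_coord x0 u0] != 0 ->
  (forall i e x, (d i).@[c e] * (a.@[c e] * Q.@[join_coord x (c e)] - b.@[c e] * P.@[join_coord x (c e)]) =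
     \sum_j (v i j).@[c e] * (F i j).@[join_coord x (fun i => (S i).@[c e])]) ->
  (forall t i j, ev serC (join_coord (xi t) (weight_arc lam o t)) (F i j) = 0) ->
  exists q r : {mpoly K[n]}, q.@[u0] != 0 /\
    forall e, (exists i, (d i).@[c e] != 0) -> q.@[c e] * a.@[c e] = r.@[c e] * b.@[c e].
Proof.
move=> lam0 S0 Scl xig xi0 Q0 dF Fxi.
pose em (h : {mpoly K[n]}) : {mpoly K[n + p]} := msub (fun i => 'X_(lshift p i)) h.
have emE h (x : 'I_n -> K) y : (em h).@[join_coord x y] = h.@[x].
  by rewrite meval_msub; apply: meval_eq => i; rewrite mevalXU join_coordl.
pose em2 (h : {mpoly K[m + n]}) : {mpoly K[m + (n + p)]} :=
  msub (join_coord (fun i => 'X_(lshift (n + p) i)) (fun i => 'X_(rshift m (lshift p i)))) h.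
have em2E h (z : 'I_m -> K) (x : 'I_n -> K) y : (em2 h).@[join_coord z (join_coord x y)] = h.@[join_coord z x].
  rewrite meval_msub; apply: meval_eq; elim/join_coordP => i.
    by rewrite !join_coordl mevalXU join_coordl.
  by rewrite !join_coordr mevalXU join_coordr join_coordl.
pose W' := (W * 'I_p * K)%type.
pose c' (e : W') := join_coord (c e.1.1) (fun u => if u == e.1.2 then e.2 else 0).
pose d' : {mpoly K[n + p]} := \sum_i 'X_(rshift n i) * em (d i).
have sumdelta (e : W') (H : 'I_p -> K) :
    \sum_i (if i == e.1.2 then e.2 else 0) * H i = e.2 * H e.1.2.
  rewrite (bigD1 e.1.2) //= eqxx big1 ?addr0 // => i /negPf ->.
  by rewrite mul0r.
have d'E (e : W') : d'.@[c' e] = e.2 * (d e.1.2).@[c e.1.1].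
  rewrite meval_sum -(sumdelta e (fun i => (d i).@[c e.1.1])); apply: eq_bigr => i _.
  by rewrite mevalM mevalXU /c' emE join_coordr.
have [|||||q [r [q0 qE]]] := @descent K (n + p) (join_coord u0 (fun=> 0)) T l lam o t0 lam0 W' c'
    (fun i => em (S i)) _ _ m xi x0 xig xi0 (em a) (em b) d' (em2 P) (em2 Q) ('I_p * J)%type
    (fun ij => 'X_(rshift n ij.1) * em (v ij.1 ij.2)) (fun ij => F ij.1 ij.2).
- by move=> i; rewrite emE.
- move=> h hv e; rewrite -[RHS](Scl h hv e.1.1); apply: meval_eq => i; by rewrite emE.
- by rewrite em2E.
- move=> e x; rewrite d'E !emE !em2E -mulrA dF mulr_sumr.
  rewrite -(pair_bigA _ (fun i j => ('X_(rshift n i) * em (v i j)).@[c' e] * (F i j).@[join_coord x (fun i => (em (S i)).@[c' e])])) /=.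
  rewrite -mulr_sumr -(sumdelta e (fun i => \sum_j (v i j).@[c e.1.1] * (F i j).@[join_coord x (fun i => (S i).@[c e.1.1])])).
  apply: eq_bigr => i _; rewrite mulr_sumr; apply: eq_bigr => j _.
  rewrite mevalM mevalXU /c' emE join_coordr -mulrA; congr (_ * (_ * _)).
  by apply: meval_eq; elim/join_coordP => u; rewrite ?join_coordl ?join_coordr ?emE.
- by move=> t ij; apply: Fxi.
pose at0 (h : {mpoly K[n + p]}) : {mpoly K[n]} := msub (join_coord (fun i => 'X_i) (fun=> 0)) h.
have at0E h x : (at0 h).@[x] = h.@[join_coord x (fun=> 0)].
  rewrite meval_msub; apply: meval_eq; elim/join_coordP => i; rewrite ?join_coordl ?join_coordr ?mevalXU //.
  exact: meval0.
exists (at0 q), (at0 r); rewrite at0E; split=> // e [i di].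
pose pi (h : {mpoly K[n + p]}) : {poly K} :=
  ev polyC (join_coord (fun j => (c e j)%:P) (fun u => if u == i then 'X else 0)) h.
have piE h w : (pi h).[w] = h.@[c' (e, i, w)].
  rewrite -[LHS]/(horner_eval w (pi h)) (@rmorph_ev _ _ _ polyC idfun (horner_eval w)) => [|z]; last exact: hornerC.
  apply: eq_ev; elim/join_coordP => u; rewrite /= /horner_eval /c' ?join_coordl ?join_coordr ?hornerC //.
  by case: eqP => _; rewrite ?hornerX ?horner0.
have pi0 : pi (q * em a) - pi (r * em b) = 0.
  apply/eqP/negPn/negP => /poly_nonroot[w w0]; rewrite hornerD hornerN !piE !mevalM.
  have := qE (e, i, w); rewrite d'E /= => E; rewrite subr_eq0 => /eqP; apply.
  have dw : w * (d i).@[c e] != 0 by apply: mulf_neq0.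
  by apply: (mulfI dw); rewrite mulrCA E mulrCA.
have := congr1 (fun h : {poly K} => h.[0]) pi0; rewrite /= horner0 hornerD hornerN !piE !mevalM => /eqP.
rewrite subr_eq0 => /eqP; rewrite !at0E.
have -> : c' (e, i, 0) = join_coord (c e) (fun=> 0).
  by apply/funext; elim/join_coordP => u; rewrite /c' ?join_coordl ?join_coordr //=; case: eqP.
by rewrite !emE.
Qed.

(** [sec] is the section of the pullback given by 1, and [dv x e] is the coordinate of [e] relative
    to it, with the value 1 off the fibre product. *)
Lemma local_section (K : closedFieldType) (G : alg_group K) (E Y : fspace K) (f : E -> Y)
    (r : E -> G -> E) (y : Y) : principal_bundle f r ->
  exists (X : fspace K) (phi : X -> Y) (x0 : X) (sec : X -> E) (dv : X -> E -> G),
  [/\ charted X, etale phi, phi x0 = y, forall x, f (sec x) = phi x & forall x, morph_at sec x] /\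
  [/\ forall x e, phi x = f e -> e = r (sec x) (dv x e),
      forall x g h, r (sec x) g = r (sec x) h -> g = h &
      forall (Z : fspace K) (u : Z -> X) (v : Z -> E) z, charted Z ->
        (forall z, phi (u z) = f (v z)) -> morph_at u z -> morph_at v z ->
        morph_at (fun z => dv (u z) (v z)) z].
Proof.
move=> [[prE _] mf _ _ /(_ y)[X [phi [[prX _] et [x0 _ x0y] [Phi [iPhi Phi1 Phi2]]]]]].
have nX := charted_prevariety prX; have nE := charted_prevariety prE.
have nG : charted G by exact: alg_group_charted.
have [/morphismP mPhi [Psi [/morphismP mPsi PhiK PsiK]]] := iPhi.
pose sec x := (set_val (Phi (x, ag_one G))).2.
pose dv x e : G := match pselect (phi x = f e) with
  | left h => (Psi (SigSub (mem_set (h : [set p : prod_space X E | phi p.1 = f p.2] (x, e))))).2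
  | right _ => ag_one G end.
have secr x g : (set_val (Phi (x, g))).2 = r (sec x) g by rewrite /sec -Phi2 ag_mul1.
have dvE x e : phi x = f e -> e = r (sec x) (dv x e).
  move=> h; rewrite /dv; case: pselect => // h'; set P := SigSub _; have := PsiK P.
  case: (Psi P) => x' g PP /=; have := congr1 set_val PP => /= E1.
  have <- : x' = x by rewrite -[LHS](Phi1 x' g) E1.
  by rewrite -secr E1.
exists X, phi, x0, sec, dv; split; split=> //.
- by move=> x; have /= := set_valP (Phi (x, ag_one G)); rewrite Phi1 => ->.
- move=> x; apply: (@morph_at_comp _ _ _ _ (fun x => set_val (Phi (x, ag_one G))) (fun p : prod_space X E => p.2)); last exact: morph_at_snd.
  apply: (@morph_at_comp _ _ _ _ (fun x => Phi (x, ag_one G)) set_val); last exact: morph_at_val.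
  apply: (@morph_at_comp _ _ _ _ (fun x => (x, ag_one G) : prod_space X G) Phi); last exact: mPhi.
  exact: (morph_at_pair nX nG nX (morph_at_id x) (morph_at_const _ x nX)).
- move=> x g h E1; have : (x, g) = (x, h) :> prod_space X G; last by case.
  apply: (can_inj PhiK); apply: val_inj.
  rewrite [LHS]surjective_pairing [RHS]surjective_pairing; congr (_, _).
    by rewrite [LHS]Phi1 [RHS]Phi1.
  by rewrite [LHS]secr [RHS]secr.
move=> Z u v z nZ uv mu mv.
pose q z : pullback phi f := SigSub (mem_set (uv z : [set p : prod_space X E | phi p.1 = f p.2] (u z, v z))).
have mq : morph_at q z by apply: morph_at_sub; apply: (@morph_at_pair _ _ _ _ u v z).
have -> : (fun z => dv (u z) (v z)) = (fun z => (Psi (q z)).2).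
  apply/funext => w; rewrite /dv; case: pselect => [h|nh]; last by case: (nh (uv w)).
  by congr ((Psi _).2); apply: val_inj.
apply: (@morph_at_comp _ _ _ _ (fun z => Psi (q z)) (fun p : prod_space X G => p.2)); last exact: morph_at_snd.
exact: (morph_at_comp mq (mPsi _)).
Qed.

(** * Lifting arcs to an etale neighbourhood *)

Section Values.
Variables (K : closedFieldType) (A : series K -> Prop) (L : series K -> K).
Hypothesis Lhom : partial_hom serC A L.

(** Membership in the domain is carried together with the value, since the values of [L] elsewhere
    are arbitrary. *)
Definition spec_val (e : series K) (v : K) := A e /\ L e = v.

Lemma val_C c : spec_val (serC c) c. Proof. by case: Lhom => h _ _; exact: h. Qed.

Lemma val_D e1 e2 v1 v2 : spec_val e1 v1 -> spec_val e2 v2 -> spec_val (e1 + e2) (v1 + v2).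
Proof. by case: Lhom => _ LD _ [A1 <-] [A2 <-]; exact: LD. Qed.

Lemma val_M e1 e2 v1 v2 : spec_val e1 v1 -> spec_val e2 v2 -> spec_val (e1 * e2) (v1 * v2).
Proof. by case: Lhom => _ _ LM [A1 <-] [A2 <-]; exact: LM. Qed.

Lemma val_B e1 e2 v1 v2 : spec_val e1 v1 -> spec_val e2 v2 -> spec_val (e1 - e2) (v1 - v2).
Proof.
move=> h1 h2; have := val_D h1 (val_M (val_C (-1)) h2).
by rewrite mulN1r rmorphN1 mulN1r.
Qed.

Lemma val_X e v n : spec_val e v -> spec_val (e ^+ n) (v ^+ n).
Proof.
move=> h; elim: n => [|n IH]; first by have := val_C 1; rewrite rmorph1.
by rewrite !exprS; apply: val_M.
Qed.

Lemma val_sum (J : Type) (l : seq J) (e : J -> series K) (v : J -> K) :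
  (forall j, spec_val (e j) (v j)) -> spec_val (\sum_(j <- l) e j) (\sum_(j <- l) v j).
Proof.
move=> h; elim: l => [|j l IH]; last by rewrite !big_cons; apply: val_D.
by have := val_C 0; rewrite rmorph0 !big_nil.
Qed.

Lemma val_ev n (x : 'I_n -> series K) (v : 'I_n -> K) p :
  (forall i, spec_val (x i) (v i)) -> spec_val (ev serC x p) p.@[v].
Proof.
move=> h; have [h1 h2] := partial_hom_ev p Lhom (fun i => (h i).1); split=> //.
by rewrite h2; apply: meval_eq => i /=; case: (h i).
Qed.

Lemma val_eq e v1 v2 : spec_val e v1 -> spec_val e v2 -> v1 = v2.
Proof. by case=> _ <- [_ <-]. Qed.

Lemma val_inv e1 e2 v : e1 * e2 = 1 -> spec_val e1 v -> A e2 -> v != 0 /\ spec_val e2 v^-1.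
Proof.
move=> e12 h1 A2; have h2 : spec_val e2 (L e2) by [].
have := val_M h1 h2; rewrite e12 => /val_eq => /(_ 1).
have := val_C 1; rewrite rmorph1 => o /(_ o) vL.
have v0 : v != 0 by apply/eqP => z; move/eqP: vL; rewrite z mul0r eq_sym oner_eq0.
by split=> //; split=> //; apply: (mulfI v0); rewrite vL divff.
Qed.

End Values.

Section Arcs.
Variables (K : closedFieldType) (X Y : fspace K) (phi : X -> Y) (x0 : X).
Variables (n : nat) (lam : 'I_n -> nat) (s : Y -> 'I_n -> K) (ystar : Y) (sl : Y -> Prop)
  (mv : K -> Y -> Y).
Hypotheses (lam_gt0 : forall i, (0 < lam i)%N) (sl_star : sl ystar) (s_star : forall i, s ystar i = 0)
  (mv_sl : forall w y, w != 0 -> sl y -> sl (mv w y))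
  (s_mv : forall w y i, w != 0 -> s (mv w y) i = w ^+ lam i * s y i)
  (germ_star : forall f, regular_at ystar f -> exists P Q : {mpoly K[n]}, Q.@[fun=> 0] != 0 /\
            forall y, sl y -> Q.@[s y] != 0 -> f y = P.@[s y] / Q.@[s y])
  (nbhs_star : forall V : set Y, nbhs ystar V -> exists2 Q : {mpoly K[n]}, Q.@[fun=> 0] != 0 &
            forall y, sl y -> Q.@[s y] != 0 -> V y).
Hypothesis phi_x0 : phi x0 = ystar.
Variables (U : set X) (V : set Y) (m k : nat) (zc : Y -> 'I_m -> K) (tc : X -> 'I_k -> K)
    (g : 'I_k -> {mpoly K[m + k]}).
Let wc x := join_coord (zc (phi x)) (tc x).
Hypotheses (Ux0 : U x0) (UV : forall x, U x -> V (phi x)) (chV : chart V zc)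
  (gU : forall x, U x -> forall i, (g i).@[wc x] = 0)
  (U_surj : forall y th, V y -> (forall i, (g i).@[join_coord (zc y) th] = 0) ->
        exists x, [/\ U x, phi x = y & tc x = th])
  (jac : \matrix_(i, j) (mderiv (rshift m j) (g i)).@[wc x0] \in unitmx).

Let arcs := weight_arc lam s.

Let ev_arc0 (p : {mpoly K[n]}) y : ev serC (arcs y) p 0%N = p.@[fun=> 0].
Proof.
have := @ideal_ev_congr _ _ serC _ (ord_ge 1) (arcs y) (fun i => serC 0) p (@ord_ge_ideal K 1).
rewrite ev_serC_const => E; apply/eqP; rewrite -subr_eq0; apply/eqP.
have := E _ 0%N isT; rewrite serB serCE; apply=> j [|//] _.
by rewrite rmorph0 subr0 /arcs /weight_arc serXnM lam_gt0.
Qed.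

Definition special_point (L : series K -> K) (A : series K -> Prop) (xi : Y -> 'I_(m + k) -> series K)
    (y : Y) (x : X) :=
  [/\ U x, phi x = mv (L serX) y, forall i, spec_val A L (xi y i) (wc x i) &
      forall i, spec_val A L (weight_arc lam s y i) (s (mv (L serX) y) i)].

(* Points of X over [mv w y], w generic, are the specializations of the lifted arcs. *)
Lemma lifted_arcs : exists xi : Y -> 'I_(m + k) -> series K,
  [/\ forall i, graded lam s (fun y => xi y i), forall y i, xi y i 0%N = wc x0 i &
      forall y1 y2 h (l : seq (series K)), sl y1 -> sl y2 -> h != 0 ->
        exists (A : series K -> Prop) (L : series K -> K) x1 x2,
          [/\ partial_hom serC A L, [/\ A h, A serX & forall e, e \in l -> A e], L h != 0 /\ L serX != 0,
              special_point L A xi y1 x1 & special_point L A xi y2 x2]].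
Proof.
have Vstar : V ystar by rewrite -phi_x0; apply: UV.
have /choice[P PE] : forall i, exists P : {mpoly K[n]}, exists Q : {mpoly K[n]}, Q.@[fun=> 0] != 0 /\
    forall y, sl y -> Q.@[s y] != 0 -> zc y i = P.@[s y] / Q.@[s y].
  by move=> i; apply: germ_star; apply: (reg_coord i chV).
have /choice[Q {}PE] := PE.
have [QV QV0 QVE] := nbhs_star (chart_nbhs chV Vstar).
have s0 : s ystar = fun=> 0 by apply/funext => i; apply: s_star.
pose inv p y := ser_inv (ev serC (arcs y) p).
(* The coordinates [zc] along the arc, expanded at z = 0 by means of their fractions at [ystar]. *)
pose ze y i := ev serC (arcs y) (P i) * inv (Q i) y.
have invE p y : p.@[fun=> 0] != 0 -> ev serC (arcs y) p * inv p y = 1.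
  by move=> p0; apply: ser_invP; rewrite ev_arc0.
have gra i : graded lam s (fun y => arcs y i) by apply: graded_arc.
have grz i : graded lam s (fun y => ze y i).
  apply: graded_M; first exact: graded_ev.
  apply: (@graded_inv _ _ _ _ _ _ ((Q i).@[fun=> 0])) => [|t|]; first by have [] := PE i.
    exact: ev_arc0.
  exact: graded_ev.
have z0 y i : ord_ge 1 (ze y i - serC (zc ystar i)).
  move=> [|//] _; rewrite serB serCE /= mulr1n; have [Qi PQ] := PE i.
  rewrite PQ // s0 // /ze serM big_ord1 subn0 ev_arc0.
  have := congr1 (fun h : series K => h 0%N) (invE (Q i) y Qi).
  rewrite serM big_ord1 subn0 ev_arc0 ser1 eqxx => E.
  have -> : inv (Q i) y 0%N = (Q i).@[fun=> 0]^-1 by apply: (mulfI Qi); rewrite E divff.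
  by rewrite subrr.
have g0 i : (g i).@[join_coord (zc ystar) (tc x0)] = 0 by have := gU Ux0 i; rewrite /wc phi_x0.
have jac' : \matrix_(i, j) (mderiv (rshift m j) (g i)).@[join_coord (zc ystar) (tc x0)] \in unitmx.
  by move: jac; rewrite /wc phi_x0.
have [th [grt t0 gth]] := @newton_lifting K m k g (zc ystar) (tc x0) g0 jac' Y (graded lam s)
  (@graded_C K Y n lam s) (@graded_D K Y n lam s) (@graded_M K Y n lam s) (@graded_N K Y n lam s)
  (@graded_sum K Y n lam s _) (@graded_ev K Y n lam s _) (@graded_limit K Y n lam s) ze grz z0.
pose xi y := join_coord (ze y) (th y).
exists xi; split=> [|y|y1 y2 h l sl1 sl2 h0].
- elim/join_coordP => i.
    have -> : (fun y => xi y (lshift k i)) = (fun y => ze y i) by apply/funext => y; rewrite /xi join_coordl.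
    exact: grz.
  have -> : (fun y => xi y (rshift m i)) = (fun y => th y i) by apply/funext => y; rewrite /xi join_coordr.
  exact: grt.
- elim/join_coordP => i; rewrite /xi /wc phi_x0 ?join_coordl ?join_coordr.
    by have := z0 y i 0%N isT; rewrite serB serCE => /eqP; rewrite subr_eq0 => /eqP.
  by have := t0 y i 0%N isT; rewrite serB serCE => /eqP; rewrite subr_eq0 => /eqP.
have dom (e1 e2 : series K) : e1 != 0 -> e2 != 0 -> e1 * e2 != 0.
  by move=> n1 n2; apply/eqP => /ser_domain[] /eqP; apply/negP.
(* A specialization nonzero at [f] keeps [h] and z nonzero and both points inside [V]; the
   generators listed in [big] below put all series involved into its domain. *)
pose f := h * (serX * (ev serC (arcs y1) QV * ev serC (arcs y2) QV)).
have evQ0 y p : p.@[fun=> 0] != 0 -> ev serC (arcs y) p != 0.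
  by move=> p0; apply: contraNneq p0 => E; rewrite -(ev_arc0 p y) E ser0.
have X0 : (serX : series K) != 0.
  apply/eqP => /(congr1 (fun h : series K => (1 * h) 1%N)); rewrite mulr0 mulrC -[serX]expr1 serXnM /=.
  by rewrite ser1 ser0 => /eqP; rewrite oner_eq0.
have f0 : f != 0 by apply: (dom) => //; apply: (dom) => //; apply: (dom); apply: evQ0.
pose lst y := [seq arcs y i | i <- enum 'I_n] ++ [seq inv (Q i) y | i <- enum 'I_m] ++ [seq th y j | j <- enum 'I_k].
pose big := [:: f, h, serX & l ++ lst y1 ++ lst y2].
have dom' (e1 e2 : series K) : e1 * e2 = 0 -> e1 = 0 \/ e2 = 0 := @ser_domain K e1 e2.
have fm : generated serC big f by apply: generated_mem; rewrite inE eqxx.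
have [L Lhom Lf] := specialization dom' fm f0.
have mem e : e \in big -> generated serC big e by apply: generated_mem.
have mem_lst y : (y = y1 \/ y = y2) -> forall e, e \in lst y -> generated serC big e.
  move=> yy e el; apply: mem; rewrite /big !in_cons; apply/or4P; apply: Or44.
  by rewrite (mem_cat e l) (mem_cat e (lst y1) (lst y2)); have [yE|yE] := yy; rewrite yE in el; rewrite el ?orbT.
have [LC _ LM] := Lhom.
have memh : generated serC big h by apply: mem; rewrite !inE eqxx orbT.
have memX : generated serC big serX by apply: mem; rewrite !inE eqxx !orbT.
have L0 : L 0 = 0 by have [_] := LC 0; rewrite rmorph0.
have L1 : L 1 = 1 by have [_] := LC 1; rewrite rmorph1.
have LXn j : generated serC big (serX ^+ j) /\ L (serX ^+ j) = L serX ^+ j.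
  elim: j => [|j [gj Lj]]; first by have := LC 1; rewrite rmorph1 !expr0.
  by rewrite !exprS -Lj; apply: LM.
have mem_arc y i : (y = y1 \/ y = y2) -> generated serC big (arcs y i).
  move=> yy; apply: (mem_lst y yy); rewrite /lst !mem_cat; apply/or3P; apply: Or31.
  by apply/mapP; exists i; rewrite ?mem_enum.
have ev_mem y p : (y = y1 \/ y = y2) -> generated serC big (ev serC (arcs y) p) /\
    L (ev serC (arcs y) p) = p.@[fun i => L (arcs y i)].
  by move=> yy; apply: (partial_hom_ev p Lhom) => i; apply: mem_arc.
have [e1 [e1L [e1g e1E]]] : exists e, e = ev serC (arcs y1) QV * ev serC (arcs y2) QV /\
    generated serC big e /\ L e = L (ev serC (arcs y1) QV) * L (ev serC (arcs y2) QV).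
  exists (ev serC (arcs y1) QV * ev serC (arcs y2) QV); split=> //; apply: LM.
    by have [] := ev_mem y1 QV (or_introl erefl).
  by have [] := ev_mem y2 QV (or_intror erefl).
have fE : L f = L h * (L serX * (L (ev serC (arcs y1) QV) * L (ev serC (arcs y2) QV))).
  have [g1 E1] := LM _ _ memX e1g; have [_ E2] := LM _ _ memh g1.
  by rewrite /f -e1L E2 E1 e1E.
move: Lf; rewrite fE !mulf_eq0 !negb_or => /andP[Lh0 /andP[LX0 /andP[LQ1 LQ2]]].
have special y : sl y -> (y = y1 \/ y = y2) -> L (ev serC (arcs y) QV) != 0 ->
    exists x, special_point L (generated serC big) xi y x.
  move=> sly yy LQ; set w := L serX in LX0 *.
  have Larc i : L (arcs y i) = s (mv w y) i.
    have [gX EX] := LXn (lam i); have [gC EC] := LC (s y i).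
    by rewrite /arcs /weight_arc; have [_ ->] := LM _ _ gX gC; rewrite EX EC s_mv.
  have evL p : L (ev serC (arcs y) p) = p.@[s (mv w y)].
    by have [_ ->] := ev_mem y p yy; apply: meval_eq.
  have slw := mv_sl LX0 sly.
  have Vw : V (mv w y) by apply: QVE => //; rewrite -evL.
  have gze i : generated serC big (ze y i) /\ L (ze y i) = zc (mv w y) i.
    have [Qi PQ] := PE i.
    have gi : generated serC big (inv (Q i) y).
      apply: (mem_lst y yy); rewrite /lst !mem_cat; apply/or3P; apply: Or32.
      by apply/mapP; exists i; rewrite ?mem_enum.
    have [gP EP] := ev_mem y (P i) yy; have [gQ EQ] := ev_mem y (Q i) yy.
    have [gz Ez] := LM _ _ gP gi; split; first exact: gz.
    have [_] := LM _ _ gQ gi; rewrite invE // L1 evL => /esym Q1.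
    have Qn : (Q i).@[s (mv w y)] != 0 by apply/eqP => z; move/eqP: Q1; rewrite z mul0r eq_sym oner_eq0.
    rewrite PQ // -evL /ze Ez; congr (_ * _).
    by apply: (mulfI Qn); rewrite Q1 divff.
  have gth' j : generated serC big (th y j).
    apply: (mem_lst y yy); rewrite /lst !mem_cat; apply/or3P; apply: Or33.
    by apply/mapP; exists j; rewrite ?mem_enum.
  have gxi i : generated serC big (xi y i).
    by elim/join_coordP: i => i; rewrite /xi ?join_coordl ?join_coordr //; have [] := gze i.
  have [|x [Ux xw tx]] := U_surj (th := fun j => L (th y j)) Vw.
    move=> i; have [_] := partial_hom_ev (g i) Lhom gxi; rewrite gth L0 => /esym; apply: etrans.
    apply: meval_eq; elim/join_coordP => j /=; rewrite /xi ?join_coordl ?join_coordr //.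
    by have [_ ->] := gze j.
  exists x; split=> //.
    move=> j; split; first exact: gxi.
    elim/join_coordP: j => i; rewrite /wc /xi ?join_coordl ?join_coordr.
      by rewrite xw; have [_ ->] := gze i.
    by rewrite tx.
  by move=> i; split; [exact: mem_arc|exact: Larc].
have [x1 sp1] := special y1 sl1 (or_introl erefl) LQ1.
have [x2 sp2] := special y2 sl2 (or_intror erefl) LQ2.
exists (generated serC big), L, x1, x2; split=> //; split=> // e el.
by apply: mem; rewrite /big !in_cons; apply/or4P; apply: Or44; rewrite mem_cat el.
Qed.

(** How identities between series are proved: a nonzero [e] would survive some specialization, where
    it is computed on genuine points of X. *)
Lemma arcs_zero xi : (forall y1 y2 h (l : seq (series K)), sl y1 -> sl y2 -> h != 0 ->
        exists (A : series K -> Prop) (L : series K -> K) x1 x2,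
          [/\ partial_hom serC A L, [/\ A h, A serX & forall e, e \in l -> A e], L h != 0 /\ L serX != 0,
              special_point L A xi y1 x1 & special_point L A xi y2 x2]) ->
  forall y1 y2 e (l : seq (series K)), sl y1 -> sl y2 ->
  (forall (A : series K -> Prop) (L : series K -> K) x1 x2, partial_hom serC A L -> A serX ->
     L serX != 0 -> (forall e, e \in l -> A e) ->
     special_point L A xi y1 x1 -> special_point L A xi y2 x2 -> spec_val A L e 0) -> e = 0.
Proof.
move=> sp y1 y2 e l sl1 sl2 He; apply/eqP; apply: contraT => e0.
have [A [L [x1 [x2 [Lhom [Ah AX Al] [Le LX] sp1 sp2]]]]] := sp y1 y2 e l sl1 sl2 e0.
by have [_ z] := He A L x1 x2 Lhom AX LX Al sp1 sp2; rewrite z eqxx in Le.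
Qed.

End Arcs.

Lemma serMC (K : closedFieldType) (F : series K) c k : (F * serC c) k = F k * c.
Proof. by rewrite mulrC serCM mulrC. Qed.

Lemma ev_coef0 (K : closedFieldType) n (x : 'I_n -> series K) p :
  ev serC x p 0%N = p.@[fun i => x i 0%N].
Proof.
have := @ideal_ev_congr _ _ serC _ (ord_ge 1) x (fun i => serC (x i 0%N)) p (@ord_ge_ideal K 1).
rewrite ev_serC_const => E; apply/eqP; rewrite -subr_eq0; apply/eqP.
have := E _ 0%N isT; rewrite serB serCE; apply=> j [|//] _.
by rewrite serB serCE /= mulr1n subrr.
Qed.

Lemma serM0 (K : closedFieldType) (F H : series K) : (F * H) 0%N = F 0%N * H 0%N.
Proof. by rewrite serM big_ord1 subn0. Qed.

Lemma graded_coef0 (K : closedFieldType) (T : Type) l (lam : 'I_l -> nat) (o : T -> 'I_l -> K) F :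
  (forall i, (0 < lam i)%N) -> graded lam o F -> exists c, forall t, F t 0%N = c.
Proof.
move=> lam0 /(_ 0%N)[Q Qh QE]; exists (Q.@[fun=> 0]) => t; rewrite QE.
have := congr1 (fun h : series K => h 0%N) (ev_arc o t Qh).
rewrite expr0 mul1r serCE eqxx mulr1n => <-; rewrite ev_coef0; apply: meval_eq => i.
by rewrite /weight_arc serXnM lam0.
Qed.

(** [mu] is determined by its value at [one], whose coefficients satisfy the relation of
    [eigen_finite]. Hence [mu] is a polynomial in z, and the action of [la] determines its value at
    z = w from the one at z = 1. *)
Lemma equivariant_eigen (K : closedFieldType) (T : Type) (mul : T -> T -> T) (one : T) (la : K -> T) N
    (mu : T -> 'M[series K]_N) (rho : T -> 'M[K]_N) B :
  (forall t, mul t one = t) ->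
  (forall s t, mu (mul s t) = mu t *m map_mx serC (rho s)) ->
  (forall w i j k, w != 0 -> w ^+ B * mu (la w) i j k = w ^+ k * mu one i j k) ->
  exists K0 (m : nat -> 'M[K]_N),
   (forall t i j, mu t i j = \sum_(k < K0) serX ^+ k * serC ((m k *m rho t) i j)) /\
   forall w, w != 0 -> w ^+ B *: ((\sum_(k < K0) m k) *m rho (la w)) = \sum_(k < K0) w ^+ k *: m k.
Proof.
move=> mul1 muM mu_la; pose m k : 'M[K]_N := \matrix_(i, j) mu one i j k.
have muE t i j k : mu t i j k = (m k *m rho t) i j.
  rewrite -{1}(mul1 t) muM !mxE ser_sum; apply: eq_bigr => q _.
  by rewrite !mxE serMC.
have eig w k : w != 0 -> w ^+ B *: (m k *m rho (la w)) = w ^+ k *: m k.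
  move=> w0; apply/matrixP => i j; rewrite [LHS]mxE [RHS]mxE -muE mu_la //.
  by rewrite mxE.
have [K0 mK] := eigen_finite eig; exists K0, m; split=> [t i j|w w0].
  apply/funext => k; rewrite muE ser_sum.
  have [kK|Kk] := ltnP k K0; last first.
    rewrite mK // mul0mx mxE big1 // => q _; rewrite serXnM.
    case: ifP => // /negbT; rewrite -leqNgt => kq; rewrite serCE (_ : (k - q == 0)%N = false) ?mulr0n //.
    by apply/negbTE; rewrite -lt0n subn_gt0 (leq_trans (ltn_ord q)).
  rewrite (bigD1 (Ordinal kK)) // serXnM (_ : nat_of_ord (Ordinal kK) = k) // ltnn subnn serCE eqxx mulr1n big1 => [|q qk]; first by rewrite [RHS]addr0.
  rewrite serXnM; case: ifP => // /negbT; rewrite -leqNgt => qk'; rewrite serCE (_ : (k - q == 0)%N = false) ?mulr0n //.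
  apply/negbTE; rewrite -lt0n subn_gt0 ltn_neqAle qk' andbT; apply: contraNneq qk => qk''.
  by apply/eqP/val_inj.
rewrite mulmx_suml scaler_sumr; apply: eq_bigr => k _; exact: eig.
Qed.

Lemma ag_inv1 (K : closedFieldType) (G : alg_group K) : ag_inv (ag_one G) = ag_one G.
Proof. by rewrite -[LHS]ag_mulr1 ag_mulV. Qed.

Lemma ag_inv_mul (K : closedFieldType) (G : alg_group K) (g h : G) :
  ag_inv (ag_mul g h) = ag_mul (ag_inv h) (ag_inv g).
Proof.
apply: (@ag_mulI _ _ (ag_mul g h)).
by rewrite ag_mulgV -ag_mulA [X in _ = ag_mul g X]ag_mulA ag_mulgV ag_mul1 ag_mulgV.
Qed.

Lemma ag_invK (K : closedFieldType) (G : alg_group K) (g : G) : ag_inv (ag_inv g) = g.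
Proof. by apply: (@ag_mulI _ _ (ag_inv g)); rewrite ag_mulgV ag_mulV. Qed.

Lemma common_denominator (K : closedFieldType) (X : fspace K) (U : set X) n (c : X -> 'I_n -> K)
    (chi : {mpoly K[n]}) (I : finType) (F : I -> X -> K) : chart U c -> closed_chart U c ->
  (forall q u, U u -> chi.@[c u] != 0 -> regular_at u (F q)) ->
  exists M (P : I -> {mpoly K[n]}), forall q u, U u -> chi.@[c u] != 0 ->
    chi.@[c u] ^+ M * F q u = (P q).@[c u].
Proof.
move=> ch cl Fr.
have /choice[M {}Fr] : forall q, exists M, exists P : {mpoly K[n]}, forall u, U u -> chi.@[c u] != 0 ->
    chi.@[c u] ^+ M * F q u = P.@[c u].
  by move=> q; exact: (bounded_denominator ch cl (Fr q)).
have /choice[P PE] := Fr.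
exists (\max_q M q)%N, (fun q => chi ^+ (\max_q M q - M q) * P q) => q u Uu cu.
by rewrite mevalM rmorphXn -PE // mulrA -exprD subnK // leq_bigmax.
Qed.

Lemma wdeg_scale (K : closedFieldType) l (lam : 'I_l -> nat) k (Q : {mpoly K[l]}) w (x : 'I_l -> K) :
  Q \is k.-homog for (wdeg lam) -> Q.@[fun i => w ^+ lam i * x i] = w ^+ k * Q.@[x].
Proof.
move=> Qh; rewrite !mevalE mulr_sumr big_seq [RHS]big_seq; apply: eq_bigr => m mQ.
have wm : wdeg lam m = k := dhomogP _ _ _ Qh m mQ.
rewrite mulrCA; congr (_ * _); rewrite -wm /wdeg (big_morph _ (fun u v => exprD w u v) (expr0 _)) -big_split.
by apply: eq_bigr => i _; rewrite exprMn -exprM mulnC.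
Qed.

(** * The formal equivariant section *)

Section FormalSection.
Variables (K : closedFieldType) (T G : alg_group K) (E Y : fspace K) (a : T -> Y -> Y) (f : E -> Y)
  (b : T -> E -> E) (r : E -> G -> E).
Local Notation mT := (@ag_mul K T).
Local Notation mG := (@ag_mul K G).
Hypotheses (nE : charted E) (nY : charted Y) (TC : forall s t, mT s t = mT t s)
  (T_char : forall f : T -> K, (forall t, regular_at t f) -> char_sums mT (fun u (_ : unit) => f u))
  (a_mor : forall z : prod_space T Y, morph_at (fun p : prod_space T Y => a p.1 p.2) z)
  (b_mor : forall z : prod_space T E, morph_at (fun p : prod_space T E => b p.1 p.2) z)
  (a1 : forall y, a (ag_one T) y = y) (aM : forall s t y, a (mT s t) y = a s (a t y))
  (b1 : forall e, b (ag_one T) e = e) (bM : forall s t e, b (mT s t) e = b s (b t e))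
  (rM : forall e g h, r e (mG g h) = r (r e g) h)
  (fr : forall e g, f (r e g) = f e) (fb : forall t e, f (b t e) = a t (f e)) (br : forall t e g, b t (r e g) = r (b t e) g).
Variables (y0 ystar : Y) (n : nat) (lam : 'I_n -> nat) (s : Y -> 'I_n -> K) (chi : 'I_n -> T -> K)
  (ell : Y -> T) (la : K -> T) (tinv : Y -> T).
Hypotheses (lam_gt0 : forall i, (0 < lam i)%N) (chi_char : forall i, character mT (chi i))
  (s_a : forall t y i, s (a t y) i = chi i t * s y i) (s_y0 : forall i, s y0 i = 1)
  (s_reg : forall y i, regular_at y (s^~ i)) (ell_mor : forall y, morph_at ell y)
  (ell_y0 : ell y0 = ag_one T) (ell_a : forall t y, ell (a t y) = mT (ell (a t y0)) (ell y))
  (ell_sl : forall y, ell (a (ag_inv (ell y)) y) = ag_one T)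
  (la_act : forall w y, w != 0 -> ell (a (la w) y) = ell y /\ forall i, s (a (la w) y) i = w ^+ lam i * s y i)
  (ell_star : ell ystar = ag_one T) (s_star : forall i, s ystar i = 0)
  (star_uniq : forall y, ell y = ag_one T -> (forall i, s y i = 0) -> y = ystar)
  (orb : forall y, (forall i, s y i != 0) -> exists t, y = a t y0)
  (tinvK : forall t, tinv (a t y0) = t) (tinv_mor : forall t, morph_at tinv (a t y0)).
Variables (X : fspace K) (phi : X -> Y) (x0 : X) (sec : X -> E) (dv : X -> E -> G).
Hypotheses (nX : charted X) (phi_mor : forall x, morph_at phi x) (phi_x0 : phi x0 = ystar)
  (f_sec : forall x, f (sec x) = phi x) (sec_mor : forall x, morph_at sec x)
  (dvE : forall x e, phi x = f e -> e = r (sec x) (dv x e))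
  (dv_free : forall x g h, r (sec x) g = r (sec x) h -> g = h)
  (dv_mor : forall (Z : fspace K) (u : Z -> X) (v : Z -> E) z, charted Z ->
        (forall z, phi (u z) = f (v z)) -> morph_at u z -> morph_at v z ->
        morph_at (fun z => dv (u z) (v z)) z).
Variables (X1 : fspace K) (phi1 : X1 -> Y) (x1 : X1) (sec1 : X1 -> E) (dv1 : X1 -> E -> G).
Hypotheses (phi1_x1 : phi1 x1 = y0)
  (f_sec1 : forall x, f (sec1 x) = phi1 x)
  (dv1E : forall x e, phi1 x = f e -> e = r (sec1 x) (dv1 x e))
  (dv1_mor : forall (Z : fspace K) (u : Z -> X1) (v : Z -> E) z, charted Z ->
        (forall z, phi1 (u z) = f (v z)) -> morph_at u z -> morph_at v z ->
        morph_at (fun z => dv1 (u z) (v z)) z).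
Variables (U : set X) (m k : nat) (zc : Y -> 'I_m -> K) (tc : X -> 'I_k -> K).
Let wc x := join_coord (zc (phi x)) (tc x).
Hypotheses (Ux0 : U x0) (chU : chart U wc) (clU : closed_chart U wc).
Variable xi : Y -> 'I_(m + k) -> series K.
Let mv w y := a (la w) y.
Let special := special_point phi lam s mv U zc tc.
Hypotheses (xi_gr : forall i, graded lam s (fun y => xi y i)) (xi0 : forall y i, xi y i 0%N = wc x0 i)
  (xi_sp : forall y1 y2 h (l : seq (series K)), ell y1 = ag_one T -> ell y2 = ag_one T -> h != 0 ->
        exists (A : series K -> Prop) (L : series K -> K) x1 x2,
          [/\ partial_hom serC A L, [/\ A h, A serX & forall e, e \in l -> A e], L h != 0 /\ L serX != 0,
              special L A xi y1 x1 & special L A xi y2 x2]).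
Variables (N : nat) (A : G -> 'M[K]_N).
Hypotheses (AM : forall g h, A (mG g h) = A g *m A h) (A1 : A (ag_one G) = 1%:M) (A_inj : injective A)
  (chG : chart setT (fun g => mxcoord (A g))) (clG : closed_chart setT (fun g => mxcoord (A g))).

Let nT : charted T. Proof. exact: alg_group_charted. Qed.

(** The projection of T onto a subgroup preserving the slice: t is divided by the retraction of its
    orbit point. *)
Definition slice_part t := mT t (ag_inv (ell (a t y0))).
Local Notation p := slice_part.
Definition slice_point t := a (p t) y0.
Local Notation yt := slice_point.

Lemma ell_slice_point t : ell (yt t) = ag_one T.
Proof. by rewrite /yt /p TC aM ell_sl. Qed.

Lemma slice_partM t u : p (mT t u) = mT (p t) (p u).
Proof.
rewrite /p aM ell_a ag_inv_mul (TC (ag_inv _)) !ag_mulA; congr (mT _ _).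
by rewrite -!ag_mulA; congr (mT _ _); rewrite TC.
Qed.

Lemma slice_part_la w : w != 0 -> p (la w) = la w.
Proof. by move=> w0; rewrite /p; have [-> _] := la_act y0 w0; rewrite ell_y0 ag_inv1 ag_mulr1. Qed.

Lemma slice_part_id t : p (p t) = p t.
Proof. by rewrite [LHS]/p -/(yt t) ell_slice_point ag_inv1 ag_mulr1. Qed.

Lemma slice_point_mul t u : yt (mT t u) = a (p t) (yt u).
Proof. by rewrite /yt slice_partM aM. Qed.

Lemma slice_point_la w t : w != 0 -> a (la w) (yt t) = yt (mT (la w) t).
Proof. by move=> w0; rewrite slice_point_mul slice_part_la. Qed.

Let o t := s (yt t).

Let oE t i : o t i = chi i (p t).
Proof. by rewrite /o /yt s_a s_y0 mulr1. Qed.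

Lemma slice_point_char i : character mT (fun t => s (yt t) i).
Proof. by move=> t u; rewrite -/(o _ i) -/(o t i) -/(o u i) !oE slice_partM chi_char. Qed.

Let o_neq0 t i : o t i != 0.
Proof.
apply/eqP => z; have := slice_point_char i t (ag_inv t); rewrite -/(o t i) z mul0r ag_mulgV.
rewrite -/(o _ i) oE /p a1 ell_y0 ag_inv1 ag_mulr1 => z1.
by have := s_a (ag_one T) y0 i; rewrite a1 z1 mul0r s_y0 => /eqP; rewrite oner_eq0.
Qed.

Let e1 := sec1 x1.
(** The section [sec] compared with the trivialization u y0 |-> b u e1 of the open orbit; it is
    shown regular only above that orbit, and its pole order along the arcs has to be bounded. *)
Let gamma x := dv1 x1 (b (ag_inv (tinv (phi x))) (sec x)).

Let gammaE u x : phi x = a u y0 -> sec x = r (b u e1) (gamma x).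
Proof.
move=> xu; rewrite -br /e1 -dv1E.
  by rewrite xu tinvK -bM ag_mulgV b1.
by rewrite xu tinvK fb f_sec xu -aM ag_mulV a1.
Qed.

(** Above the open orbit, the transition elements of the action of T on [sec] are a coboundary of
    [gamma]. *)
Let gamma_cross u v x x' : phi x = a u y0 -> phi x' = a (mT v u) y0 ->
  dv x' (b v (sec x)) = mG (ag_inv (gamma x')) (gamma x).
Proof.
move=> xu xv; apply: (@dv_free x'); rewrite -dvE; last by rewrite fb f_sec xv xu aM.
by rewrite (gammaE xu) {1}(gammaE xv) -rM ag_mulA ag_mulgV ag_mul1 br bM.
Qed.

Let sprod x := \prod_i s (phi x) i.

Let sprod_reg x : regular_at x sprod.
Proof. by apply: reg_prod => // i; exact: ((phi_mor x).2 _ (s_reg (phi x) i)). Qed.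

Let sprod_orb x : sprod x != 0 -> exists t, phi x = a t y0.
Proof. by move=> h; apply: orb => i; move/prodf_neq0: h; apply. Qed.

Let A_reg i j g : regular_at g (fun g => A g i j).
Proof.
have -> : (fun g => A g i j) = (fun g => mxcoord (A g) (mxvec_index i j)).
  by apply/funext => h; rewrite mxcoordE.
exact: (reg_coord (mxvec_index i j) chG I).
Qed.

Let b_mor' (Z : fspace K) (u : Z -> T) (v : Z -> E) z : charted Z -> morph_at u z -> morph_at v z ->
  morph_at (fun z => b (u z) (v z)) z.
Proof. by move=> nZ hu hv; exact: (morph_at_comp (morph_at_pair nT nE nZ hu hv) (b_mor _)). Qed.

Let gamma_mor x : sprod x != 0 -> morph_at gamma x.
Proof.
move=> xs; pose S := [set x | sprod x != 0].
have oS : open S by rewrite openE => z; exact: (reg_neq0 nX (sprod_reg z)).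
pose z : sub_space S := SigSub (mem_set (xs : S x)).
apply: (@morph_at_open K X G S gamma z oS).
have nS : charted (sub_space S) by exact: charted_sub.
apply: (dv1_mor (u := fun=> x1) (v := fun v : sub_space S => b (ag_inv (tinv (phi (set_val v)))) (sec (set_val v)))) => //.
- move=> v; have [t vt] := sprod_orb (set_valP v).
  by rewrite phi1_x1 fb f_sec vt tinvK -aM ag_mulV a1.
- exact: morph_at_const.
- apply: b_mor' => //.
    apply: morph_at_inv; have [t xt] := sprod_orb xs.
    have tm : morph_at tinv (phi (set_val z)) by rewrite /= xt.
    exact: (morph_at_comp (morph_at_comp (morph_at_val z) (phi_mor _)) tm).
  exact: (morph_at_comp (morph_at_val z) (sec_mor _)).
Qed.

Let star_fix t : a (p t) ystar = ystar.
Proof.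
apply: star_uniq => [|i]; last by rewrite s_a s_star mulr0.
by rewrite ell_a ell_star ag_mulr1 -/(yt t) ell_slice_point.
Qed.

Let e0 := sec x0.
(** The action of T, through [slice_part], on the fibre over its fixed point [ystar]: this is the
    homomorphism of the final trivialization. *)
Definition slice_hom t := dv x0 (b (p t) e0).
Local Notation d := slice_hom.

Let dE t : b (p t) e0 = r e0 (d t).
Proof. by rewrite /d /e0 -dvE // fb f_sec phi_x0 star_fix. Qed.

Let dM t u : d (mT t u) = mG (d t) (d u).
Proof.
apply: (@dv_free x0); rewrite -/e0 -dE rM -dE -br -dE -bM -slice_partM; by [].
Qed.

Let d_mor t : morph_at d t.
Proof.
apply: (dv_mor (u := fun=> x0) (v := fun t => b (p t) e0)) => //.
- by move=> u; rewrite fb f_sec phi_x0 star_fix.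
- exact: morph_at_const.
- have h : morph_at (fun t => (t, y0) : prod_space T Y) t.
    by apply: (morph_at_pair nT nY nT (morph_at_id t)); exact: morph_at_const.
  have he : morph_at (fun t => ell (a t y0)) t := morph_at_comp (morph_at_comp h (a_mor _)) (ell_mor _).
  have hp : morph_at p t := morph_at_mul nT (morph_at_id t) (morph_at_inv he).
  by apply: (b_mor' (v := fun=> e0) nT hp); exact: morph_at_const.
Qed.

Let d1 : d (ag_one T) = ag_one G.
Proof. by apply: (@ag_mulI _ _ (d (ag_one T))); rewrite -dM ag_mulr1 ag_mulr1. Qed.

Let rho t := A (ag_inv (d t)).

(** Unlike [gamma], the transition elements are regular at (x0, x0), which lies on the fibre product
    because [ystar] is fixed; hence denominators that do not vanish there. *)
Lemma formal_section_cocycle t : exists C D : 'I_N -> 'I_N -> {mpoly K[(m + k) + (m + k)]},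
  forall i j, (D i j).@[join_coord (wc x0) (wc x0)] != 0 /\
  forall x x', U x -> U x' -> phi x' = a (p t) (phi x) -> (D i j).@[join_coord (wc x) (wc x')] != 0 ->
    A (ag_inv (dv x' (b (p t) (sec x)))) i j =
      (C i j).@[join_coord (wc x) (wc x')] / (D i j).@[join_coord (wc x) (wc x')].
Proof.
pose S := [set z : prod_space X X | phi z.2 = a (p t) (phi z.1)].
have nXX : charted (prod_space X X) by exact: charted_prod.
have nS : charted (sub_space S) by exact: charted_sub.
have S0 : S (x0, x0) by rewrite /S /= phi_x0 star_fix.
pose z0 : sub_space S := SigSub (mem_set S0).
have mor : morph_at (fun z : sub_space S => ag_inv (dv (set_val z).2 (b (p t) (sec (set_val z).1)))) z0.
  apply: morph_at_inv.
  apply: (dv_mor (u := fun z : sub_space S => (set_val z).2)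
    (v := fun z : sub_space S => b (p t) (sec (set_val z).1))) => //.
  - by move=> z; rewrite fb f_sec; exact: (set_valP z).
  - exact: (morph_at_comp (morph_at_val z0) (@morph_at_snd _ _ _ (set_val z0) nX nX)).
  - apply: b_mor' => //; first exact: morph_at_const.
    exact: (morph_at_comp (morph_at_comp (morph_at_val z0) (@morph_at_fst _ _ _ (set_val z0) nX nX)) (sec_mor _)).
have ch := sub_space_chart S (prod_chart chU chU).
have [_ chr _] := ch.
have ex i j : exists CD : {mpoly K[(m + k) + (m + k)]} * {mpoly K[(m + k) + (m + k)]},
    CD.2.@[join_coord (wc x0) (wc x0)] != 0 /\
    forall x x', U x -> U x' -> phi x' = a (p t) (phi x) -> CD.2.@[join_coord (wc x) (wc x')] != 0 ->
    A (ag_inv (dv x' (b (p t) (sec x)))) i j =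
      CD.1.@[join_coord (wc x) (wc x')] / CD.2.@[join_coord (wc x) (wc x')].
  have U0 : (set_val @^-1` [set z : prod_space X X | U z.1 /\ U z.2])%classic z0 by split.
  have [h1 _] := chr z0 ((fun g => A g i j) \o (fun z : sub_space S => ag_inv (dv (set_val z).2 (b (p t) (sec (set_val z).1))))) U0.
  have [P [Q [Q0 PQ]]] := h1 (mor.2 _ (A_reg i j _)).
  exists (P, Q); split=> // x x' Ux Ux' xx' Qx.
  have Sx : S (x, x') by [].
  by have := PQ (SigSub (mem_set Sx)) (conj Ux Ux') Qx.
have /choice[F FE] : forall q : 'I_N * 'I_N, exists CD : {mpoly K[(m + k) + (m + k)]} * {mpoly K[(m + k) + (m + k)]},
    CD.2.@[join_coord (wc x0) (wc x0)] != 0 /\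
    forall x x', U x -> U x' -> phi x' = a (p t) (phi x) -> CD.2.@[join_coord (wc x) (wc x')] != 0 ->
    A (ag_inv (dv x' (b (p t) (sec x)))) q.1 q.2 =
      CD.1.@[join_coord (wc x) (wc x')] / CD.2.@[join_coord (wc x) (wc x')].
  by case=> i j; exact: ex.
exists (fun i j => (F (i, j)).1), (fun i j => (F (i, j)).2) => i j.
exact: (FE (i, j)).
Qed.

Lemma formal_section : exists (eb : E) (ka : T -> 'M[series K]_N) (h0 : G),
  [/\ alg_group_hom d, f eb = y0, forall i j, graded lam (fun t => s (yt t)) (fun t => ka t i j),
      forall t i j, ka t i j 0%N = A h0 i j &
  forall (B : series K -> Prop) L t x, partial_hom serC B L -> B serX -> L serX != 0 ->
    (forall i j, B (ka t i j)) -> special L B xi (yt t) x ->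
    exists h, (forall i j, L (ka t i j) = A h i j) /\
      forall u, phi x = a u y0 -> r (sec x) h = r (b u eb) (ag_inv (d u))].
Proof.
have [chiP chiE] := regular_poly chU clU (fun u _ => sprod_reg u).
pose F (q : 'I_N * 'I_N * bool) x := A (if q.2 then gamma x else ag_inv (gamma x)) q.1.1 q.1.2.
have [M [P PE]] : exists M (P : 'I_N * 'I_N * bool -> {mpoly K[m + k]}), forall q u, U u ->
    chiP.@[wc u] != 0 -> chiP.@[wc u] ^+ M * F q u = (P q).@[wc u].
  apply: common_denominator => // -[[i j] bb] u Uu; rewrite -chiE // => su.
  have gm := gamma_mor su; case: bb; rewrite /F /=.
    exact: (gm.2 _ (A_reg i j _)).
  exact: ((morph_at_inv gm).2 _ (A_reg i j _)).
pose ps t := \prod_i o t i.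
have ps0 t : ps t != 0 by apply/prodf_neq0 => i _; apply: o_neq0.
have psM t u : ps (mT t u) = ps t * ps u.
  by rewrite /ps -big_split; apply: eq_bigr => i _; exact: slice_point_char.
(* Along an arc the product of the coordinates [s] is z^B0 ps(t). Its M-th power clears the
   denominators of [gamma] and of its inverse, so both have poles of order at most B0 M. *)
pose B0 := (\sum_i lam i)%N.
have arcP t : \prod_i weight_arc lam s (yt t) i = serX ^+ B0 * serC (ps t).
  have -> : serC (ps t) = \prod_i serC (o t i) by rewrite /ps (big_morph serC (rmorphM serC) (rmorph1 serC)).
  rewrite /weight_arc big_split /=; congr (_ * _).
  by rewrite /B0 -(big_morph _ (fun u v => exprD (serX : series K) u v) (expr0 _)).
have zero := arcs_zero xi_sp.
have ellp := ell_slice_point.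
have phi_sp (B : series K -> Prop) L t x : L serX != 0 -> special L B xi (yt t) x ->
    phi x = yt (mT (la (L serX)) t).
  by move=> L0 [_ -> _ _]; rewrite /mv slice_point_la.
have sprod_sp (B : series K -> Prop) L t x : L serX != 0 -> special L B xi (yt t) x ->
    chiP.@[wc x] = L serX ^+ B0 * ps t.
  move=> L0 sp; have [Ux -> _ _] := sp; rewrite -chiE // /sprod.
  have [_ -> _ _] := sp; rewrite /mv /ps /B0.
  rewrite (big_morph _ (fun u v => exprD (L serX) u v) (expr0 _)) -big_split.
  by apply: eq_bigr => i _; have [_ ->] := la_act (yt t) L0.
have sp_neq0 (B : series K -> Prop) L t x : L serX != 0 -> special L B xi (yt t) x -> chiP.@[wc x] != 0.
  by move=> L0 sp; rewrite (sprod_sp _ _ _ _ L0 sp) mulf_neq0 ?expf_neq0.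
pose gm bb t : 'M[series K]_N := \matrix_(i, j) (serC (ps t ^- M) * ev serC (xi (yt t)) (P (i, j, bb))).
have gm_val bb (B : series K -> Prop) L t x i j : partial_hom serC B L -> L serX != 0 ->
    special L B xi (yt t) x -> spec_val B L (gm bb t i j) (L serX ^+ (B0 * M) * F (i, j, bb) x).
  move=> Lh L0 sp; have c0 := sp_neq0 _ _ _ _ L0 sp; have cE := sprod_sp _ _ _ _ L0 sp.
  have [Ux xy vx _] := sp.
  have := val_M Lh (val_C Lh (ps t ^- M)) (val_ev Lh (P (i, j, bb)) vx); rewrite mxE.
  rewrite -/(wc x) -PE // cE exprMn -exprM.
  suff -> : ps t ^- M * (L serX ^+ (B0 * M) * ps t ^+ M * F (i, j, bb) x) =
    L serX ^+ (B0 * M) * F (i, j, bb) x by [].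
  have alg (u v w : K) : v != 0 -> v^-1 * (u * v * w) = u * w.
    by move=> v0; rewrite [u * v]mulrC -mulrA mulKf.
  by rewrite alg // expf_neq0.
have F_inv x i j : \sum_l F (i, l, true) x * F (l, j, false) x = (i == j)%:R.
  have /matrixP/(_ i j) : A (gamma x) *m A (ag_inv (gamma x)) = 1%:M by rewrite -AM ag_mulgV A1.
  by rewrite !mxE.
pose bb := (B0 * M + B0 * M)%N.
have ga_gai t : gm true t *m gm false t = (serX ^+ bb)%:M.
  apply/matrixP => i j; rewrite [LHS]mxE [RHS]mxE; apply/eqP; rewrite -subr_eq0; apply/eqP.
  apply: (zero (yt t) (yt t) _ [::]) => // B L x x' Lh BX L0 _ sp _.
  have -> : serX ^+ bb *+ (i == j) = serX ^+ bb * serC (i == j)%:R :> series K.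
    by rewrite rmorph_nat mulr_natr.
  have vX : spec_val B L serX (L serX) by split.
  have := val_B Lh (val_sum Lh (index_enum _) (fun l => val_M Lh (gm_val true _ _ _ _ i l Lh L0 sp)
      (gm_val false _ _ _ _ l j Lh L0 sp))) (val_M Lh (val_X Lh bb vX) (val_C Lh (i == j)%:R)).
  congr spec_val; rewrite -(F_inv x) mulr_sumr -sumrB big1 // => l _.
  by rewrite mulrACA -exprD subrr.
have gr_comp i : graded lam o (fun t => xi (yt t) i).
  by move=> q; have [Q Qh QE] := xi_gr i q; exists Q.
have ga_char i j q : char_sums mT (fun u (_ : unit) => gm true u i j q).
  have gc : char_sums mT (fun u (_ : unit) => ev serC (xi (yt u)) (P (i, j, true)) q).
    have h : graded lam o (fun t => ev serC (xi (yt t)) (P (i, j, true))) by exact: graded_ev.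
    exact: (graded_char slice_point_char q h).
  have pc : char_sums mT (fun u (_ : unit) => ps u ^- M).
    exists unit, (fun _ u => ps u ^- M); split=> [_ u v|_]; first by rewrite psM exprMn invfM.
    by exists (fun=> 1) => u; rewrite big_const card_unit /= mul1r addr0.
  by apply: char_sums_ext (char_sums_mul pc gc) => u _; rewrite mxE serCM.
have /choice[C Cex] := formal_section_cocycle.
have /choice[D CD] := Cex.
pose jxi t u := join_coord (xi (yt u)) (xi (yt (mT t u))).
pose Di t u i j := ser_inv (ev serC (jxi t u) (D t i j)).
have jxi0 t u q : jxi t u q 0%N = join_coord (wc x0) (wc x0) q.
  by elim/join_coordP: q => q; rewrite /jxi ?join_coordl ?join_coordr xi0.
have DDi t u i j : ev serC (jxi t u) (D t i j) * Di t u i j = 1.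
  apply: ser_invP; rewrite ev_coef0.
  rewrite (_ : _.@[_] = (D t i j).@[join_coord (wc x0) (wc x0)]); first by have [] := CD t i j.
  by apply: meval_eq => q; rewrite jxi0.
pose c t u : 'M[series K]_N := \matrix_(i, j) (ev serC (jxi t u) (C t i j) * Di t u i j).
have jval t u (B : series K -> Prop) L x x' : special L B xi (yt u) x -> special L B xi (yt (mT t u)) x' ->
    forall q, spec_val B L (jxi t u q) (join_coord (wc x) (wc x') q).
  move=> [_ _ v1 _] [_ _ v2 _]; elim/join_coordP => q; rewrite /jxi ?join_coordl ?join_coordr.
    exact: v1.
  exact: v2.
have c_val t u (B : series K -> Prop) L x x' i j : partial_hom serC B L -> L serX != 0 ->
    special L B xi (yt u) x -> special L B xi (yt (mT t u)) x' -> B (Di t u i j) ->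
    spec_val B L (c t u i j) (A (mG (ag_inv (gamma x)) (gamma x')) i j).
  move=> Lh L0 sp sp' BD; have jv := jval _ _ _ _ _ _ sp sp'.
  have [D0 vD] := val_inv Lh (DDi t u i j) (val_ev Lh (D t i j) jv) BD.
  have := val_M Lh (val_ev Lh (C t i j) jv) vD; rewrite /c mxE.
  have px := phi_sp _ _ _ _ L0 sp; have px' := phi_sp _ _ _ _ L0 sp'.
  have px'' : phi x' = a (mT (p t) (p (mT (la (L serX)) u))) y0.
    rewrite px' /slice_point; congr (a _ _); rewrite !slice_partM (TC (p (la _))) -ag_mulA.
    by congr (mT _ _); rewrite TC.
  have [_ CDE] := CD t i j; rewrite -CDE //.
  - by rewrite (gamma_cross px px'') ag_inv_mul ag_invK.
  - by have [] := sp.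
  - by have [] := sp'.
  - by rewrite px'' aM px.
pose Dl t u := [seq Di t u q.1 q.2 | q <- enum {: 'I_N * 'I_N}].
have mem_Dl t u i j : Di t u i j \in Dl t u.
  by apply/mapP; exists (i, j) => //; rewrite mem_enum.
have F_AM x x' i j : \sum_l F (i, l, false) x * F (l, j, true) x' = A (mG (ag_inv (gamma x)) (gamma x')) i j.
  by rewrite AM mxE.
have cE t u : serX ^+ bb *: c t u = gm false u *m gm true (mT t u).
  apply/matrixP => i j; rewrite [LHS]mxE [RHS]mxE; apply/eqP; rewrite -subr_eq0; apply/eqP.
  apply: (zero (yt u) (yt (mT t u)) _ (Dl t u)) => // B L x x' Lh BX L0 Bl sp sp'.
  have vX : spec_val B L serX (L serX) by split.
  have := val_B Lh (val_M Lh (val_X Lh bb vX) (c_val _ _ _ _ _ _ i j Lh L0 sp sp' (Bl _ (mem_Dl t u i j))))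
    (val_sum Lh (index_enum _) (fun l => val_M Lh (gm_val false _ _ _ _ i l Lh L0 sp)
      (gm_val true _ _ _ _ l j Lh L0 sp'))).
  congr spec_val; rewrite -F_AM mulr_sumr -sumrB big1 // => l _.
  by rewrite mulrACA -exprD subrr.
pose GA (B : 'M[K]_N) := exists g, B = A g.
have c_G t u q : group_ideal GA q -> ev serC (mxcoord (c t u)) q = 0.
  move=> Gq; apply: (zero (yt u) (yt (mT t u)) _ (Dl t u)) => // B L x x' Lh BX L0 Bl sp sp'.
  have v : forall l, spec_val B L (mxcoord (c t u) l) (mxcoord (A (mG (ag_inv (gamma x)) (gamma x'))) l).
    apply: mxcoordP => i j; rewrite !mxcoordE; exact: (c_val _ _ _ _ _ _ i j Lh L0 sp sp' (Bl _ (mem_Dl t u i j))).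
  have := val_ev Lh q v; rewrite Gq //; by eexists.
have c_gr t i j : graded lam o (fun u => c t u i j).
  have -> : (fun u => c t u i j) = (fun u => ev serC (jxi t u) (C t i j) * Di t u i j).
    by apply/funext => u; rewrite mxE.
  have jg q : graded lam o (fun u => jxi t u q).
    elim/join_coordP: q => q.
      have -> : (fun u => jxi t u (lshift (m + k) q)) = (fun u => xi (yt u) q).
        by apply/funext => u; rewrite /jxi join_coordl.
      exact: gr_comp.
    have -> : (fun u => jxi t u (rshift (m + k) q)) = (fun u => xi (yt (mT t u)) q).
      by apply/funext => u; rewrite /jxi join_coordr.
    exact: (graded_shift slice_point_char t (gr_comp q)).
  apply: graded_M; first exact: graded_ev.
  have jD u : ev serC (jxi t u) (D t i j) 0%N = (D t i j).@[join_coord (wc x0) (wc x0)].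
    by rewrite ev_coef0; apply: meval_eq => q; rewrite jxi0.
  have [D0 _] := CD t i j.
  by apply: (graded_inv D0 jD); exact: graded_ev.
have c_0 t u : mx_cong 1 (c t u) (map_mx serC (rho t)).
  move=> i j [|//] _; rewrite serB !mxE serCE eqxx mulr1n serM0.
  have jE (Q : {mpoly K[(m + k) + (m + k)]}) : ev serC (jxi t u) Q 0%N = Q.@[join_coord (wc x0) (wc x0)].
    by rewrite ev_coef0; apply: meval_eq => q; rewrite jxi0.
  have [D0 CDE] := CD t i j; have := CDE x0 x0 Ux0 Ux0; rewrite phi_x0 star_fix => /(_ erefl D0).
  rewrite -/e0 -/(d t) -/(rho t) jE => ->.
  have := congr1 (fun h : series K => h 0%N) (DDi t u i j); rewrite serM0 jE ser1 eqxx => D1.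
  by rewrite (_ : Di t u i j 0%N = (D t i j).@[join_coord (wc x0) (wc x0)]^-1) ?subrr //; apply: (mulfI D0); rewrite D1 divff.
have [ka [ka_gr ka_G ka_eq]] := @equivariant_trivialization K T mT (ag_one T) (@ag_mulA _ T) TC (@ag_mul1 _ T)
  N GA (ex_intro _ _ (esym A1))
  (fun _ _ g h => let: ex_intro x gx := g in let: ex_intro y hy := h in
     ex_intro _ (mG x y) (etrans (congr2 mulmx gx hy) (esym (AM x y))))
  (graded lam o) (@graded_C K T n lam o) (@graded_D K T n lam o) (@graded_M K T n lam o)
  (graded_shift slice_point_char) (@graded_limit K T n lam o) (fun F q => @graded_char K T mT n lam o slice_point_char F q)
  rho (fun t => A (d t)) (gm true) (gm false) bb c
  (fun t u => etrans (congr1 A (etrans (congr1 (@ag_inv K G) (etrans (congr1 d (TC t u)) (dM u t))) (ag_inv_mul (d u) (d t)))) (AM _ _))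
  (fun t => etrans (esym (AM _ _)) (etrans (congr1 A (ag_mulV (d t))) A1))
  (fun t => ex_intro _ (d t) erefl)
  (fun i j => T_char (fun t => (d_mor t).2 _ (A_reg i j (d t))))
  ga_gai ga_char cE
  c_gr
  c_G
  c_0.
have [h0 h0E] : exists h0, forall t i j, ka t i j 0%N = A h0 i j.
  have /choice[k0 k0E] : forall q : 'I_N * 'I_N, exists c0, forall t, ka t q.1 q.2 0%N = c0.
    by case=> i j; exact: (graded_coef0 lam_gt0 (ka_gr i j)).
  pose Mx : 'M[K]_N := \matrix_(i, j) k0 (i, j).
  have [q qG|h0 _ h0E] := clG (w := mxcoord Mx).
    have qGA : group_ideal GA q by move=> _ [g ->]; exact: (qG g I).
    have := congr1 (fun h : series K => h 0%N) (ka_G (ag_one T) q qGA).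
    rewrite ev_coef0 ser0 => <-; apply: meval_eq; apply: mxcoordP => i j.
    by rewrite !mxcoordE mxE (k0E (i, j)).
  exists h0 => t i j; rewrite (k0E (i, j)) -mxcoordE h0E mxcoordE mxE; by [].
(* Up to the factor z^(B0 M), this is the formal section compared with the trivialization of the
   open orbit. It satisfies mu(t u) = mu(u) rho(t) and is homogeneous under [la], hence it is a
   polynomial in z. *)
pose mu t := gm true t *m ka t.
have mu_eq t u : mu (mT t u) = mu u *m map_mx serC (rho t).
  rewrite /mu -mulmxA -ka_eq mulmxA; congr (_ *m _).
  apply: (@scale_serX_inj K N bb); rewrite scalemxAr cE mulmxA ga_gai.
  by rewrite mul_scalar_mx.
have o_la w i : w != 0 -> o (la w) i = w ^+ lam i.
  move=> w0; rewrite /o /yt slice_part_la //; have [_ ->] := la_act y0 w0.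
  by rewrite s_y0 mulr1.
have p1 : p (ag_one T) = ag_one T by rewrite /p a1 ell_y0 ag_inv1 ag_mulr1.
have o_1 i : o (ag_one T) i = 1 by rewrite /o /yt p1 a1.
have hom_la (H : T -> series K) w q : w != 0 -> graded lam o H -> H (la w) q = w ^+ q * H (ag_one T) q.
  move=> w0 /(_ q)[Q Qh QE]; rewrite !QE.
  rewrite -(wdeg_scale _ _ Qh); apply: meval_eq => l.
  by rewrite o_la // o_1 mulr1.
have mu_la w i j q : w != 0 -> w ^+ (B0 * M) * mu (la w) i j q = w ^+ q * mu (ag_one T) i j q.
  move=> w0.
  have psw : ps (la w) = w ^+ B0.
    rewrite /ps /B0 (big_morph _ (fun u v => exprD w u v) (expr0 _)); apply: eq_bigr => l _; exact: o_la.
  have ps1 : ps (ag_one T) = 1 by rewrite /ps big1 // => l _; exact: o_1.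
  have muE t : mu t i j = serC (ps t ^- M) * \sum_l ev serC (xi (yt t)) (P (i, l, true)) * ka t l j.
    rewrite /mu mxE mulr_sumr; apply: eq_bigr => l _; by rewrite mxE mulrA.
  rewrite !muE !serCM psw ps1 expr1n invr1 mul1r -exprM mulrA mulfV ?mul1r ?expf_neq0 //.
  apply: (hom_la (fun t => \sum_l ev serC (xi (yt t)) (P (i, l, true)) * ka t l j)) => //.
  apply: graded_sum => l; apply: graded_M => //; exact: graded_ev.
have [K0 [mm [muS mm_la]]] := equivariant_eigen (@ag_mulr1 K T) mu_eq mu_la.
pose mus := \sum_(q < K0) mm q.
have key (B : series K -> Prop) L t x : partial_hom serC B L -> B serX -> L serX != 0 ->
    (forall i j, B (ka t i j)) -> special L B xi (yt t) x ->
    exists h, (forall i j, L (ka t i j) = A h i j) /\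
      A (mG (gamma x) h) = mus *m rho (mT (la (L serX)) t).
  move=> Lh BX L0 Bk sp; have vX : spec_val B L serX (L serX) by split.
  have vk i j : spec_val B L (ka t i j) (L (ka t i j)) by split.
  have [q qG|h _ hE] := clG (w := mxcoord (map_mx L (ka t))).
    have v : forall l, spec_val B L (mxcoord (ka t) l) (mxcoord (map_mx L (ka t)) l).
      by apply: mxcoordP => i j; rewrite !mxcoordE mxE.
    have := val_ev Lh q v; rewrite ka_G; last by move=> _ [g ->]; exact: (qG g I).
    by have := val_C Lh 0; rewrite rmorph0 => v0 /(val_eq v0).
  have hE' i j : L (ka t i j) = A h i j by have := congr1 (fun v => v (mxvec_index i j)) hE; rewrite /= !mxcoordE mxE => ->.
  exists h; split=> //; apply/matrixP => i j.
  have v1 : spec_val B L (mu t i j) (L serX ^+ (B0 * M) * A (mG (gamma x) h) i j).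
    rewrite /mu AM mxE mxE mulr_sumr.
    have := val_sum Lh (index_enum _) (fun l => val_M Lh (gm_val true _ _ _ _ i l Lh L0 sp) (vk l j)).
    by congr spec_val; apply: eq_bigr => l _; rewrite hE' mulrA.
  have v2 : spec_val B L (mu t i j) (L serX ^+ (B0 * M) * (mus *m rho (mT (la (L serX)) t)) i j).
    rewrite muS.
    have := val_sum Lh (index_enum _) (fun q : 'I_K0 => val_M Lh (val_X Lh q vX) (val_C Lh ((mm q *m rho t) i j))).
    have rE : rho (mT (la (L serX)) t) = rho (la (L serX)) *m rho t.
      by rewrite /rho TC dM ag_inv_mul AM.
    congr spec_val; have := mm_la _ L0; rewrite rE mulmxA => me.
    transitivity ((L serX ^+ (B0 * M) *: (mus *m rho (la (L serX))) *m rho t) i j).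
      by rewrite me mulmx_suml summxE; apply: eq_bigr => q _; rewrite -scalemxAl [RHS]mxE.
    by rewrite -scalemxAl mxE.
  apply: (mulfI (expf_neq0 (B0 * M) L0)); exact: (val_eq v1 v2).
(* One specialization is enough: there the constant matrix [mus] is a product of elements of G. *)
have [mug mugE] : exists g, mus = A g.
  have [B [L [x [x' [Lh [_ BX Bl] [_ L0] sp _]]]]] := xi_sp
    [seq ka (ag_one T) q.1 q.2 | q <- enum {: 'I_N * 'I_N}] (ellp (ag_one T)) (ellp (ag_one T))
    (oner_neq0 _).
  have [|h [_ hE]] := key B L (ag_one T) x Lh BX L0 _ sp.
    by move=> i j; apply: Bl; apply/mapP; exists (i, j) => //; rewrite mem_enum.
  exists (mG (mG (gamma x) h) (d (mT (la (L serX)) (ag_one T)))).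
  by rewrite AM hE -mulmxA /rho -AM ag_mulV A1 mulmx1.
exists (r e1 mug), ka, h0; split=> //.
- by split; [apply/morphismP => t; exact: d_mor|exact: dM].
- by rewrite /e1; have := f_sec1 x1; rewrite phi1_x1 => <-; rewrite fr.
- move=> B L t x Lh BX L0 Bk sp; have [h [hE hm]] := key B L t x Lh BX L0 Bk sp.
  exists h; split=> // u xu; rewrite (gammaE xu) -rM br -rM; congr (r _ _).
  apply: A_inj; rewrite hm mugE /rho -AM; congr (A (mG _ (ag_inv _))).
  have : u = p (mT (la (L serX)) t) by rewrite -(tinvK u) -xu (phi_sp _ _ _ _ L0 sp) tinvK.
  by move=> ->; rewrite /d slice_part_id.
Qed.

End FormalSection.

(** * Algebraicity of the section *)

Section Sigma.
Variables (K : closedFieldType) (T G : alg_group K) (E Y : fspace K) (a : T -> Y -> Y) (f : E -> Y)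
  (b : T -> E -> E) (r : E -> G -> E).
Local Notation mT := (@ag_mul K T).
Local Notation mG := (@ag_mul K G).
Hypotheses (nE : charted E) (nY : charted Y) (TC : forall s t, mT s t = mT t s)
  (a_mor : forall z : prod_space T Y, morph_at (fun p : prod_space T Y => a p.1 p.2) z)
  (b_mor : forall z : prod_space T E, morph_at (fun p : prod_space T E => b p.1 p.2) z)
  (r_mor : forall z : prod_space E G, morph_at (fun p : prod_space E G => r p.1 p.2) z)
  (a1 : forall y, a (ag_one T) y = y) (aM : forall s t y, a (mT s t) y = a s (a t y))
  (b1 : forall e, b (ag_one T) e = e) (bM : forall s t e, b (mT s t) e = b s (b t e))
  (rM : forall e g h, r e (mG g h) = r (r e g) h) (br : forall t e g, b t (r e g) = r (b t e) g).
Hypotheses (sepE : separated_space E) (irrY : irreducible_space Y)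
  (chE : forall e : E, exists (W : set E) q (eps : E -> 'I_q -> K),
     [/\ W e, chart W eps & closed_chart W eps]).
Variables (ny : nat) (yc : Y -> 'I_ny -> K).
Hypothesis chY : chart setT yc.
Variables (y0 ystar : Y) (n : nat) (lam : 'I_n -> nat) (s : Y -> 'I_n -> K) (ell : Y -> T) (la : K -> T)
  (tinv : Y -> T).
Hypotheses (lam_gt0 : forall i, (0 < lam i)%N)
  (s_reg : forall y i, regular_at y (s^~ i)) (ell_mor : forall y, morph_at ell y)
  (ell_sl : forall y, ell (a (ag_inv (ell y)) y) = ag_one T)
  (la_act : forall w y, w != 0 -> ell (a (la w) y) = ell y /\ forall i, s (a (la w) y) i = w ^+ lam i * s y i)
  (ell_star : ell ystar = ag_one T) (s_star : forall i, s ystar i = 0)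
  (germ_star : forall f, regular_at ystar f -> exists P Q : {mpoly K[n]}, Q.@[fun=> 0] != 0 /\
            forall y, ell y = ag_one T -> Q.@[s y] != 0 -> f y = P.@[s y] / Q.@[s y])
  (tinvK : forall t, tinv (a t y0) = t) (tinv_mor : forall t, morph_at tinv (a t y0))
  (orb_open : open (range (a^~ y0))).
Let ret y := a (ag_inv (ell y)) y.
Let yt t := slice_point a y0 ell t.
Let p t := slice_part a y0 ell t.
Let nT : charted T. Proof. exact: alg_group_charted. Qed.
Let nG : charted G. Proof. exact: alg_group_charted. Qed.

Let ret_orb t : ret (a t y0) = yt t.
Proof. by rewrite /ret /yt /slice_point /slice_part TC aM. Qed.

Let ret_sl y : ell y = ag_one T -> ret y = y.
Proof. by rewrite /ret => ->; rewrite ag_inv1 a1. Qed.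

Let ell_yt t : ell (yt t) = ag_one T. Proof. by rewrite -ret_orb /ret ell_sl. Qed.

Let a_mor' (Z : fspace K) (u : Z -> T) (v : Z -> Y) z : charted Z -> morph_at u z -> morph_at v z ->
  morph_at (fun z => a (u z) (v z)) z.
Proof. by move=> nZ hu hv; exact: (morph_at_comp (morph_at_pair nT nY nZ hu hv) (a_mor _)). Qed.
Let b_mor' (Z : fspace K) (u : Z -> T) (v : Z -> E) z : charted Z -> morph_at u z -> morph_at v z ->
  morph_at (fun z => b (u z) (v z)) z.
Proof. by move=> nZ hu hv; exact: (morph_at_comp (morph_at_pair nT nE nZ hu hv) (b_mor _)). Qed.
Let r_mor' (Z : fspace K) (u : Z -> E) (v : Z -> G) z : charted Z -> morph_at u z -> morph_at v z ->
  morph_at (fun z => r (u z) (v z)) z.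
Proof. by move=> nZ hu hv; exact: (morph_at_comp (morph_at_pair nE nG nZ hu hv) (r_mor _)). Qed.

Let ret_mor y : morph_at ret y.
Proof. exact: (a_mor' nY (morph_at_inv (ell_mor y)) (morph_at_id y)). Qed.

Let q_reg (q : {mpoly K[n]}) y : regular_at y (fun y => q.@[s (ret y)]).
Proof.
apply: (@reg_ev _ _ y nY _ (fun i y => s (ret y) i) q) => i.
exact: ((ret_mor y).2 _ (s_reg (ret y) i)).
Qed.

Definition slice_nonzero (q : {mpoly K[n]}) := exists y, q.@[s (a (ag_inv (ell y)) y)] != 0.
Local Notation nz := slice_nonzero.

Let reg_open (F : Y -> K) : (forall y, regular_at y F) -> open [set y | F y != 0].
Proof. by move=> Fr; rewrite openE => y; exact: (reg_neq0 nY (Fr y)). Qed.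

Let open_generic (O : set Y) (F : Y -> K) : open O -> O !=set0 -> (forall y, regular_at y F) ->
  (exists y, F y != 0) -> exists t, O (a t y0) /\ F (a t y0) != 0.
Proof.
move=> oO On Fr [y Fy]; have [_ irr] := irrY.
have [z [Oz Fz]] : O `&` [set y | F y != 0] !=set0.
  by apply: irr => //; [exact: reg_open|exists y].
have [w [[Ow Fw] [t _ tw]]] : (O `&` [set y | F y != 0]) `&` range (a^~ y0) !=set0.
  apply: irr => //; first by apply: openI => //; exact: reg_open.
    by exists z.
  by exists (a (ag_one T) y0); exists (ag_one T).
by exists t; rewrite tw.
Qed.

Let nbhs_open (y : Y) (S : set Y) : nbhs y S -> exists O : set Y, [/\ open O, O y & O `<=` S].
Proof. by move=> nS; exists (S^°)%classic; split; [exact: open_interior|exact: nS|exact: interior_subset]. Qed.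

Lemma slice_generic (O : set Y) q : open O -> O !=set0 -> nz q -> exists t, O (a t y0) /\ q.@[s (yt t)] != 0.
Proof.
move=> oO On nq; have [t [Ot qt]] := open_generic oO On (q_reg q) nq.
by exists t; rewrite -ret_orb.
Qed.

Lemma slice_nonzeroM q1 q2 : nz q1 -> nz q2 -> nz (q1 * q2).
Proof.
move=> n1 n2; have [t [q1t q2t]] := slice_generic (reg_open (q_reg q1)) n1 n2.
exists (a t y0); rewrite -/(ret _) mevalM; apply: mulf_neq0; [exact: q1t|by rewrite ret_orb].
Qed.

Lemma slice_nonzero0 (q : {mpoly K[n]}) : q.@[fun=> 0] != 0 -> nz q.
Proof.
move=> q0; exists ystar; rewrite -/(ret _) ret_sl //.
by rewrite (_ : s ystar = fun=> 0) //; apply/funext.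
Qed.

Lemma slice_nonzero_prod (I : Type) (l : seq I) (q : I -> {mpoly K[n]}) :
  (forall i, nz (q i)) -> nz (\prod_(i <- l) q i).
Proof.
move=> nq; elim: l => [|i l IH]; last by rewrite big_cons; apply: slice_nonzeroM.
by rewrite big_nil; apply: slice_nonzero0; rewrite meval1 oner_neq0.
Qed.

Let yc_reg (q : {mpoly K[ny]}) y : regular_at y (fun y => q.@[yc y]).
Proof. by apply: (@reg_ev _ _ y nY _ (fun i y => yc y i) q) => i; exact: (reg_coord i chY I). Qed.

Let slice_frac (q : {mpoly K[ny]}) y1 : ell y1 = ag_one T -> q.@[yc y1] != 0 ->
  exists P Q : {mpoly K[n]}, nz (P * Q) /\
    forall y, ell y = ag_one T -> (P * Q).@[s y] != 0 -> q.@[yc y] = P.@[s y] / Q.@[s y].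
Proof.
move=> sl1 q1; have [P [Q [Q0 PQ]]] := germ_star (yc_reg q ystar).
exists P, Q; split; last by move=> y sy; rewrite mevalM mulf_eq0 negb_or => /andP[_ Qy]; exact: PQ.
apply: slice_nonzeroM; last exact: slice_nonzero0.
have Fr y : regular_at y (fun y => q.@[yc (ret y)]) := (ret_mor y).2 _ (yc_reg q (ret y)).
have [||t [Qt qt]] := open_generic (reg_open (q_reg Q)) _ Fr.
- exact: (slice_nonzero0 Q0).
- by exists y1; rewrite ret_sl.
exists (a t y0); rewrite -/(ret _); move: qt; rewrite PQ //; last by rewrite /ret ell_sl.
by rewrite mulf_eq0 negb_or => /andP[].
Qed.

(** Polynomials in the coordinates of Y are fractions in [s] near [ystar], valid on the slice where
    their denominators are nonzero. By irreducibility, a denominator nonzero at one point of the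
    slice has a numerator that is not identically zero there, and can be inverted generically. *)
Lemma slice_rational y1 (F : Y -> K) : ell y1 = ag_one T -> regular_at y1 F ->
  exists P Q : {mpoly K[n]}, nz Q /\
    forall y, ell y = ag_one T -> Q.@[s y] != 0 -> F y = P.@[s y] / Q.@[s y].
Proof.
move=> sl1 Fr; have [_ cr _] := chY; have [/(_ Fr)[u [v [v1 uv]]] _] := cr y1 F I.
have [P2 [Q2 [n2 E2]]] := slice_frac sl1 v1.
have [P [Q [Q0 PQ]]] := germ_star (yc_reg u ystar).
exists (P * Q2 * Q2), (Q * (P2 * Q2)); split; first by apply: slice_nonzeroM => //; exact: slice_nonzero0.
move=> y sy; rewrite mevalM mulf_eq0 negb_or => /andP[Qy PQ2].
move: (PQ2); rewrite mevalM mulf_eq0 negb_or => /andP[P2y Q2y].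
have vy : v.@[yc y] != 0 by rewrite E2 // mulf_neq0 // invr_neq0.
rewrite (uv y I vy) PQ // E2 // !mevalM.
by field; rewrite Qy P2y Q2y.
Qed.

Lemma slice_nbhs y1 (V : set Y) : ell y1 = ag_one T -> nbhs y1 V ->
  exists2 Q : {mpoly K[n]}, nz Q & forall y, ell y = ag_one T -> Q.@[s y] != 0 -> V y.
Proof.
move=> sl1 nV; have [_ _ cn] := chY; have [/(_ nV)[v v1 vV] _] := cn y1 V I.
have [P [Q [n2 E2]]] := slice_frac sl1 v1; exists (P * Q) => // y sy PQ.
apply: vV => //; rewrite E2 //; move: PQ; rewrite mevalM mulf_eq0 negb_or => /andP[Py Qy].
by rewrite mulf_neq0 // invr_neq0.
Qed.

(** A [chart] is not assumed injective: points with equal coordinates have the same neighbourhoods,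
    and separatedness of E identifies them. *)
Lemma separated_chart_inj (W : set E) q (eps : E -> 'I_q -> K) e e' : chart W eps -> W e -> W e' ->
  eps e = eps e' -> e = e'.
Proof.
move=> chW We We' ee; apply: contrapT => ne.
have [_ _ cn] := prod_chart chW chW.
have nb : nbhs ((e, e') : prod_space E E) (~` [set p : prod_space E E | p.1 = p.2]).
  by apply: open_nbhs_nbhs; split=> //; apply: closed_openC; exact: sepE.
have [h1 _] := cn ((e, e') : prod_space E E) (~` [set p : prod_space E E | p.1 = p.2]) (conj We We').
have [v v1 vV] := h1 nb.
by apply: (vV (e, e)) => //; move: v1 => /=; rewrite ee.
Qed.

Lemma separated_eq (u v : Y -> E) y q : nz q -> morph_at u y -> morph_at v y ->
  nbhs y [set z | forall t, z = a t y0 -> q.@[s (yt t)] != 0 -> u z = v z] -> u y = v y.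
Proof.
move=> nq um vm nb; apply: contrapT => ne.
have uvm : morph_at (fun z => (u z, v z) : prod_space E E) y by exact: morph_at_pair.
have nd : nbhs ((u y, v y) : prod_space E E) (~` [set p : prod_space E E | p.1 = p.2]).
  by apply: open_nbhs_nbhs; split=> //; apply: closed_openC; exact: sepE.
have [O [oO Oy sub]] := nbhs_open (filterI nb (uvm.1 _ nd)).
have [|t [Ot qt]] := slice_generic oO _ nq; first by exists y.
by have [h1 h2] := sub _ Ot; apply: h2; exact: (h1 t).
Qed.

Variables (X : fspace K) (phi : X -> Y) (x0 : X) (sec : X -> E).
Hypotheses (nX : charted X) (sec_mor : forall x, morph_at sec x).
Variables (U : set X) (m k : nat) (zc : Y -> 'I_m -> K) (tc : X -> 'I_k -> K).
Let wc x := join_coord (zc (phi x)) (tc x).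
Hypotheses (Ux0 : U x0) (chU : chart U wc).
Variable xi : Y -> 'I_(m + k) -> series K.
Let mv w y := a (la w) y.
Let special := special_point phi lam s mv U zc tc.
Hypotheses (xi_gr : forall i, graded lam s (fun y => xi y i)) (xi0 : forall y i, xi y i 0%N = wc x0 i)
  (xi_sp : forall y1 y2 h (l : seq (series K)), ell y1 = ag_one T -> ell y2 = ag_one T -> h != 0 ->
        exists (A : series K -> Prop) (L : series K -> K) x1 x2,
          [/\ partial_hom serC A L, [/\ A h, A serX & forall e, e \in l -> A e], L h != 0 /\ L serX != 0,
              special L A xi y1 x1 & special L A xi y2 x2]).
Variables (N : nat) (A : G -> 'M[K]_N).
Hypotheses (chG : chart setT (fun g => mxcoord (A g))).
Variables (d : T -> G) (eb : E) (ka : T -> 'M[series K]_N) (h0 : G).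
Hypotheses (dM : forall t u, d (mT t u) = mG (d t) (d u)) (d_mor : forall t, morph_at d t)
  (ka_gr : forall i j, graded lam (fun t => s (yt t)) (fun t => ka t i j))
  (ka0 : forall t i j, ka t i j 0%N = A h0 i j)
  (ka_sp : forall (B : series K -> Prop) L t x, partial_hom serC B L -> B serX -> L serX != 0 ->
    (forall i j, B (ka t i j)) -> special L B xi (yt t) x ->
    exists h, (forall i j, L (ka t i j) = A h i j) /\
      forall u, phi x = a u y0 -> r (sec x) h = r (b u eb) (ag_inv (d u))).

(** Here [t] stands for the point t y0; the twist by [d t] turns the T-orbit of [eb] into a section
    sigma with u sigma(y) = sigma(u y) d(u). *)
Definition orbit_section t := r (b t eb) (ag_inv (d t)).
Let sg y := orbit_section (tinv y).

Let sg_mor t : morph_at sg (a t y0).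
Proof.
have tm := tinv_mor t; apply: r_mor' => //.
  by apply: b_mor' => //; exact: morph_at_const.
by apply: morph_at_inv; exact: (morph_at_comp tm (d_mor _)).
Qed.

Let jc x h := join_coord (wc x) (mxcoord (A h)).
Let jxi t := join_coord (xi (yt t)) (mxcoord (ka t)).

Let jxi_gr i : graded lam (fun t => s (yt t)) (fun t => jxi t i).
Proof.
elim/join_coordP: i => i.
  have -> : (fun t => jxi t (lshift (N * N) i)) = (fun t => xi (yt t) i).
    by apply/funext => t; rewrite /jxi join_coordl.
  by move=> q; have [Q Qh QE] := xi_gr i q; exists Q.
have -> : (fun t => jxi t (rshift (m + k) i)) = (fun t => mxcoord (ka t) i).
  by apply/funext => t; rewrite /jxi join_coordr.
elim/mxcoordP: i => i j.
have -> : (fun t => mxcoord (ka t) (mxvec_index i j)) = (fun t => ka t i j).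
  by apply/funext => t; rewrite mxcoordE.
exact: ka_gr.
Qed.

Let jxi0 t i : jxi t i 0%N = jc x0 h0 i.
Proof.
elim/join_coordP: i => i; rewrite /jxi /jc ?join_coordl ?join_coordr; first exact: xi0.
by elim/mxcoordP: i => i j; rewrite !mxcoordE ka0.
Qed.

Let ka_list t := [seq ka t q.1 q.2 | q <- enum {: 'I_N * 'I_N}].

Let special_jxi (B : series K -> Prop) L t x : partial_hom serC B L -> B serX -> L serX != 0 ->
  (forall e, e \in ka_list t -> B e) -> special L B xi (yt t) x ->
  exists h u, [/\ phi x = a u y0, ell (phi x) = ag_one T, r (sec x) h = orbit_section u &
    forall i, spec_val B L (jxi t i) (jc x h i)].
Proof.
move=> Lh BX L0 Bl sp.
have Bk i j : B (ka t i j) by apply: Bl; apply/mapP; exists (i, j) => //; rewrite mem_enum.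
have [h [hE hr]] := ka_sp Lh BX L0 Bk sp; have [Ux px vx _] := sp.
exists h, (mT (la (L serX)) (p t)).
have pE : phi x = a (mT (la (L serX)) (p t)) y0 by rewrite px /mv aM.
split=> //; first by rewrite px /mv; have [-> _] := la_act (yt t) L0.
  exact: hr.
elim/join_coordP => i; rewrite /jxi /jc ?join_coordl ?join_coordr; first exact: vx.
by elim/mxcoordP: i => i j; rewrite !mxcoordE -hE; split.
Qed.

(** In a chart of E around the limit of the formal section, the coordinates of the orbit section are
    generically fractions in [s] on the slice, and agree along the arcs with fractions in (x, h)
    defined at (x0, h0). [descent] combines both into fractions defined at [ystar], and the closed
    chart turns these into a map to E. *)
Lemma local_sigma : exists (Q : {mpoly K[n]}) (sg0 : Y -> E), Q.@[fun=> 0] != 0 /\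
  forall y, Q.@[s (ret y)] != 0 -> morph_at sg0 y /\ forall t, y = a t y0 -> sg0 y = orbit_section (p t).
Proof.
have [W [q [eps [We chW clW]]]] := chE (r (sec x0) h0).
have nXG : charted (prod_space X G) by exact: charted_prod.
have pch := prod_chart chU chG; have [_ pcr pcn] := pch.
have mor : morph_at (fun z : prod_space X G => r (sec z.1) z.2) (x0, h0).
  exact: (r_mor' nXG (morph_at_comp (@morph_at_fst _ X G (x0, h0) nX nG) (sec_mor _)) (@morph_at_snd _ X G (x0, h0) nX nG)).
have U0 : [set z : prod_space X G | U z.1 /\ setT z.2] (x0, h0) by [].
have [hW _] := pcn (x0, h0) ((fun z : prod_space X G => r (sec z.1) z.2) @^-1` W) U0.
have [QW QW0 QWE] := hW (mor.1 _ (chart_nbhs chW We)).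
have PQex i : exists PQ : {mpoly K[m + k + N * N]} * {mpoly K[m + k + N * N]},
    PQ.2.@[jc x0 h0] != 0 /\ forall x h, U x -> PQ.2.@[jc x h] != 0 ->
      eps (r (sec x) h) i = PQ.1.@[jc x h] / PQ.2.@[jc x h].
  have [h1 _] := pcr (x0, h0) ((eps^~ i) \o (fun z : prod_space X G => r (sec z.1) z.2)) U0.
  have [P [Q [Q0 PQE]]] := h1 (mor.2 _ (reg_coord i chW We)).
  by exists (P, Q); split=> // x h Ux Qx; have := PQE (x, h) (conj Ux I) Qx.
have /choice[PQ PQE] := PQex.
have evQW : ev serC (jxi (ag_one T)) QW != 0.
  apply: contraNneq QW0 => z; have := ev_coef0 (jxi (ag_one T)) QW; rewrite z ser0 => z'.
  by apply/eqP; rewrite z'; apply: meval_eq => i; rewrite jxi0.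
(* Some specialization of the formal section lies in [W], which supplies a point of the slice where
   the chart can be used. *)
have [B [L [x [x' [Lh [BQ BX Bl] [LQ L0] sp _]]]]] :=
  xi_sp (ka_list (ag_one T)) (ell_yt (ag_one T)) (ell_yt (ag_one T)) evQW.
have [h [u [pxu slx rx vj]]] := special_jxi Lh BX L0 Bl sp.
have Ux : U x by case: sp.
have Wsg : W (sg (a u y0)).
  rewrite /sg tinvK -rx; apply: (QWE (x, h)) => //=.
  by have [_ <-] := val_ev Lh QW vj.
have slu : ell (a u y0) = ag_one T by rewrite -pxu.
have rat i : exists PQ : {mpoly K[n]} * {mpoly K[n]}, nz PQ.2 /\
    forall y, ell y = ag_one T -> PQ.2.@[s y] != 0 -> eps (sg y) i = PQ.1.@[s y] / PQ.2.@[s y].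
  have [P [Q PQr]] := slice_rational slu ((sg_mor u).2 _ (reg_coord i chW Wsg)).
  by exists (P, Q).
have /choice[ab abE] := rat.
have [bW bW0 bWE] := slice_nbhs slu ((sg_mor u).1 _ (chart_nbhs chW Wsg)).
have desc i : exists qr : {mpoly K[n]} * {mpoly K[n]}, qr.1.@[fun=> 0] != 0 /\
    forall t, (ab i).2.@[s (yt t)] != 0 -> qr.1.@[s (yt t)] * eps (sg (yt t)) i = qr.2.@[s (yt t)].
  pose P1 := (PQ i).1; pose Q1 := (PQ i).2; pose a1' := (ab i).1; pose b1' := (ab i).2.
  have [Q10 PQ1] := PQE i; have [_ ab1] := abE i.
  pose lf (h : {mpoly K[m + k + N * N]}) : {mpoly K[(m + k + N * N) + n]} := msub (fun i => 'X_(lshift n i)) h.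
  pose rf (h : {mpoly K[n]}) : {mpoly K[(m + k + N * N) + n]} := msub (fun i => 'X_(rshift (m + k + N * N) i)) h.
  have lfE h' v w : (lf h').@[join_coord v w] = h'.@[v].
    by rewrite meval_msub; apply: meval_eq => j; rewrite mevalXU join_coordl.
  have rfE h' v w : (rf h').@[join_coord v w] = h'.@[w].
    by rewrite meval_msub; apply: meval_eq => j; rewrite mevalXU join_coordr.
  (* The extra factors [b1'] and [Q1] make the relation vanish also where one of these denominators
     does. *)
  pose Fx := rf (a1' * b1') * lf (Q1 * Q1) - rf (b1' * b1') * lf (P1 * Q1).
  have S0 j : ('X_j : {mpoly K[n]}).@[fun=> 0] = 0 by rewrite mevalXU.
  have Sv (h' : {mpoly K[n]}) : (forall t, h'.@[s (yt t)] = 0) ->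
      forall t : T, h'.@[fun j => ('X_j : {mpoly K[n]}).@[s (yt t)]] = 0.
    by move=> h'0 t; rewrite -(h'0 t); apply: meval_eq => j; rewrite mevalXU.
  have Qn : (lf (Q1 * Q1)).@[join_coord (jc x0 h0) (fun=> 0)] != 0 by rewrite lfE mevalM mulf_neq0.
  have FE v w : Fx.@[join_coord v w] = a1'.@[w] * b1'.@[w] * (Q1.@[v] * Q1.@[v]) - b1'.@[w] * b1'.@[w] * (P1.@[v] * Q1.@[v]).
    by rewrite /Fx mevalB !(mevalM (join_coord _ _)) !lfE !rfE !mevalM.
  have id1 (t : T) (v : 'I_(m + k + N * N) -> K) : (1 : {mpoly K[n]}).@[s (yt t)] *
      ((a1' * b1').@[s (yt t)] * (lf (Q1 * Q1)).@[join_coord v (s (yt t))] -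
       (b1' * b1').@[s (yt t)] * (lf (P1 * Q1)).@[join_coord v (s (yt t))]) =
      \sum_(j : unit) (1 : {mpoly K[n]}).@[s (yt t)] * Fx.@[join_coord v (fun j => ('X_j : {mpoly K[n]}).@[s (yt t)])].
    rewrite (_ : (fun j => ('X_j : {mpoly K[n]}).@[s (yt t)]) = s (yt t)); last by apply/funext => j; rewrite mevalXU.
    by rewrite sumr_const card_unit mulr1n FE !lfE !mevalM.
  have arc0 t (j : unit) : ev serC (join_coord (jxi t) (weight_arc lam (fun t => s (yt t)) t)) Fx = 0.
    apply: (arcs_zero xi_sp (l := ka_list t) (ell_yt t) (ell_yt t)) => B' L' z z' Lh' BX' L0' Bl' sp' _.
    have [h' [u' [pz slz rz vz]]] := special_jxi Lh' BX' L0' Bl' sp'.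
    have [Uz pz' _ va] := sp'.
    have vall i' : spec_val B' L' (join_coord (jxi t) (weight_arc lam (fun t => s (yt t)) t) i')
        (join_coord (jc z h') (s (phi z)) i').
      elim/join_coordP: i' => i'; rewrite ?join_coordl ?join_coordr; first exact: vz.
      by rewrite pz'; exact: va.
    have := val_ev Lh' Fx vall; congr spec_val; rewrite FE.
    have [Qz|Qz] := eqVneq (Q1.@[jc z h']) 0; first by rewrite Qz !mulr0 subrr.
    have [bz|bz] := eqVneq (b1'.@[s (phi z)]) 0; first by rewrite bz !mulr0 !mul0r subrr.
    have e1 := PQ1 z h' Uz Qz; have e2 := ab1 (phi z) slz bz.
    move: e2; rewrite {1}pz /sg tinvK -rz e1 => e2.
    have -> : a1'.@[s (phi z)] = P1.@[jc z h'] / Q1.@[jc z h'] * b1'.@[s (phi z)].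
      by rewrite e2 divfK.
    by field.
  have [Q [R [Q0 QR]]] := @descent K n (fun=> 0) T n lam (fun t => s (yt t)) (ag_one T) lam_gt0
    T (fun t => s (yt t)) (fun j => 'X_j) S0 Sv _ jxi (jc x0 h0) jxi_gr jxi0
    (a1' * b1') (b1' * b1') 1 (lf (P1 * Q1)) (lf (Q1 * Q1)) unit (fun=> 1) (fun=> Fx) Qn id1 arc0.
  exists (Q, R); split=> // t bt; have /= := QR t; rewrite meval1 !mul1r !mevalM => QRt.
  rewrite ab1 //; apply: (mulIf bt); apply: (mulIf bt); rewrite -[RHS]mulrA -QRt.
  by field.
have /choice[qr qrE] := desc.
pose Qa := \prod_i (qr i).1.
have QaE v : Qa.@[v] != 0 -> forall i, (qr i).1.@[v] != 0.
  by move=> Qv i; move: Qv; rewrite /Qa (bigD1 i) //= mevalM mulf_eq0 negb_or => /andP[].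
pose bb := bW * \prod_i (ab i).2.
have bb_nz : nz bb.
  by apply: slice_nonzeroM => //; apply: slice_nonzero_prod => i; have [] := abE i.
pose w y i := (qr i).2.@[s (ret y)] / (qr i).1.@[s (ret y)].
have w_reg y i : Qa.@[s (ret y)] != 0 -> regular_at y (fun y => w y i).
  by move=> /QaE Qy; exact: (reg_M nY (q_reg _ y) (reg_V nY (q_reg _ y) (Qy i))).
have w_sg t : Qa.@[s (yt t)] != 0 -> bb.@[s (yt t)] != 0 ->
    W (sg (yt t)) /\ forall i, eps (sg (yt t)) i = w (a t y0) i.
  move=> Qt; rewrite /bb mevalM mulf_eq0 negb_or => /andP[bWt bt]; split; first exact: bWE.
  move=> i; have bi : (ab i).2.@[s (yt t)] != 0.
    by move: bt; rewrite (bigD1 i) //= mevalM mulf_eq0 negb_or => /andP[].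
  have [_ qrt] := qrE i; have := qrt t bi; have Qi := QaE _ Qt i.
  by rewrite /w ret_orb => <-; rewrite mulrC mulKf.
have Q_near y : Qa.@[s (ret y)] != 0 -> nbhs y [set y | Qa.@[s (ret y)] != 0].
  exact: (reg_neq0 nY (q_reg Qa y)).
have /choice[sg0 sg0E] : forall y, exists e, Qa.@[s (ret y)] != 0 -> W e /\ eps e = w y.
  move=> y; have [Qy|Qy] := eqVneq (Qa.@[s (ret y)]) 0; first by exists eb.
  have [pp ppW|e We' ee] := clW (w y); last by exists e.
  apply/eqP; apply: contrapT => /negP pw.
  have pr : regular_at y (fun y => pp.@[w y]).
    by apply: (@reg_ev _ _ y nY _ (fun i y => w y i) pp) => i; exact: w_reg.
  have [O [oO Oy sub]] := nbhs_open (filterI (Q_near y Qy) (reg_neq0 nY pr pw)).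
  have [|t [Ot bt]] := slice_generic oO _ bb_nz; first by exists y.
  have [Qt pt] := sub _ Ot; have [|Wt wt] := w_sg t _ bt; first by rewrite -ret_orb.
  by move/negP: pt; apply; rewrite -(ppW _ Wt); apply/eqP; apply: meval_eq => i; rewrite wt.
exists Qa, sg0; split.
  by rewrite /Qa rmorph_prod; apply/prodf_neq0 => i _; have [] := qrE i.
move=> y Qy; have [W0 e0] := sg0E y Qy.
have sm : morph_at sg0 y.
  apply: (morph_at_chart nY chW W0).
    by apply: filterS (Q_near y Qy) => z Qz; have [] := sg0E z Qz.
  move=> i; apply: regular_at_local (w_reg y i Qy); apply: filterS (Q_near y Qy) => z Qz.
  by have [_ ->] := sg0E z Qz.
split=> // t yt'; transitivity (sg (ret y)); last by rewrite yt' ret_orb /sg tinvK.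
apply: (separated_eq (v := fun y => sg (ret y)) bb_nz sm); first by apply: (morph_at_comp (ret_mor y)); rewrite yt' ret_orb; exact: sg_mor.
apply: filterS (Q_near y Qy) => z Qz t' zt bt; have [Wz ez] := sg0E z Qz.
have [|Ws ws] := w_sg t' _ bt; first by rewrite -ret_orb -zt.
have E1 : ret z = yt t' by rewrite zt ret_orb.
apply: (separated_chart_inj chW Wz); rewrite E1 //.
by rewrite ez; apply/funext => i; rewrite ws -zt.
Qed.

(** Every point y is moved into the domain of [sg0] by la(w) ell(y)^-1 for suitable w, because [la]
    contracts the slice to [ystar]. The translates [tau u] extend the same section of the open orbit
    and are glued by separatedness. *)
Lemma equivariant_sigma : exists sigma : Y -> E,
  (forall y, morph_at sigma y) /\ forall t, sigma (a t y0) = orbit_section t.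
Proof.
have [Q [sg0 [Q0 sgE]]] := local_sigma.
pose v u y := mT (ag_inv (ell (a u y))) u.
pose tau u y := r (b (ag_inv (v u y)) (sg0 (a u y))) (d (v u y)).
have au_mor u y : morph_at (a u) y by apply: (a_mor' nY _ (morph_at_id y)); exact: morph_at_const.
have v_mor u y : morph_at (v u) y.
  apply: morph_at_mul => //; last exact: morph_at_const.
  by apply: morph_at_inv; exact: (morph_at_comp (au_mor u y) (ell_mor _)).
have tau_mor u y : Q.@[s (ret (a u y))] != 0 -> morph_at (tau u) y.
  move=> /sgE[sm _]; apply: r_mor' => //; last exact: (morph_at_comp (v_mor u y) (d_mor _)).
  apply: b_mor' => //; first by apply: morph_at_inv; exact: v_mor.
  exact: (morph_at_comp (au_mor u y) sm).
have tau_orb u t : Q.@[s (ret (a u (a t y0)))] != 0 -> tau u (a t y0) = orbit_section t.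
  move=> /sgE[_ /(_ (mT u t))]; rewrite aM => /(_ erefl) sE; rewrite /tau sE.
  have -> : p (mT u t) = mT (v u (a t y0)) t.
    by rewrite /p /slice_part /v aM [LHS]TC ag_mulA.
  rewrite /orbit_section br bM -[b (ag_inv _) (b _ _)]bM ag_mulV b1 -rM dM ag_inv_mul.
  by rewrite -ag_mulA ag_mulV ag_mulr1.
have near_u y : exists u, Q.@[s (ret (a u y))] != 0.
  (* [Q] along the contraction of y: a polynomial in w with nonzero value at 0. *)
  pose pl : {poly K} := \sum_(mm <- msupp Q) (Q@_mm * \prod_i s (ret y) i ^+ mm i) *: 'X^(wdeg lam mm).
  have plE w : pl.[w] = Q.@[fun i => w ^+ lam i * s (ret y) i].
    rewrite /pl horner_sum mevalE; apply: eq_bigr => mm _; rewrite hornerZ hornerXn -mulrA; congr (_ * _).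
    rewrite /wdeg (big_morph _ (fun u v => exprD w u v) (expr0 _)) mulrC -big_split.
    by apply: eq_bigr => i _; rewrite exprMn -exprM mulnC.
  have pl0 : pl != 0.
    apply: contraNneq Q0 => z; have := plE 0; rewrite z horner0 => /esym e; rewrite -e; apply/eqP.
    by apply: meval_eq => i; rewrite expr0n gtn_eqF // mul0r.
  have [w w0 pw] := poly_nonroot pl0; exists (mT (la w) (ag_inv (ell y))).
  rewrite aM -/(ret y); have [le sw] := la_act (ret y) w0.
  rewrite (_ : ret (a (la w) (ret y)) = a (la w) (ret y)); last by apply: ret_sl; rewrite le /ret ell_sl.
  by move: pw; rewrite plE; congr (_ != 0); apply: meval_eq => i; rewrite sw.
have /choice[u uE] := near_u.
have nearQ w y : Q.@[s (ret (a w y))] != 0 -> nbhs y [set y | Q.@[s (ret (a w y))] != 0].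
  move=> Qy; exact: (reg_neq0 nY ((au_mor w y).2 _ (q_reg Q (a w y))) Qy).
have nz1 : nz 1 by apply: slice_nonzero0; rewrite meval1 oner_neq0.
have tau_eq w w' y : Q.@[s (ret (a w y))] != 0 -> Q.@[s (ret (a w' y))] != 0 -> tau w y = tau w' y.
  move=> Qw Qw'; apply: (separated_eq nz1 (tau_mor w y Qw) (tau_mor w' y Qw')).
  apply: filterS (filterI (nearQ w y Qw) (nearQ w' y Qw')) => z [h1 h2] t zt _.
  by rewrite zt in h1 h2 *; rewrite !tau_orb.
exists (fun y => tau (u y) y); split=> [y|t]; last exact: tau_orb.
apply: morph_at_eq (tau_mor (u y) y (uE y)); apply: filterS (nearQ _ y (uE y)) => z Qz /=.
exact: tau_eq.
Qed.

End Sigma.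

(** * Regularity of the division map *)

Section Clearing.
Variable K : closedFieldType.

Lemma clear_denominators (I : finType) (W : Type) n k (c : W -> 'I_n -> K) (z : W -> 'I_k -> K)
    (den : {mpoly K[n]}) (num : 'I_k -> {mpoly K[n]}) (p : I -> {mpoly K[k]}) :
  (forall e i, den.@[c e] * z e i = (num i).@[c e]) ->
  exists M (p' : I -> {mpoly K[n]}), forall i e, den.@[c e] ^+ M * (p i).@[z e] = (p' i).@[c e].
Proof.
move=> dz; pose M := (\max_i msize (p i))%N.
exists M, (fun i => \sum_(mm <- msupp (p i)) (p i)@_mm *: (den ^+ (M - mdeg mm) * \prod_j num j ^+ mm j)) => i e.
rewrite meval_sum mevalE mulr_sumr big_seq [RHS]big_seq; apply: eq_bigr => mm mp.
have mM : (mdeg mm <= M)%N.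
  by rewrite (leq_trans (ltnW (msize_mdeg_lt mp))) // /M leq_bigmax.
rewrite mevalZ mevalM rmorphXn rmorph_prod /= mulrCA; congr (_ * _).
rewrite -{1}(subnK mM) exprD -mulrA; congr (_ * _).
rewrite mdegE (big_morph _ (fun u v => exprD den.@[c e] u v) (expr0 _)) -big_split.
by apply: eq_bigr => j _; rewrite rmorphXn /= -dz exprMn.
Qed.

Lemma prod_join_coord n1 n2 (x : 'I_n1 -> K) (y : 'I_n2 -> K) (e : 'I_(n1 + n2) -> nat) :
  \prod_i join_coord x y i ^+ e i = (\prod_j x j ^+ e (lshift n2 j)) * \prod_j y j ^+ e (rshift n1 j).
Proof.
have e1 : \prod_j join_coord x y (lshift n2 j) ^+ e (lshift n2 j) = \prod_j x j ^+ e (lshift n2 j).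
  by apply: eq_bigr => j _; rewrite join_coordl.
have e2 : \prod_j join_coord x y (rshift n1 j) ^+ e (rshift n1 j) = \prod_j y j ^+ e (rshift n1 j).
  by apply: eq_bigr => j _; rewrite join_coordr.
by rewrite big_split_ord; exact: (congr2 *%R e1 e2).
Qed.

(** Separation of the variables x and g. The coefficients [c] are combinations of values of the
    [H i] at sample points, so they vanish wherever all these values do. *)
Lemma poly_family_sample p l1 l2 (H : 'I_p -> {mpoly K[l1 + l2]}) (X : Type) (A : X -> 'I_l2 -> K) :
  exists N (B : 'I_N -> {mpoly K[l2]}) (c : 'I_p -> 'I_N -> {mpoly K[l1]}) (pts : 'I_N -> X)
    (w : 'I_N -> 'I_N -> K),
  (forall i x g, (H i).@[join_coord x (A g)] = \sum_k (B k).@[A g] * (c i k).@[x]) /\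
  (forall i k x, (c i k).@[x] = \sum_l w k l * (H i).@[join_coord x (A (pts l))]).
Proof.
pose d := (\max_i msize (H i))%N.
pose phi (j : 'I_p * ('I_l1 -> K)) g := (H j.1).@[join_coord j.2 (A g)].
have phiE j g : phi j g = \sum_(mm : 'X_{1..(l1 + l2) < d})
    (\prod_i A g i ^+ (mm : 'X_{1..(l1 + l2)}) (rshift l1 i)) *
    ((H j.1)@_mm * \prod_i j.2 i ^+ (mm : 'X_{1..(l1 + l2)}) (lshift l2 i)).
  have Hd : (msize (H j.1) <= d)%N by rewrite /d leq_bigmax.
  rewrite /phi {1}(mpolywE Hd) meval_sum; apply: eq_bigr => mm _.
  by rewrite mevalZ mevalX prod_join_coord [RHS]mulrC -mulrA.
have [N [ij [x [_ span]]]] := finite_rank_sample phiE.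
set F := invmx _ in span.
pose B k : {mpoly K[l2]} := msub (join_coord (fun i => ((ij k).2 i)%:MP) (fun i => 'X_i)) (H (ij k).1).
pose c i k : {mpoly K[l1]} := \sum_l F k l *: msub (join_coord (fun j => 'X_j) (fun j => (A (x l) j)%:MP)) (H i).
have cE i k y : (c i k).@[y] = \sum_l F k l * (H i).@[join_coord y (A (x l))].
  rewrite meval_sum; apply: eq_bigr => l _; rewrite mevalZ meval_msub; congr (_ * _).
  apply: meval_eq; elim/join_coordP => j; rewrite ?join_coordl ?join_coordr ?mevalXU //.
  exact: mevalC.
exists N, B, c, x, (fun k l => F k l); split=> // i y g.
rewrite -[LHS]/(phi (i, y) g) span; apply: eq_bigr => k _; rewrite cE; congr (_ * _).
rewrite /B meval_msub /phi; apply: meval_eq; elim/join_coordP => j; rewrite ?join_coordl ?join_coordr ?mevalXU //.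
by rewrite mevalC.
Qed.

(** The denominators common to the functions [phi mo] and vanishing outside [W] form an ideal;
    finitely many generators of it already cover the good points. *)
Lemma denominators_family (I : eqType) (l : seq I) (Pt : Type) q (z : Pt -> 'I_q -> K) (phi : I -> Pt -> K)
    (W good : Pt -> Prop) :
  (forall pt, good pt -> forall mo, exists D C : {mpoly K[q]}, D.@[z pt] != 0 /\
     forall pt', D.@[z pt'] * phi mo pt' = C.@[z pt']) ->
  (forall pt, good pt -> exists2 D : {mpoly K[q]}, D.@[z pt] != 0 & forall pt', D.@[z pt'] != 0 -> W pt') ->
  exists p (D : 'I_p -> {mpoly K[q]}) (C : 'I_p -> I -> {mpoly K[q]}),
  [/\ forall i mo pt, mo \in l -> (D i).@[z pt] * phi mo pt = (C i mo).@[z pt],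
      forall i pt, (D i).@[z pt] != 0 -> W pt & forall pt, good pt -> exists i, (D i).@[z pt] != 0].
Proof.
move=> locphi locW.
pose gd (D : {mpoly K[q]}) := (forall mo, mo \in l -> exists C : {mpoly K[q]}, forall pt, D.@[z pt] * phi mo pt = C.@[z pt])
  /\ forall pt, D.@[z pt] != 0 -> W pt.
have igd : ideal gd.
  split=> [|D1 D2 [h1 w1] [h2 w2]|x D [h w]].
  - split=> [mo _|pt]; last by rewrite meval0 eqxx.
    by exists 0 => pt; rewrite meval0 mul0r.
  - split=> [mo ml|pt].
      have [C1 E1] := h1 mo ml; have [C2 E2] := h2 mo ml; exists (C1 + C2) => pt.
      by rewrite !mevalD mulrDl E1 E2.
    rewrite mevalD; have [z1|z1] := eqVneq (D1.@[z pt]) 0; last by move=> _; exact: w1.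
    by rewrite z1 add0r; exact: w2.
  - split=> [mo ml|pt]; last by rewrite mevalM mulf_eq0 negb_or => /andP[_]; exact: w.
    have [C CE] := h mo ml; exists (x * C) => pt; by rewrite !mevalM -mulrA CE.
have [gs gsI Igs] := mpoly_noetherian (n := q) (@field_noetherian K) igd.
have gsg (i : 'I_(size gs)) : gd gs`_i by apply: gsI; exact: mem_nth.
have /choice[C CE] : forall im : 'I_(size gs) * I, exists C : {mpoly K[q]}, im.2 \in l ->
    forall pt, (gs`_im.1).@[z pt] * phi im.2 pt = C.@[z pt].
  move=> [i mo]; have [ml|ml] := boolP (mo \in l); last by exists 0.
  by have [h _] := gsg i; have [C CE] := h mo ml; exists C.
exists (size gs), (fun i => gs`_i), (fun i mo => C (i, mo)); split=> [i mo pt ml|i pt|pt gpt].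
- exact: (CE (i, mo)).
- by have [_] := gsg i; apply.
have [D gD D0] : exists2 D, gd D & D.@[z pt] != 0.
  have [DW W0 WE] := locW pt gpt.
  suff [D [D0 Dl]] : exists D : {mpoly K[q]}, D.@[z pt] != 0 /\
      forall mo, mo \in l -> exists C : {mpoly K[q]}, forall pt, D.@[z pt] * phi mo pt = C.@[z pt].
    exists (D * DW); last by rewrite mevalM mulf_neq0.
    split=> [mo ml|pt']; last by rewrite mevalM mulf_eq0 negb_or => /andP[_]; exact: WE.
    by have [C1 E1] := Dl mo ml; exists (DW * C1) => pt'; rewrite !mevalM -E1 mulrAC mulrC.
  elim: l {gd igd gsI Igs gsg C CE gs} => [|mo l' [D [D0 Dl]]]; first by exists 1; rewrite meval1 oner_neq0.
  have [D1 [C1 [D10 E1]]] := locphi pt gpt mo; exists (D1 * D); split; first by rewrite mevalM mulf_neq0.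
  move=> mo'; rewrite inE => /predU1P[->|ml].
    by exists (D * C1) => pt'; rewrite !mevalM -E1 mulrCA mulrA.
  by have [C2 E2] := Dl mo' ml; exists (D1 * C2) => pt'; rewrite !mevalM -E2 mulrA.
apply: contrapT => nex; move/negP: D0; apply; apply/eqP.
have iz : ideal (fun D : {mpoly K[q]} => D.@[z pt] = 0).
  split=> [|u v u0 v0|u v v0]; first exact: meval0.
    by rewrite mevalD u0 v0 addr0.
  by rewrite mevalM v0 mulr0.
apply: (Igs D gD _ iz) => y yg; apply/eqP; apply: contrapT => /negP ny; apply: nex.
have ix : (index y gs < size gs)%N by rewrite index_mem.
by exists (Ordinal ix); rewrite /= nth_index.
Qed.

End Clearing.

Section Division.
Variables (K : closedFieldType) (T G : alg_group K) (E Y : fspace K) (a : T -> Y -> Y) (f : E -> Y)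
  (b : T -> E -> E) (r : E -> G -> E).
Local Notation mT := (@ag_mul K T).
Local Notation mG := (@ag_mul K G).
Hypotheses (nE : charted E) (nY : charted Y) (TC : forall s t, mT s t = mT t s)
  (f_mor : forall e, morph_at f e)
  (a_mor : forall z : prod_space T Y, morph_at (fun p : prod_space T Y => a p.1 p.2) z)
  (b_mor : forall z : prod_space T E, morph_at (fun p : prod_space T E => b p.1 p.2) z)
  (r_mor : forall z : prod_space E G, morph_at (fun p : prod_space E G => r p.1 p.2) z)
  (a1 : forall y, a (ag_one T) y = y) (aM : forall s t y, a (mT s t) y = a s (a t y))
  (b1 : forall e, b (ag_one T) e = e) (bM : forall s t e, b (mT s t) e = b s (b t e))
  (r1 : forall e, r e (ag_one G) = e)
  (rM : forall e g h, r e (mG g h) = r (r e g) h) (br : forall t e g, b t (r e g) = r (b t e) g)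
  (fr : forall e g, f (r e g) = f e) (fb : forall t e, f (b t e) = a t (f e)).
Variables (ny : nat) (yc : Y -> 'I_ny -> K).
Hypothesis chY : chart setT yc.
Variables (y0 ystar : Y) (n : nat) (lam : 'I_n -> nat) (s : Y -> 'I_n -> K) (ell : Y -> T) (la : K -> T)
  (tinv : Y -> T).
Hypotheses (lam_gt0 : forall i, (0 < lam i)%N) (s_y0 : forall i, s y0 i = 1)
  (s_reg : forall y i, regular_at y (s^~ i)) (ell_mor : forall y, morph_at ell y)
  (ell_y0 : ell y0 = ag_one T)
  (ell_sl : forall y, ell (a (ag_inv (ell y)) y) = ag_one T)
  (la_act : forall w y, w != 0 -> ell (a (la w) y) = ell y /\ forall i, s (a (la w) y) i = w ^+ lam i * s y i)
  (ell_star : ell ystar = ag_one T) (s_star : forall i, s ystar i = 0)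
  (germ_star : forall f, regular_at ystar f -> exists P Q : {mpoly K[n]}, Q.@[fun=> 0] != 0 /\
            forall y, ell y = ag_one T -> Q.@[s y] != 0 -> f y = P.@[s y] / Q.@[s y])
  (nbhs_star : forall V : set Y, nbhs ystar V -> exists2 Q : {mpoly K[n]}, Q.@[fun=> 0] != 0 &
            forall y, ell y = ag_one T -> Q.@[s y] != 0 -> V y)
  (orb : forall y, (forall i, s y i != 0) -> exists t, y = a t y0)
  (s_yt : forall t i, s (slice_point a y0 ell t) i != 0)
  (tinvK : forall t, tinv (a t y0) = t) (tinv_mor : forall t, morph_at tinv (a t y0)).
Let ret y := a (ag_inv (ell y)) y.
Let yt t := slice_point a y0 ell t.
Local Notation nz := (slice_nonzero a s ell).
Hypotheses (slice_gen : forall (O : set Y) q, open O -> O !=set0 -> nz q ->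
    exists t, O (a t y0) /\ q.@[s (yt t)] != 0)
  (nzM : forall q1 q2 : {mpoly K[n]}, nz q1 -> nz q2 -> nz (q1 * q2))
  (nz0 : forall q : {mpoly K[n]}, q.@[fun=> 0] != 0 -> nz q).
Variables (X : fspace K) (phi : X -> Y) (x0 : X) (sec : X -> E) (dv : X -> E -> G).
Hypotheses (nX : charted X) (phi_mor : forall x, morph_at phi x) (phi_x0 : phi x0 = ystar)
  (f_sec : forall x, f (sec x) = phi x)
  (dvE : forall x e, phi x = f e -> e = r (sec x) (dv x e))
  (dv_free : forall x g h, r (sec x) g = r (sec x) h -> g = h)
  (dv_mor : forall (Z : fspace K) (u : Z -> X) (v : Z -> E) z, charted Z ->
        (forall z, phi (u z) = f (v z)) -> morph_at u z -> morph_at v z ->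
        morph_at (fun z => dv (u z) (v z)) z).
Variables (X1 : fspace K) (phi1 : X1 -> Y) (x1 : X1) (sec1 : X1 -> E) (dv1 : X1 -> E -> G).
Hypotheses (phi1_x1 : phi1 x1 = y0)
  (dv1E : forall x e, phi1 x = f e -> e = r (sec1 x) (dv1 x e))
  (dv1_free : forall x g h, r (sec1 x) g = r (sec1 x) h -> g = h)
  (dv1_mor : forall (Z : fspace K) (u : Z -> X1) (v : Z -> E) z, charted Z ->
        (forall z, phi1 (u z) = f (v z)) -> morph_at u z -> morph_at v z ->
        morph_at (fun z => dv1 (u z) (v z)) z).
Variables (U : set X) (m k : nat) (zc : Y -> 'I_m -> K) (tc : X -> 'I_k -> K).
Let wc x := join_coord (zc (phi x)) (tc x).
Hypotheses (Ux0 : U x0) (chU : chart U wc).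
Variable xi : Y -> 'I_(m + k) -> series K.
Let mv w y := a (la w) y.
Let special := special_point phi lam s mv U zc tc.
Hypotheses (xi_gr : forall i, graded lam s (fun y => xi y i)) (xi0 : forall y i, xi y i 0%N = wc x0 i)
  (xi_sp : forall y1 y2 h (l : seq (series K)), ell y1 = ag_one T -> ell y2 = ag_one T -> h != 0 ->
        exists (A : series K -> Prop) (L : series K -> K) x1 x2,
          [/\ partial_hom serC A L, [/\ A h, A serX & forall e, e \in l -> A e], L h != 0 /\ L serX != 0,
              special L A xi y1 x1 & special L A xi y2 x2]).
Variables (N : nat) (A : G -> 'M[K]_N).
Hypotheses (chG : chart setT (fun g => mxcoord (A g))).
Variables (d : T -> G) (sigma : Y -> E) (dvs : E -> G).
Hypotheses (d_mor : forall t, morph_at d t)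
  (sigma_mor : forall y, morph_at sigma y) (f_sigma : forall y, f (sigma y) = y)
  (b_sigma : forall u y, b u (sigma y) = r (sigma (a u y)) (d u))
  (dvsE : forall e, e = r (sigma (f e)) (dvs e))
  (sigma_free : forall y g h, r (sigma y) g = r (sigma y) h -> g = h).
Variables (W : set E) (q : nat) (eps : E -> 'I_q -> K).
Hypotheses (We0 : W (sec x0)) (chW : chart W eps) (clW : closed_chart W eps).

Let nT : charted T. Proof. exact: alg_group_charted. Qed.
Let nG : charted G. Proof. exact: alg_group_charted. Qed.

Let ret_orb t : ret (a t y0) = yt t.
Proof. by rewrite /ret /yt /slice_point /slice_part TC aM. Qed.
Let ret_sl y : ell y = ag_one T -> ret y = y.
Proof. by rewrite /ret => ->; rewrite ag_inv1 a1. Qed.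
Let ell_yt t : ell (yt t) = ag_one T. Proof. by rewrite -ret_orb /ret ell_sl. Qed.
Let b_mor' (Z : fspace K) (u : Z -> T) (v : Z -> E) z : charted Z -> morph_at u z -> morph_at v z ->
  morph_at (fun z => b (u z) (v z)) z.
Proof. by move=> nZ hu hv; exact: (morph_at_comp (morph_at_pair nT nE nZ hu hv) (b_mor _)). Qed.
Let r_mor' (Z : fspace K) (u : Z -> E) (v : Z -> G) z : charted Z -> morph_at u z -> morph_at v z ->
  morph_at (fun z => r (u z) (v z)) z.
Proof. by move=> nZ hu hv; exact: (morph_at_comp (morph_at_pair nE nG nZ hu hv) (r_mor _)). Qed.
Let ret_mor y : morph_at ret y.
Proof.
exact: (morph_at_comp (morph_at_pair nT nY nY (morph_at_inv (ell_mor y)) (morph_at_id y)) (a_mor _)).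
Qed.
Let nbhs_open (Z : fspace K) (y : Z) (S : set Z) : nbhs y S -> exists O : set Z, [/\ open O, O y & O `<=` S].
Proof. by move=> nS; exists (S^°)%classic; split; [exact: open_interior|exact: nS|exact: interior_subset]. Qed.

Let A_reg i j g : regular_at g (fun g => A g i j).
Proof.
have -> : (fun g => A g i j) = (fun g => mxcoord (A g) (mxvec_index i j)).
  by apply/funext => h; rewrite mxcoordE.
exact: (reg_coord (mxvec_index i j) chG I).
Qed.

Lemma division_act u e h : dvs (r (b u e) h) = mG (mG (d u) (dvs e)) h.
Proof.
have E1 : r (sigma (a u (f e))) (dvs (r (b u e) h)) = r (b u e) h by rewrite [RHS]dvsE fr fb.
apply: (@sigma_free (a u (f e))); rewrite E1 !rM -b_sigma.
by rewrite -(br u (sigma (f e))) -dvsE.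
Qed.

Let sprod e := \prod_i s (f e) i.
Let sprod_reg e : regular_at e sprod.
Proof. by apply: reg_prod => // i; exact: ((f_mor e).2 _ (s_reg (f e) i)). Qed.
Let sprod_orb e : sprod e != 0 -> exists t, f e = a t y0.
Proof. by move=> h; apply: orb => i; move/prodf_neq0: h; apply. Qed.

(** Over the open orbit [e] is brought back to the fibre over [y0], where [dvs] is compared with the
    division map of the local trivialization at [x1]. *)
Lemma division_orbit e : sprod e != 0 -> morph_at dvs e.
Proof.
move=> es; pose S := [set x | sprod x != 0].
have oS : open S by rewrite openE => z; exact: (reg_neq0 nE (sprod_reg z)).
pose z : sub_space S := SigSub (mem_set (es : S e)).
apply: (@morph_at_open K E G S dvs z oS).
have nS : charted (sub_space S) by exact: charted_sub.
pose c0 := dv1 x1 (sigma y0).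
pose back (v : sub_space S) := b (ag_inv (tinv (f (set_val v)))) (set_val v).
have fback v : phi1 x1 = f (back v).
  have [t vt] := sprod_orb (set_valP v).
  by rewrite phi1_x1 fb vt tinvK -aM ag_mulV a1.
have -> : (fun v : sub_space S => dvs (set_val v)) =
    (fun v => mG (d (tinv (f (set_val v)))) (mG (ag_inv c0) (dv1 x1 (back v)))).
  apply/funext => v; set t := tinv _; have tf := fback v.
  have e1 := dvsE (back v); rewrite -tf phi1_x1 in e1.
  have e2 : sigma y0 = r (sec1 x1) c0 by apply: dv1E; rewrite f_sigma.
  have e3 : dv1 x1 (back v) = mG c0 (dvs (back v)).
    by apply: (@dv1_free x1); rewrite -dv1E // rM -e2.
  rewrite e3 (ag_mulA (ag_inv c0)) ag_mulV ag_mul1.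
  have := division_act t (back v) (ag_one G); rewrite ag_mulr1 r1 => <-.
  by rewrite /back -/t -bM ag_mulgV b1.
have [t et] := sprod_orb es.
have tm : morph_at (fun v : sub_space S => tinv (f (set_val v))) z.
  have h : morph_at tinv (f (set_val z)) by rewrite /= et.
  exact: (morph_at_comp (morph_at_comp (morph_at_val z) (f_mor _)) h).
apply: morph_at_mul => //; first exact: (morph_at_comp tm (d_mor _)).
apply: morph_at_mul => //; first exact: morph_at_const.
apply: (dv1_mor (u := fun=> x1) (v := back)) => //; first exact: morph_at_const.
exact: (b_mor' nS (morph_at_inv tm) (morph_at_val z)).
Qed.

Let retE e := b (ag_inv (ell (f e))) e.

(** Over the open orbit [dvs] is a fraction with denominator [den]; on the fibre product with the
    etale neighbourhood it is a fraction defined at the base point. Their comparison [F] vanishes on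
    the fibre product, whereas descent asks for relations in x and in the coordinates [s] of f(e)
    alone. So E over the slice is parametrized by pairs (y, g) through [sigma], [F] is expanded in
    g, and its coefficients are the relations. *)
Lemma division_slice i0 j0 : exists Q R : {mpoly K[q]}, Q.@[eps (sec x0)] != 0 /\
  forall e, W e -> ell (f e) = ag_one T -> Q.@[eps e] * A (dvs e) i0 j0 = R.@[eps e].
Proof.
have /choice[S SE] : forall i, exists S : {mpoly K[q]}, forall e, W e -> s (f e) i = S.@[eps e].
  by move=> i; apply: (regular_poly chW clW) => e _; exact: ((f_mor e).2 _ (s_reg (f e) i)).
pose chi := \prod_i S i.
have chiE e : W e -> chi.@[eps e] = sprod e.
  by move=> We; rewrite rmorph_prod; apply: eq_bigr => i _; rewrite SE.
have [M [P PE]] : exists M (P : 'I_N * 'I_N -> {mpoly K[q]}), forall ij e, W e -> chi.@[eps e] != 0 ->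
    chi.@[eps e] ^+ M * A (dvs e) ij.1 ij.2 = (P ij).@[eps e].
  apply: common_denominator => // ij e We; rewrite chiE // => se.
  exact: ((division_orbit se).2 _ (A_reg ij.1 ij.2 (dvs e))).
pose den := chi ^+ M.
have denE e : W e -> chi.@[eps e] != 0 -> den.@[eps e] != 0.
  by move=> _ ce; rewrite rmorphXn expf_neq0.
pose Z := [set z : prod_space X E | phi z.1 = f z.2].
have nXE : charted (prod_space X E) by exact: charted_prod.
have nZ : charted (sub_space Z) by exact: charted_sub.
have Z0 : Z (x0, sec x0) by rewrite /Z /= f_sec.
pose z0 : sub_space Z := SigSub (mem_set Z0).
have morZ : morph_at (fun z : sub_space Z => dvs (set_val z).2) z0.
  have -> : (fun z : sub_space Z => dvs (set_val z).2) =
      (fun z => mG (ag_inv (dv (set_val z).1 (sigma (phi (set_val z).1)))) (dv (set_val z).1 (set_val z).2)).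
    apply/funext => z; have zZ : phi (set_val z).1 = f (set_val z).2 by exact: (set_valP z).
    have e1 : sigma (phi (set_val z).1) = r (sec (set_val z).1) (dv (set_val z).1 (sigma (phi (set_val z).1))).
      by apply: dvE; rewrite f_sigma.
    apply: (@ag_mulI _ _ (dv (set_val z).1 (sigma (phi (set_val z).1)))).
    rewrite ag_mulA ag_mulgV ag_mul1; apply: (@dv_free (set_val z).1).
    by rewrite rM -e1 -dvE // zZ -dvsE.
  have h1 : morph_at (fun z : sub_space Z => (set_val z).1) z0 :=
    morph_at_comp (morph_at_val z0) (@morph_at_fst _ _ _ (set_val z0) nX nE).
  have h2 : morph_at (fun z : sub_space Z => (set_val z).2) z0 :=
    morph_at_comp (morph_at_val z0) (@morph_at_snd _ _ _ (set_val z0) nX nE).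
  apply: morph_at_mul => //.
    apply: morph_at_inv; apply: (dv_mor (u := fun z : sub_space Z => (set_val z).1)
      (v := fun z : sub_space Z => sigma (phi (set_val z).1))) => //.
    exact: (morph_at_comp (morph_at_comp h1 (phi_mor _)) (sigma_mor _)).
  apply: (dv_mor (u := fun z : sub_space Z => (set_val z).1) (v := fun z : sub_space Z => (set_val z).2)) => //.
  by move=> z; exact: (set_valP z).
have [P1 [Q1 [Q10 PQ1]]] : exists P1 Q1 : {mpoly K[m + k + q]}, Q1.@[join_coord (wc x0) (eps (sec x0))] != 0 /\
    forall x e, U x -> W e -> phi x = f e -> Q1.@[join_coord (wc x) (eps e)] != 0 ->
      A (dvs e) i0 j0 = P1.@[join_coord (wc x) (eps e)] / Q1.@[join_coord (wc x) (eps e)].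
  have [_ cr _] := sub_space_chart Z (prod_chart chU chW).
  have Uz : (set_val @^-1` [set z : prod_space X E | U z.1 /\ W z.2])%classic z0 by split.
  have [h1 _] := cr z0 ((fun g => A g i0 j0) \o (fun z : sub_space Z => dvs (set_val z).2)) Uz.
  have [P1 [Q1 [Q10 PQ]]] := h1 (morZ.2 _ (A_reg i0 j0 _)).
  exists P1, Q1; split=> // x e Ux We xe Qx.
  have Zx : Z (x, e) by [].
  by have := PQ (SigSub (mem_set Zx)) (conj Ux We) Qx.
pose rc (h : {mpoly K[q]}) : {mpoly K[m + k + q]} := msub (fun i => 'X_(rshift (m + k) i)) h.
have rcE h v w : (rc h).@[join_coord v w] = h.@[w].
  by rewrite meval_msub; apply: meval_eq => i; rewrite mevalXU join_coordr.
pose F := rc (P (i0, j0)) * (Q1 * Q1) - rc den * (P1 * Q1).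
have FE v w : F.@[join_coord v w] = (P (i0, j0)).@[w] * (Q1 * Q1).@[join_coord v w] - den.@[w] * (P1 * Q1).@[join_coord v w].
  by rewrite /F mevalB (mevalM _ (rc (P _))) (mevalM _ (rc den)) !rcE.
have F0 x e : U x -> W e -> phi x = f e -> sprod e != 0 -> F.@[join_coord (wc x) (eps e)] = 0.
  move=> Ux We xe se; rewrite FE !mevalM.
  have ce : chi.@[eps e] != 0 by rewrite chiE.
  rewrite -PE //= /den rmorphXn /=.
  have [Qz|Qz] := eqVneq (Q1.@[join_coord (wc x) (eps e)]) 0; first by rewrite Qz !mulr0 subrr.
  by rewrite (PQ1 x e) //; field.
have /choice[Py PyE] : forall j, exists PQ : {mpoly K[n]} * {mpoly K[n]}, PQ.2.@[fun=> 0] != 0 /\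
    forall y, ell y = ag_one T -> PQ.2.@[s y] != 0 -> yc y j = PQ.1.@[s y] / PQ.2.@[s y].
  by move=> j; have [P2 [Q2 h]] := germ_star (reg_coord (x := ystar) j chY I); exists (P2, Q2).
pose Qy := \prod_j (Py j).2.
pose Ry j := (Py j).1 * \prod_(i | i != j) (Py i).2.
have QyE y j : ell y = ag_one T -> Qy.@[s y] != 0 -> Qy.@[s y] * yc y j = (Ry j).@[s y].
  move=> sy; rewrite /Qy /Ry (bigD1 j) //= !mevalM mulf_eq0 negb_or => /andP[Qj _].
  have [_ PQj] := PyE j; rewrite PQj // [X in _ * X]mulrC mulrACA mulfV // mul1r.
  by rewrite mulrC.
have Qy0 : Qy.@[fun=> 0] != 0 by rewrite rmorph_prod; apply/prodf_neq0 => j _; have [] := PyE j.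
pose Pt := {yh : Y * G | ell yh.1 = ag_one T}.
pose ept (pt : Pt) := r (sigma (sval pt).1) (sval pt).2.
pose zpt (pt : Pt) := join_coord (s (sval pt).1) (mxcoord (A (sval pt).2)).
pose mon (mo : 'X_{1..(m + k + q)}) e := \prod_j eps e j ^+ mo (rshift (m + k) j).
(* The monomials in the chart coordinates are extended by 0 outside [W]; the denominators found
   below vanish there, so that the products remain polynomial. *)
pose fpt mo (pt : Pt) := if `[< W (ept pt) >] then mon mo (ept pt) else 0.
pose good pt := W (ept pt) /\ Qy.@[s (sval pt).1] != 0.
pose ptQ := {pt : Pt | Qy.@[s (sval pt).1] != 0}.
pose lf (h : {mpoly K[n]}) : {mpoly K[n + N * N]} := msub (fun i => 'X_(lshift (N * N) i)) h.
have lfE h v w : (lf h).@[join_coord v w] = h.@[v].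
  by rewrite meval_msub; apply: meval_eq => i; rewrite mevalXU join_coordl.
have clr (I : finType) (p : I -> {mpoly K[ny + N * N]}) : exists M' (p' : I -> {mpoly K[n + N * N]}),
    forall i (pt : ptQ), (lf Qy).@[zpt (sval pt)] ^+ M' *
      (p i).@[join_coord (yc (sval (sval pt)).1) (mxcoord (A (sval (sval pt)).2))] = (p' i).@[zpt (sval pt)].
  apply: (@clear_denominators _ I ptQ _ _ (fun pt => zpt (sval pt))
    (fun pt => join_coord (yc (sval (sval pt)).1) (mxcoord (A (sval (sval pt)).2))) (lf Qy)
    (join_coord (fun j => lf (Ry j)) (fun j => lf Qy * 'X_(rshift n j)))).
  move=> [pt Qpt] /=; elim/join_coordP => j; rewrite ?join_coordl ?join_coordr.
    by rewrite /zpt !lfE QyE //; exact: (svalP pt).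
  by rewrite mevalM mevalXU /zpt join_coordr.
have pch := prod_chart chY chG; have [_ pcr pcn] := pch.
have mor_e (pt : Pt) : morph_at (fun z : prod_space Y G => r (sigma z.1) z.2) (sval pt).
  have nYG : charted (prod_space Y G) by exact: charted_prod.
  exact: (r_mor' nYG (morph_at_comp (@morph_at_fst _ Y G (sval pt) nY nG) (sigma_mor _)) (@morph_at_snd _ Y G (sval pt) nY nG)).
have loc1 pt : good pt -> forall mo, exists D C : {mpoly K[n + N * N]}, D.@[zpt pt] != 0 /\
    forall pt', D.@[zpt pt'] * fpt mo pt' = C.@[zpt pt'].
  move=> [Wpt Qpt] mo.
  pose Fz (z : prod_space Y G) := if `[< W (r (sigma z.1) z.2) >] then mon mo (r (sigma z.1) z.2) else 0.
  have Fr : regular_at (sval pt : prod_space Y G) Fz.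
    have mr : regular_at (ept pt) (mon mo).
      apply: reg_prod => // j; have := @reg_ev _ _ (ept pt) nE _ (fun (_ : 'I_1) e => eps e j) ('X_0 ^+ mo (rshift (m + k) j)).
      move=> h; have := h (fun _ => reg_coord j chW Wpt); congr regular_at.
      by apply/funext => e; rewrite rmorphXn /= mevalXU.
    apply: regular_at_local ((mor_e pt).2 _ mr).
    by apply: filterS ((mor_e pt).1 _ (chart_nbhs chW Wpt)) => z /= Wz; rewrite /Fz asboolT.
  have [h1 _] := pcr (sval pt) Fz (conj I I); have [u [v [v0 uv]]] := h1 Fr.
  have [M' [p' pE]] := clr bool (fun c => if c then u else v).
  exists (lf Qy * (p' false * p' false)), (lf Qy * (p' true * p' false)); split.
    have := pE false (exist _ pt Qpt); rewrite /= => E1.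
    have p0 : (p' false).@[zpt pt] != 0.
      by rewrite -E1 mulf_neq0 // expf_neq0 // /zpt lfE.
    by rewrite !mevalM !mulf_neq0 // /zpt lfE.
  move=> pt'; rewrite !mevalM.
  have [Qz|Qz] := eqVneq ((lf Qy).@[zpt pt']) 0; first by rewrite Qz !mul0r.
  have Qz' : Qy.@[s (sval pt').1] != 0 by move: Qz; rewrite /zpt lfE.
  have := pE false (exist _ pt' Qz'); have := pE true (exist _ pt' Qz'); rewrite /= => E1 E2.
  have [vz|vz] := eqVneq (v.@[join_coord (yc (sval pt').1) (mxcoord (A (sval pt').2))]) 0.
    by rewrite -E2 vz !mulr0 mul0r.
  have := uv (sval pt') (conj I I) vz; rewrite /Fz -/(ept pt') -/(fpt mo pt') => ->.
  rewrite -E1 -E2; set qq := _ ^+ M'; by field.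
have loc2 pt : good pt -> exists2 D : {mpoly K[n + N * N]}, D.@[zpt pt] != 0 &
    forall pt', D.@[zpt pt'] != 0 -> W (ept pt').
  move=> [Wpt Qpt].
  have [h1 _] := pcn (sval pt) ((fun z : prod_space Y G => r (sigma z.1) z.2) @^-1` W)%classic (conj I I).
  have [v v0 vW] := h1 ((mor_e pt).1 _ (chart_nbhs chW Wpt)).
  have [M' [p' pE]] := clr unit (fun=> v).
  exists (lf Qy * p' tt).
    by rewrite mevalM mulf_neq0 //; [rewrite /zpt lfE|rewrite -(pE tt (exist _ pt Qpt)) /= mulf_neq0 // expf_neq0 // /zpt lfE].
  move=> pt'; rewrite mevalM mulf_eq0 negb_or => /andP[Qz pz].
  have Qz' : Qy.@[s (sval pt').1] != 0 by move: Qz; rewrite /zpt lfE.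
  move: pz; rewrite -(pE tt (exist _ pt' Qz')) /= mulf_eq0 negb_or => /andP[_ vz].
  exact: (vW (sval pt') (conj I I) vz).
have [p [D [C [DC DW Dgood]]]] := @denominators_family K _ (msupp F) Pt _ zpt fpt (fun pt => W (ept pt)) good loc1 loc2.
pose eC (h : {mpoly K[n + N * N]}) : {mpoly K[m + k + n + N * N]} :=
  msub (join_coord (fun j => 'X_(lshift (N * N) (rshift (m + k) j))) (fun j => 'X_(rshift (m + k + n) j))) h.
have eCE h x v w : (eC h).@[join_coord (join_coord x v) w] = h.@[join_coord v w].
  rewrite meval_msub; apply: meval_eq; elim/join_coordP => j; rewrite ?join_coordl ?join_coordr mevalXU.
    by rewrite join_coordl join_coordr.
  by rewrite join_coordr.
pose eX (mo : 'X_{1..(m + k + q)}) : {mpoly K[m + k + n + N * N]} :=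
  \prod_j 'X_(lshift (N * N) (lshift n j)) ^+ mo (lshift q j).
have eXE mo x v w : (eX mo).@[join_coord (join_coord x v) w] = \prod_j x j ^+ mo (lshift q j).
  rewrite rmorph_prod; apply: eq_bigr => j _; by rewrite rmorphXn /= mevalXU !join_coordl.
(* [D i] times [F] as a polynomial in x, [s] and g; it is 0 at points outside [W] as well. *)
pose H i := \sum_(mo <- msupp F) F@_mo *: (eX mo * eC (C i mo)).
have HE i x v w : (H i).@[join_coord (join_coord x v) w] =
    \sum_(mo <- msupp F) F@_mo * (\prod_j x j ^+ mo (lshift q j) * (C i mo).@[join_coord v w]).
  rewrite meval_sum; apply: eq_bigr => mo _; by rewrite mevalZ mevalM eXE eCE.
have HW i x (pt : Pt) : W (ept pt) -> (D i).@[zpt pt] * F.@[join_coord x (eps (ept pt))] =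
    (H i).@[join_coord (join_coord x (s (sval pt).1)) (mxcoord (A (sval pt).2))].
  move=> Wp; rewrite HE mevalE mulr_sumr big_seq [RHS]big_seq; apply: eq_bigr => mo mF.
  rewrite -/(zpt pt) -DC // /fpt asboolT // mulrCA; congr (_ * _).
  rewrite [RHS]mulrCA; congr (_ * _); exact: (prod_join_coord x (eps (ept pt)) mo).
have HnW i x (pt : Pt) : ~ W (ept pt) -> (H i).@[join_coord (join_coord x (s (sval pt).1)) (mxcoord (A (sval pt).2))] = 0.
  move=> Wp; rewrite HE big_seq big1 // => mo mF.
  by rewrite -/(zpt pt) -DC // /fpt asboolF // !mulr0.
have [N1 [BB [c [pts [wts [HB cE]]]]]] := @poly_family_sample K p (m + k + n) (N * N) H G (fun g => mxcoord (A g)).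
pose WS := {e : E | [/\ W e, ell (f e) = ag_one T & chi.@[eps e] != 0]}.
pose rf (h : {mpoly K[N * N]}) : {mpoly K[n + N * N]} := msub (fun i => 'X_(rshift n i)) h.
have rfE h v w : (rf h).@[join_coord v w] = h.@[w].
  by rewrite meval_msub; apply: meval_eq => i; rewrite mevalXU join_coordr.
pose numG (l : 'I_(N * N)) : {mpoly K[q]} := mxvec (\matrix_(i, j) P (i, j)) 0 l.
have clrG (e : WS) j : den.@[eps (sval e)] * join_coord (s (f (sval e))) (mxcoord (A (dvs (sval e)))) j =
    (join_coord (fun j => den * S j) numG j).@[eps (sval e)].
  have [We le ce] := svalP e.
  elim/join_coordP: j => j; rewrite ?join_coordl ?join_coordr; first by rewrite mevalM SE.
  by elim/mxcoordP: j => i j; rewrite mxcoordE /numG mxvecE mxE -PE //= /den rmorphXn.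
have [M' [dp dpE]] := @clear_denominators K ('I_p + 'I_N1)%type WS q (n + N * N) (fun e => eps (sval e))
  (fun e => join_coord (s (f (sval e))) (mxcoord (A (dvs (sval e))))) den
  (join_coord (fun j => den * S j) numG)
  (fun o => match o with inl i => D i | inr l => rf (BB l) end) clrG.
pose a' := P (i0, j0).
have Su0 i : (S i).@[eps (sec x0)] = 0 by rewrite -SE // f_sec phi_x0.
have Sv (h : {mpoly K[n]}) : (forall t, h.@[s (yt t)] = 0) -> forall e : WS, h.@[fun i => (S i).@[eps (sval e)]] = 0.
  move=> h0 [e [We le ce]] /=; have [t et] : exists t, f e = a t y0.
    by apply: sprod_orb; rewrite -chiE.
  rewrite -(h0 t); apply: meval_eq => i; rewrite -SE //.
  by rewrite -(ret_sl le) et ret_orb.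
have xig i : graded lam (fun t => s (yt t)) (fun t => xi (yt t) i).
  by move=> j; have [Qh hh QE] := xi_gr i j; exists Qh.
have Qn : (Q1 * Q1).@[join_coord (wc x0) (eps (sec x0))] != 0 by rewrite mevalM mulf_neq0.
have idn (i : 'I_p) (e : WS) x : (dp (inl i)).@[eps (sval e)] *
    (a'.@[eps (sval e)] * (Q1 * Q1).@[join_coord x (eps (sval e))] - den.@[eps (sval e)] * (P1 * Q1).@[join_coord x (eps (sval e))]) =
    \sum_(l < N1) (dp (inr l)).@[eps (sval e)] * (c i l).@[join_coord x (fun j => (S j).@[eps (sval e)])].
  have [We le ce] := svalP e.
  rewrite -FE -dpE -mulrA.
  pose pt : Pt := exist _ (f (sval e), dvs (sval e)) le.
  have ee : ept pt = sval e by rewrite /ept /= -dvsE.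
  have := HW i x pt; rewrite ee => /(_ We); rewrite /zpt /= => ->.
  rewrite HB mulr_sumr; apply: eq_bigr => l _; rewrite -dpE rfE mulrA; congr (_ * _).
  apply: meval_eq; elim/join_coordP => j; rewrite ?join_coordl ?join_coordr //.
  by rewrite SE.
have arc0 t (i : 'I_p) (l : 'I_N1) : ev serC (join_coord (xi (yt t)) (weight_arc lam (fun t => s (yt t)) t)) (c i l) = 0.
  apply: (arcs_zero xi_sp (l := [::]) (ell_yt t) (ell_yt t)) => B L x x' Lh BX L0 _ sp _.
  have [Ux px vx va] := sp.
  have vall j : spec_val B L (join_coord (xi (yt t)) (weight_arc lam (fun t => s (yt t)) t) j)
      (join_coord (wc x) (s (phi x)) j).
    elim/join_coordP: j => j; rewrite ?join_coordl ?join_coordr; first exact: vx.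
    by rewrite px; exact: va.
  have := val_ev Lh (c i l) vall; congr spec_val; rewrite cE big1 // => l' _.
  have lx : ell (phi x) = ag_one T by rewrite px /mv; have [-> _] := la_act (yt t) L0.
  pose pt : Pt := exist _ (phi x, pts l') lx.
  have [Wp|Wp] := EM (W (ept pt)); last by rewrite (HnW i (wc x) pt Wp) mulr0.
  rewrite -(HW i (wc x) pt Wp) F0 ?mulr0 //; first by rewrite /ept /= fr f_sigma.
  rewrite /sprod /ept /= fr f_sigma; apply/prodf_neq0 => j _.
  rewrite px /mv; have [_ ->] := la_act (yt t) L0.
  by apply: mulf_neq0; [exact: expf_neq0|exact: s_yt].
have [Q [R [Q0 QR]]] := @descent_family K q (eps (sec x0)) T n lam (fun t => s (yt t)) (ag_one T) WS
  (fun e => eps (sval e)) S (m + k) (fun t => xi (yt t)) (wc x0) a' den (P1 * Q1) (Q1 * Q1) p (fun i => dp (inl i))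
  'I_N1 (fun i l => dp (inr l)) c lam_gt0 Su0 Sv xig (fun t i => xi0 (yt t) i) Qn idn arc0.
exists Q, R; split=> // e We le.
have gen e' : W e' -> ell (f e') = ag_one T -> sprod e' != 0 -> Qy.@[s (f e')] != 0 ->
    Q.@[eps e'] * A (dvs e') i0 j0 = R.@[eps e'].
  move=> We' le' se' Qe'; have ce' : chi.@[eps e'] != 0 by rewrite chiE.
  pose e'' : WS := exist _ e' (And3 We' le' ce').
  pose pt : Pt := exist _ (f e', dvs e') le'.
  have ee : ept pt = e' by rewrite /ept /= -dvsE.
  have [|i Di] := Dgood pt; first by split; rewrite ?ee.
  have hex : exists i, (dp (inl i)).@[eps (sval e'')] != 0.
    exists i; rewrite -(dpE (inl i) e''); apply: mulf_neq0; last exact: Di.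
    by apply: expf_neq0; exact: denE.
  have := QR e'' hex; rewrite /=.
  rewrite /a' -(PE (i0, j0)) //= => qr; apply: (mulIf (denE e' We' ce')); rewrite -qr /den rmorphXn /=.
  by rewrite -!mulrA; congr (_ * _); rewrite mulrC.
(* The relation holds generically. If it failed at [e], it would fail at nearby points with the same
   value of [dvs], obtained by moving f(e) along [sigma], and some of these are generic. *)
apply/eqP; rewrite -subr_eq0; apply: contraT => ne; exfalso.
pose h := dvs e; pose ey y := r (sigma (ret y)) h.
have eyE : ey (f e) = e by rewrite /ey ret_sl // -dvsE.
have eym y : morph_at ey y by apply: (r_mor' nY (morph_at_comp (ret_mor y) (sigma_mor _))); exact: morph_at_const.
pose psi e' := Q.@[eps e'] * A h i0 j0 - R.@[eps e'].
have psir : regular_at e psi.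
  have er (pp : {mpoly K[q]}) : regular_at e (fun e' => pp.@[eps e']).
    by apply: (@reg_ev _ _ e nE _ (fun i e' => eps e' i) pp) => i; exact: (reg_coord i chW We).
  have h2 := reg_M nE (reg_C e nE (-1)) (er R).
  have := reg_D nE (reg_M nE (er Q) (reg_C e nE (A h i0 j0))) h2.
  by congr regular_at; apply/funext => e'; rewrite /psi mulN1r.
have np : nbhs (ey (f e)) (W `&` [set e' | psi e' != 0]).
  by rewrite eyE; apply: filterI; [exact: (chart_nbhs chW We)|exact: (reg_neq0 nE psir)].
have [O [oO Oe sub]] := nbhs_open ((eym (f e)).1 _ np).
have nzX i : nz 'X_i by exists y0; rewrite -/(ret _) ret_sl // mevalXU s_y0 oner_neq0.
have nzp : nz (\prod_i 'X_i * Qy).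
  apply: nzM; last exact: nz0.
  elim: (index_enum _) => [|i l IH]; first by rewrite big_nil; apply: nz0; rewrite meval1 oner_neq0.
  by rewrite big_cons; apply: nzM.
have [|t [Ot qt]] := slice_gen oO _ nzp; first by exists (f e).
have [Wt pt] := sub _ Ot; move: qt; rewrite mevalM mulf_eq0 negb_or rmorph_prod => /andP[st Qt].
have fy : f (ey (a t y0)) = yt t by rewrite /ey fr f_sigma ret_orb.
have dy : dvs (ey (a t y0)) = h.
  by apply: (@sigma_free (yt t)); rewrite -[in LHS]fy -dvsE /ey ret_orb.
move/negP: pt; apply; rewrite /psi subr_eq0; apply/eqP.
rewrite -dy; apply: gen => //; rewrite ?fy //.
by rewrite /sprod fy; move: st; congr (_ != 0); apply: eq_bigr => i _; rewrite /= mevalXU.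
Qed.

(** Equivariance reduces the claim to the slice: [retE] moves [e] over the slice and changes [dvs]
    by the factor [d (ell (f e))], which is regular. *)
Lemma division_base : morph_at dvs (sec x0).
Proof.
have lm e : morph_at (fun e => ell (f e)) e := morph_at_comp (f_mor e) (ell_mor _).
have rm e : morph_at retE e := b_mor' nE (morph_at_inv (lm e)) (morph_at_id e).
have l0 : ell (f (sec x0)) = ag_one T by rewrite f_sec phi_x0.
have r0 : retE (sec x0) = sec x0 by rewrite /retE l0 ag_inv1 b1.
have lr e : ell (f (retE e)) = ag_one T by rewrite /retE fb ell_sl.
have dE e : dvs e = mG (d (ell (f e))) (dvs (retE e)).
  have := division_act (ell (f e)) (retE e) (ag_one G).
  by rewrite ag_mulr1 r1 /retE -bM ag_mulgV b1.
have ent i j : regular_at (sec x0) (fun e => A (dvs (retE e)) i j).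
  have [Q [R [Q0 QR]]] := division_slice i j.
  have er (pp : {mpoly K[q]}) : regular_at (sec x0) (fun e => pp.@[eps (retE e)]).
    have h : regular_at (retE (sec x0)) (fun e' => pp.@[eps e']).
      by rewrite r0; apply: (@reg_ev _ _ (sec x0) nE _ (fun i e' => eps e' i) pp) => l; exact: (reg_coord l chW We0).
    exact: ((rm _).2 _ h).
  have Qr0 : Q.@[eps (retE (sec x0))] != 0 by rewrite r0.
  have Wn : nbhs (sec x0) (retE @^-1` W)%classic by apply: (rm _).1; rewrite r0; exact: (chart_nbhs chW We0).
  apply: regular_at_local (reg_M nE (er R) (reg_V nE (er Q) Qr0)).
  apply: filterS (filterI Wn (reg_neq0 nE (er Q) Qr0)) => e [We Qe].
  by rewrite -QR // mulrC mulKf.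
have -> : dvs = (fun e => mG (d (ell (f e))) (dvs (retE e))) by apply/funext => e; exact: dE.
apply: morph_at_mul => //; first exact: (morph_at_comp (lm _) (d_mor _)).
apply: (morph_at_chart nE chG) => //; first exact: filterT.
by apply: mxcoordP => i j; have := ent i j; congr regular_at; apply/funext => e; rewrite mxcoordE.
Qed.

(** Regularity of [dvs] is an open condition compatible with the two actions. Some u moves f(e)
    within the slice so close to [ystar] that, for a suitable h, the translate of [e] by u and h
    lies in the neighbourhood [O] of the base point. *)
Lemma division_morphism e : morph_at dvs e.
Proof.
have [O [oO O0 sub]] : exists O : set E, [/\ open O, O (sec x0) & O `<=` [set e | morph_at dvs e]].
  apply: nbhs_open.
  have ent l : nbhs (sec x0) [set e | regular_at e (fun e => mxcoord (A (dvs e)) l)].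
    apply: (reg_near nE); exact: (division_base.2 _ (reg_coord l chG I)).
  have all (sq : seq 'I_(N * N)) :
      nbhs (sec x0) [set e | forall l, l \in sq -> regular_at e (fun e => mxcoord (A (dvs e)) l)].
    elim: sq => [|l sq IH]; first by apply: filterS filterT => ? _ ?.
    apply: filterS (filterI (ent l) IH) => e' [h1 h2] l'; rewrite inE => /predU1P[->//|].
    exact: h2.
  apply: filterS (all (enum 'I_(N * N))) => e' he; apply: (morph_at_chart nE chG) => //; first exact: filterT.
  by move=> l; apply: he; rewrite mem_enum.
pose h0 := dvs (sec x0); pose tr y := r (sigma y) h0.
have tr0 : tr ystar = sec x0 by rewrite /tr /h0 [RHS]dvsE f_sec phi_x0.
have trm : morph_at tr ystar by apply: (r_mor' nY (sigma_mor _)); exact: morph_at_const.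
have nO : nbhs ystar (tr @^-1` O)%classic by apply: trm.1; rewrite tr0; apply: open_nbhs_nbhs.
have [Q Q0 QO] := nbhs_star nO.
have [u Qu] : exists u, ell (a u (f e)) = ag_one T /\ Q.@[s (a u (f e))] != 0.
  pose y := f e.
  pose pl : {poly K} := \sum_(mm <- msupp Q) (Q@_mm * \prod_i s (ret y) i ^+ mm i) *: 'X^(wdeg lam mm).
  have plE w : pl.[w] = Q.@[fun i => w ^+ lam i * s (ret y) i].
    rewrite /pl horner_sum mevalE; apply: eq_bigr => mm _; rewrite hornerZ hornerXn -mulrA; congr (_ * _).
    rewrite /wdeg (big_morph _ (fun u v => exprD w u v) (expr0 _)) mulrC -big_split.
    by apply: eq_bigr => i _; rewrite exprMn -exprM mulnC.
  have pl0 : pl != 0.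
    apply: contraNneq Q0 => z; have := plE 0; rewrite z horner0 => /esym ez; rewrite -ez; apply/eqP.
    by apply: meval_eq => i; rewrite expr0n gtn_eqF // mul0r.
  have [w w0 pw] := poly_nonroot pl0; exists (mT (la w) (ag_inv (ell y))).
  rewrite aM -/(ret y); have [le sw] := la_act (ret y) w0; split; first by rewrite le /ret ell_sl.
  by move: pw; rewrite plE; congr (_ != 0); apply: meval_eq => i; rewrite sw.
have [lu su] := Qu; have Ou := QO _ lu su.
have [h hE] : exists h, h = mG (ag_inv (mG (d u) (dvs e))) h0 by eexists.
pose mvE e := r (b u e) h.
have mvO : O (mvE e).
  suff -> : mvE e = tr (a u (f e)) by [].
  rewrite /mvE [LHS]dvsE fr fb division_act /tr; congr (r _ _).
  by rewrite hE ag_mulA ag_mulgV ag_mul1.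
have mm : morph_at mvE e.
  apply: (r_mor' nE); last exact: morph_at_const.
  by apply: (b_mor' nE _ (morph_at_id e)); exact: morph_at_const.
have -> : dvs = (fun e => mG (mG (ag_inv (d u)) (dvs (mvE e))) (ag_inv h)).
  apply/funext => e'; rewrite /mvE division_act -!ag_mulA ag_mulgV ag_mulr1.
  by rewrite ag_mulA ag_mulV ag_mul1.
apply: morph_at_mul => //; last exact: morph_at_const.
apply: morph_at_mul => //; first exact: morph_at_const.
exact: (morph_at_comp mm (sub _ mvO)).
Qed.

End Division.

(** * The global trivialization *)

Theorem theorem4p1 (K : closedFieldType) (T G : alg_group K) (Y E : fspace K)
    (a : T -> Y -> Y) (f : E -> Y) (b : T -> E -> E) (r : E -> G -> E) :
  affine_toric_variety a ->
  reductive G ->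
  equivariant_principal_bundle a f b r ->
  equivariantly_trivializable a f b r.
Proof.
move=> tor [affG _] [pb [/morphismP b_mor b1 bM] fb br].
have [y0 [n [lam [s [chi [ell [la [ystar [tinv tsl]]]]]]]]] := toric_slice tor.
have [[nY TC T_char _ dens] [lam_gt0 chi_char s_a s_y0 s_reg] tsl'] := tsl.
move=> {tsl}; have [ell_mor ell_y0 ell_a ell_sl la_act] := tsl'.
move=> [ell_star s_star star_uniq germ_star nbhs_star] [orb tinvK tinv_mor].
have [[_ [ny [ZY [cZ [iY isoY]]]] irrY _ [/morphismP a_mor a1 aM]] _] := tor.
have [[prevE sepE] /morphismP f_mor [/morphismP r_mor r1 rM] fr _] := pb.
have nE : charted E by exact: charted_prevariety.
have nT : charted T by exact: alg_group_charted.
have nG : charted G by exact: alg_group_charted.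
pose yc (y : Y) i := (set_val (iY y) : 'rV[K]_ny) 0 i.
have [chY _] : chart setT yc /\ closed_chart setT yc := affine_variety_chart cZ isoY.
have yc_inj y y' : yc y = yc y' -> y = y'.
  move=> e; have [_ [psi [_ K1 _]]] := isoY; apply: (can_inj K1); apply: val_inj.
  by apply/rowP => i; exact: (congr1 (fun h => h i) e).
have s_orb t i : s (a t y0) i != 0.
  apply/eqP => z; have := s_a (ag_inv t) (a t y0) i.
  by rewrite -aM ag_mulV a1 z mulr0 s_y0 => /eqP; rewrite oner_eq0.
have s_yt t i : s (slice_point a y0 ell t) i != 0 by exact: s_orb.
have orb_open : open (range (a^~ y0)).
  have -> : range (a^~ y0) = [set y | \prod_i s y i != 0].
    apply/seteqP; split=> y /=; first by case=> t _ <-; apply/prodf_neq0 => i _; exact: s_orb.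
    by move/prodf_neq0 => h; have [t ->] := orb y (fun i => h i isT); exists t.
  by rewrite openE => y; apply: (reg_neq0 nY); apply: reg_prod.
have [X [phi [x0 [sec [dv [[nX et phi_x0 f_sec sec_mor] [dvE dv_free dv_mor]]]]]]] := local_section ystar pb.
have [X1 [phi1 [x1 [sec1 [dv1 [[nX1 _ phi1_x1 f_sec1 _] [dv1E dv1_free dv1_mor]]]]]]] := local_section y0 pb.
have phi_mor := (morphismP phi).1 et.1.
have [U [V [m [k [zc [tc [g [[Ux0 UV chV chU clU] gU U_surj jac]]]]]]]] := etale_chart (et.2 x0).
have [xi [xi_gr xi0 xi_sp]] := @lifted_arcs K X Y phi x0 n lam s ystar (fun y => ell y = ag_one T) (fun w y => a (la w) y)
  lam_gt0 ell_star s_star (fun w y w0 h => etrans (la_act w y w0).1 h) (fun w y i w0 => (la_act w y w0).2 i)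
  germ_star nbhs_star phi_x0 U V m k zc tc g Ux0 UV chV gU U_surj (jac x0 Ux0).
have [N [A [AM A1 A_inj chG clG]]] := matrix_embedding affG.
have [eb [ka [h0 [[/morphismP d_mor dM] feb ka_gr ka0 ka_sp]]]] := formal_section nE nY TC T_char a_mor b_mor a1 aM b1 bM rM
  fr fb br lam_gt0 chi_char s_a s_y0 s_reg ell_mor ell_y0 ell_a ell_sl la_act ell_star s_star star_uniq orb tinvK tinv_mor
  nX phi_mor phi_x0 f_sec sec_mor dvE dv_free dv_mor phi1_x1 f_sec1 dv1E dv1_mor Ux0 chU clU xi_gr xi0 xi_sp AM A1 A_inj chG clG.
set d := slice_hom _ _ _ _ _ _ _ in d_mor dM ka_sp.
have [sigma [sigma_mor sigma_orb]] := equivariant_sigma nE nY TC a_mor b_mor r_mor a1 aM b1 bM rM br sepE irrY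
  (fun e => prevariety_chart e prevE) chY lam_gt0 s_reg ell_mor ell_sl la_act ell_star s_star germ_star tinvK tinv_mor
  orb_open nX sec_mor Ux0 chU xi_gr xi0 xi_sp chG dM d_mor ka_gr ka0 ka_sp.
have f_sigma y : f (sigma y) = y.
  apply: yc_inj; apply/funext => i.
  apply: (dens (fun y => yc (f (sigma y)) i) (fun y => yc y i)) => [z|z|t].
  - have rg : regular_at (f (sigma z)) (fun y => yc y i) by exact: (reg_coord i chY I).
    exact: ((morph_at_comp (sigma_mor z) (f_mor _)).2 _ rg).
  - exact: (reg_coord i chY I).
  - by rewrite sigma_orb /orbit_section fr fb feb.
have a_mor' u y : morph_at (a u) y.
  by apply: (morph_at_comp (morph_at_pair nT nY nY _ (morph_at_id y)) (a_mor _)); exact: morph_at_const.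
have nz1 : slice_nonzero a s ell 1 by apply: (slice_nonzero0 a1 ell_star s_star); rewrite meval1 oner_neq0.
have b_sigma u y : b u (sigma y) = r (sigma (a u y)) (d u).
  apply: (separated_eq nE nY TC a_mor aM sepE irrY s_reg ell_mor orb_open (u := fun y => b u (sigma y))
    (v := fun y => r (sigma (a u y)) (d u)) nz1).
  - by apply: (morph_at_comp (morph_at_pair nT nE nY _ (sigma_mor y)) (b_mor _)); exact: morph_at_const.
  - apply: (morph_at_comp (morph_at_pair nE nG nY (morph_at_comp (a_mor' u y) (sigma_mor _)) _) (r_mor _)).
    exact: morph_at_const.
  - apply: filterS filterT => z _ t -> _ /=.
    rewrite -aM !sigma_orb /orbit_section br -bM -rM dM ag_inv_mul -ag_mulA ag_mulV ag_mulr1.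
    by [].
(* Freeness on the fibres, and transitivity in the next step, are read off a trivialization in an
   etale neighbourhood of the base point of the fibre. *)
have sigma_free y g1 g2 : r (sigma y) g1 = r (sigma y) g2 -> g1 = g2.
  have [X' [phi' [x' [sec' [dv' [[_ _ px' _ _] [dvE' dv_free' _]]]]]]] := local_section y pb.
  have -> : sigma y = r (sec' x') (dv' x' (sigma y)) by apply: dvE'; rewrite px' f_sigma.
  by rewrite -!rM => /dv_free' /ag_mulI.
have /choice[dvs dvsE] : forall e, exists h, e = r (sigma (f e)) h.
  move=> e; have [X' [phi' [x' [sec' [dv' [[_ _ px' _ _] [dvE' _ _]]]]]]] := local_section (f e) pb.
  have E1 : sigma (f e) = r (sec' x') (dv' x' (sigma (f e))) by apply: dvE'; rewrite px' f_sigma.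
  exists (ag_mul (ag_inv (dv' x' (sigma (f e)))) (dv' x' e)).
  rewrite {1}E1 -rM ag_mulA ag_mulgV ag_mul1; exact: dvE'.
have [W [q [eps [We0 chW clW]]]] := prevariety_chart (sec x0) prevE.
have dvs_mor := division_morphism nE nY TC f_mor a_mor b_mor r_mor a1 aM b1 bM r1 rM br fr fb chY lam_gt0 s_y0 s_reg
  ell_mor ell_y0 ell_sl la_act ell_star s_star germ_star nbhs_star orb s_yt tinvK tinv_mor
  (fun O q => @slice_generic K T Y a nY TC a_mor aM irrY y0 n s ell s_reg ell_mor orb_open O q)
  (fun q1 q2 => @slice_nonzeroM K T Y a nY TC a_mor aM irrY y0 n s ell s_reg ell_mor orb_open q1 q2)
  (fun q => @slice_nonzero0 K T Y a a1 ystar n s ell ell_star s_star q)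
  nX phi_mor phi_x0 f_sec dvE dv_free dv_mor phi1_x1 dv1E dv1_free dv1_mor Ux0 chU xi_gr xi0 xi_sp
  chG d_mor sigma_mor f_sigma b_sigma dvsE sigma_free We0 chW clW.
exists d, (fun e => (f e, dvs e)); split=> //=.
- by split=> //; apply/morphismP.
- split; first by apply/morphismP => e; exact: (morph_at_pair nY nG nE (f_mor e) (dvs_mor e)).
  exists (fun z => r (sigma z.1) z.2); split.
  + apply/morphismP => z.
    have nYG : charted (prod_space Y G) by exact: charted_prod.
    exact: (morph_at_comp (morph_at_pair nE nG nYG (morph_at_comp (@morph_at_fst _ Y G z nY nG) (sigma_mor _))
      (@morph_at_snd _ Y G z nY nG)) (r_mor _)).
  + by move=> e /=; rewrite -dvsE.
  + case=> y h /=; rewrite fr f_sigma; congr (_, _).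
    by apply: (sigma_free y); have := dvsE (r (sigma y) h); rewrite fr f_sigma => <-.
- move=> e h; rewrite fr; congr (_, _); apply: (sigma_free (f e)).
  by rewrite rM -dvsE; have := dvsE (r e h); rewrite fr => <-.
- move=> t e; rewrite fb; congr (_, _); apply: (sigma_free (a t (f e))).
  rewrite rM -b_sigma -br -dvsE; by have := dvsE (b t e); rewrite fb => <-.
Qed.
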